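(* For each of the following eleven uniform realizable rank-3 chirotopes $\chi\in\{\pm\}^{\binom{[7]}{3}}$, each described by the list of 3-subsets $ijk$ with $\chi_{ijk}=-$ (all other entries $+$), the chirotropical Dressian $\mathrm{Dr}^\chi(3,7)$ modulo lineality is a pure $6$-dimensional polyhedral fan equal to $\mathrm{Trop}^\chi\mathrm{G}(3,7)$, with f-vector (numbers of cones of dimensions $1,\dots,6$ modulo lineality) as listed: (1) $\{356,456,457,467\}$: $(30,244,864,1513,1287,424)$; (2) $\{267,357,367,456,457,467,567\}$: $(31,252,892,1565,1335,441)$; (3) $\{345,467,567\}$: $(28,222,781,1373,1179,393)$; (4) $\{356,357,456,457\}$: $(39,342,1224,2109,1746,558)$; (5) $\{356,456,457\}$: $(35,298,1073,1885,1597,522)$; (6) $\{367,456,457,467,567\}$: $(34,291,1050,1844,1560,509)$; (7) $\{367,457,467,567\}$: $(36,311,1125,1974,1665,541)$; (8) $\{457,467,567\}$: $(30,248,891,1577,1351,447)$; (9) $\{467,567\}$: $(37,325,1181,2070,1740,563)$; (10) $\{567\}$: $(34,296,1084,1922,1634,534)$; (11) $\emptyset$ (all entries $+$): $(42,392,1463,2583,2163,693)$.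
   Context: For a real polynomial $f$ in Plücker variables $p_I$, $f^\chi_\pm$ is the sum of the terms of $f$ whose evaluation at $p=\chi$ has sign $\pm1$; $\mathrm{Trop}(h)(x)=\min\alpha\cdot x$ over exponent vectors of monomials of $h$; $\mathrm{Trop}^\chi V(f)=\{x:\mathrm{Trop}(f^\chi_+)(x)=\mathrm{Trop}(f^\chi_-)(x)\}$. $\mathrm{Dr}^\chi(k,n)=\bigcap_{f\in P_{k,n}}\mathrm{Trop}^\chi V(f)$ with $P_{k,n}$ the three-term Plücker relations of $\mathrm{G}(k,n)$, and $\mathrm{Trop}^\chi\mathrm{G}(k,n)=\bigcap_{f\in I_{k,n}}\mathrm{Trop}^\chi V(f)$ with $I_{k,n}$ the Plücker ideal. The lineality space is the image of $x\mapsto(\sum_{i\in I}x_i)_I$, $x\in\mathbb{R}^n$. *)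

(* Defs.v *)
From HB Require Import structures.
From mathcomp Require Import all_boot all_order all_algebra.
From mathcomp Require Import mpoly.
From mathcomp Require Import boolp classical_sets functions cardinality.
From mathcomp Require Import reals constructive_ereal.

Set Implicit Arguments.
Unset Strict Implicit.
Unset Printing Implicit Defensive.

Import Order.TTheory GRing.Theory Num.Theory.
Local Open Scope classical_set_scope.
Local Open Scope ring_scope.

Definition ksubset (k n : nat) : finType := {I : {set 'I_n} | #|I| == k}.

(* Plucker coordinates are numbered by [enum_rank]/[enum_val] on [ksubset k n]. *)
Definition npl (k n : nat) : nat := #|ksubset k n|.

(* Uniform sign vectors; [chi I = true] means that the entry at [I] is -. *)
Definition signvec (k n : nat) := ksubset k n -> bool.

(* [ksubset_nth I j] is the j-th smallest element of [I]. *)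
Definition ksubset_nth (k n : nat) (I : ksubset k n) (j : 'I_k) : 'I_n :=
  enum_val (cast_ord (esym (eqP (valP I))) j).

Definition minor (A : comNzRingType) (k n : nat) (M : 'M[A]_(k, n))
    (I : ksubset k n) : A :=
  \det (colsub (ksubset_nth I) M).

Definition sgnval (R : realType) (k n : nat) (chi : signvec k n)
    (I : ksubset k n) : R :=
  (-1) ^+ chi I.

Definition realizable (R : realType) (k n : nat) (chi : signvec k n) : Prop :=
  exists M : 'M[R]_(k, n), forall I, Num.sg (minor M I) = sgnval R chi I.

Section Trop.
Variables (R : realType) (k n : nat).
Local Notation N := (npl k n).
Local Notation poly := {mpoly R[N]}.
Implicit Types (chi : signvec k n) (f h : poly) (x y : 'rV[R]_N).

Definition term f (m : 'X_{1..N}) : poly := f@_m *: 'X_[m].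

Definition sign_part chi (s : R) f : poly :=
  \sum_(m <- msupp f
        | Num.sg ((term f m).@[fun j => sgnval R chi (enum_val j)]) == s)
     term f m.

Definition mdot (m : 'X_{1..N}) x : R := \sum_(j < N) (m j)%:R * x 0 j.

(* The minimum over the empty set of monomials is +oo. *)
Definition Trop h x : \bar R :=
  \big[Order.min/+oo%E]_(m <- msupp h) (mdot m x)%:E.

Definition TropV chi f : set 'rV[R]_N :=
  [set x | Trop (sign_part chi 1 f) x = Trop (sign_part chi (-1) f) x].

Definition plvar (I : {set 'I_n}) : poly :=
  if insub I is Some J then 'X_(enum_rank (J : ksubset k n)) else 0.

(* The variables are indexed by sets, i.e. by increasing sequences.  The signs
   that sort S,a,b  S,c,d  etc. agree in the three products, so the relation has
   the signs below for every position of S relative to a < b < c < d. *)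
Definition three_term (S : {set 'I_n}) (a b c d : 'I_n) : poly :=
  plvar (S :|: [set a; b])%SET * plvar (S :|: [set c; d])%SET
  - plvar (S :|: [set a; c])%SET * plvar (S :|: [set b; d])%SET
  + plvar (S :|: [set a; d])%SET * plvar (S :|: [set b; c])%SET.

Definition three_term_relations : set poly :=
  [set f | exists (S : {set 'I_n}) (a b c d : 'I_n),
     [/\ (#|S| + 2)%N = k,
         [/\ (a < b)%N, (b < c)%N & (c < d)%N],
         [/\ a \notin S, b \notin S, c \notin S & d \notin S]
       & f = three_term S a b c d]].

Definition generic_mx : 'M[{mpoly R[k * n]}]_(k, n) :=
  \matrix_(i, j) 'X_(mxvec_index i j).

(* Kernel of p_I |-> (maximal minor I of the generic k x n matrix). *)
Definition pluecker_ideal : set poly :=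
  [set f | mmap (@mpolyC (k * n) R)
                (fun j => minor generic_mx (enum_val j)) f = 0].

Definition chi_Dressian chi : set 'rV[R]_N :=
  \bigcap_(f in three_term_relations) TropV chi f.

Definition chi_TropGr chi : set 'rV[R]_N :=
  \bigcap_(f in pluecker_ideal) TropV chi f.

Definition lineality_mx : 'M[R]_(n, N) :=
  \matrix_(i, j) (i \in val (enum_val j : ksubset k n))%:R.

(* A model of the projection R^N -> R^N / (lineality space): its kernel is the
   row space of [lineality_mx], i.e. the image of x |-> (sum_(i in I) x_i)_I. *)
Definition mod_lineality x : 'rV[R]_N := x *m cokermx lineality_mx.

(* The fan structure that the Dressian carries as an intersection of tropical
   hypersurfaces: x and y lie in the relative interior of the same cone iff for
   each three-term relation the minimum is attained at the same monomials.
   [Dressian_cone x] is the closed cone with x in its relative interior. *)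
Definition Dressian_cone x : set 'rV[R]_N :=
  [set y | forall f, three_term_relations f ->
     forall m, m \in msupp f ->
       Trop f x = (mdot m x)%:E -> Trop f y = (mdot m y)%:E].

Definition Dressian_fan chi : set (set 'rV[R]_N) :=
  [set mod_lineality @` Dressian_cone x | x in chi_Dressian chi].

End Trop.

Arguments chi_Dressian R {k n} chi.
Arguments chi_TropGr R {k n} chi.
Arguments Dressian_fan R {k n} chi.

Section Fans.
Variables (R : realType) (N : nat).
Local Notation V := 'rV[R]_N.
Implicit Types (C D F : set V) (Sigma : set (set V)).

Definition polyhedral_cone C : Prop :=
  exists (m : nat) (A : 'M[R]_(N, m)), C = [set x | forall j, 0 <= (x *m A) 0 j].

Definition is_face F C : Prop :=
  exists l : 'cV[R]_N, (forall x, C x -> 0 <= (x *m l) 0 0) /\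
    F = C `&` [set x | (x *m l) 0 0 = 0].

Definition polyhedral_fan Sigma : Prop :=
  [/\ finite_set Sigma,
      Sigma !=set0,
      forall C, Sigma C -> polyhedral_cone C,
      forall C F, Sigma C -> is_face F C -> Sigma F
    & forall C D, Sigma C -> Sigma D ->
        is_face (C `&` D) C /\ is_face (C `&` D) D].

Definition has_dim C (d : nat) : Prop :=
  exists U : {vspace V},
    [/\ forall x, C x -> x \in U,
        forall W : {vspace V}, (forall x, C x -> x \in W) -> (U <= W)%VS
      & \dim U = d].

Definition pure_dim Sigma (d : nat) : Prop :=
  forall C, Sigma C -> (forall D, Sigma D -> C `<=` D -> D = C) -> has_dim C d.

Definition num_cones Sigma (d m : nat) : Prop :=
  ([set C | Sigma C /\ has_dim C d] #= `I_m)%card.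

End Fans.

(* Subsets of {1..7} are written as increasing lists; ['I_7] is 0-based. *)
Definition signvec_of_negatives (k n : nat) (neg : seq (seq nat)) :
    signvec k n :=
  fun I => [seq (val i).+1 | i <- enum (val I)] \in neg.

Definition chirotopes37 : seq (seq (seq nat) * seq nat) :=
  [:: ([:: [:: 3; 5; 6]; [:: 4; 5; 6]; [:: 4; 5; 7]; [:: 4; 6; 7]],
       [:: 30; 244; 864; 1513; 1287; 424]);
      ([:: [:: 2; 6; 7]; [:: 3; 5; 7]; [:: 3; 6; 7]; [:: 4; 5; 6]; [:: 4; 5; 7];
           [:: 4; 6; 7]; [:: 5; 6; 7]],
       [:: 31; 252; 892; 1565; 1335; 441]);
      ([:: [:: 3; 4; 5]; [:: 4; 6; 7]; [:: 5; 6; 7]],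
       [:: 28; 222; 781; 1373; 1179; 393]);
      ([:: [:: 3; 5; 6]; [:: 3; 5; 7]; [:: 4; 5; 6]; [:: 4; 5; 7]],
       [:: 39; 342; 1224; 2109; 1746; 558]);
      ([:: [:: 3; 5; 6]; [:: 4; 5; 6]; [:: 4; 5; 7]],
       [:: 35; 298; 1073; 1885; 1597; 522]);
      ([:: [:: 3; 6; 7]; [:: 4; 5; 6]; [:: 4; 5; 7]; [:: 4; 6; 7]; [:: 5; 6; 7]],
       [:: 34; 291; 1050; 1844; 1560; 509]);
      ([:: [:: 3; 6; 7]; [:: 4; 5; 7]; [:: 4; 6; 7]; [:: 5; 6; 7]],
       [:: 36; 311; 1125; 1974; 1665; 541]);
      ([:: [:: 4; 5; 7]; [:: 4; 6; 7]; [:: 5; 6; 7]],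
       [:: 30; 248; 891; 1577; 1351; 447]);
      ([:: [:: 4; 6; 7]; [:: 5; 6; 7]],
       [:: 37; 325; 1181; 2070; 1740; 563]);
      ([:: [:: 5; 6; 7]],
       [:: 34; 296; 1084; 1922; 1634; 534]);
      ([::],
       [:: 42; 392; 1463; 2583; 2163; 693])]%N.

(* Main.v *)
(** For each chirotope every three-term relation has one product [c] whose sign differs
    from that of the other two products [a], [b], so the Dressian is the set of solutions of
    [x_c = min(x_a, x_b)] for all relations. Solving these equations one after the other
    (a chart) identifies the Dressian modulo lineality with R^6; for two of the chirotopes one
    Pluecker coordinate [J] remains free above part of a polyhedral complex in R^6, where it
    produces "vertical" cones. The charts linearise on a complete simplicial fan of R^6: its
    cones are found by crossing walls along circuits [r_i + r_j + sum neg = sum pos], and it is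
    complete because each crossing at a negative coefficient decreases the value of a
    piecewise linear height function. The cones of the Dressian correspond to the sign patterns
    of subsets of the simplicial cones; they are counted by computation, the dimension of a
    cone being the largest size of a subset with its pattern. Finally, solving the relations
    [p_c = p_a + p_b] along the same charts with data of order exp(-s x) yields real matrices
    with prescribed signs whose minors are of order exp(-s x_I), so every point of the
    Dressian is (a limit of points) in the tropical Grassmannian. *)
Require Import Defs.
From HB Require Import structures.
From Stdlib Require Import BinNums BinInt FMapPositive Ascii String.
From mathcomp Require Import all_boot all_order all_algebra.
From mathcomp Require Import mpoly.
From mathcomp Require Import boolp classical_sets functions cardinality.
From mathcomp Require Import reals constructive_ereal.
From mathcomp Require sequences exp.
From mathcomp Require Import lra ring zify ssrZ.

Set Implicit Arguments.
Unset Strict Implicit.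
Unset Printing Implicit Defensive.

Import Order.TTheory GRing.Theory Num.Theory.

(** * Relations, charts and fans as data *)


(** The substitution q_I = chi_I p_I turns every relation into q_c = q_a + q_b with positive
    unknowns. Solving for a factor of q_c needs no subtraction, so it tropicalizes without any
    genericity and serves both the parametrization by R^6 and the realizing matrices. Solving for a
    factor of a summand subtracts, which is legitimate only where that summand strictly dominates;
    this is why points in the interior of six-dimensional simplicial cones are realized and all
    others are reached as limits. A cone of the Dressian may be cut into many simplicial cones. It
    is therefore named by the set of all rays that lie in it, which is computed from the strict
    signs of the differences a - b at the rays. The coordinate J is bounded below by the relations
    in which it occurs in a summand, and the vertical ray is the unit vector at J. The order of
    solving, the rays, the circuits and the heights are certificates: nothing is assumed about their
    origin, and one boolean test verifies everything that the geometric argument uses. *)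

Definition trips : seq (seq nat) :=
  flatten [seq flatten [seq [seq [:: i; j; k] | k <- iota j.+1 (6 - j)]
    | j <- iota i.+1 (6 - i)] | i <- iota 0 7].

Definition tix (i j k : nat) : nat := index (sort leq [:: i; j; k]) trips.

Definition quads : seq (nat * nat * nat * nat * nat) :=
  [seq q <- flatten [seq flatten [seq flatten [seq flatten [seq
     [seq (s, a, b, c, d) | d <- iota c.+1 (6 - c)] | c <- iota b.+1 (6 - b)]
      | b <- iota a.+1 (6 - a)] | a <- iota 0 7] | s <- iota 0 7]
   | let: (s, a, b, c, d) := q in s \notin [:: a; b; c; d]].

(** A relation is kept as three pairs of coordinate indices. As produced by [products], the middle
    product has coefficient -1; after [lone_first] the order is (c, a, b), with c the product of the
    isolated sign. *)
Definition trel := ((nat * nat) * (nat * nat) * (nat * nat))%type.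

Definition products (q : nat * nat * nat * nat * nat) : trel :=
  let: (s, a, b, c, d) := q in
  ((tix s a b, tix s c d), (tix s a c, tix s b d), (tix s a d, tix s b c)).

Definition prodsign (chi : seq bool) (p : nat * nat) : bool :=
  nth false chi p.1 (+) nth false chi p.2.

(** The middle sign is negated to account for the coefficient -1. If all three signs agree the
    result is meaningless, a case that [mixed] excludes. *)
Definition lone_first (chi : seq bool) (r : trel) : trel :=
  let: (p1, p2, p3) := r in
  let s1 := prodsign chi p1 in
  let s2 := ~~ prodsign chi p2 in
  let s3 := prodsign chi p3 in
  if s1 == s2 then (p3, p1, p2) else if s1 == s3 then (p2, p1, p3)
  else (p1, p2, p3).

Definition mixed (chi : seq bool) (r : trel) : bool :=
  let: (p1, p2, p3) := r in
  let s1 := prodsign chi p1 in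
  let s2 := ~~ prodsign chi p2 in
  let s3 := prodsign chi p3 in
  ~~ ((s1 == s2) && (s1 == s3)).

Definition signs (neg : seq (seq nat)) : seq bool :=
  [seq [seq i.+1 | i <- t] \in neg | t <- trips].

Definition rels (chi : seq bool) : seq trel := [seq lone_first chi (products q) | q <- quads].

Definition zval (v : seq Z) (p : nat * nat) : Z :=
  Z.add (nth Z0 v p.1) (nth Z0 v p.2).

Definition other (p : nat * nat) (t : nat) : nat := if p.1 == t then p.2 else p.1.

(** [Free t] takes coordinate t as a parameter. [Solve r t] finds the factor t of c from a and b.
    [Open r ta tb] starts from c and takes the difference a - b as a parameter, which yields one new
    factor in a and one in b. [Dom r t] finds a factor of one summand by subtracting the other
    summand from c. *)
Inductive step := Free of nat | Solve of nat & nat | Open of nat & nat & nat | Dom of nat & nat.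

Definition rel0 : trel := ((0, 0), (0, 0), (0, 0)).

(** Tropical evaluation of a chart at the integer parameters [ys]. In an [Open] step the values b =
    c - min(u, 0) and a = b + u are the only ones with difference u and minimum c. [Dom] steps are
    skipped; the charts evaluated here are required to have none. *)
Fixpoint lift_ray (rl : seq trel) (st : seq step) (ys : seq Z) (v : seq Z) : seq Z :=
  match st with
  | [::] => v
  | Free t :: st' => lift_ray rl st' (behead ys) (set_nth Z0 v t (head Z0 ys))
  | Solve r t :: st' =>
    let: (c, a, b) := nth rel0 rl r in
    lift_ray rl st' ys (set_nth Z0 v t (Z.sub (Z.min (zval v a) (zval v b)) (nth Z0 v (other c t))))
  | Open r ta tb :: st' =>
    let: (c, a, b) := nth rel0 rl r in
    let u := head Z0 ys in
    let e := Z.sub (zval v c) (Z.min u Z0) in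
    lift_ray rl st' (behead ys)
      (set_nth Z0 (set_nth Z0 v ta (Z.sub (Z.add e u) (nth Z0 v (other a ta))))
         tb (Z.sub e (nth Z0 v (other b tb))))
  | Dom _ _ :: st' => lift_ray rl st' ys v
  end.

(** The first bit says b < a and the second a < b. Both are off at a tie, so the union of the
    signatures of compatible vectors is the signature of their sum. *)
Definition zsig (v : seq Z) (r : trel) : seq bool :=
  let: (_, a, b) := r in
  let x := zval v a in let y := zval v b in [:: Z.ltb y x; Z.ltb x y].

Definition sigma (rl : seq trel) (v : seq Z) : seq bool := flatten [seq zsig v r | r <- rl].

Fixpoint bsub (p q : seq bool) : bool :=
  match p, q with
  | b :: p', c :: q' => if b then (if c then bsub p' q' else false) else bsub p' q'
  | b :: p', [::] => if b then false else bsub p' [::]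
  | [::], _ => true
  end.

Fixpoint bor (p q : seq bool) : seq bool :=
  match p, q with
  | b :: p', c :: q' => (b || c) :: bor p' q'
  | [::], _ => q
  | _, [::] => p
  end.

Fixpoint band (p q : seq bool) : seq bool :=
  match p, q with
  | b :: p', c :: q' => (b && c) :: band p' q'
  | _, _ => [::]
  end.

(* Bits [2k] and [2k + 1] of a signature record the two strict signs of the [k]-th difference. *)
Fixpoint bcompat (p q : seq bool) : bool :=
  match p, q with
  | b1 :: b2 :: p', c1 :: c2 :: q' =>
     if (b1 && c2) || (b2 && c1) then false else bcompat p' q'
  | _, _ => true
  end.

Fixpoint setb (p : seq bool) (i : nat) (b : bool) : seq bool :=
  match p, i with
  | [::], _ => [::]
  | _ :: p', 0 => b :: p'
  | c :: p', i'.+1 => c :: setb p' i' b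
  end.

(** The final [xH] acts as an end marker, so masks that differ only by trailing zeros get distinct
    keys. *)
Fixpoint enc (p : seq bool) : positive :=
  match p with
  | [::] => xH
  | b :: p' => if b then xI (enc p') else xO (enc p')
  end.

Definition bmask (m : nat) (l : seq nat) : seq bool := [seq i \in l | i <- iota 0 m].

Definition charix (c : ascii) : nat := nat_of_ascii c - 65.
(** Circuits are separated by commas and each letter stands for a ray, A being ray 0. A repeated
    letter encodes a multiplicity, and the first two letters on the left are the rays exchanged
    across the wall. *)
Fixpoint parse (s : string) (cur : seq nat) (lhs : seq nat) : seq (seq nat * seq nat) :=
  match s with
  | EmptyString => [::]
  | String c s' =>
    if Ascii.eqb c "=" then parse s' [::] (rev cur)
    else if Ascii.eqb c "," then (lhs, rev cur) :: parse s' [::] [::]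
    else parse s' (charix c :: cur) lhs
  end.
Definition parse_circuits (ls : seq string) := flatten [seq parse l [::] [::] | l <- ls].

Definition entry := (nat * seq bool * seq bool)%type.

(** Each circuit is filed under both of its exchanged rays, together with the other one, the mask of
    the remaining rays of the circuit and the row of rays compatible with the entering ray. *)
Definition table (m : nat) (compat : seq (seq bool)) (cs : seq (seq nat * seq nat)) : seq (seq entry) :=
  let cs' := [seq (nth 0 c.1 0, nth 0 c.1 1, bmask m (drop 2 c.1 ++ c.2)) | c <- cs] in
  [seq pmap (fun c : nat * nat * seq bool => let: (i, j, g) := c in
      if i == k then Some (j, g, nth [::] compat j)
      else if j == k then Some (i, g, nth [::] compat i) else None) cs' | k <- iota 0 m].

Fixpoint nbr (C : seq bool) (i : nat) (es : seq entry) : option (seq bool) :=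
  match es with
  | [::] => None
  | (j, g, cm) :: es' =>
    (* The default [true] prevents an index beyond the mask from being chosen as entering ray. *)
    if nth true C j then nbr C i es'
    else if bsub g C then
      let D := setb C i false in
      if bsub D cm then Some (setb D j true) else nbr C i es'
    else nbr C i es'
  end.

Fixpoint nbrs (C : seq bool) (i : nat) (rest : seq bool) (tab : seq (seq entry)) :
  option (seq (nat * seq bool)) :=
  match rest, tab with
  | b :: rest', es :: tab' =>
    if b then
      match nbr C i es with
      | None => None
      | Some D => match nbrs C i.+1 rest' tab' with None => None | Some l => Some ((i, D) :: l) end
      end
    else nbrs C i.+1 rest' tab'
  | _, _ => Some [::]
  end.

Fixpoint push (l : seq (nat * seq bool)) (todo : seq (seq bool)) (seen : PositiveMap.t unit) :=
  match l with
  | [::] => (todo, seen)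
  | (_, D) :: l' =>
    let k := enc D in
    match PositiveMap.find k seen with
    | Some _ => push l' todo seen
    | None => push l' (D :: todo) (PositiveMap.add k tt seen)
    end
  end.

Fixpoint bfs (fuel : nat) (tab : seq (seq entry)) (todo : seq (seq bool)) (seen : PositiveMap.t unit)
  (acc : seq (seq bool * seq (nat * seq bool))) : option (seq (seq bool * seq (nat * seq bool))) :=
  match todo with
  | [::] => Some acc
  | C :: todo' =>
    match fuel with
    | 0 => None
    | f.+1 =>
      match nbrs C 0 C tab with
      | None => None
      | Some l => let: (todo2, seen2) := push l todo' seen in bfs f tab todo2 seen2 ((C, l) :: acc)
      end
    end
  end.

(** Lists the masks from I up to F with their joined signatures and sizes. The lower bound I holds
    the rays whose opposite neighbour was handled earlier; masks that miss one of them were already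
    met there. *)
Fixpoint between (F I : seq bool) (sig : seq (seq bool)) : seq (seq bool * (seq bool * nat)) :=
  match F, I, sig with
  | f :: F', i :: I', s :: sig' =>
    let l := between F' I' sig' in
    if f then
      let w := [seq (true :: x.1, (bor s x.2.1, x.2.2.+1)) | x <- l] in
      if i then w else w ++ [seq (false :: x.1, x.2) | x <- l]
    else [seq (false :: x.1, x.2) | x <- l]
  | _, _, _ => [:: ([::], ([::], 0))]
  end.

Fixpoint closure (T Ch : seq bool) (sig : seq (seq bool)) (j : seq bool) : seq bool :=
  match T, Ch, sig with
  | t :: T', c :: Ch', s :: sig' => (if t then true else if c then bsub s j else false) :: closure T' Ch' sig' j
  | _, _, _ => [::]
  end.

Definition join (F : seq bool) (sig : seq (seq bool)) : seq bool :=
  foldr (fun x acc => if x.1 then bor x.2 acc else acc) [::] (zip F sig).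

(** The largest size is kept because it will be the dimension of the cell. *)
Definition bump (k : positive) (d : nat) (m : PositiveMap.t nat) : PositiveMap.t nat :=
  match PositiveMap.find k m with
  | None => PositiveMap.add k d m
  | Some e => if e < d then PositiveMap.add k d m else m
  end.

Definition visited (done : PositiveMap.t unit) (l : seq (nat * seq bool)) : seq nat :=
  pmap (fun x => match PositiveMap.find (enc x.2) done with Some _ => Some x.1 | None => None end) l.

(** * Enumeration of masks and cells *)


Definition bsubR (p q : seq bool) : Prop := forall i, nth false p i -> nth false q i.

Lemma bsubP p q : reflect (bsubR p q) (bsub p q).
Proof.
elim: p q => [|b p IH] q /=; first by left=> i; rewrite nth_nil.
case: q => [|c q].
  case: b; first by right=> /(_ 0 isT); rewrite nth_nil.
  by apply: (iffP (IH [::])) => H; [move=> [|i] //= h | move=> i h]; [have := H i h | have := H i.+1 h]; rewrite ?nth_nil.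
case: b; case: c => /=.
- by apply: (iffP (IH q)) => H; [move=> [|i] //=; apply: H | move=> i; apply: (H i.+1)].
- by right=> /(_ 0 isT).
- by apply: (iffP (IH q)) => H; [move=> [|i] //=; apply: H | move=> i; apply: (H i.+1)].
- by apply: (iffP (IH q)) => H; [move=> [|i] //=; apply: H | move=> i; apply: (H i.+1)].
Qed.

Lemma nth_bor p q i : nth false (bor p q) i = nth false p i || nth false q i.
Proof. by elim: p q i => [|b p IH] [|c q] [|i] //=; rewrite ?orbF ?nth_nil ?orbF. Qed.

Fixpoint dec (p : positive) : seq bool :=
  match p with xH => [::] | xI q => true :: dec q | xO q => false :: dec q end.

Lemma encK : cancel enc dec.
Proof. by elim=> //= -[] p /= ->. Qed.
Lemma decK : cancel dec enc.
Proof. by elim=> //= p ->. Qed.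
Lemma enc_inj : injective enc. Proof. exact: can_inj encK. Qed.

Lemma find_add (T : Type) k k' (v : T) m :
  PositiveMap.find k (PositiveMap.add k' v m) = if dec k == dec k' then Some v else PositiveMap.find k m.
Proof.
case: eqP => [/(can_inj decK) ->|ne]; first exact: PositiveMap.gss.
by apply: PositiveMap.gso => E; apply: ne; rewrite E.
Qed.

(** * Correctness of the search for maximal cones *)

Section Bfs.
Variable tab : seq (seq entry).

Definition edge (C D : seq bool) : Prop := exists i, [/\ nth false C i, i < size tab &
  nbr C i (nth [::] tab i) = Some D].

Lemma nbrs_spec C i0 rest tb l : nbrs C i0 rest tb = Some l ->
  (forall k, nth false rest k -> k < size tb -> exists2 D, nbr C (i0 + k) (nth [::] tb k) = Some D & (i0 + k, D) \in l) /\
  (forall i D, (i, D) \in l -> exists k, [/\ i = i0 + k, nth false rest k, k < size tb & nbr C i (nth [::] tb k) = Some D]).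
Proof.
elim: rest tb i0 l => [|b rest IH] [|es tb] i0 l /=.
- by move=> [<-]; split=> [k|i D]; rewrite ?nth_nil.
- by move=> [<-]; split=> [k|i D]; rewrite ?nth_nil.
- by move=> [<-]; split=> // k; rewrite ltn0.
case: b => /=; last first.
  move=> /IH[H1 H2]; split=> [[|k] //= h1 h2|i D /H2[k [-> h1 h2 h3]]].
    by have [D] := H1 k h1 h2; rewrite addSnnS => h3 h4; exists D.
  by exists k.+1; rewrite addSnnS in h3 *.
case E : (nbr C i0 es) => [D0|] //; case E' : (nbrs _ _ _ _) => [l'|] // [<-].
have [H1 H2] := IH _ _ _ E'; split.
  move=> [|k] /= h1 h2; first by exists D0; rewrite addn0 // inE eqxx.
  by have [D] := H1 k h1 h2; rewrite addSnnS => h3 h4; exists D => //; rewrite inE h4 orbT.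
move=> i D; rewrite inE => /predU1P[[-> ->]|/H2[k [-> h1 h2 h3]]].
  by exists 0; rewrite addn0.
by exists k.+1; rewrite addSnnS in h3 *.
Qed.

Lemma push_spec l todo seen todo' seen' : push l todo seen = (todo', seen') ->
  [/\ {subset todo <= todo'}, forall D, D \in todo' -> D \in todo \/ D \in map snd l,
      (forall D, D \in map snd l -> PositiveMap.find (enc D) seen' <> None),
      (forall k, PositiveMap.find k seen <> None -> PositiveMap.find k seen' <> None) &
      (forall k, PositiveMap.find k seen' <> None -> PositiveMap.find k seen <> None \/ dec k \in todo')].
Proof.
elim: l todo seen => [|[i D] l IH] todo seen /=.
  by move=> [<- <-]; split=> //; [move=> D; left | move=> k; left].
case E : (PositiveMap.find (enc D) seen) => [u|] /IH[s1 s2 s3 s4 s5]; split.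
- by [].
- by move=> D' /s2[|h]; [left | right; rewrite inE h orbT].
- by move=> D'; rewrite inE => /predU1P[->|/s3//]; apply: s4; rewrite E.
- by [].
- by [].
- by move=> D' h; apply: s1; rewrite inE h orbT.
- move=> D' /s2[|h]; last by right; rewrite inE h orbT.
  by rewrite inE => /predU1P[->|h]; [right; rewrite mem_head | left].
- by move=> D'; rewrite inE => /predU1P[->|/s3//]; apply: s4; rewrite find_add eqxx.
- by move=> k h; apply: s4; rewrite find_add; case: ifP.
- move=> k /s5[|]; last by right.
  rewrite find_add; case: eqP => [E'|_] h; last by left.
  by right; rewrite E' encK; apply: s1; rewrite mem_head.
Qed.

(** The invariant is that every key marked as seen belongs to a cone that is waiting or finished,
    and that all neighbours of a finished cone are marked. The last clause is the resulting
    induction along edges, by which properties of the starting cone spread to the whole list. *)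
Lemma bfs_spec fuel todo seen acc L : bfs fuel tab todo seen acc = Some L ->
  (forall k, PositiveMap.find k seen <> None -> dec k \in todo \/ dec k \in map fst acc) ->
  (forall C l, (C, l) \in acc -> nbrs C 0 C tab = Some l /\
      forall D, D \in map snd l -> PositiveMap.find (enc D) seen <> None) ->
  [/\ {subset todo <= map fst L}, {subset acc <= L},
     forall C l, (C, l) \in L -> nbrs C 0 C tab = Some l /\ {subset map snd l <= map fst L} &
     forall Pr : seq bool -> Prop, (forall C, C \in todo -> Pr C) -> (forall C, C \in map fst acc -> Pr C) ->
       (forall C D, Pr C -> edge C D -> Pr D) -> forall C, C \in map fst L -> Pr C].
Proof.
elim: fuel todo seen acc => [|fuel IH] [|C todo] seen acc //= run Hs Ha.
- case: run => <-; split=> // C l Cl; have [h1 h2] := Ha _ _ Cl; split=> // D /h2 /Hs.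
  by rewrite encK => -[].
- case: run => <-; split=> // C' l Cl; have [h1 h2] := Ha _ _ Cl; split=> // D /h2 /Hs.
  by rewrite encK => -[].
move: run; case En : (nbrs C 0 C tab) => [l|] //; case Ep : (push l todo seen) => [todo2 seen2] run.
have [s1 s2 s3 s4 s5] := push_spec Ep.
have [||t1 t2 t3 t4] := IH _ _ _ run.
- move=> k /s5[/Hs[]|]; last by left.
    rewrite inE => /predU1P[->|h]; first by right; rewrite mem_head.
    by left; apply: s1.
  by move=> h; right; rewrite inE h orbT.
- move=> C' l'; rewrite inE => /predU1P[[-> ->]|/Ha[h1 h2]]; first by split.
  by split=> // D /h2; apply: s4.
split.
- move=> D; rewrite inE => /predU1P[->|h]; last by apply: t1; apply: s1.
  by have := t2 (C, l) (mem_head _ _); move=> /(map_f fst).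
- by move=> x xin; apply: t2; rewrite inE xin orbT.
- by [].
move=> Pr H1 H2 H3; apply: t4 => //.
  have PC : Pr C by apply: H1; rewrite mem_head.
  move=> D /s2[h|/mapP[[i D'] h ->]]; first by apply: H1; rewrite inE h orbT.
  have [_ Hl] := nbrs_spec En; have [k [-> h1 h2 h3]] := Hl _ _ h.
  by apply: H3 PC _; exists k.
by move=> D; rewrite inE => /predU1P[->|]; [apply: H1; rewrite mem_head | apply: H2].
Qed.

End Bfs.

Lemma nbrP C i es D : nbr C i es = Some D -> exists j g cm,
  [/\ (j, g, cm) \in es, nth true C j = false, bsubR g C, bsubR (setb C i false) cm &
      D = setb (setb C i false) j true].
Proof.
elim: es => [|[[j g] cm] es IH] //=.
have rec : nbr C i es = Some D -> exists j' g' cm',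
  [/\ (j', g', cm') \in (j, g, cm) :: es, nth true C j' = false, bsubR g' C, bsubR (setb C i false) cm' &
      D = setb (setb C i false) j' true].
  by move=> /IH[j' [g' [cm' [h1 h2 h3 h4 h5]]]]; exists j', g', cm'; rewrite inE h1 orbT.
case E : (nth true C j) => //; case: bsubP => // h1; case: bsubP => // h2 [<-].
by exists j, g, cm; rewrite mem_head.
Qed.

(** * Patterns of the subsets of one simplicial cone *)

Section Cells.
Variables (m : nat) (sig : seq (seq bool)) (actb : seq bool).
Hypothesis sig_size : size sig = m.
Hypothesis act_size : size actb = m.

Definition joinbit (T : seq bool) (b : nat) : Prop :=
  exists2 l, nth false T l & nth false (nth [::] sig l) b.

Lemma between_spec F I sg T j c : size F = size sg -> size I = size sg ->
  ((T, (j, c)) \in between F I sg -> [/\ size T = size sg, bsubR T F, (bsubR I F -> bsubR I T), count id T = c &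
    forall b, nth false j b <-> exists2 l, nth false T l & nth false (nth [::] sg l) b]).
Proof.
elim: sg F I T j c => [|s sg IH] [|f F] [|i I] T j c //=.
  move=> _ _; rewrite inE => /eqP[-> -> ->]; split=> // b; rewrite nth_nil.
  by split=> // -[l]; rewrite nth_nil.
move=> [sF] [sI].
have skip T' : (T', (j, c)) \in between F I sg -> T = false :: T' -> (f = false \/ i = false) ->
   [/\ size T = (size sg).+1, bsubR T (f :: F), (bsubR (i :: I) (f :: F) -> bsubR (i :: I) T), count id T = c &
    forall b, nth false j b <-> exists2 l, nth false T l & nth false (nth [::] (s :: sg) l) b].
  move=> /(IH _ _ _ _ _ sF sI)[h1 h2 h3 h4 h5] -> fi; split=> /=; rewrite ?h1 ?h4 //.
  - by case=> //= k; apply: h2.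
  - move=> H [|k] /=; first by move=> it; have := H 0 it; case: fi => e; rewrite e // in it *.
    by apply: h3 => k'; apply: (H k'.+1).
  - move=> b; rewrite h5; split=> [[l l1 l2]|[[|l] // l1 l2]]; first by exists l.+1.
    by exists l.
have take_ x : x \in between F I sg -> (T, (j, c)) = (true :: x.1, (bor s x.2.1, x.2.2.+1)) -> f ->
   [/\ size T = (size sg).+1, bsubR T (f :: F), (bsubR (i :: I) (f :: F) -> bsubR (i :: I) T), count id T = c &
    forall b, nth false j b <-> exists2 l, nth false T l & nth false (nth [::] (s :: sg) l) b].
  case: x => [T' [j' c']] /(IH _ _ _ _ _ sF sI)[h1 h2 h3 h4 h5] [-> -> ->] ft; split=> /=; rewrite ?h1 ?h4 //.
  - by case=> //= k; apply: h2.
  - move=> H [|k] //=; apply: h3 => k'; apply: (H k'.+1).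
  - move=> b; rewrite nth_bor; split.
      by case/orP=> [h|/h5[l l1 l2]]; [exists 0 | exists l.+1].
    by move=> [[|l] l1 l2]; rewrite ?l2 // orbC; have -> : nth false j' b by apply/h5; exists l.
case: f skip take_ => skip take_; last first.
  by move=> /mapP[[T' [j' c']] h [e1 e2 e3]]; apply: (skip T'); rewrite ?e2 ?e3 //; left.
case: i skip take_ => skip take_; first by move=> /mapP[x h e]; apply: (take_ x h e).
rewrite mem_cat => /orP[/mapP[x h e]|/mapP[[T' [j' c']] h [e1 e2 e3]]]; first exact: (take_ x h e).
by apply: (skip T'); rewrite ?e2 ?e3 //; right.
Qed.

Lemma between_complete F I sg T : size F = size sg -> size I = size sg -> size T = size sg ->
  bsubR T F -> bsubR I T -> exists j, (T, (j, count id T)) \in between F I sg.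
Proof.
elim: sg F I T => [|s sg IH] [|f F] [|i I] [|t T] //=; first by exists [::]; rewrite mem_head.
move=> [sF] [sI] [sT] TF IT.
have [||j Hj] := IH _ _ _ sF sI sT; first by move=> k; apply: (TF k.+1).
  by move=> k; apply: (IT k.+1).
case: t TF IT => TF IT.
  have -> : f by apply: (TF 0).
  exists (bor s j); have W : (true :: T, (bor s j, (count id T).+1)) \in [seq (true :: x.1, (bor s x.2.1, x.2.2.+1)) | x <- between F I sg].
    by apply/mapP; exists (T, (j, count id T)).
  by case: i IT => _; rewrite ?mem_cat W.
have i0 : i = false by case: i IT => // /(_ 0 isT).
exists j; have W : (false :: T, (j, count id T)) \in [seq (false :: x.1, x.2) | x <- between F I sg].
  by apply/mapP; exists (T, (j, count id T)).
by case: f TF => _; rewrite ?i0 ?mem_cat ?W ?orbT.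
Qed.

Lemma join_spec F b : size F = m -> nth false (join F sig) b <-> joinbit F b.
Proof.
rewrite /joinbit /join -sig_size; elim: sig F => [|s sg IH] [|f F] //=.
  by rewrite nth_nil; split=> // -[l]; rewrite nth_nil.
move=> [sF]; case: f => /=; last first.
  rewrite IH //; split=> [[l l1 l2]|[[|l] // l1 l2]]; first by exists l.+1.
  by exists l.
rewrite nth_bor; split.
  by case/orP=> [h|/(IH _ sF)[l l1 l2]]; [exists 0 | exists l.+1].
move=> [[|l] l1 l2]; first by rewrite l2.
by apply/orP; right; apply/(IH _ sF); exists l.
Qed.

Lemma nth_closure T Ch sg j i : size T = size sg -> size Ch = size sg ->
  nth false (closure T Ch sg j) i = nth false T i || nth false Ch i && bsub (nth [::] sg i) j && (i < size sg).
Proof.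
elim: sg T Ch i => [|s sg IH] [|t T] [|c Ch] [|i] //= [sT] [sC]; rewrite ?nth_nil //.
  by case: t; case: c; rewrite ?andbT.
by rewrite IH.
Qed.

Lemma size_closure T Ch sg j : size T = size sg -> size Ch = size sg -> size (closure T Ch sg j) = size sg.
Proof. by elim: sg T Ch => [|s sg IH] [|t T] [|c Ch] //= [sT] [sC]; rewrite IH. Qed.

(** The rays that can occur in the closure of some subset of F; finding them once per cone shortens
    the inner loop. *)
Definition hull (F : seq bool) : seq bool :=
  let jF := join F sig in [seq x.1 && bsub x.2 jF | x <- zip actb sig].

(* The closure computed inside [hull F] does not depend on [F]. *)
Definition cls (T : seq bool) : seq bool :=
  mkseq (fun i => nth false actb i && bsub (nth [::] sig i) (join T sig)) m.

(** Joined signatures grow with the mask: a ray whose signature is contained in that of T is also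
    contained in that of F, so restricting to the hull of F loses no ray of the closure. *)
Lemma closure_cls F T j : size F = m -> size T = m -> bsubR T F -> bsubR F actb ->
  (forall b, nth false j b <-> joinbit T b) -> closure T (hull F) sig j = cls T.
Proof.
move=> sF sT TF Fa Hj.
have sh : size (hull F) = size sig by rewrite size_map size_zip act_size sig_size minnn.
apply: (@eq_from_nth _ false); rewrite size_closure ?sig_size ?size_mkseq // ?sh ?sig_size //.
move=> i im; rewrite nth_closure ?sig_size ?sh ?sig_size // nth_mkseq // im andbT.
have Eh : nth false (hull F) i = nth false actb i && bsub (nth [::] sig i) (join F sig).
  by rewrite (nth_map (false, [::])) ?size_zip ?act_size ?sig_size ?minnn // nth_zip ?act_size ?sig_size.
have Ej : bsub (nth [::] sig i) j = bsub (nth [::] sig i) (join T sig).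
  by apply/bsubP/bsubP => H b /H; [move=> /Hj h; apply/join_spec | move=> /(join_spec _ sT) h; apply/Hj].
rewrite Eh Ej; case Ti : (nth false T i) => /=.
  rewrite (Fa _ (TF _ Ti)) /=; apply/esym/bsubP => b h; apply/join_spec => //.
  by exists i.
case: (nth false actb i) => //=; case Hb : (bsub _ (join T sig)); rewrite ?andbF // andbT.
apply/bsubP => b; move/bsubP: Hb => Hb /Hb /(join_spec _ sT)[l l1 l2].
by apply/join_spec => //; exists l => //; apply: TF.
Qed.

(** Together with [sound_cell] this forces the stored number to be the largest size of a subset with
    the given closure. *)
Definition has_cell (ce : PositiveMap.t nat) (T : seq bool) : Prop :=
  exists2 d, PositiveMap.find (enc (cls T)) ce = Some d & count id T <= d.
Definition sound_cell (MM : seq bool -> Prop) (ce : PositiveMap.t nat) : Prop :=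
  forall k d, PositiveMap.find k ce = Some d -> exists M T,
    [/\ MM M, bsubR T M, size T = m, k = enc (cls T) & count id T = d].

Lemma bump_mono k d ce T : has_cell ce T -> has_cell (bump k d ce) T.
Proof.
move=> [e h1 h2]; rewrite /bump; case E : (PositiveMap.find k ce) => [e'|].
  case: ifP => lt; last by exists e.
  rewrite /has_cell find_add; case: eqP => [/(can_inj decK) Ek|_]; last by exists e.
  exists d => //; rewrite Ek E in h1; case: h1 => h1; rewrite -h1 in h2.
  by apply: leq_trans h2 _; apply: ltnW.
rewrite /has_cell find_add; case: eqP => [/(can_inj decK) Ek|_]; last by exists e.
by rewrite Ek E in h1.
Qed.

Lemma bump_has ce T : has_cell (bump (enc (cls T)) (count id T) ce) T.
Proof.
rewrite /bump /has_cell; case E : (PositiveMap.find _ ce) => [e|]; last by exists (count id T); rewrite ?find_add ?eqxx.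
by case: ifP => lt; [exists (count id T); rewrite ?find_add ?eqxx | exists e; rewrite // leqNgt lt].
Qed.

Lemma bump_sound MM ce M T : sound_cell MM ce -> MM M -> bsubR T M -> size T = m ->
  sound_cell MM (bump (enc (cls T)) (count id T) ce).
Proof.
move=> S h1 h2 h3 k d; have new : dec k = dec (enc (cls T)) -> Some (count id T) = Some d -> exists M T,
    [/\ MM M, bsubR T M, size T = m, k = enc (cls T) & count id T = d].
  by move=> /(can_inj decK) -> [<-]; exists M, T.
rewrite /bump; case E : (PositiveMap.find _ ce) => [e|].
  by case: ifP => lt; [rewrite find_add; case: eqP => [/new//|_]; apply: S | apply: S].
by rewrite find_add; case: eqP => [/new//|_]; apply: S.
Qed.

Definition add_cells (F I : seq bool) (ce : PositiveMap.t nat) : PositiveMap.t nat :=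
  if bsub I F then
    let h := hull F in
    foldr (fun x ce => bump (enc (closure x.1 h sig x.2.1)) x.2.2 ce) ce (between F I sig)
  else ce.

Lemma add_cells_spec (MM : seq bool -> Prop) F I ce : size F = m -> size I = m -> bsubR F actb -> MM F ->
  (sound_cell MM ce -> sound_cell MM (add_cells F I ce)) /\
  (forall T, has_cell ce T -> has_cell (add_cells F I ce) T) /\
  (forall T, size T = m -> bsubR T F -> bsubR I T -> has_cell (add_cells F I ce) T).
Proof.
move=> sF sI Fa MF; rewrite /add_cells; case: bsubP => IF; last first.
  by split=> //; split=> // T _ TF IT; case: IF => i /IT /TF.
have B T j c : (T, (j, c)) \in between F I sig ->
    [/\ size T = m, bsubR T F, count id T = c & closure T (hull F) sig j = cls T].
  move=> /between_spec []; rewrite ?sig_size // => h1 h2 h3 h4 h5; split=> //.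
  by apply: closure_cls.
have C T : size T = m -> bsubR T F -> bsubR I T -> exists j, (T, (j, count id T)) \in between F I sig.
  by move=> sT TF IT; apply: between_complete; rewrite ?sig_size.
elim: (between F I sig) B C => [|[T0 [j0 c0]] l IH] B C /=.
  by split=> //; split=> // T sT TF IT; have [j] := C T sT TF IT.
have [b1 b2 b3 b4] := B _ _ _ (mem_head _ _); rewrite b4 -b3.
have B' T j c : (T, (j, c)) \in l -> [/\ size T = m, bsubR T F, count id T = c & closure T (hull F) sig j = cls T].
  by move=> h; apply: (B T j c); rewrite inE h orbT.
pose C' (T : seq bool) := exists j, (T, (j, count id T)) \in l.
have [i1 [i2 i3]] : (sound_cell MM ce -> sound_cell MM (foldr (fun x ce => bump (enc (closure x.1 (hull F) sig x.2.1)) x.2.2 ce) ce l)) /\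
   (forall T, has_cell ce T -> has_cell (foldr (fun x ce => bump (enc (closure x.1 (hull F) sig x.2.1)) x.2.2 ce) ce l) T) /\
   (forall T, C' T -> has_cell (foldr (fun x ce => bump (enc (closure x.1 (hull F) sig x.2.1)) x.2.2 ce) ce l) T).
  rewrite /C'; elim: l B' {IH B C C'} => [|[T1 [j1 c1]] l IH] B' /=; first by split=> //; split=> // T [j].
  have [b1' b2' b3' b4'] := B' _ _ _ (mem_head _ _); rewrite b4' -b3'.
  have [i1 [i2 i3]] := IH (fun T j c h => B' T j c (mem_behead (s := _ :: _) h)).
  split; first by move=> /i1 S; apply: bump_sound S MF b2' b1'.
  split=> T; first by move=> /i2; apply: bump_mono.
  move=> [j]; rewrite inE => /predU1P[[-> _ _]|h]; first exact: bump_has.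
  by apply: bump_mono; apply: i3; exists j.
split; first by move=> /i1 S; apply: bump_sound S MF b2 b1.
split=> T; first by move=> /i2; apply: bump_mono.
move=> sT TF IT; have [j] := C T sT TF IT; rewrite inE => /predU1P[[-> _ _]|h]; first exact: bump_has.
by apply: bump_mono; apply: i3; exists j.
Qed.

End Cells.

Lemma nth_band p q i : nth false (band p q) i = nth false p i && nth false q i.
Proof. by elim: p q i => [|b p IH] [|c q] [|i] //=; rewrite ?nth_nil ?andbF. Qed.

Lemma size_band p q : size p = size q -> size (band p q) = size p.
Proof. by elim: p q => [|b p IH] [|c q] //= [e]; rewrite IH. Qed.

Lemma size_bor p q : size p = size q -> size (bor p q) = size p.
Proof. by elim: p q => [|b p IH] [|c q] //= [e]; rewrite IH. Qed.

Lemma nth_bmask m l i : nth false (bmask m l) i = (i < m) && (i \in l).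
Proof.
have [im|im] := ltnP i m; last by rewrite nth_default // size_map size_iota.
by rewrite (nth_map 0) ?size_iota // nth_iota.
Qed.

Lemma mem_visited done l i : i \in visited done l ->
  exists2 D, (i, D) \in l & PositiveMap.find (enc D) done <> None.
Proof.
elim: l => [|[j D] l IH] //=; case E : (PositiveMap.find (enc D) done) => [u|] /=.
  rewrite inE => /predU1P[->|/IH[D' h1 h2]]; first by exists D; rewrite ?mem_head // E.
  by exists D' => //; rewrite inE h1 orbT.
by move=> /IH[D' h1 h2]; exists D' => //; rewrite inE h1 orbT.
Qed.

(** The part of a cone selected by [g.1], enlarged by the rays of [g.2], which belong to no cone of
    the complete fan. In use, [g.2] is empty or consists of the vertical ray. *)
Definition restr (g : seq bool * seq bool) (C : seq bool) : seq bool := bor (band C g.1) g.2.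

Lemma nth_restr g C i : nth false (restr g C) i = nth false C i && nth false g.1 i || nth false g.2 i.
Proof. by rewrite nth_bor nth_band. Qed.

Definition add_all (sig : seq (seq bool)) (actb : seq bool) (gs : seq (seq bool * seq bool)) C I ce :=
  foldr (fun g ce => add_cells sig actb (restr g C) I ce) ce gs.

Fixpoint cells_of (m : nat) (sig : seq (seq bool)) (actb : seq bool) (gs : seq (seq bool * seq bool))
    (L : seq (seq bool * seq (nat * seq bool))) (done : PositiveMap.t unit) (ce : PositiveMap.t nat) :=
  match L with
  | [::] => ce
  | (C, ns) :: L' =>
    cells_of m sig actb gs L' (PositiveMap.add (enc C) tt done)
      (add_all sig actb gs C (bmask m (visited done ns)) ce)
  end.

(** * Collecting the patterns over the whole fan *)

Section Loop.
Variables (m : nat) (sig : seq (seq bool)) (actb : seq bool).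
Hypothesis sig_size : size sig = m.
Hypothesis act_size : size actb = m.
Variables (gs : seq (seq bool * seq bool)) (MM : seq bool -> Prop).
Local Notation has_cell := (has_cell m sig actb).
Local Notation sound_cell := (sound_cell m sig actb MM).

Lemma add_all_spec gs' C I ce : size I = m ->
  (forall g, g \in gs' -> [/\ size (restr g C) = m, bsubR (restr g C) actb & MM (restr g C)]) ->
  (sound_cell ce -> sound_cell (add_all sig actb gs' C I ce)) /\
  (forall T, has_cell ce T -> has_cell (add_all sig actb gs' C I ce) T) /\
  (forall g T, g \in gs' -> size T = m -> bsubR T (restr g C) -> bsubR I T ->
     has_cell (add_all sig actb gs' C I ce) T).
Proof.
move=> sI; elim: gs' => [|g gs' IH] H /=; first by [].
have [|i1 [i2 i3]] := IH; first by move=> g' h; apply: H; rewrite inE h orbT.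
have [h1 h2 h3] := H g (mem_head _ _).
have [j1 [j2 j3]] := add_cells_spec sig_size act_size (add_all sig actb gs' C I ce) h1 sI h2 h3.
split; first by move=> /i1 /j1.
split=> [T /i2 /j2 //|g' T].
rewrite inE => /predU1P[->|h] sT T1 T2; first exact: j3.
by apply: j2; apply: (i3 g').
Qed.

(** A subset that misses a ray i whose opposite neighbour is done lies in that neighbour too, since
    the neighbour contains every other ray of the cone. Hence listing only the subsets that contain
    all such i reaches every pattern. *)
Lemma cells_of_spec (L : seq (seq bool * seq (nat * seq bool))) done ce :
  (forall C l, (C, l) \in L -> forall i D, (i, D) \in l -> bsubR (setb C i false) D) ->
  (forall C l g, (C, l) \in L -> g \in gs ->
     [/\ size (restr g C) = m, bsubR (restr g C) actb & MM (restr g C)]) ->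
  (forall C, PositiveMap.find (enc C) done <> None -> forall g T, g \in gs -> size T = m ->
     bsubR T (restr g C) -> has_cell ce T) ->
  (sound_cell ce -> sound_cell (cells_of m sig actb gs L done ce)) /\
  (forall T, has_cell ce T -> has_cell (cells_of m sig actb gs L done ce) T) /\
  (forall C l g T, (C, l) \in L -> g \in gs -> size T = m -> bsubR T (restr g C) ->
     has_cell (cells_of m sig actb gs L done ce) T).
Proof.
elim: L done ce => [|[C ns] L IH] done ce HL Hg Hd /=; first by [].
have HgC g : g \in gs -> [/\ size (restr g C) = m, bsubR (restr g C) actb & MM (restr g C)].
  by apply: Hg (mem_head _ _).
set I := bmask m _; have sI : size I = m by rewrite size_map size_iota.
have [a1 [a2 a3]] := add_all_spec ce sI HgC.
have HC g T : g \in gs -> size T = m -> bsubR T (restr g C) -> has_cell (add_all sig actb gs C I ce) T.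
  move=> gin sT TC; have [IT|nIT] := bsubP I T; first exact: (a3 g).
  have /hasP[i _ /andP[Ii Ti]] : has (fun i => nth false I i && ~~ nth false T i) (iota 0 m).
    apply: contraPT nIT => /hasPn H h; apply: h => i Ii.
    have im : i < m by move: Ii; rewrite nth_bmask => /andP[].
    by have := H i; rewrite mem_iota Ii /= negbK => ->.
  move: Ii; rewrite nth_bmask => /andP[im /mem_visited[D iD fD]].
  apply: a2; apply: (Hd D fD g) => // k Tk; have := TC k Tk; rewrite !nth_restr.
  case/orP=> [/andP[Ck ->]|->]; last by rewrite orbT.
  have ki : k != i by apply: contraNneq Ti => <-.
  have -> // : nth false D k.
  have := HL _ _ (mem_head _ _) _ _ iD k; apply.
  have nsb (p : seq bool) a b : a != b -> nth false (setb p b false) a = nth false p a.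
    by elim: p a b => [|x p IHp] [|a] [|b] //= ab; apply: IHp.
  by rewrite nsb.
have [|||i1 [i2 i3]] := IH (PositiveMap.add (enc C) tt done) (add_all sig actb gs C I ce).
- by move=> C' l h; apply: HL; rewrite inE h orbT.
- by move=> C' l g h; apply: (Hg C' l); rewrite inE h orbT.
- move=> C'; rewrite find_add !encK; case: eqP => [-> _|_] h g T; first exact: HC.
  by move=> h1 h2 h3; apply: a2; apply: (Hd C' h g).
split; first by move=> /a1 /i1.
split=> [T /a2 /i2 //|C' l g T].
rewrite inE => /predU1P[[-> _]|h] gin sT TC; first by apply: i2; apply: (HC g).
exact: (i3 C' l g).
Qed.

End Loop.

(** * Indexing the 3-subsets *)


Lemma trips_mem (i j k : nat) : (i < j)%N -> (j < k)%N -> (k < 7)%N -> [:: i; j; k] \in trips.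
Proof.
have H : all (fun i : nat => all (fun j : nat => all (fun k : nat => (i < j)%N && (j < k)%N ==> ([:: i; j; k] \in trips)) (iota 0 7)) (iota 0 7)) (iota 0 7) by vm_compute.
move=> ij jk k7.
have j7 := ltn_trans jk k7; have i7 := ltn_trans ij j7.
move/allP: H => /(_ i); rewrite mem_iota => /(_ i7) /allP /(_ j); rewrite mem_iota => /(_ j7) /allP /(_ k).
by rewrite mem_iota ij jk => /(_ k7).
Qed.

Lemma size_trips : size trips = 35. Proof. by []. Qed.
Lemma trips_nth (t : nat) : (t < 35)%N -> exists i j k : 'I_7,
  [/\ (i < j)%N, (j < k)%N & nth [::] trips t = [:: val i; val j; val k]].
Proof.
have H : all (fun s : seq nat => if s is [:: i; j; k] then [&& i < j, j < k & k < 7]%N else false) trips by vm_compute.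
move=> t35; move/allP: H => /(_ _ (mem_nth [::] (_ : t < size trips)%N)); rewrite size_trips => /(_ t35).
case: (nth _ _ _) => [|i [|j [|k [|]]]] // /and3P[ij jk k7].
have j7 := ltn_trans jk k7; have i7 := ltn_trans ij j7.
by exists (Ordinal i7), (Ordinal j7), (Ordinal k7).
Qed.

Definition tset (t : nat) : {set 'I_7} := [set i | val i \in nth [::] trips t].

Lemma enum_tset (t : nat) : (t < 35)%N -> [seq val i | i <- enum (tset t)] = nth [::] trips t.
Proof.
move=> t35.
have [i [j [k [ij jk E]]]] := trips_nth t35.
apply: (@irr_sorted_eq _ ltn ltn_trans ltnn).
- have -> : enum (tset t) = [seq x <- enum 'I_7 | x \in tset t] by rewrite !enumT.
  have : sorted ltn [seq val i | i <- enum 'I_7] by rewrite val_enum_ord iota_ltn_sorted.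
  rewrite sorted_map => H; rewrite sorted_map.
  by apply: sorted_filter H => x y z; apply: ltn_trans.
- by rewrite E /= ij jk.
- move=> x; apply/mapP/idP.
    by case=> y; rewrite mem_enum inE => H ->.
  move=> xin; have x7 : (x < 7)%N.
    by move: xin; rewrite E !inE => /or3P[] /eqP->; apply: ltn_ord.
  by exists (Ordinal x7); rewrite ?mem_enum ?inE.
Qed.

Lemma card_tset (t : nat) : (t < 35)%N -> #|tset t| == 3.
Proof.
move=> t35; rewrite cardE -(size_map val) enum_tset //.
by have [i [j [k [_ _ ->]]]] := trips_nth t35.
Qed.

Definition tk0 : ksubset 3 7 := Sub (tset 0) (card_tset (isT : 0 < 35)%N).
Definition tk (t : nat) : ksubset 3 7 := insubd tk0 (tset t).
Definition tn (I : ksubset 3 7) : nat := index [seq val i | i <- enum (val I)] trips.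

Lemma val_tk (t : nat) : (t < 35)%N -> val (tk t) = tset t.
Proof. by move=> t35; rewrite /tk val_insubd card_tset. Qed.

Lemma enum_ksubset (I : ksubset 3 7) : exists i j k : 'I_7,
  [/\ (i < j)%N, (j < k)%N & enum (val I) = [:: i; j; k]].
Proof.
have /eqP := valP I; rewrite cardE.
have : sorted ltn [seq val i | i <- enum (val I)].
  have -> : enum (val I) = [seq x <- enum 'I_7 | x \in val I] by rewrite !enumT.
  have : sorted ltn [seq val i | i <- enum 'I_7] by rewrite val_enum_ord iota_ltn_sorted.
  rewrite sorted_map => H; rewrite sorted_map.
  by apply: sorted_filter H => x y z; apply: ltn_trans.
case: (enum _) => [|i [|j [|k [|]]]] //= /and3P[ij jk _] _.
by exists i, j, k.
Qed.

Lemma tn_lt (I : ksubset 3 7) : (tn I < 35)%N.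
Proof.
have [i [j [k [ij jk E]]]] := enum_ksubset I.
by rewrite /tn E -size_trips index_mem; exact: trips_mem (ltn_ord k).
Qed.

Lemma tnK (I : ksubset 3 7) : tk (tn I) = I.
Proof.
apply: val_inj; rewrite val_tk ?tn_lt //; apply/setP=> x; rewrite inE.
have [i [j [k [ij jk E]]]] := enum_ksubset I.
rewrite /tn nth_index; last by rewrite E; exact: trips_mem (ltn_ord k).
by rewrite mem_map ?mem_enum //; apply: val_inj.
Qed.

Lemma tkK (t : nat) : (t < 35)%N -> tn (tk t) = t.
Proof. by move=> t35; rewrite /tn val_tk // enum_tset // index_uniq. Qed.

Lemma tk_inj (t u : nat) : (t < 35)%N -> (u < 35)%N -> tk t = tk u -> t = u.
Proof. by move=> ht hu /(congr1 tn); rewrite !tkK. Qed.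

Lemma sort3_trips (i j k : 'I_7) : i != j -> i != k -> j != k ->
  sort leq [:: val i; val j; val k] \in trips.
Proof.
move=> ij ik jk.
have U : uniq (sort leq [:: val i; val j; val k]).
  by rewrite sort_uniq /= !inE !negb_or ij ik jk.
have := sort_sorted leq_total [:: val i; val j; val k].
have : all (fun x => x < 7)%N (sort leq [:: val i; val j; val k]).
  by apply/allP => x; rewrite mem_sort !inE => /or3P[] /eqP->; apply: ltn_ord.
have : size (sort leq [:: val i; val j; val k]) = 3%N by rewrite size_sort.
rewrite [trips]lock; move: U; case: (sort _ _) => [|a [|b [|c [|]]]] //=.
rewrite !inE !negb_or !andbT => /andP[/andP[ab ac] bc] _ /and3P[_ _ c7] /andP[le1 le2].
by rewrite -lock; apply: trips_mem => //; rewrite ltn_neqAle ?ab ?bc ?le1.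
Qed.

Lemma tix_lt (i j k : 'I_7) : i != j -> i != k -> j != k -> (tix i j k < 35)%N.
Proof. by move=> *; rewrite /tix -size_trips index_mem sort3_trips. Qed.

Lemma val_tix (i j k : 'I_7) : i != j -> i != k -> j != k ->
  val (tk (tix i j k)) = [set i; j; k]%SET.
Proof.
move=> ij ik jk; rewrite val_tk ?tix_lt //; apply/setP=> x.
rewrite !inE /tix nth_index ?sort3_trips // mem_sort !inE.
by rewrite -!val_eqE /= orbA.
Qed.

(** * Three-term relations *)

Local Open Scope classical_set_scope.
Local Open Scope ring_scope.
Local Opaque tix trips.

Section Trop.
Variables (R : realType) (k n : nat).
Local Notation N := (npl k n).
Implicit Types (chi : signvec k n) (f h : {mpoly R[N]}) (x y : 'rV[R]_N).

Lemma Trop_geP h x (a : \bar R) :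
  reflect (forall m, m \in msupp h -> (a <= (mdot m x)%:E)%E) (a <= Trop h x)%E.
Proof.
rewrite /Trop; apply: (iffP idP).
  elim: (msupp h) => [|m0 s IH] // H m; rewrite big_cons le_min in H.
  by case/andP: H => H1 H2; rewrite inE => /predU1P[->|] //; apply: IH.
elim: (msupp h) => [|m0 s IH] H; first by rewrite big_nil leey.
rewrite big_cons le_min H ?mem_head //=; apply: IH => m ms.
by apply: H; rewrite inE ms orbT.
Qed.

Lemma Trop_attained h x m : m \in msupp h ->
  (Trop h x = (mdot m x)%:E) <-> (forall m', m' \in msupp h -> mdot m x <= mdot m' x).
Proof.
move=> mh; split=> [E m' m'h|H].
  by rewrite -lee_fin -E; have /Trop_geP := lexx (Trop h x); apply.
apply/eqP; rewrite eq_le; apply/andP; split.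
  by have /Trop_geP := lexx (Trop h x); apply.
by apply/Trop_geP => m' m'h; rewrite lee_fin H.
Qed.

Definition sgn_at chi f (m : 'X_{1..N}) : R :=
  Num.sg ((term f m).@[fun j => sgnval R chi (enum_val j)]).

Lemma mcoeff_sign_part chi s f m :
  (sign_part chi s f)@_m = if sgn_at chi f m == s then f@_m else 0.
Proof.
rewrite /sign_part raddf_sum /=.
under eq_bigr => m' _ do rewrite /term mcoeffZ mcoeffX.
case: (boolP (m \in msupp f)) => mf.
  rewrite big_mkcond (bigD1_seq m) ?msupp_uniq //= eqxx mulr1 big1 ?addr0 //.
  by move=> m' /negPf ->; rewrite mulr0; case: ifP.
rewrite (memN_msupp_eq0 mf) if_same big1_seq // => m' /andP[_ m'f].
by case: eqP => [E|_]; rewrite ?mulr0 //; rewrite -E m'f in mf.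
Qed.

Lemma mem_sign_part chi s f m :
  (m \in msupp (sign_part chi s f)) = (m \in msupp f) && (sgn_at chi f m == s).
Proof.
rewrite !mcoeff_msupp mcoeff_sign_part; case: ifP; first by rewrite andbT.
by rewrite eqxx andbF.
Qed.

Lemma Trop_sign_part_geP chi s f x (a : \bar R) :
  reflect (forall m, m \in msupp f -> sgn_at chi f m = s -> (a <= (mdot m x)%:E)%E)
          (a <= Trop (sign_part chi s f) x)%E.
Proof.
apply: (iffP (Trop_geP _ _ _)) => H m.
  by move=> mf /eqP ms; apply: H; rewrite mem_sign_part mf.
by rewrite mem_sign_part => /andP[mf /eqP ms]; apply: H.
Qed.

End Trop.

Section Link.
Variable R : realType.
Local Notation N := (npl 3 7).
Implicit Types (x y : 'rV[R]_N).

(** The lock keeps conversion from evaluating the enumeration of the 3-subsets. *)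
Definition pix (t : nat) : 'I_N := locked (enum_rank (tk t)).
Definition coord x (t : nat) : R := x 0 (pix t).
Definition val2 (X : nat -> R) (p : nat * nat) : R := X p.1 + X p.2.

Lemma pix_inj t u : (t < 35)%N -> (u < 35)%N -> pix t = pix u -> t = u.
Proof. by move=> ht hu; rewrite /pix -!lock => /enum_rank_inj /tk_inj; apply. Qed.

Definition mon (p : nat * nat) : 'X_{1..N} := (U_(pix p.1) + U_(pix p.2))%MM.

Lemma mul_pix t u : 'X_(pix t) * 'X_(pix u) = 'X_[mon (t, u)] :> {mpoly R[N]}.
Proof. by rewrite /mon mpolyXD. Qed.

Lemma mdot_mon p x : mdot (mon p) x = val2 (coord x) p.
Proof.
rewrite /mdot /mon /val2 /coord.
under eq_bigr => j _ do rewrite mnmDE !mnm1E natrD mulrDl.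
rewrite big_split /= (bigD1 (pix p.1)) //= eqxx mul1r big1 ?addr0; last first.
  by move=> j /negPf; rewrite eq_sym => ->; rewrite mul0r.
congr (_ + _).
rewrite (bigD1 (pix p.2)) //= eqxx mul1r big1 ?addr0 //.
by move=> j /negPf; rewrite eq_sym => ->; rewrite mul0r.
Qed.

Definition tri_poly (r : trel) : {mpoly R[N]} :=
  let: (p1, p2, p3) := r in 'X_[mon p1] - 'X_[mon p2] + 'X_[mon p3].

Definition tri_idx (r : trel) : seq nat :=
  let: (p1, p2, p3) := r in [:: p1.1; p1.2; p2.1; p2.2; p3.1; p3.2].

(** Six distinct indices make the three monomials distinct, so no coefficients merge or cancel. *)
Definition good_rel (r : trel) := uniq (tri_idx r) && all (fun t => t < 35)%N (tri_idx r).

Lemma mon_neq p q : p.1 \notin [:: q.1; q.2] -> (p.1 < 35)%N -> (q.1 < 35)%N -> (q.2 < 35)%N ->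
  mon p != mon q.
Proof.
rewrite !inE negb_or => /andP[n1 n2] h h1 h2; apply/eqP => /mnmP /(_ (pix p.1)).
rewrite /mon !mnmDE !mnm1E eqxx add1n.
have e1 : (pix q.1 == pix p.1) = false.
  by apply/negbTE; apply: contraNneq n1 => /(pix_inj h1 h) ->.
have e2 : (pix q.2 == pix p.1) = false.
  by apply/negbTE; apply: contraNneq n2 => /(pix_inj h2 h) ->.
by rewrite e1 e2.
Qed.

Lemma good_mons p1 p2 p3 : good_rel (p1, p2, p3) ->
  [/\ mon p1 != mon p2, mon p1 != mon p3 & mon p2 != mon p3].
Proof.
rewrite /good_rel /= !inE !negb_or.
move=> /andP[/and5P[/and5P[a1 a2 a3 a4 a5] /and4P[b1 b2 b3 b4] /and3P[c1 c2 c3] /andP[d1 d2] /andP[e1 _]]].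
move=> /and5P[h1 h2 h3 h4 /andP[h5 /andP[h6 _]]].
by split; apply: mon_neq; rewrite // !inE negb_or ?a2 ?a3 ?a4 ?a5 ?c2 ?c3 ?a5.
Qed.

Lemma mcoeff_tri p1 p2 p3 m : (tri_poly (p1, p2, p3))@_m =
  (mon p1 == m)%:R - (mon p2 == m)%:R + (mon p3 == m)%:R.
Proof. by rewrite /tri_poly mcoeffD mcoeffB !mcoeffX. Qed.

Lemma tri_coefs p1 p2 p3 : good_rel (p1, p2, p3) ->
  [/\ (tri_poly (p1, p2, p3))@_(mon p1) = 1, (tri_poly (p1, p2, p3))@_(mon p2) = -1
    & (tri_poly (p1, p2, p3))@_(mon p3) = 1].
Proof.
move=> /good_mons[n12 n13 n23]; rewrite !mcoeff_tri !eqxx.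
rewrite (negPf n12) (negPf n13) (negPf n23) eq_sym (negPf n12) eq_sym (negPf n13).
by rewrite [_ == mon p2]eq_sym (negPf n23) !subr0 !addr0 sub0r add0r.
Qed.

Lemma msupp_tri p1 p2 p3 m : good_rel (p1, p2, p3) ->
  (m \in msupp (tri_poly (p1, p2, p3))) = (m \in [:: mon p1; mon p2; mon p3]).
Proof.
move=> g; have [c1 c2 c3] := tri_coefs g.
rewrite mcoeff_msupp !inE; apply/idP/idP.
  rewrite mcoeff_tri; apply: contraNT; rewrite !negb_or => /and3P[n1 n2 n3].
  by rewrite ![_ == m]eq_sym (negPf n1) (negPf n2) (negPf n3) subrr addr0.
by case/or3P=> /eqP->; rewrite ?c1 ?c2 ?c3 ?oppr_eq0 oner_eq0.
Qed.

Section Sign.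
Variable chi : signvec 3 7.
Let chs : seq bool := [seq chi (tk t) | t <- iota 0 35].

Lemma nth_chs t : (t < 35)%N -> nth false chs t = chi (tk t).
Proof. by move=> h; rewrite (nth_map 0%N) ?size_iota // nth_iota. Qed.

Lemma eval_mon p : (p.1 < 35)%N -> (p.2 < 35)%N ->
  ('X_[mon p] : {mpoly R[N]}).@[fun j => sgnval R chi (enum_val j)] = (-1) ^+ prodsign chs p.
Proof.
move=> h1 h2; rewrite /mon mpolyXD mevalM !mevalXU /sgnval /pix -!lock !enum_rankK.
by rewrite /prodsign !nth_chs // signr_addb.
Qed.

Lemma sgn_tri (p1 p2 p3 : nat * nat) : good_rel (p1, p2, p3) ->
  let f := tri_poly (p1, p2, p3) in
  [/\ sgn_at chi f (mon p1) = (-1) ^+ prodsign chs p1,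
      sgn_at chi f (mon p2) = (-1) ^+ ~~ prodsign chs p2 &
      sgn_at chi f (mon p3) = (-1) ^+ prodsign chs p3].
Proof.
move=> g f; have [c1 c2 c3] := tri_coefs g.
have := g; rewrite /good_rel => /andP[_ /= /and5P[h1 h2 h3 h4 /andP[h5 /andP[h6 _]]]].
rewrite /sgn_at /term c1 c2 c3 !mevalZ !eval_mon //.
by split; case: (prodsign _ _); rewrite /= ?expr0 ?expr1 ?mul1r ?mulr1 ?mulrN1 ?opprK ?sgrN ?sgr1.
Qed.

(** For mixed signs one sign part is the single monomial c and the other consists of a and b, so the
    equality of the two tropical values reads c = min(a, b). *)
Lemma TropV_tri p1 p2 p3 x : good_rel (p1, p2, p3) -> mixed chs (p1, p2, p3) ->
  TropV chi (tri_poly (p1, p2, p3)) x <->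
  let: (c, a, b) := lone_first chs (p1, p2, p3) in
  val2 (coord x) c = Num.min (val2 (coord x) a) (val2 (coord x) b).
Proof.
move=> g mx; have [s1 s2 s3] := sgn_tri g.
set f := tri_poly _ in s1 s2 s3 *.
have sup m := msupp_tri m g; rewrite -/f in sup.
pose T s := Trop (sign_part chi s f) x.
have TE (s : R) (l : seq (nat * nat)) (v : R) :
    (forall p, p \in l -> v <= val2 (coord x) p) -> (exists2 p, p \in l & val2 (coord x) p = v) ->
    (forall p, p \in [:: p1; p2; p3] -> (sgn_at chi f (mon p) == s) = (p \in l)) ->
    {subset l <= [:: p1; p2; p3]} -> T s = v%:E.
  move=> lb [p0 p0l p0v] H sb; apply/eqP; rewrite eq_le; apply/andP; split.
    have /Trop_sign_part_geP := lexx (T s); move/(_ (mon p0)); rewrite mdot_mon p0v; apply.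
      by rewrite sup (map_f mon (sb _ p0l : p0 \in [:: p1; p2; p3])).
    by apply/eqP; rewrite H ?sb.
  apply/Trop_sign_part_geP => m; rewrite sup => /(mapP (f := mon) (s := [:: p1; p2; p3]))[p pin ->] /eqP.
  by rewrite H // mdot_mon lee_fin; apply: lb.
have neq : [/\ p1 != p2, p1 != p3 & p2 != p3].
  by have [n12 n13 n23] := good_mons g; split; [apply: contraNneq n12|apply: contraNneq n13|apply: contraNneq n23] => ->.
have sgE (b c : bool) : ((-1) ^+ b == (-1) ^+ c :> R) = (b == c).
  by apply: (inj_eq signr_inj).
(* The bit e is the sign shared by a and b. Changing it swaps the two sign parts, and the equation
   between them is symmetric. *)
have key (c a b : nat * nat) (e : bool) :
    (forall p, p \in [:: p1; p2; p3] -> sgn_at chi f (mon p) = (-1) ^+ ((p == c) (+) e)) ->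
    {subset [:: c; a; b] <= [:: p1; p2; p3]} -> {subset [:: p1; p2; p3] <= [:: c; a; b]} ->
    a != c -> b != c ->
    (T 1 = T (-1) <-> val2 (coord x) c = Num.min (val2 (coord x) a) (val2 (coord x) b)).
  move=> H sb sb' ac bc.
  have Tc : T ((-1) ^+ ~~ e) = (val2 (coord x) c)%:E.
    apply: (TE _ [:: c]) => [p||p pin|p]; rewrite ?inE.
    - by move/eqP->.
    - by exists c; rewrite ?inE.
    - by rewrite H // sgE; case: (p == c); case: (e).
    - by move/eqP->; have := sb c (mem_head _ _); rewrite !inE.
  have Tab : T ((-1) ^+ e) = (Num.min (val2 (coord x) a) (val2 (coord x) b))%:E.
    apply: (TE _ [:: a; b]) => [p||p pin|p]; rewrite ?inE.
    - by case/orP=> /eqP->; rewrite ge_min lexx ?orbT.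
    - by case: (leP (val2 (coord x) a) (val2 (coord x) b)) => h; [exists a|exists b]; rewrite ?inE ?eqxx ?orbT.
    - have := sb' p pin; rewrite H // sgE !inE.
      have [->|pc] := eqVneq p c; first by rewrite ![c == _]eq_sym (negPf ac) (negPf bc); case: (e).
      by move=> /= ->; rewrite eqxx.
    - by move=> h; have := sb p; rewrite !inE h orbT; apply.
  have -> : (T 1 = T (-1)) <-> (T ((-1) ^+ ~~ e) = T ((-1) ^+ e)).
    by case: (e); rewrite ?expr0 ?expr1; split=> ->.
  by rewrite Tc Tab; split=> [[]|->].
have [n12 n13 n23] := neq.
rewrite /lone_first; move: mx; rewrite /mixed.
set e1 := prodsign _ p1 in s1 *; set e2 := ~~ prodsign _ p2 in s2 *; set e3 := prodsign _ p3 in s3 *.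
have memP p : p \in [:: p1; p2; p3] -> [\/ p = p1, p = p2 | p = p3].
  by rewrite !inE => /or3P[]/eqP->; [constructor 1|constructor 2|constructor 3].
have [E12|N12] := eqVneq e1 e2 => /=.
  move=> N13; apply: (key p3 p1 p2 e1) => //.
  - move=> p /memP[] ->; rewrite ?s1 ?s2 ?s3 ?(negPf n13) ?(negPf n23) ?eqxx //=; first by rewrite -E12.
    by move: N13; case: (e1); case: (e3).
  - by move=> p; rewrite !inE => /or3P[]->; rewrite ?orbT.
  - by move=> p; rewrite !inE => /or3P[]->; rewrite ?orbT.
move=> _; have [E13|N13] := eqVneq e1 e3 => /=.
  apply: (key p2 p1 p3 e1) => //.
  - move=> p /memP[] ->; rewrite ?s1 ?s2 ?s3 ?(negPf n12) ?[p3 == _]eq_sym ?(negPf n23) ?eqxx //=; last by rewrite -E13.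
    by move: N12; case: (e1); case: (e2).
  - by move=> p; rewrite !inE => /or3P[]->; rewrite ?orbT.
  - by move=> p; rewrite !inE => /or3P[]->; rewrite ?orbT.
  - by rewrite eq_sym.
apply: (key p1 p2 p3 e2) => //; last 2 first.
- by rewrite eq_sym.
- by rewrite eq_sym.
move=> p /memP[] ->; rewrite ?s1 ?s2 ?s3 ?[_ == p1]eq_sym ?(negPf n12) ?(negPf n13) ?eqxx //=.
  by move: N12; case: (e1); case: (e2).
by move: N12 N13; case: (e1); case: (e2); case: (e3).
Qed.

End Sign.

Lemma cone_tri p1 p2 p3 x y : good_rel (p1, p2, p3) ->
  (forall m, m \in msupp (tri_poly (p1, p2, p3)) ->
     Trop (tri_poly (p1, p2, p3)) x = (mdot m x)%:E ->
     Trop (tri_poly (p1, p2, p3)) y = (mdot m y)%:E) <->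
  (forall p, p \in [:: p1; p2; p3] ->
     (forall q, q \in [:: p1; p2; p3] -> val2 (coord x) p <= val2 (coord x) q) ->
     (forall q, q \in [:: p1; p2; p3] -> val2 (coord y) p <= val2 (coord y) q)).
Proof.
move=> g; have sup m := msupp_tri m g.
have at_ z p : p \in [:: p1; p2; p3] ->
    Trop (tri_poly (p1, p2, p3)) z = (mdot (mon p) z)%:E <->
    (forall q, q \in [:: p1; p2; p3] -> val2 (coord z) p <= val2 (coord z) q).
  move=> pin; rewrite Trop_attained ?sup ?(map_f mon pin) //.
  split=> H q.
    by move=> /(map_f mon) qin; rewrite -!mdot_mon; apply: H; rewrite sup.
  rewrite sup => /(mapP (f := mon) (s := [:: p1; p2; p3]))[p' p'in ->].
  by rewrite !mdot_mon; apply: H.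
split=> H.
  move=> p pin Hx; apply/(at_ y p pin); apply: H; first by rewrite sup (map_f mon pin).
  exact/(at_ x p pin).
move=> m; rewrite sup => /(mapP (f := mon) (s := [:: p1; p2; p3]))[p pin ->] /(at_ x p pin) Hx.
by apply/(at_ y p pin); apply: H.
Qed.

Lemma plvar_tix (s a b : 'I_7) : s != a -> s != b -> a != b ->
  plvar R 3 ([set s]%SET :|: [set a; b]%SET) = 'X_(pix (tix s a b)).
Proof.
move=> sa sb ab; rewrite /plvar.
have -> : ([set s] :|: [set a; b])%SET = val (tk (tix s a b)).
  by rewrite val_tix //; apply/setP => i; rewrite !inE orbA.
by rewrite valK /pix -lock.
Qed.

Lemma tix_neq (i j k i' j' k' z : 'I_7) : i != j -> i != k -> j != k ->
  i' != j' -> i' != k' -> j' != k' -> z \in [set i; j; k]%SET -> z \notin [set i'; j'; k']%SET ->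
  tix i j k != tix i' j' k'.
Proof.
move=> ij ik jk ij' ik' jk' zin; apply: contraNneq => E.
by rewrite -val_tix // -E val_tix.
Qed.

Lemma ord_neq_lt (i j : 'I_7) : (i < j)%N -> i != j.
Proof. by move=> ij; rewrite -val_eqE /= neq_ltn ij. Qed.

Lemma good_relI (t1 t2 t3 t4 t5 t6 : nat) :
  (t1 < 35)%N -> (t2 < 35)%N -> (t3 < 35)%N -> (t4 < 35)%N -> (t5 < 35)%N -> (t6 < 35)%N ->
  uniq [:: t1; t2; t3; t4; t5; t6] -> good_rel ((t1, t2), (t3, t4), (t5, t6)).
Proof. by move=> h1 h2 h3 h4 h5 h6 U; rewrite /good_rel U /= h1 h2 h3 h4 h5 h6. Qed.

Lemma good_products (s a b c d : 'I_7) : (a < b)%N -> (b < c)%N -> (c < d)%N ->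
  s != a -> s != b -> s != c -> s != d ->
  good_rel (products (s : nat, a : nat, b : nat, c : nat, d : nat)).
Proof.
move=> ab bc cd sa sb sc sd.
have ac := ltn_trans ab bc; have bd := ltn_trans bc cd; have ad := ltn_trans ab bd.
have nab := ord_neq_lt ab; have nbc := ord_neq_lt bc; have ncd := ord_neq_lt cd.
have nac := ord_neq_lt ac; have nbd := ord_neq_lt bd; have nad := ord_neq_lt ad.
(* Both triples contain s, so they differ as soon as i or j lies outside {k, l}. *)
have H (i j k l : 'I_7) : s != i -> s != j -> s != k -> s != l -> i != j -> k != l ->
    (i != k) && (i != l) || (j != k) && (j != l) -> tix s i j != tix s k l.
  move=> si sj sk sl ij kl /orP[]/andP[h1 h2].
    apply: (tix_neq (z := i) si sj ij sk sl kl); rewrite !inE; first by rewrite eqxx orbT.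
    by rewrite !negb_or eq_sym si h1 h2.
  apply: (tix_neq (z := j) si sj ij sk sl kl); rewrite !inE; first by rewrite eqxx orbT.
  by rewrite !negb_or eq_sym sj h1 h2.
have nba : b != a by rewrite eq_sym. have ncb : c != b by rewrite eq_sym.
have ndc : d != c by rewrite eq_sym. have nca : c != a by rewrite eq_sym.
have ndb : d != b by rewrite eq_sym. have nda : d != a by rewrite eq_sym.
have e12 : tix s a b != tix s c d by apply: H => //; rewrite nac nad.
have e13 : tix s a b != tix s a c by apply: H => //; rewrite nba nbc orbT.
have e14 : tix s a b != tix s b d by apply: H => //; rewrite nab nad.
have e15 : tix s a b != tix s a d by apply: H => //; rewrite nba nbd orbT.
have e16 : tix s a b != tix s b c by apply: H => //; rewrite nab nac.
have e23 : tix s c d != tix s a c by apply: H => //; rewrite nda ndc orbT.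
have e24 : tix s c d != tix s b d by apply: H => //; rewrite ncb ncd.
have e25 : tix s c d != tix s a d by apply: H => //; rewrite nca ncd.
have e26 : tix s c d != tix s b c by apply: H => //; rewrite ndb ndc orbT.
have e34 : tix s a c != tix s b d by apply: H => //; rewrite nab nad.
have e35 : tix s a c != tix s a d by apply: H => //; rewrite nca ncd orbT.
have e36 : tix s a c != tix s b c by apply: H => //; rewrite nab nac.
have e45 : tix s b d != tix s a d by apply: H => //; rewrite nba nbd.
have e46 : tix s b d != tix s b c by apply: H => //; rewrite ndb ndc orbT.
have e56 : tix s a d != tix s b c by apply: H => //; rewrite nab nac.
apply: good_relI; try exact: tix_lt.
move: e12 e13 e14 e15 e16 e23 e24 e25 e26 e34 e35 e36 e45 e46 e56.
move: (tix s a b) (tix s c d) (tix s a c) (tix s b d) (tix s a d) (tix s b c).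
by move=> t1 t2 t3 t4 t5 t6; rewrite /= !inE !negb_or => -> -> -> -> -> -> -> -> -> -> -> -> -> -> ->.
Qed.


End Link.
Local Close Scope ring_scope.
Local Close Scope classical_set_scope.
Local Transparent tix trips.

Local Open Scope classical_set_scope.
Local Open Scope ring_scope.

Section Link.
Variable R : realType.
Local Notation N := (npl 3 7).
Implicit Types (x y : 'rV[R]_N).

Lemma three_term_tri (s a b c d : 'I_7) : (a < b)%N -> (b < c)%N -> (c < d)%N ->
  s != a -> s != b -> s != c -> s != d ->
  three_term R 3 [set s]%SET a b c d = tri_poly R (products (s : nat, a : nat, b : nat, c : nat, d : nat)).
Proof.
move=> ab bc cd sa sb sc sd.
have ac := ltn_trans ab bc; have bd := ltn_trans bc cd; have ad := ltn_trans ab bd.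
rewrite /three_term !plvar_tix // ?ord_neq_lt //.
rewrite /products.
move: (tix s a b) (tix s c d) (tix s a c) (tix s b d) (tix s a d) (tix s b c) => t1 t2 t3 t4 t5 t6.
by rewrite !mul_pix.
Qed.

Lemma quads_mem (s a b c d : nat) : (a < b)%N -> (b < c)%N -> (c < d)%N -> (d < 7)%N -> (s < 7)%N ->
  s \notin [:: a; b; c; d] -> (s, a, b, c, d) \in quads.
Proof.
move=> ab bc cd d7 s7 sn; rewrite mem_filter; apply/andP; split; first exact: sn.
have c7 := ltn_trans cd d7; have b7 := ltn_trans bc c7; have a7 := ltn_trans ab b7.
have I (i j : nat) : (i < j)%N -> (j < 7)%N -> j \in iota i.+1 (6 - i).
  move=> ij j7; rewrite mem_iota ij /= addSn subnKC //.
  by rewrite -ltnS (leq_trans _ j7) // ltnS ltnW.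
apply/flatten_mapP; exists s; first by rewrite mem_iota.
apply/flatten_mapP; exists a; first by rewrite mem_iota.
apply/flatten_mapP; exists b; first exact: I.
apply/flatten_mapP; exists c; first exact: I.
by apply/mapP; exists d => //; exact: I.
Qed.

Lemma quadsP q : q \in quads -> exists s a b c d : 'I_7,
  [/\ q = (s : nat, a : nat, b : nat, c : nat, d : nat), (a < b)%N, (b < c)%N, (c < d)%N &
      [/\ s != a, s != b, s != c & s != d]].
Proof.
have H : all (fun q => let: (s, a, b, c, d) := q in
   [&& a < b, b < c, c < d, d < 7 & s < 7]%N && (s \notin [:: a; b; c; d])) quads by vm_compute.
move/(allP H); case: q => [[[[s a] b] c] d] /andP[/and5P[ab bc cd d7 s7]].
rewrite !inE !negb_or => /and4P[sa sb sc sd].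
have c7 := ltn_trans cd d7; have b7 := ltn_trans bc c7; have a7 := ltn_trans ab b7.
by exists (Ordinal s7), (Ordinal a7), (Ordinal b7), (Ordinal c7), (Ordinal d7).
Qed.

Lemma three_term_relationsP (f : {mpoly R[N]}) :
  three_term_relations f <-> exists2 q, q \in quads & f = tri_poly R (products q).
Proof.
split.
  case=> S [a [b [c [d [cS [ab bc cd] [nS1 nS2 nS3 nS4] ->]]]]].
  have /cards1P[s Es] : #|S| == 1%N by rewrite -(eqn_add2r 2) cS.
  move: nS1 nS2 nS3 nS4; rewrite {}Es !inE ![_ == s]eq_sym => sa sb sc sd.
  exists (s : nat, a : nat, b : nat, c : nat, d : nat); last exact: three_term_tri.
  by apply: quads_mem; rewrite ?ltn_ord // !inE !negb_or sa sb sc sd.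
case=> q /quadsP[s [a [b [c [d [-> ab bc cd [sa sb sc sd]]]]]]] ->.
exists [set s]%SET, a, b, c, d; split; rewrite ?cards1 ?inE ?[_ == s]eq_sym //.
by rewrite three_term_tri.
Qed.

Lemma good_quad q : q \in quads -> good_rel (products q).
Proof.
by move=> /quadsP[s [a [b [c [d [-> ab bc cd [sa sb sc sd]]]]]]]; apply: good_products.
Qed.

Lemma chs_signs (neg : seq (seq nat)) :
  [seq (signvec_of_negatives neg : signvec 3 7) (tk t) | t <- iota 0 35] = signs neg.
Proof.
apply: (@eq_from_nth _ false); rewrite size_map size_iota; first by rewrite size_map size_trips.
move=> t t35; rewrite (nth_map 0%N) ?size_iota // nth_iota // add0n.
rewrite (nth_map [::]) ?size_trips // /signvec_of_negatives val_tk // -(enum_tset t35).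
by rewrite -map_comp.
Qed.

Definition dr (rl : seq trel) (X : nat -> R) : Prop :=
  forall c a b, (c, a, b) \in rl -> val2 X c = Num.min (val2 X a) (val2 X b).

Definition face_le (rl : seq trel) (X Y : nat -> R) : Prop :=
  forall c a b, (c, a, b) \in rl ->
    (val2 X a <= val2 X b -> val2 Y a <= val2 Y b) /\
    (val2 X b <= val2 X a -> val2 Y b <= val2 Y a).

Lemma chi_DressianP (neg : seq (seq nat)) (x : 'rV[R]_N) :
  all (fun q => mixed (signs neg) (products q)) quads ->
  chi_Dressian R (signvec_of_negatives neg) x <-> dr (rels (signs neg)) (coord x).
Proof.
move=> /allP mx.
have key q : q \in quads -> TropV (signvec_of_negatives neg) (tri_poly R (products q)) x <->
    let: (c, a, b) := lone_first (signs neg) (products q) in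
    val2 (coord x) c = Num.min (val2 (coord x) a) (val2 (coord x) b).
  move=> qin; have := good_quad qin; have := mx _ qin; rewrite -chs_signs.
  by case: (products q) => [[p1 p2] p3] mxq gq; apply: TropV_tri.
split=> H.
  move=> c a b /mapP[q qin E]; have [k1 _] := key _ qin; rewrite -E in k1; apply: k1.
  by apply: H; apply/three_term_relationsP; exists q.
move=> f /three_term_relationsP[q qin ->]; apply/(key _ qin).
case E : (lone_first _ _) => [[c a] b]; apply: H.
by apply/mapP; exists q.
Qed.

Lemma lone_first_mem chs p1 p2 p3 c a b : lone_first chs (p1, p2, p3) = (c, a, b) ->
  [:: p1; p2; p3] =i [:: c; a; b].
Proof.
rewrite /lone_first; case: ifP => _; last case: ifP => _; case=> -> -> -> p //.
  by rewrite !inE orbA orbC.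
by rewrite !inE orbCA.
Qed.

(** At a point of the Dressian the minimum of a relation is attained at c and at the smaller of a
    and b. Keeping the minimizing monomials minimal therefore amounts to keeping c = min(a, b) and
    the weak comparisons between a and b. *)
Lemma Dressian_coneP chs (x y : 'rV[R]_N) : dr (rels chs) (coord x) ->
  Dressian_cone x y <-> dr (rels chs) (coord y) /\ face_le (rels chs) (coord x) (coord y).
Proof.
move=> drx.
have key q c a b : q \in quads -> lone_first chs (products q) = (c, a, b) ->
   (forall m, m \in msupp (tri_poly R (products q)) ->
     Trop (tri_poly R (products q)) x = (mdot m x)%:E ->
     Trop (tri_poly R (products q)) y = (mdot m y)%:E) <->
   [/\ val2 (coord y) c = Num.min (val2 (coord y) a) (val2 (coord y) b),
       (val2 (coord x) a <= val2 (coord x) b -> val2 (coord y) a <= val2 (coord y) b) &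
       (val2 (coord x) b <= val2 (coord x) a -> val2 (coord y) b <= val2 (coord y) a)].
  move=> qin E; have cx : val2 (coord x) c = Num.min (val2 (coord x) a) (val2 (coord x) b).
    by apply: drx; apply/mapP; exists q.
  have := good_quad qin; case: (products q) E => [[p1 p2] p3] /lone_first_mem M g.
  rewrite cone_tri //.
  have {}M : (forall p, p \in [:: p1; p2; p3] ->
     (forall q, q \in [:: p1; p2; p3] -> val2 (coord x) p <= val2 (coord x) q) ->
     (forall q, q \in [:: p1; p2; p3] -> val2 (coord y) p <= val2 (coord y) q)) <->
    (forall p, p \in [:: c; a; b] ->
     (forall q, q \in [:: c; a; b] -> val2 (coord x) p <= val2 (coord x) q) ->
     (forall q, q \in [:: c; a; b] -> val2 (coord y) p <= val2 (coord y) q)).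
    by split=> H p pin Hx q' q'in; (apply: (H p); rewrite ?M // -?M // => z zin; apply: Hx; rewrite ?M // -?M).
  rewrite M; move: cx.
  set xc := val2 (coord x) c; set xa := val2 (coord x) a; set xb := val2 (coord x) b.
  set yc := val2 (coord y) c; set ya := val2 (coord y) a; set yb := val2 (coord y) b.
  move=> cx; split=> H.
    have Hc : yc <= ya /\ yc <= yb.
      have hx z : z \in [:: c; a; b] -> val2 (coord x) c <= val2 (coord x) z.
        by rewrite !inE => /or3P[]/eqP->; rewrite ?lexx // -/xc cx ge_min lexx ?orbT.
      have h1 := H c (mem_head _ _) hx.
      by split; apply: h1; rewrite !inE eqxx ?orbT.
    have Ha : xa <= xb -> ya <= yc /\ ya <= yb.
      move=> ab.
      have hx z : z \in [:: c; a; b] -> val2 (coord x) a <= val2 (coord x) z.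
        by rewrite !inE => /or3P[]/eqP->; rewrite ?lexx // -/xa -/xc cx le_min lexx ab.
      have h1 := H a; rewrite !inE eqxx orbT in h1; have {}h1 := h1 isT hx.
      by split; apply: h1; rewrite !inE eqxx ?orbT.
    have Hb : xb <= xa -> yb <= yc /\ yb <= ya.
      move=> ab.
      have hx z : z \in [:: c; a; b] -> val2 (coord x) b <= val2 (coord x) z.
        by rewrite !inE => /or3P[]/eqP->; rewrite ?lexx // -/xb -/xc cx le_min lexx ab.
      have h1 := H b; rewrite !inE eqxx !orbT in h1; have {}h1 := h1 isT hx.
      by split; apply: h1; rewrite !inE eqxx ?orbT.
    split=> [|/Ha[]|/Hb[]] //.
    case: Hc => ca cb; apply/eqP; rewrite eq_le le_min ca cb /= ge_min.
    by case/orP: (le_total xa xb) => [/Ha[->]|/Hb[->]]; rewrite ?orbT.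
  case: H => yE Ha Hb p; rewrite !inE => /or3P[]/eqP-> Hx z; rewrite !inE => /or3P[]/eqP->;
    rewrite ?lexx // -/yc -/ya -/yb ?yE ?ge_min ?le_min ?lexx ?orbT //=.
  - by apply: Ha; apply: Hx; rewrite !inE eqxx ?orbT.
  - by apply: Ha; apply: Hx; rewrite !inE eqxx ?orbT.
  - by rewrite andbT; apply: Hb; apply: Hx; rewrite !inE eqxx ?orbT.
  - by apply: Hb; apply: Hx; rewrite !inE eqxx ?orbT.
split=> [H|[dry fl] f /three_term_relationsP[q qin ->]].
  have K c a b : (c, a, b) \in rels chs -> 
     [/\ val2 (coord y) c = Num.min (val2 (coord y) a) (val2 (coord y) b),
       (val2 (coord x) a <= val2 (coord x) b -> val2 (coord y) a <= val2 (coord y) b) &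
       (val2 (coord x) b <= val2 (coord x) a -> val2 (coord y) b <= val2 (coord y) a)].
    move=> /mapP[q qin E]; apply/(key _ _ _ _ qin (esym E)).
    by apply: H; apply/three_term_relationsP; exists q.
  by split=> c a b /K[].
case E : (lone_first chs (products q)) => [[c a] b].
apply/(key _ _ _ _ qin E).
have rin : (c, a, b) \in rels chs by apply/mapP; exists q.
by have [] := fl _ _ _ rin; split=> //; apply: dry.
Qed.

End Link.
Local Close Scope ring_scope.
Local Close Scope classical_set_scope.

(** * Fans cut out by tropical equations *)

Local Open Scope classical_set_scope.
Local Open Scope ring_scope.

Lemma count_lt (T : eqType) (s : seq T) (p q : pred T) (r : T) :
  {in s, forall x, p x -> q x} -> r \in s -> ~~ p r -> q r -> (count p s < count q s)%N.
Proof.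
have le s' : {in s', forall x, p x -> q x} -> (count p s' <= count q s')%N.
  elim: s' => //= x s' IH sub; rewrite leq_add ?IH //; last first.
    by move=> y ys; apply: sub; rewrite inE ys orbT.
  by have := sub x (mem_head _ _); case: (p x) => // ->.
elim: s => // x s IH sub; rewrite inE => /predU1P[<-|rin] np qr /=.
  rewrite (negPf np) qr add0n add1n ltnS le // => y ys; apply: sub; by rewrite inE ys orbT.
rewrite -addnS leq_add //; last by apply: IH => // y ys; apply: sub; rewrite inE ys orbT.
by have := sub x (mem_head _ _); case: (p x) => // ->.
Qed.

Section Fan.
Variables (R : realType) (N n : nat) (Lm : 'M[R]_(n, N)).
Local Notation V := 'rV[R]_N.
Local Notation F := 'cV[R]_N.
Definition ev (x : V) (l : F) : R := (x *m l) 0 0.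

Lemma evD x y l : ev (x + y) l = ev x l + ev y l.
Proof. by rewrite /ev mulmxDl mxE. Qed.
Lemma evB x y l : ev (x - y) l = ev x l - ev y l.
Proof. by rewrite /ev mulmxBl !mxE. Qed.
Lemma evZ k x l : ev (k *: x) l = k * ev x l.
Proof. by rewrite /ev -scalemxAl mxE. Qed.
Lemma ev0 l : ev 0 l = 0.
Proof. by rewrite /ev mul0mx mxE. Qed.
Lemma evBr x l m : ev x (l - m) = ev x l - ev x m.
Proof. by rewrite /ev mulmxBr !mxE. Qed.

Lemma evN x l : ev x (- l) = - ev x l.
Proof. by rewrite /ev mulmxN mxE. Qed.
Lemma ev_col x (A : 'M[R]_N) j : ev x (col j A) = (x *m A) 0 j.
Proof. by rewrite /ev !mxE; apply: eq_bigr => i _; rewrite !mxE. Qed.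

Lemma polyhedral_coneI (C : set V) (ls : seq F) :
  (forall z, C z <-> (forall l, l \in ls -> 0 <= ev z l)) -> polyhedral_cone C.
Proof.
move=> H; exists (size ls), (\matrix_(i < N, j < size ls) (nth 0 ls j) i 0).
apply/seteqP; split=> z.
  move=> /H Cz j; have -> : (z *m (\matrix_(i < N, j < size ls) (nth 0 ls j) i 0)) 0 j = ev z (nth 0 ls j).
    by rewrite /ev !mxE; apply: eq_bigr => i _; rewrite !mxE.
  by apply: Cz; rewrite mem_nth.
move=> Hz; apply/H => l lin; have li : (index l ls < size ls)%N by rewrite index_mem.
have := Hz (Ordinal li); congr (0 <= _).
by rewrite /ev !mxE; apply: eq_bigr => i _; rewrite !mxE /= nth_index.
Qed.

Variable gl : seq (F * F * F).
Definition DR (x : V) : Prop :=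
  forall c a b, (c, a, b) \in gl -> ev x c = Num.min (ev x a) (ev x b).
Definition FL (x y : V) : Prop := forall c a b, (c, a, b) \in gl ->
  (ev x a <= ev x b -> ev y a <= ev y b) /\ (ev x b <= ev x a -> ev y b <= ev y a).
(** Points whose pattern of comparisons is that of x or a degeneration of it, where strict signs may
    become ties. *)
Definition Kc (x : V) : set V := [set y | DR y /\ FL x y].

(** On this cone the smaller of a and b is fixed, so c = min(a, b) is a linear equation; it is
    encoded as two opposite inequalities. A tie at x contributes both halves. *)
Definition kfun (x : V) (r : F * F * F) : seq F :=
  let: (c, a, b) := r in
  (if ev x a <= ev x b then [:: a - c; c - a; b - a] else [::]) ++
  (if ev x b <= ev x a then [:: b - c; c - b; a - b] else [::]).
Definition kfuns x := flatten [seq kfun x r | r <- gl].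

Lemma KcP x y : Kc x y <-> (forall l, l \in kfuns x -> 0 <= ev y l).
Proof.
split=> [[dy fy] l /flatten_mapP[[[c a] b] rin]|H].
  have := dy _ _ _ rin; have [f1 f2] := fy _ _ _ rin.
  rewrite mem_cat => E /orP[].
    case: ifP => // /f1 ab; rewrite (min_l ab) in E.
    by rewrite !inE => /or3P[]/eqP->; rewrite evBr subr_ge0 ?E.
  case: ifP => // /f2 ab; rewrite (min_r ab) in E.
  by rewrite !inE => /or3P[]/eqP->; rewrite evBr subr_ge0 ?E.
have K c a b : (c, a, b) \in gl ->
  (ev x a <= ev x b -> ev y c = ev y a /\ ev y a <= ev y b) /\
  (ev x b <= ev x a -> ev y c = ev y b /\ ev y b <= ev y a).
  move=> rin; split=> xab.
    have h l : l \in [:: a - c; c - a; b - a] -> 0 <= ev y l.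
      by move=> lin; apply: H; apply/flatten_mapP; exists (c, a, b) => //; rewrite mem_cat xab lin.
    have := h (a - c); have := h (c - a); have := h (b - a).
    rewrite !inE !eqxx ?orbT !evBr !subr_ge0 => /(_ isT) h1 /(_ isT) h2 /(_ isT) h3.
    by split=> //; apply/eqP; rewrite eq_le h2 h3.
  have h l : l \in [:: b - c; c - b; a - b] -> 0 <= ev y l.
    by move=> lin; apply: H; apply/flatten_mapP; exists (c, a, b) => //; rewrite mem_cat xab lin orbT.
  have := h (b - c); have := h (c - b); have := h (a - b).
  rewrite !inE !eqxx ?orbT !evBr !subr_ge0 => /(_ isT) h1 /(_ isT) h2 /(_ isT) h3.
  by split=> //; apply/eqP; rewrite eq_le h2 h3.
split=> c a b rin; have [k1 k2] := K _ _ _ rin.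
  by case/orP: (le_total (ev x a) (ev x b)) => [/k1[-> /min_l->]|/k2[-> /min_r->]].
by split=> [/k1[]|/k2[]].
Qed.

Lemma KcD x y z : Kc x y -> Kc x z -> Kc x (y + z).
Proof.
by move=> /KcP hy /KcP hz; apply/KcP => l lin; rewrite evD addr_ge0 ?hy ?hz.
Qed.

Lemma KcZ x y k : 0 <= k -> Kc x y -> Kc x (k *: y).
Proof. by move=> k0 /KcP hy; apply/KcP => l lin; rewrite evZ mulr_ge0 ?hy. Qed.

Lemma Kc0 x : Kc x 0.
Proof. by apply/KcP => l lin; rewrite ev0. Qed.

Lemma Kc_self x : DR x -> Kc x x.
Proof. by move=> dx; split=> // c a b rin. Qed.

Lemma Kc_trans x y : Kc x y -> Kc y `<=` Kc x.
Proof.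
move=> [_ f] z [dz g]; split=> // c a b rin.
by have [f1 f2] := f _ _ _ rin; have [g1 g2] := g _ _ _ rin; split=> [/f1/g1|/f2/g2].
Qed.

Hypothesis HL : forall c a b, (c, a, b) \in gl -> Lm *m c = Lm *m a /\ Lm *m a = Lm *m b.

Lemma ev_lin u c a b : (c, a, b) \in gl ->
  ev (u *m Lm) c = ev (u *m Lm) a /\ ev (u *m Lm) a = ev (u *m Lm) b.
Proof. by move=> /HL[h1 h2]; rewrite /ev -!mulmxA h1 h2. Qed.

Lemma Kc_lin x y u : Kc x y -> Kc x (y + u *m Lm).
Proof.
move=> [dy fy]; split=> c a b rin; have [e1 e2] := ev_lin u rin.
  by rewrite !evD e1 e2 (dy _ _ _ rin) addr_minl.
by rewrite !evD e2 !lerD2r; apply: fy rin.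
Qed.

Local Notation P := (cokermx Lm).
Local Notation Q := (pinvmx (cokermx Lm)).
Local Notation pr := (fun x : V => x *m P).

Lemma prP x y : pr x = pr y <-> exists u, y = x + u *m Lm.
Proof.
split=> [E|[u ->]].
  have /submxP[u Eu] : (y - x <= Lm)%MS by rewrite submxE mulmxBl -E subrr.
  by exists u; rewrite -Eu addrCA subrr addr0.
by rewrite mulmxDl -mulmxA mulmx_coker mulmx0 addr0.
Qed.

Lemma prQ (x : V) : exists u, x *m P *m Q = x + u *m Lm.
Proof. by apply/prP; rewrite mulmxKpV ?submxMl. Qed.

Lemma pr_Kc x z : (pr @` Kc x) (pr z) <-> Kc x z.
Proof.
split=> [[y Ky /prP[u ->]]|Kz]; last by exists z.
exact: Kc_lin.
Qed.

Lemma pr_Kc_sub x y : pr @` Kc x `<=` pr @` Kc y <-> Kc x `<=` Kc y.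
Proof.
split=> H z; first by move=> Kz; apply/pr_Kc; apply: H; exists z.
by move=> [w Kw <-]; apply/pr_Kc; apply: H.
Qed.

(** The pseudo-inverse Q lifts a projected point up to the lineality space, along which the cone is
    invariant, so its inequalities can be pulled back along Q. The image of the projection consists
    of the points fixed by Q P, which the columns of Q P - 1 and their opposites express. *)
Lemma pr_polyhedral x : polyhedral_cone (pr @` Kc x).
Proof.
pose cols := [seq col j (Q *m P - 1%:M) | j <- enum 'I_N].
apply: (@polyhedral_coneI _ ([seq Q *m l | l <- kfuns x] ++ cols ++ [seq - l | l <- cols])).
move=> z; split.
  move=> [y Ky <-] l; rewrite !mem_cat => /or3P[/mapP[k kin ->]|/mapP[j _ ->]|/mapP[k /mapP[j _ ->] ->]].
  - have [u E] := prQ y; rewrite /ev mulmxA E; apply: (proj1 (KcP _ _) _ _ kin).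
    exact: Kc_lin.
  - by rewrite ev_col mulmxBr mulmx1 mulmxA mulmxKpV ?submxMl // subrr mxE.
  - by rewrite evN ev_col mulmxBr mulmx1 mulmxA mulmxKpV ?submxMl // subrr mxE oppr0.
move=> H; have E : z *m Q *m P = z.
  apply/subr0_eq; rewrite -{2}[z]mulmx1 -mulmxA -mulmxBr; apply/rowP => j.
  have jin : col j (Q *m P - 1%:M) \in cols.
    by apply: (map_f (fun j => col j (Q *m P - 1%:M))); rewrite mem_enum.
  have h1 : 0 <= ev z (col j (Q *m P - 1%:M)) by apply: H; rewrite !mem_cat jin orbT.
  have h2 : 0 <= ev z (- col j (Q *m P - 1%:M)).
    by apply: H; rewrite !mem_cat (map_f (fun l => - l) jin) !orbT.
  rewrite evN ev_col oppr_ge0 in h2; rewrite ev_col in h1; rewrite [RHS]mxE.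
  by apply/eqP; rewrite eq_le h1 h2.
exists (z *m Q) => //; apply/KcP => l lin.
have := H (Q *m l); rewrite mem_cat map_f // => /(_ isT).
by rewrite /ev mulmxA.
Qed.

(** Used to move a little from a point of a polyhedron against a second one without leaving it:
    inequalities that are tight at the first point must be tight at the second. *)
Lemma small_eps (s : seq (R * R)) :
  (forall u v, (u, v) \in s -> 0 <= u /\ (u = 0 -> v = 0)) ->
  exists2 e : R, 0 < e & forall u v, (u, v) \in s -> 0 <= u - e * v.
Proof.
elim: s => [|[u v] s IH] H; first by exists 1.
have [|e e0 He] := IH; first by move=> u' v' h; apply: H; rewrite inE h orbT.
have [u0 uv] := H u v (mem_head _ _).
have [vle|vgt] := lerP v 0.
  exists e => // u' v'; rewrite inE => /predU1P[[-> ->]|/He //].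
  by rewrite subr_ge0 (le_trans _ u0) // mulr_ge0_le0 // ltW.
have u1 : 0 < u by rewrite lt_neqAle u0 andbT eq_sym; apply: contraTneq vgt => /uv ->; rewrite ltxx.
exists (Num.min e (u / v)); first by rewrite lt_min e0 divr_gt0.
move=> u' v'; rewrite inE => /predU1P[[-> ->]|uin].
  by rewrite subr_ge0 -ler_pdivlMr // ge_min lexx orbT.
have := He _ _ uin; rewrite !subr_ge0 => h.
have [v'le|v'gt] := lerP v' 0.
  have /H[u'0 _] : (u', v') \in (u, v) :: s by rewrite inE uin orbT.
  by rewrite (le_trans _ u'0) // mulr_ge0_le0 // le_min (ltW e0) divr_ge0 // ltW.
by apply: le_trans h; rewrite ler_wpM2r ?ge_min ?lexx // ltW.
Qed.

(** An inequality tight at y is a tie of y or one of its equations, and both persist in the cone of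
    y. *)
Lemma kfun_vanish x y z l : Kc x y -> Kc y z -> l \in kfuns x -> ev y l = 0 -> ev z l = 0.
Proof.
move=> Kxy Kyz /flatten_mapP[[[c a] b] rin] lin.
have [dy _] := Kxy; have Ey := dy _ _ _ rin; have [dz fz] := Kyz; have Ez := dz _ _ _ rin.
have [f1 f2] := fz _ _ _ rin.
have g : ev y a = ev y b -> ev z a = ev z b.
  by move=> e; apply/eqP; rewrite eq_le f1 ?f2 ?e.
have {}Ez : (ev y a <= ev y b -> ev z c = ev z a) /\ (ev y b <= ev y a -> ev z c = ev z b).
  by split=> [/f1 h|/f2 h]; rewrite Ez ?(min_l h) ?(min_r h).
case/orP: (le_total (ev y a) (ev y b)) => hy; rewrite ?(min_l hy) ?(min_r hy) in Ey.
  have [e1 _] := Ez; have {}e1 := e1 hy.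
  by move: lin; rewrite mem_cat => /orP[]; case: ifP => // _; rewrite !inE => /or3P[]/eqP->; rewrite !evBr => e;
    first [lra | have /g : ev y a = ev y b by lra]; lra.
have [_ e1] := Ez; have {}e1 := e1 hy.
by move: lin; rewrite mem_cat => /orP[]; case: ifP => // _; rewrite !inE => /or3P[]/eqP->; rewrite !evBr => e;
  first [lra | have /g : ev y a = ev y b by lra]; lra.
Qed.

Definition strict (y : V) : nat := count (fun r : F * F * F => ev y r.1.2 != ev y r.2) gl.

Lemma Kc_face (x : V) (l : F) : (forall y, Kc x y -> 0 <= ev y l) ->
  exists y, [/\ DR y, Kc x y & Kc y = Kc x `&` [set z | ev z l = 0]].
Proof.
move=> lpos.
pose G := [set y | Kc x y /\ ev y l = 0].
(* A relative interior point of the face: one with as many strict relations as possible. It exists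
   because their number is bounded. *)
have [y [Gy ymax]] : exists y, G y /\ forall z, G z -> (strict z <= strict y)%N.
  pose p := fun k => `[< exists2 y, G y & strict y = k >].
  have ex : exists k, p k by exists (strict 0); apply/asboolP; exists 0 => //; split; [exact: Kc0 | exact: ev0].
  have ub k : p k -> (k <= size gl)%N by move=> /asboolP[y _ <-]; exact: count_size.
  case: (ex_maxnP ex ub) => k /asboolP[y Gy <-] kmax.
  by exists y; split=> // z Gz; apply: kmax; apply/asboolP; exists z.
have [Kxy ly] := Gy.
exists y; split; [by case: Kxy | by [] | apply/seteqP; split=> z].
  move=> Kyz; have Kxz := Kc_trans Kxy Kyz; split=> //=.
  (* Moving from y slightly against z stays in the cone of x, so l cannot be positive at z. *)
  have [|e e0 He] := @small_eps [seq (ev y k, ev z k) | k <- kfuns x].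
    move=> u v /mapP[k kin [-> ->]]; split; first exact: (proj1 (KcP _ _) Kxy).
    exact: kfun_vanish kin.
  have Kw : Kc x (y - e *: z).
    apply/KcP => k kin; rewrite evB evZ; apply: He.
    by apply/mapP; exists k.
  have := lpos _ Kw; rewrite evB evZ ly sub0r oppr_ge0 pmulr_rle0 // => h.
  by apply/eqP; rewrite eq_le h lpos.
move=> [Kxz lz]; split; first by case: Kxz.
(* The sum y + z lies in the face and is strict wherever y is. By maximality it is strict nowhere
   else, so each tie at y is also a tie at z. *)
have Gyz : G (y + z) by split; [exact: KcD | rewrite evD ly lz addr0].
have [_ fy] := Kxy; have [_ fz] := Kxz.
have sub : {in gl, forall r : F * F * F, ev y r.1.2 != ev y r.2 -> ev (y + z) r.1.2 != ev (y + z) r.2}.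
  move=> [[c a] b] rin /=; have [p1 p2] := fy _ _ _ rin; have [q1 q2] := fz _ _ _ rin.
  rewrite !evD => ne; case/orP: (le_total (ev x a) (ev x b)) => h.
    have h1 := p1 h; have h2 := q1 h; apply: contra_neq ne; lra.
  have h1 := p2 h; have h2 := q2 h; apply: contra_neq ne; lra.
have eqv : {in gl, forall r : F * F * F, ev y r.1.2 = ev y r.2 -> ev (y + z) r.1.2 = ev (y + z) r.2}.
  move=> r rin e; apply/eqP; apply: contraT => ne.
  have : (strict y < strict (y + z))%N.
    apply: (@count_lt _ gl _ _ r) => //; by rewrite e eqxx.
  by rewrite ltnNge ymax.
move=> c a b rin; have [p1 p2] := fy _ _ _ rin; have [q1 q2] := fz _ _ _ rin.
have := eqv _ rin => /=; rewrite !evD => ee.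
case/orP: (le_total (ev x a) (ev x b)) => h.
  have h1 := p1 h; have h2 := q1 h; split=> h3; first by [].
  have e : ev y a = ev y b by lra.
  have := ee e; lra.
have h1 := p2 h; have h2 := q2 h; split=> h3; last by [].
have e : ev y a = ev y b by lra.
have := ee e; lra.
Qed.

Definition fan : set (set V) := [set pr @` Kc x | x in DR].

Lemma Kc_pattern x x' :
  (forall r, r \in gl -> (ev x r.1.2 <= ev x r.2) = (ev x' r.1.2 <= ev x' r.2) /\
                       (ev x r.2 <= ev x r.1.2) = (ev x' r.2 <= ev x' r.1.2)) ->
  Kc x = Kc x'.
Proof.
move=> H; apply/seteqP; split=> z [dz f]; split=> // c a b rin; have [h1 h2] := H _ rin;
  have [f1 f2] := f _ _ _ rin; rewrite /= in h1 h2.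
  by rewrite -h1 -h2.
by rewrite h1 h2.
Qed.

Lemma fan_finite : finite_set fan.
Proof.
(* A cone depends only on the comparisons at its base point, which form an element of a finite
   type. *)
pose pat (x : V) : {ffun 'I_(size gl) -> bool * bool} :=
  [ffun i : 'I_(size gl) => let r := nth (0, 0, 0) gl i in (ev x r.1.2 <= ev x r.2, ev x r.2 <= ev x r.1.2)].
pose cone_of (p : {ffun 'I_(size gl) -> bool * bool}) : set V :=
  pr @` [set y | exists2 x, pat x = p & Kc x y].
apply: (sub_finite_set (B := cone_of @` setT)); last by apply: finite_image; exact: finite_finset.
move=> C [x dx <-]; exists (pat x) => //; rewrite /cone_of; congr (_ @` _).
apply/seteqP; split=> y; last by move=> Ky; exists x.
move=> [x' E Ky]; suff -> : Kc x = Kc x' by [].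
apply: Kc_pattern => r rin; have ri : (index r gl < size gl)%N by rewrite index_mem.
have := congr1 (fun f : {ffun 'I_(size gl) -> bool * bool} => f (Ordinal ri)) E.
by rewrite !ffunE /= nth_index // => -[-> ->].
Qed.

Lemma DR0 : DR 0.
Proof. by move=> c a b rin; rewrite !ev0 minxx. Qed.

Lemma ev_prQ x c a b : (c, a, b) \in gl -> ev (x *m P *m Q) (a - b) = ev x (a - b).
Proof.
move=> rin; have [u ->] := prQ x; rewrite evD evBr evBr.
by have [_ ->] := ev_lin u rin; rewrite subrr addr0.
Qed.

(** A form that is nonnegative on the cone of x and vanishes where a strict sign of x not shared by
    y becomes a tie. *)
Definition sep (x y : V) (r : F * F * F) : F :=
  let: (c, a, b) := r in
  if (ev x a < ev x b) && ~~ (ev y a < ev y b) then b - a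
  else if (ev x b < ev x a) && ~~ (ev y b < ev y a) then a - b else 0.

Lemma ev_sum x (s : seq (F * F * F)) (f : F * F * F -> F) :
  ev x (\sum_(r <- s) f r) = \sum_(r <- s) ev x (f r).
Proof. by rewrite /ev mulmx_sumr summxE. Qed.

(** A sum of nonnegative forms vanishes only where each of them does. On the cone of x this happens
    exactly when no strict sign foreign to y is left, that is, on the cone of y. *)
Lemma inter_face x y : DR x -> DR y -> is_face (pr @` Kc x `&` pr @` Kc y) (pr @` Kc x).
Proof.
move=> dx dy; pose h := \sum_(r <- gl) sep x y r.
have pos z : Kc x z -> forall r, r \in gl -> 0 <= ev z (sep x y r).
  move=> [dz fz] [[c a] b] rin; have [f1 f2] := fz _ _ _ rin; rewrite /sep.
  case: ifP => [/andP[/ltW/f1 hab _]|_]; first by rewrite evBr subr_ge0.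
  case: ifP => [/andP[/ltW/f2 hab _]|_]; first by rewrite evBr subr_ge0.
  by rewrite /ev mulmx0 mxE.
have hQ z : ev (z *m P *m Q) h = ev z h.
  rewrite !ev_sum; apply: eq_big_seq => -[[c a] b] rin; rewrite /sep.
  case: ifP => _; first by rewrite -opprB /ev !mulmxN mxE [in RHS]mxE -!/(ev _ _) (ev_prQ z rin).
  case: ifP => _; first exact: ev_prQ rin.
  by rewrite /ev !mulmx0 !mxE.
have h0 z : Kc x z -> (ev z h = 0 <-> Kc y z).
  move=> Kz; have [dz fz] := Kz; split.
    move=> /eqP; rewrite ev_sum big_seq psumr_eq0 => [/allP H|r rin]; last exact: pos.
    split=> // c a b rin; have [f1 f2] := fz _ _ _ rin.
    have := H _ rin; rewrite rin /= /sep => /eqP.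
    case: ltgtP (f1) (f2) => xab {}f1 {}f2 /=.
    - have h1 := f1 isT; case: (ltP (ev y a) (ev y b)) => yab /=; last by rewrite evBr => ?; split=> _; lra.
      by move=> _; split=> // /le_lt_trans /(_ yab); rewrite ltxx.
    - have h1 := f2 isT; case: (ltP (ev y b) (ev y a)) => yab /=; last by rewrite evBr => ?; split=> _; lra.
      by move=> _; split=> // /le_lt_trans /(_ yab); rewrite ltxx.
    - by move=> _; have h1 := f1 isT; have h2 := f2 isT; split.
  move=> [_ gz]; rewrite ev_sum big1_seq // => -[[c a] b] /andP[_ rin]; rewrite /sep.
  have [f1 f2] := fz _ _ _ rin; have [g1 g2] := gz _ _ _ rin.
  case: ifP => [/andP[/ltW/f1 hab]|_].
    by rewrite -leNgt => /g2 hba; rewrite evBr; lra.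
  case: ifP => [/andP[/ltW/f2 hab]|_]; last by rewrite /ev mulmx0 mxE.
  by rewrite -leNgt => /g1 hba; rewrite evBr; lra.
exists (Q *m h); split.
  move=> _ [z Kz <-]; rewrite mulmxA -/(ev _ _) hQ ev_sum big_seq sumr_ge0 // => r rin.
  exact: pos.
apply/seteqP; split=> w [[z Kz <-] H]; (split; first by exists z).
  by rewrite /= mulmxA -/(ev _ _) hQ; apply/h0 => //; apply/pr_Kc.
by rewrite /= mulmxA -/(ev _ _) hQ in H; apply/pr_Kc/h0.
Qed.

Lemma fan_polyhedral : polyhedral_fan fan.
Proof.
split.
- exact: fan_finite.
- by exists (pr @` Kc 0), 0 => //; exact: DR0.
- by move=> C [x _ <-]; exact: pr_polyhedral.
- move=> C G [x dx <-] [l [lpos ->]].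
  have [|y [dy Kxy E]] := @Kc_face x (P *m l).
    by move=> y Ky; rewrite /ev mulmxA; apply: lpos; exists y.
  exists y => //; apply/seteqP; split=> w.
    move=> [z]; rewrite E => -[Kz lz] <-; split; first by exists z.
    by move: lz; rewrite /= /ev mulmxA.
  move=> [[z Kz <-] lz]; exists z => //; rewrite E; split=> //.
  by rewrite /= /ev mulmxA; exact: lz.
- move=> C D [x dx <-] [y dy <-]; split; first exact: inter_face.
  by rewrite setIC; exact: inter_face.
Qed.

Lemma fan_support : \bigcup_(C in fan) C = pr @` DR.
Proof.
apply/seteqP; split=> w.
  by move=> [C [x dx <-] [y [dy _] <-]]; exists y.
move=> [x dx <-]; exists (pr @` Kc x); first by exists x.
by exists x => //; apply: Kc_self.
Qed.

End Fan.
Local Close Scope ring_scope.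
Local Close Scope classical_set_scope.

(** * Cells and dimensions *)

Local Open Scope classical_set_scope.
Local Open Scope ring_scope.

Section Avoid.
Variables (R : realType) (N : nat).
Local Notation V := 'rV[R]_N.
Variable K : set V.
Hypothesis KD : forall a b (s : R), K a -> K b -> 0 < s -> K (b + s *: a).

(** A cone covered by finitely many subspaces lies in one of them. If a avoids subspace i, then
    among more points b + t a than there are subspaces two share one; it contains a and b, so it is
    not i, and b is covered by the others. *)
Lemma cone_in_union (I : eqType) (Q : I -> V -> Prop) (l : seq I) :
  (forall j y z (s : R), Q j y -> Q j z -> Q j (s *: y + z)) ->
  K !=set0 ->
  (forall y, K y -> exists2 j, j \in l & Q j y) -> exists2 j, j \in l & forall y, K y -> Q j y.
Proof.
move=> lin [k0 Kk0]; elim: l => [H|i l IH H]; first by have [] := H _ Kk0.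
have [Ki|/existsNP[a /not_implyP[Ka nQa]]] := pselect (forall y, K y -> Q i y).
  by exists i => //; rewrite mem_head.
have [b Kb|j jl Hj] := IH; last by exists j => //; rewrite inE jl orbT.
have pick_ (s : 'I_(size l).+2) : exists j : 'I_(size l).+1, Q (nth i (i :: l) j) (b + (s%:R + 1) *: a).
  have [|j jin Qj] := H (b + (s%:R + 1) *: a); first by apply: KD => //; rewrite ltr_wpDl.
  have jl : (index j (i :: l) < (size l).+1)%N by rewrite -index_mem in jin.
  by exists (Ordinal jl); rewrite /= -/(nth i (i :: l) _) nth_index.
have [f Hf] := choice pick_.
have /injectivePn[s [t st Est]] : ~~ injectiveb f.
  by apply/negP => /injectiveP /leq_card; rewrite !card_ord ltnn.
have Qs := Hf s; have Qt := Hf t; rewrite -Est in Qt.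
set j := nth _ _ _ in Qs Qt.
have st' : (s%:R : R) - t%:R != 0.
  by rewrite subr_eq0 eqr_nat; apply: contra st => /eqP e; apply/eqP/val_inj.
have Q0 : Q j 0 by rewrite -(subrr (b + (t%:R + 1) *: a)) addrC -scaleN1r; apply: lin.
have Qd : Q j ((s%:R - t%:R) *: a).
  have -> : (s%:R - t%:R) *: a = -1 *: (b + (t%:R + 1) *: a) + (b + (s%:R + 1) *: a).
    rewrite scaleN1r opprD [RHS]addrC addrACA subrr add0r -scalerBl.
    by congr (_ *: _); lra.
  exact: lin.
have Qa : Q j a.
  by have := lin j _ _ (s%:R - t%:R)^-1 Qd Q0; rewrite scalerA mulVf // scale1r addr0.
have Qb : Q j b.
  have -> : b = (- (s%:R + 1)) *: a + (b + (s%:R + 1) *: a) by rewrite scaleNr addrC addrK.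
  exact: lin.
have jin : j \in i :: l by rewrite mem_nth //=.
move: jin; rewrite inE => /predU1P[E|jl]; last by exists j.
by case: nQa; rewrite -E.
Qed.
End Avoid.

Section Rays.
Variables (R : realType) (N n : nat) (Lm : 'M[R]_(n, N)).
Local Notation V := 'rV[R]_N.
Local Notation F := 'cV[R]_N.
Variable gl : seq (F * F * F).
Hypothesis HL : forall c a b, (c, a, b) \in gl -> Lm *m c = Lm *m a /\ Lm *m a = Lm *m b.
Variables (m : nat) (ray : nat -> V) (act : nat -> bool) (MM : seq (seq bool)).
Local Notation P := (cokermx Lm).
Local Notation pr := (fun x : V => x *m P).
Local Notation DR := (DR gl).
Local Notation FL := (FL gl).
Local Notation Kc := (Kc gl).

Definition comb (M : seq bool) (k : nat -> R) : V := \sum_(i < m | nth false M i) k i *: ray i.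
Definition bary (M : seq bool) : V := comb M (fun _ => 1).
Definition smask (T M : seq bool) : Prop := forall i, nth false T i -> nth false M i.
(** The rays that lie in the cell of the barycentre of T: a canonical name for that cell,
    independent of T. *)
Definition clo (T : seq bool) : seq bool :=
  mkseq (fun i => act i && `[< FL (bary T) (ray i) >]) m.

Hypothesis MM_size : forall M, M \in MM -> size M = m.
Hypothesis MM_act : forall M i, M \in MM -> nth false M i -> act i.
Hypothesis act_DR : forall i, act i -> DR (ray i).
Hypothesis MM_compat : forall M i j c a b, M \in MM -> nth false M i -> nth false M j ->
  (c, a, b) \in gl -> ev (ray i) a < ev (ray i) b -> ev (ray j) a <= ev (ray j) b.
Hypothesis MM_free : forall M k u, M \in MM -> comb M k = u *m Lm ->
  forall i, nth false M i -> k i = 0.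
Hypothesis MM_cover : forall x, DR x -> exists M k u,
  [/\ M \in MM, forall i, 0 <= k i & x = comb M k + u *m Lm].

Lemma ev_comb M k l : ev (comb M k) l = \sum_(i < m | nth false M i) k i * ev (ray i) l.
Proof.
rewrite /comb /ev mulmx_suml summxE; apply: eq_bigr => i _.
by rewrite -scalemxAl mxE.
Qed.

Lemma MM_orient M c a b : M \in MM -> (c, a, b) \in gl ->
  (forall i, nth false M i -> ev (ray i) a <= ev (ray i) b) \/
  (forall i, nth false M i -> ev (ray i) b <= ev (ray i) a).
Proof.
move=> Min rin.
have [[j Mj lt]|H] := pselect (exists2 j, nth false M j & ev (ray j) a < ev (ray j) b).
  by left=> i Mi; apply: (MM_compat Min Mj Mi rin).
right=> i Mi; rewrite leNgt; apply/negP => lt; apply: H; by exists i.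
Qed.

(** All rays of a mask put the minimum of a relation on the same side. The relation is thus linear
    on their cone and passes from the rays to their combinations. *)
Lemma comb_DR M k : M \in MM -> (forall i, 0 <= k i) -> DR (comb M k).
Proof.
move=> Min k0 c a b rin; rewrite !ev_comb.
have [o|o] := MM_orient Min rin.
  rewrite min_l; last by apply: ler_sum => i Mi; rewrite ler_wpM2l ?o.
  apply: eq_bigr => i Mi; congr (_ * _).
  by rewrite (act_DR (MM_act Min Mi) rin) min_l ?o.
rewrite min_r; last by apply: ler_sum => i Mi; rewrite ler_wpM2l ?o.
apply: eq_bigr => i Mi; congr (_ * _).
by rewrite (act_DR (MM_act Min Mi) rin) min_r ?o.
Qed.

(* On the cone over a mask each difference [a - b] keeps its sign, so it vanishes at a
   combination iff it vanishes at every ray that occurs in it. *)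
Lemma comb_FL M k y : M \in MM -> (forall i, 0 <= k i) ->
  FL y (comb M k) <-> (forall i, (i < m)%N -> nth false M i -> 0 < k i -> FL y (ray i)).
Proof.
move=> Min k0; split=> H.
  move=> i im Mi ki c a b rin; have [h1 h2] := H _ _ _ rin.
  have key (f g : F) : (forall i, nth false M i -> ev (ray i) f <= ev (ray i) g) ->
      ev (comb M k) g <= ev (comb M k) f -> ev (ray i) g <= ev (ray i) f.
    move=> o; rewrite !ev_comb => le.
    have le' : \sum_(j < m | nth false M j) k j * (ev (ray j) g - ev (ray j) f) <= 0.
      under eq_bigr do rewrite mulrBr.
      by rewrite sumrB subr_le0.
    have nn (j : 'I_m) : nth false M j -> 0 <= k j * (ev (ray j) g - ev (ray j) f).
      by move=> Mj; rewrite mulr_ge0 // subr_ge0 o.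
    have s0 : \sum_(j < m | nth false M j) k j * (ev (ray j) g - ev (ray j) f) = 0.
      by apply/eqP; rewrite eq_le le' sumr_ge0.
    have /eqP := psumr_eq0P nn s0 (i := Ordinal im) Mi; rewrite mulf_eq0 (gt_eqF ki) /= subr_eq0.
    by move=> /eqP ->.
  have [o|o] := MM_orient Min rin; split=> yab; try exact: o.
    by apply: (key a b o); apply: h2.
  by apply: (key b a o); apply: h1.
move=> c a b rin; rewrite !ev_comb; split=> yab; apply: ler_sum => i Mi.
  have := k0 i; rewrite le_eqVlt => /predU1P[<-|ki]; first by rewrite !mul0r.
  by rewrite ler_wpM2l //; have [h _] := H i (ltn_ord i) Mi ki _ _ _ rin; apply: h.
have := k0 i; rewrite le_eqVlt => /predU1P[<-|ki]; first by rewrite !mul0r.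
by rewrite ler_wpM2l //; have [_ h] := H i (ltn_ord i) Mi ki _ _ _ rin; apply: h.
Qed.

Definition supp (M : seq bool) (k : nat -> R) : seq bool :=
  mkseq (fun i => nth false M i && (0 < k i)) m.

Lemma nth_supp M k i : nth false (supp M k) i = [&& (i < m)%N, nth false M i & 0 < k i].
Proof.
case: (ltnP i m) => im; first by rewrite nth_mkseq.
by rewrite nth_default // size_mkseq.
Qed.

Lemma comb_sub M T : size M = m -> smask T M ->
  bary T = comb M (fun i => (nth false T i)%:R).
Proof.
move=> sM TM; rewrite /bary /comb [RHS](bigID (fun i : 'I_m => nth false T i)) /=.
rewrite [X in _ + X]big1 ?addr0; last by move=> i /andP[_ /negPf->]; rewrite scale0r.
apply: eq_big => [i|i ->] //; case E : (nth false T i); rewrite ?andbF //.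
by rewrite (TM _ E).
Qed.

Lemma bary_DR M T : M \in MM -> smask T M -> DR (bary T).
Proof.
move=> Min TM; rewrite (comb_sub (MM_size Min) TM).
by apply: comb_DR => // i; rewrite ler0n.
Qed.

Lemma bary_FL M T y : M \in MM -> smask T M ->
  FL y (bary T) <-> (forall i, (i < m)%N -> nth false T i -> FL y (ray i)).
Proof.
move=> Min TM; rewrite (comb_sub (MM_size Min) TM).
rewrite (comb_FL _ Min) => [|i]; last by rewrite ler0n.
split=> H i im.
  by move=> Ti; apply: H => //; [exact: TM | rewrite Ti ltr01].
by move=> Mi; case E : (nth false T i); rewrite ?ltxx // => _; apply: H.
Qed.

Lemma FL_refl y : FL y y. Proof. by []. Qed.
Lemma FL_trans x y z : FL x y -> FL y z -> FL x z.
Proof.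
move=> f g c a b rin; have [f1 f2] := f _ _ _ rin; have [g1 g2] := g _ _ _ rin.
by split=> [/f1/g1|/f2/g2].
Qed.

(** The pattern of a combination depends only on which coefficients are positive. *)
Lemma supp_equiv M k : M \in MM -> (forall i, 0 <= k i) ->
  smask (supp M k) M /\ FL (comb M k) (bary (supp M k)) /\ FL (bary (supp M k)) (comb M k).
Proof.
move=> Min k0; have S : smask (supp M k) M by move=> i; rewrite nth_supp => /and3P[].
split=> //; split.
  apply/(bary_FL _ Min S) => i im; rewrite nth_supp => /and3P[_ Mi ki].
  by have /(comb_FL _ Min k0) := @FL_refl (comb M k); apply.
apply/(comb_FL _ Min k0) => i im Mi ki.
have /(bary_FL _ Min S) := @FL_refl (bary (supp M k)); apply => //.
by rewrite nth_supp im Mi ki.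
Qed.

Lemma FL_lin x y u : FL x y -> FL x (y + u *m Lm) /\ FL (x + u *m Lm) y.
Proof.
move=> f; split=> c a b rin; have [_ e2] := ev_lin HL u rin; have := f _ _ _ rin.
  by rewrite !evD e2 !lerD2r.
by rewrite !evD e2 !lerD2r.
Qed.

Lemma Kc_eqP x y : DR x -> DR y -> Kc x = Kc y <-> FL x y /\ FL y x.
Proof.
move=> dx dy; split=> [E|[xy yx]].
  have h1 : Kc x y by rewrite E; apply: Kc_self.
  have h2 : Kc y x by rewrite -E; apply: Kc_self.
  by case: h1 => _ ?; case: h2.
by apply/seteqP; split; apply: Kc_trans.
Qed.

Lemma DR_cell x : DR x -> exists M T k u,
  [/\ M \in MM, smask T M, size T = m, Kc x = Kc (bary T) &
   (forall i, 0 <= k i) /\ (x = comb T k + u *m Lm)].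
Proof.
move=> dx; have [M [k [u [Min k0 E]]]] := MM_cover dx.
have [S [f g]] := supp_equiv Min k0.
exists M, (supp M k), k, u; split=> //; first by rewrite size_mkseq.
  apply/Kc_eqP => //; first exact: bary_DR Min S.
  split; rewrite E.
    by have [_ h] := FL_lin u f.
  by have [h _] := FL_lin u g.
split=> //; rewrite E; congr (_ + _).
rewrite /comb [LHS](bigID (fun i : 'I_m => 0 < k i)) /= [X in _ + X]big1 ?addr0; last first.
  by move=> i /andP[_]; rewrite lt_neqAle k0 andbT negbK => /eqP <-; rewrite scale0r.
by apply: eq_bigl => i; rewrite nth_supp ltn_ord.
Qed.

Lemma nth_clo T i : nth false (clo T) i = [&& (i < m)%N, act i & `[< FL (bary T) (ray i) >]].
Proof.
case: (ltnP i m) => im; first by rewrite nth_mkseq.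
by rewrite nth_default // size_mkseq.
Qed.

(** The rays of T belong to its own closure, so equal closures place each barycentre in the cell of
    the other. *)
Lemma clo_eqP M T M' T' : M \in MM -> smask T M -> M' \in MM -> smask T' M' ->
  clo T = clo T' <-> Kc (bary T) = Kc (bary T').
Proof.
move=> Min TM Min' TM'; rewrite (Kc_eqP (bary_DR Min TM) (bary_DR Min' TM')).
have sub M1 T1 M2 T2 : M1 \in MM -> smask T1 M1 -> M2 \in MM -> smask T2 M2 ->
    clo T1 = clo T2 -> FL (bary T2) (bary T1).
  move=> h1 h2 h3 h4 E; apply/(bary_FL _ h1 h2) => i im Ti.
  have : nth false (clo T1) i.
    rewrite nth_clo im (MM_act h1 (h2 _ Ti)) /=; apply/asboolP.
    by have /(bary_FL _ h1 h2) := @FL_refl (bary T1); apply.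
  by rewrite E nth_clo => /and3P[_ _ /asboolP].
split=> [E|[f g]]; first by split; [exact: (sub M' T' M T Min' TM' Min TM (esym E)) | exact: (sub M T M' T' Min TM Min' TM' E)].
apply: (@eq_from_nth _ false); rewrite !size_mkseq // => i im.
rewrite !nth_clo im /=; congr (_ && _); apply/asboolP/asboolP; [exact: (FL_trans g) | exact: (FL_trans f)].
Qed.

(** The computed list of cells. Soundness and completeness together say that the number stored with
    a closure is the largest size of a subset representing it. *)
Variable ce : seq (seq bool * nat).
Hypothesis ce_uniq : uniq [seq x.1 | x <- ce].
Hypothesis ce_sound : forall S d, (S, d) \in ce -> exists M T,
  [/\ M \in MM, smask T M, size T = m, S = clo T & count id T = d].
Hypothesis ce_complete : forall M T, M \in MM -> smask T M -> size T = m ->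
  exists2 d, (clo T, d) \in ce & (count id T <= d)%N.
Hypothesis MM_le6 : forall M, M \in MM -> (count id M <= 6)%N.
Hypothesis MM_full : forall M, M \in MM -> exists2 M', M' \in MM & smask M M' /\ count id M' = 6%N.

Definition idx (T : seq bool) : seq nat := [seq i <- iota 0 m | nth false T i].
Definition gens (T : seq bool) : seq V := [seq pr (ray i) | i <- idx T].

Lemma size_gens T : size T = m -> size (gens T) = count id T.
Proof.
move=> sT; rewrite size_map size_filter -sT.
have -> : count id T = count id (mkseq (nth false T) (size T)) by rewrite mkseq_nth.
by rewrite /mkseq count_map.
Qed.

(** A linear relation between projected rays lifts to a combination of rays in the lineality space,
    which [MM_free] forbids. *)
Lemma gens_free M T : M \in MM -> smask T M -> size T = m -> free (gens T).
Proof.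
move=> Min TM sT.
have ul : uniq (idx T) by rewrite filter_uniq ?iota_uniq.
change (free (in_tuple (gens T))); apply/freeP => k Hk i.
pose k' (i : nat) : R := if insub i is Some o then k o else 0.
pose kk j := k' (index j (idx T)).
have k'E (o : 'I_(size (gens T))) : k' o = k o by rewrite /k' valK.
have sg : size (gens T) = size (idx T) by rewrite size_map.
have comb0 : pr (comb T kk) = 0.
  rewrite -[RHS]Hk /comb mulmx_suml.
  transitivity (\sum_(j <- idx T) kk j *: pr (ray j)).
    rewrite /idx big_filter -[m in iota 0 m]subn0 -/(index_iota 0 m) big_mkord.
    by apply: eq_bigr => j _; rewrite -scalemxAl.
  rewrite (big_nth 0%N) big_mkord -sg; apply: eq_bigr => o _ /=.
  have ol : (o < size (idx T))%N by rewrite -sg.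
  by rewrite /kk index_uniq // k'E /gens (nth_map 0%N).
have /prP[u Eu] : pr 0 = pr (comb T kk) by rewrite comb0 mul0mx.
rewrite add0r in Eu.
have EM : comb T kk = comb M (fun j => if nth false T j then kk j else 0).
  rewrite /comb [RHS](bigID (fun i : 'I_m => nth false T i)) /= [X in _ + X]big1 ?addr0; last first.
    by move=> j /andP[_ /negPf->]; rewrite scale0r.
  apply: eq_big => [j|j ->] //; case E : (nth false T j); rewrite ?andbF //.
  by rewrite (TM _ E).
rewrite EM in Eu.
have il : (i < size (idx T))%N by rewrite -sg.
have Ti : nth false T (nth 0%N (idx T) i).
  by have := mem_nth 0%N il; rewrite mem_filter => /andP[].
have := MM_free Min Eu (TM _ Ti); rewrite Ti /kk index_uniq // k'E.
by [].
Qed.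

Lemma has_dim_unique (C : set V) d d' : has_dim C d -> has_dim C d' -> d = d'.
Proof.
move=> [U [CU minU <-]] [U' [CU' minU' <-]].
by congr (\dim _); apply/eqP; rewrite eqEsubv minU // minU'.
Qed.

(** The lower bound comes from a subset T' of size d with this closure, whose rays are independent.
    For the upper bound the cell is shown to lie in the span of a single subset B with this closure;
    since B has at most d rays, its span is that of T'. *)
Lemma cell_dim M T d : M \in MM -> smask T M -> size T = m -> (clo T, d) \in ce ->
  has_dim (pr @` Kc (bary T)) d.
Proof.
move=> Min TM sT din.
have [M' [T' [Min' TM' sT' cT' cd]]] := ce_sound din.
have EK : Kc (bary T) = Kc (bary T') by apply/(clo_eqP Min TM Min' TM').
have dimU : \dim <<gens T'>>%VS = d.
  by have /eqP -> := gens_free Min' TM' sT'; rewrite size_gens.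
have inK M1 T1 i : M1 \in MM -> smask T1 M1 -> (i < m)%N -> nth false T1 i -> Kc (bary T1) (ray i).
  move=> h1 h2 im Ti; split; first exact: act_DR (MM_act h1 (h2 _ Ti)).
  by have /(bary_FL _ h1 h2) := @FL_refl (bary T1); apply.
have genK w : w \in gens T' -> (pr @` Kc (bary T)) w.
  move=> /mapP[i]; rewrite mem_filter mem_iota add0n => /andP[Ti /= im] ->.
  by exists (ray i) => //; rewrite EK; apply: (inK M').
exists <<gens T'>>%VS; split=> //; last first.
  by move=> W HW; apply/span_subvP => w /genK; apply: HW.
(* A point of the cell either has the full pattern and lies in the span of some subset with the same
   closure, or has a tie at a relation that is strict at the barycentre. These finitely many
   subspaces cover the cell; those of the second kind miss the barycentre. *)
pose I := ((m.-tuple bool) + 'I_(size gl))%type.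
pose Q (j : I) (y : V) : Prop := match j with
  | inl B => (pr y) \in <<gens B>>%VS
  | inr r => ev y (nth (0, 0, 0) gl r).1.2 = ev y (nth (0, 0, 0) gl r).2 end.
pose good (j : I) : bool := match j with
  | inl B => `[< exists2 M1, M1 \in MM & smask B M1 /\ clo B = clo T >]
  | inr r => ev (bary T) (nth (0, 0, 0) gl r).1.2 != ev (bary T) (nth (0, 0, 0) gl r).2 end.
have [||||j jin Hj] := @cone_in_union R N (Kc (bary T)) _ I Q [seq j <- enum {: I} | good j].
- by move=> a b s Ka Kb s0; apply: KcD => //; apply: KcZ => //; apply: ltW.
- move=> [B|r] y z s /=; last by rewrite !evD !evZ => -> ->.
  by move=> h1 h2; rewrite mulmxDl -scalemxAl memvD // memvZ.
- by exists 0; apply: Kc0.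
- move=> y Ky; have [dy fy] := Ky.
  have [M1 [T1 [k [u [Min1 TM1 sT1 E1 [k0 Ey]]]]]] := DR_cell dy.
  have [fl|nfl] := pselect (FL y (bary T)).
    exists (inl (Tuple (introT eqP sT1))).
      rewrite mem_filter mem_enum andbT /=; apply/asboolP; exists M1 => //; split=> //.
      apply/(clo_eqP Min1 TM1 Min TM); rewrite -E1; apply/Kc_eqP => //; exact: bary_DR TM.
    rewrite /= Ey mulmxDl -mulmxA mulmx_coker mulmx0 addr0 /comb mulmx_suml.
    apply: memv_suml => i Ti; rewrite -scalemxAl memvZ // memv_span //.
    by apply/mapP; exists (val i) => //; rewrite mem_filter mem_iota ltn_ord Ti.
  have [r [rin H]] : exists r, r \in gl /\ (ev y r.1.2 = ev y r.2 /\ ev (bary T) r.1.2 <> ev (bary T) r.2).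
    apply: contrapT => H; apply: nfl => c a b rin; have [f1 f2] := fy _ _ _ rin.
    have h : ev y a = ev y b -> ev (bary T) a = ev (bary T) b.
      by move=> e; apply: contrapT => ne; apply: H; exists (c, a, b).
    split=> yab; rewrite leNgt; apply/negP => lt.
      have e : ev y a = ev y b by apply/eqP; rewrite eq_le yab f2 // ltW.
      by rewrite (h e) ltxx in lt.
    have e : ev y a = ev y b by apply/eqP; rewrite eq_le yab f1 // ltW.
    by rewrite (h e) ltxx in lt.
  have ri : (index r gl < size gl)%N by rewrite index_mem.
  exists (inr (Ordinal ri)); last by rewrite /= nth_index //; case: H.
  by rewrite mem_filter mem_enum andbT /= nth_index //; apply/eqP; case: H.
have KT : Kc (bary T) (bary T) by apply: Kc_self; apply: bary_DR TM.
case: j jin Hj => [B|r]; rewrite mem_filter mem_enum andbT /=; last first.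
  by move=> /eqP ne /(_ _ KT).
move=> /asboolP[M1 Min1 [BM1 cB]] HB.
have [d' din' le'] := ce_complete Min1 BM1 (size_tuple B).
have ed : d' = d.
  rewrite cB in din'.
  have /uniqP inj := ce_uniq.
  have i1 : (index (clo T, d') ce < size ce)%N by rewrite index_mem.
  have i2 : (index (clo T, d) ce < size ce)%N by rewrite index_mem.
  have := inj [::] (index (clo T, d') ce) (index (clo T, d) ce).
  rewrite !inE size_map => /(_ i1 i2).
  rewrite !(nth_map ([::], 0%N)) // !nth_index // => /(_ erefl) e.
  by have := congr1 (nth ([::], 0%N) ce) e; rewrite !nth_index // => -[].
have sub : (<<gens T'>> <= <<gens B>>)%VS.
  apply/span_subvP => w /mapP[i]; rewrite mem_filter mem_iota add0n => /andP[Ti /= im] ->.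
  by apply: HB; rewrite EK; apply: (inK M').
have eU : <<gens T'>>%VS = <<gens B>>%VS.
  apply/eqP; rewrite eqEdim sub /= dimU.
  by rewrite (leq_trans (dim_span _)) // size_gens ?size_tuple // (leq_trans le') // ed.
by move=> w [y Ky <-]; rewrite eU; apply: HB.
Qed.

Lemma fan_cell C : fan Lm gl C -> exists M T,
  [/\ M \in MM, smask T M, size T = m & C = pr @` Kc (bary T)].
Proof.
by move=> [x dx <-]; have [M [T [k [u [Min TM sT E _]]]]] := DR_cell dx; exists M, T; rewrite E.
Qed.

(** Every cell is contained in that of a mask with six rays, so a maximal cell is one of these. Its
    number is at least six by completeness and at most six because no mask is larger. *)
Lemma fan_pure : pure_dim (fan Lm gl) 6.
Proof.
move=> C /fan_cell[M [T [Min TM sT ->]]] Cmax.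
have [M' Min' [MM' c6]] := MM_full Min.
have idM : smask M' M' by [].
have d' := bary_DR Min' idM.
have E : pr @` Kc (bary M') = pr @` Kc (bary T).
  apply: Cmax; first by exists (bary M').
  apply/(pr_Kc_sub HL); apply: Kc_trans; split; first exact: bary_DR TM.
  apply/(bary_FL _ Min TM) => i im Ti.
  by have /(bary_FL _ Min' idM) := @FL_refl (bary M'); apply => //; apply: MM'; apply: TM.
rewrite -E.
have [d din le] := ce_complete Min' idM (MM_size Min').
have [M1 [T1 [Min1 TM1 sT1 _ cd]]] := ce_sound din.
have d6 : (d <= 6)%N.
  rewrite -cd (leq_trans _ (MM_le6 Min1)) //.
  have sM1 := MM_size Min1.
  have -> : count id T1 = count id (mkseq (nth false T1) m) by rewrite -sT1 mkseq_nth.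
  have -> : count id M1 = count id (mkseq (nth false M1) m) by rewrite -sM1 mkseq_nth.
  by rewrite /mkseq !count_map; apply: sub_count => i; apply: TM1.
have -> : 6%N = d by apply/eqP; rewrite eqn_leq d6 -c6 le.
exact: (cell_dim Min' idM (MM_size Min') din).
Qed.

Lemma fan_count d : num_cones (fan Lm gl) d (count (fun x => x.2 == d) ce).
Proof.
pose s := [seq x.1 | x <- ce & x.2 == d].
have ss : size s = count (fun x => x.2 == d) ce by rewrite size_map size_filter.
have us : uniq s by apply: subseq_uniq ce_uniq; apply: map_subseq; apply: filter_subseq.
have wit S : S \in s -> exists M T, [/\ M \in MM, smask T M, size T = m, S = clo T & (S, d) \in ce].
  move=> /mapP[[S' d'']]; rewrite mem_filter /= => /andP[/eqP-> inc] ->.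
  by have [M [T [? ? ? ? ?]]] := ce_sound inc; exists M, T.
(* The existentials are swapped so that [cid] returns the subset, not the mask around it. *)
pose rep S := if pselect (S \in s) is left h then
  projT1 (cid (let: ex_intro M (ex_intro T p) := wit S h in ex_intro (fun T => exists M, [/\ M \in MM, smask T M, size T = m, S = clo T & (S, d) \in ce]) T (ex_intro _ M p))) else [::].
have repP S : S \in s -> exists M, [/\ M \in MM, smask (rep S) M, size (rep S) = m, S = clo (rep S) & (S, d) \in ce].
  by rewrite /rep => h; case: pselect => // h'; case: (cid _).
pose g k := pr @` Kc (bary (rep (nth [::] s k))).
have gE : [set C | fan Lm gl C /\ has_dim C d] = g @` `I_(size s).
  apply/seteqP; split=> C.
    move=> [/fan_cell[M [T [Min TM sT ->]]] hd].
    have [d' din _] := ce_complete Min TM sT.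
    have ed := has_dim_unique hd (cell_dim Min TM sT din); rewrite -ed in din.
    have cin : clo T \in s by apply/mapP; exists (clo T, d) => //; rewrite mem_filter /= eqxx.
    exists (index (clo T) s); first by rewrite /= index_mem.
    rewrite /g nth_index //; have [M' [Min' TM' _ E _]] := repP _ cin.
    by congr (_ @` _); apply/(clo_eqP Min' TM' Min TM).
  move=> [k kn <-]; have [M [Min TM sT E din]] := repP _ (mem_nth [::] kn); rewrite /g.
  split; first by exists (bary (rep (nth [::] s k))) => //; exact: bary_DR TM.
  by apply: cell_dim Min TM sT _; rewrite -E.
rewrite /num_cones gE -ss; apply: inj_card_eq => j k; rewrite !inE => jn kn.
rewrite /g => Ejk.
have [M [Min TM _ E _]] := repP _ (mem_nth [::] jn).
have [M' [Min' TM' _ E' _]] := repP _ (mem_nth [::] kn).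
have EK : Kc (bary (rep (nth [::] s j))) = Kc (bary (rep (nth [::] s k))).
  by apply/seteqP; split; apply/(pr_Kc_sub HL); rewrite Ejk.
by move/(clo_eqP Min TM Min' TM'): EK; rewrite -E -E' => /eqP; rewrite nth_uniq // => /eqP.
Qed.

End Rays.
Local Close Scope ring_scope.
Local Close Scope classical_set_scope.

(** * Completeness by descent *)

Local Open Scope ring_scope.

Definition flip (C : seq bool) (i j : nat) : seq bool := setb (setb C i false) j true.

Lemma nth_setb (C : seq bool) i b j : nth false (setb C i b) j =
  if (j == i) && (i < size C)%N then b else nth false C j.
Proof.
elim: C i j => [|c C IH] [|i] [|j] //=.
by rewrite andbF.
Qed.

Lemma size_setb (C : seq bool) i b : size (setb C i b) = size C.
Proof. by elim: C i => [|c C IH] [|i] //=; rewrite IH. Qed.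

Lemma nth_flip C i j l : (i < size C)%N -> (j < size C)%N ->
  nth false (flip C i j) l = (l == j) || (l != i) && nth false C l.
Proof.
move=> iC jC; rewrite /flip !nth_setb size_setb iC jC !andbT.
by case: (l == j); case: (l == i).
Qed.

Section Descent.
Variables (R : realType) (W : lmodType R) (m : nat) (rho : nat -> W) (phi : nat -> R).
Variable V : seq (seq bool).
Definition lcomb (C : seq bool) (c : nat -> R) : W := \sum_(l < m | nth false C l) c l *: rho l.
Definition lfree (C : seq bool) : Prop := forall c, lcomb C c = 0 -> forall l, (l < m)%N -> nth false C l -> c l = 0.

(** Coefficient 1 at both i and j puts them on opposite sides of the hyperplane of the other rays.
    The inequality says that the height of j lies below the linear extension of the heights of C. *)
Definition wall (C : seq bool) (i j : nat) : Prop := exists g : nat -> R,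
  [/\ (i < m)%N, (j < m)%N, nth false C i, nth false C j = false &
   rho i + rho j = \sum_(l < m | nth false C l && (l != i :> nat)) g l *: rho l /\
   phi i + phi j < \sum_(l < m | nth false C l && (l != i :> nat)) g l * phi l].

Hypothesis V_size : forall C, C \in V -> size C = m.
Hypothesis V_wall : forall C i, C \in V -> (i < m)%N -> nth false C i ->
  exists2 j, wall C i j & flip C i j \in V.
Variable C0 : seq bool.
Hypothesis C0V : C0 \in V.
Hypothesis V_ind : forall Pr : seq bool -> Prop, Pr C0 ->
  (forall C i j, C \in V -> Pr C -> wall C i j -> flip C i j \in V -> Pr (flip C i j)) ->
  forall C, C \in V -> Pr C.
Hypothesis C0_free : lfree C0.

Lemma lcomb_split (M : zmodType) (f : nat -> M) C i : (i < m)%N -> nth false C i ->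
  \sum_(l < m | nth false C l) f l = f i + \sum_(l < m | nth false C l && (l != i :> nat)) f l.
Proof. by move=> im Ci; rewrite (bigD1 (Ordinal im)) //=. Qed.

Lemma lcomb_flip (M : zmodType) (f : nat -> M) C i j : size C = m -> (i < m)%N -> (j < m)%N ->
  nth false C i -> nth false C j = false ->
  \sum_(l < m | nth false (flip C i j) l) f l =
  f j + \sum_(l < m | nth false C l && (l != i :> nat)) f l.
Proof.
move=> sC im jm Ci Cj; rewrite (bigD1 (Ordinal jm)) /=; last by rewrite nth_flip ?sC // eqxx.
congr (_ + _); apply: eq_bigl => l; rewrite nth_flip ?sC //.
rewrite -val_eqE /=; have [->|ne] := eqVneq (l : nat) j; first by rewrite Cj andbF.
by rewrite andbT /= andbC.
Qed.

(* Exchanging [i] for [j] along a wall substitutes [r_i = sum g_l r_l - r_j]. *)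
Lemma wall_exchange C i j : size C = m -> wall C i j -> exists2 D : R, 0 < D & forall c, exists c',
  [/\ lcomb (flip C i j) c' = lcomb C c, c' j = - c i,
     (forall l, c i = 0 -> l != j -> c' l = c l) &
     \sum_(l < m | nth false (flip C i j) l) c' l * phi l =
     \sum_(l < m | nth false C l) c l * phi l + c i * D].
Proof.
move=> sC [g [im jm Ci Cj [Er Ep]]].
set S := \sum_(l < m | _) g l * phi l in Ep.
exists (S - (phi i + phi j)); first by rewrite subr_gt0.
move=> c; pose c1 l := if l == j then - c i else c l + c i * g l; exists c1.
have ne (l : 'I_m) : nth false C l && (l != i :> nat) -> (l == j :> nat) = false.
  by case/andP=> Cl _; apply/negbTE; apply: contraTneq Cl => ->; rewrite Cj.
split.
- rewrite /lcomb (lcomb_flip (fun l => c1 l *: rho l)) // {1}/c1 eqxx (lcomb_split (fun l => c l *: rho l) im Ci).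
  have -> : \sum_(l < m | nth false C l && (l != i :> nat)) c1 l *: rho l
    = \sum_(l < m | nth false C l && (l != i :> nat)) c l *: rho l + c i *: (rho i + rho j).
    rewrite Er scaler_sumr -big_split /=; apply: eq_bigr => l h.
    by rewrite /c1 (ne l h) scalerDl scalerA.
  by rewrite scaleNr [rho i + _]addrC scalerDr [X in _ + X]addrCA addKr addrC.
- by rewrite /c1 eqxx.
- by move=> l h0 /negPf h1; rewrite /c1 h1 h0 mul0r addr0.
- rewrite (lcomb_flip (fun l => c1 l * phi l)) // {1}/c1 eqxx (lcomb_split (fun l => c l * phi l) im Ci).
  have -> : \sum_(l < m | nth false C l && (l != i :> nat)) c1 l * phi l
    = \sum_(l < m | nth false C l && (l != i :> nat)) c l * phi l + c i * S.
    rewrite /S mulr_sumr -big_split /=; apply: eq_bigr => l h.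
    by rewrite /c1 (ne l h) mulrDl mulrA.
  by rewrite mulNr mulrBr mulrDr; lra.
Qed.

(** The exchange is reversible: a relation after the flip becomes one before it, whose coefficient
    at i is the opposite of that at j. *)
Lemma wall_sym_free C i j : size C = m -> wall C i j -> lfree C -> lfree (flip C i j).
Proof.
move=> sC [g [im jm Ci Cj [Er _]]] fC c Hc.
pose c' l := if l == i then - c j else c l + c j * g l.
have E : lcomb C c' = 0.
  rewrite -[RHS]Hc /lcomb (lcomb_flip (fun l => c l *: rho l)) // (lcomb_split (fun l => c' l *: rho l) im Ci).
  rewrite /c' eqxx.
  have -> : \sum_(l < m | nth false C l && (l != i :> nat)) (if l == i :> nat then - c j else c l + c j * g l) *: rho l
    = \sum_(l < m | nth false C l && (l != i :> nat)) c l *: rho l + c j *: (rho i + rho j).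
    rewrite Er scaler_sumr -big_split /=; apply: eq_bigr => l /andP[_ /negPf ->].
    by rewrite scalerDl scalerA.
  by rewrite scaleNr scalerDr [X in _ + X]addrCA addKr addrC.
have cj : c j = 0.
  by have := fC _ E i im Ci; rewrite /c' eqxx => /eqP; rewrite oppr_eq0 => /eqP.
move=> l lm; rewrite nth_flip ?sC // => /predU1P[->//|/andP[li Cl]].
by have := fC _ E l lm Cl; rewrite /c' (negPf li) cj mul0r addr0.
Qed.

Lemma V_free C : C \in V -> lfree C.
Proof.
move: C; apply: V_ind => // C i j CV fC w _; exact: wall_sym_free (V_size CV) w fC.
Qed.

Lemma lfree_inj C c c' : lfree C -> lcomb C c = lcomb C c' ->
  \sum_(l < m | nth false C l) c l * phi l = \sum_(l < m | nth false C l) c' l * phi l.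
Proof.
move=> fC E; apply: eq_bigr => l Cl; congr (_ * _); apply/subr0_eq.
apply: (fC (fun l => c l - c' l) _ l) => //; rewrite /lcomb.
under eq_bigr do rewrite scalerBl.
by rewrite sumrB; apply/eqP; rewrite subr_eq0; apply/eqP.
Qed.

(** The list of cones is finite, so a minimum replaces a termination argument: at a cone that
    assigns the least height to y no coefficient of y can be negative. *)
Lemma descent y : (exists c, y = lcomb C0 c) ->
  exists C c, [/\ C \in V, forall l, (l < m)%N -> nth false C l -> 0 <= c l & y = lcomb C c].
Proof.
move=> [c0 Ey0].
(* A crossing keeps the span, so y is a combination of the rays of every cone. The implication makes
   the statement total in C, as choice requires. *)
have ex C : exists c, C \in V -> y = lcomb C c.
  have [CV|nCV] := boolP (C \in V); last by exists (fun=> 0).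
  suff [c E] : exists c, y = lcomb C c by exists c.
  move: C CV; apply: V_ind; first by exists c0.
  move=> C i j CV [c Ec] w _; have [D _ /(_ c)[c' [E _ _ _]]] := wall_exchange (V_size CV) w.
  by exists c'; rewrite E.
have [cf Hcf] := choice ex.
pose val C := \sum_(l < m | nth false C l) cf C l * phi l.
have [C CV Cmin] : exists2 C, C \in V & forall C', C' \in V -> val C <= val C'.
  have H (s : seq (seq bool)) : s != [::] -> exists2 C, C \in s & forall C', C' \in s -> val C <= val C'.
    elim: s => // C [|C1 s] IH _; first by exists C; rewrite ?mem_head // => C'; rewrite inE => /eqP->.
    have [//|C2 C2s C2min] := IH.
    have [le|lt] := lerP (val C) (val C2).
      exists C; first exact: mem_head.
      by move=> C'; rewrite inE => /predU1P[->//|/C2min]; apply: le_trans.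
    exists C2; first by rewrite inE C2s orbT.
    by move=> C'; rewrite inE => /predU1P[->|/C2min//]; apply: ltW.
  by apply: H; apply: contraTneq C0V => ->.
exists C, (cf C); split=> //; last exact: Hcf.
move=> i im Ci; rewrite leNgt; apply/negP => neg.
have [j w fV] := V_wall CV im Ci.
have [D D0 /(_ (cf C))[c' [E _ _ Ep]]] := wall_exchange (V_size CV) w.
have : val (flip C i j) < val C.
  (* The chosen coefficients at the new cone need not be those of the exchange; independence makes
     the value the same. *)
  have -> : val (flip C i j) = \sum_(l < m | nth false (flip C i j) l) c' l * phi l.
    by apply: lfree_inj; [exact: V_free | rewrite E -!Hcf].
  by rewrite Ep gtrDl nmulr_rlt0.
by rewrite ltNge Cmin.
Qed.

End Descent.
Local Close Scope ring_scope.

(** * Exponential asymptotics *)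

Local Open Scope ring_scope.

Section Theta.
Variable R : realType.
Local Notation E s x := (sequences.expR (- (s * x))).

Definition eventually (Pr : R -> Prop) := exists s0 : R, forall s, s0 <= s -> Pr s.

Lemma ev_and (Pr Qr : R -> Prop) : eventually Pr -> eventually Qr -> eventually (fun s => Pr s /\ Qr s).
Proof.
move=> [s0 H] [s1 H1]; exists (Num.max s0 s1) => s; rewrite ge_max => /andP[h h1].
by split; [exact: H | exact: H1].
Qed.

Lemma ev_imp (Pr Qr : R -> Prop) : (forall s, Pr s -> Qr s) -> eventually Pr -> eventually Qr.
Proof. by move=> H [s0 H0]; exists s0 => s /H0; apply: H. Qed.

Lemma ev_ge0 : eventually (fun s => 0 <= s). Proof. by exists 0. Qed.

Lemma ev_all (T : eqType) (l : seq T) (Pr : T -> R -> Prop) :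
  (forall t, t \in l -> eventually (Pr t)) -> eventually (fun s => forall t, t \in l -> Pr t s).
Proof.
elim: l => [_|t l IH H]; first by exists 0.
have h1 := H t (mem_head _ _).
have h2 : eventually (fun s => forall t, t \in l -> Pr t s).
  by apply: IH => u ul; apply: H; rewrite inE ul orbT.
apply: ev_imp (ev_and h1 h2) => s [a b] u; rewrite inE => /predU1P[->|] //; exact: b.
Qed.

(** Eventually g is positive and of exact order exp(-s x). The exponent behaves like a valuation:
    products add it and sums of such functions take the minimum. *)
Definition Th (g : R -> R) (x : R) : Prop := exists k K : R,
  0 < k /\ eventually (fun s => k * E s x <= g s <= K * E s x).

Lemma E_gt0 (s x : R) : 0 < E s x. Proof. exact: exp.expR_gt0. Qed.
Lemma ED (s x y : R) : E s (x + y) = E s x * E s y.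
Proof. by rewrite mulrDr opprD exp.expRD. Qed.
Lemma EN (s x : R) : E s (- x) = (E s x)^-1.
Proof. by rewrite mulrN exp.expRN. Qed.
Lemma E_le (s x y : R) : 0 <= s -> x <= y -> E s y <= E s x.
Proof. by move=> s0 xy; rewrite exp.ler_expR lerN2 ler_wpM2l. Qed.

Lemma Th_pos g x : Th g x -> eventually (fun s => 0 < g s).
Proof.
move=> [k [K [k0 H]]]; apply: ev_imp H => s /andP[h _].
by apply: lt_le_trans h; rewrite mulr_gt0 ?E_gt0.
Qed.

Lemma Th_ext g h x : eventually (fun s => g s = h s) -> Th g x -> Th h x.
Proof.
move=> e [k [K [k0 H]]]; exists k, K; split=> //.
by apply: ev_imp (ev_and e H) => s [<-].
Qed.

Lemma Th_K g x : Th g x -> exists2 K, 0 < K & eventually (fun s => g s <= K * E s x).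
Proof.
move=> [k [K [k0 H]]]; exists (Num.max K 1); first by rewrite lt_max ltr01 orbT.
apply: ev_imp H => s /andP[_ h]; apply: le_trans h _.
by rewrite ler_wpM2r ?le_max ?lexx // ltW ?E_gt0.
Qed.

Lemma Th_E (x : R) : Th (fun s => E s x) x.
Proof. by exists 1, 1; split=> //; exists 0 => s _; rewrite mul1r lexx. Qed.

Lemma Th_c c g x : 0 < c -> Th g x -> Th (fun s => c * g s) x.
Proof.
move=> c0 [k [K [k0 H]]]; exists (c * k), (c * K); split; first exact: mulr_gt0.
by apply: ev_imp H => s /andP[h1 h2]; rewrite -!mulrA !ler_pM2l // h1.
Qed.

Lemma Th_mul g h x y : Th g x -> Th h y -> Th (fun s => g s * h s) (x + y).
Proof.
move=> [k [K [k0 H]]] [k' [K' [k0' H']]]; exists (k * k'), (K * K'); split; first exact: mulr_gt0.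
apply: ev_imp (ev_and H H') => s [/andP[h1 h2] /andP[h3 h4]].
have e1 := E_gt0 s x; have e2 := E_gt0 s y.
rewrite ED !(mulrACA _ _ (E s x)) !ler_pM // ?mulr_ge0 ?(ltW k0) ?(ltW k0') ?(ltW e1) ?(ltW e2) //.
  by apply: le_trans h1; rewrite mulr_ge0 // ltW.
by apply: le_trans h3; rewrite mulr_ge0 // ltW.
Qed.

Lemma Th_inv g x : Th g x -> Th (fun s => (g s)^-1) (- x).
Proof.
move=> Hg; have [k [K [k0 H]]] := Hg.
have [K1 K10 H1] := Th_K Hg.
exists K1^-1, k^-1; split; first by rewrite invr_gt0.
apply: ev_imp (ev_and (Th_pos Hg) (ev_and H H1)) => s [gp [/andP[h1 _] h2]].
have e1 := E_gt0 s x.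
rewrite EN -!invfM; apply/andP; split.
  by rewrite lef_pV2 ?posrE ?mulr_gt0.
by rewrite lef_pV2 ?posrE ?mulr_gt0.
Qed.

Lemma Th_addl g h x y : x <= y -> Th g x -> Th h y -> Th (fun s => g s + h s) x.
Proof.
move=> xy Hg Hh; have [k [K [k0 H]]] := Hg; have [K1 K10 H1] := Th_K Hh.
exists k, (K + K1); split=> //.
apply: ev_imp (ev_and ev_ge0 (ev_and (Th_pos Hh) (ev_and H H1))) => s [s0 [hp [/andP[h1 h2] h3]]].
have e := E_le s0 xy; apply/andP; split; first by rewrite (le_trans h1) // lerDl ltW.
rewrite mulrDl lerD // (le_trans h3) // ler_wpM2l //; exact: ltW.
Qed.

Lemma Th_add g h x y : Th g x -> Th h y -> Th (fun s => g s + h s) (Num.min x y).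
Proof.
move=> Hg Hh; case: (leP x y) => xy; first exact: Th_addl Hg Hh.
apply: Th_ext (Th_addl (ltW xy) Hh Hg).
by exists 0 => s _; rewrite addrC.
Qed.

(** The bound exp(s d) >= 1 + s d makes s = |B| / d an explicit threshold. *)
Lemma ev_small (d B : R) : 0 < d -> eventually (fun s => B * E s d <= 1).
Proof.
move=> d0; exists (`|B| / d) => s hs.
have h : `|B| <= s * d by rewrite -ler_pdivrMr.
rewrite exp.expRN ler_pdivrMr ?exp.expR_gt0 // mul1r.
apply: le_trans (exp.expR_ge1Dx _); apply: le_trans (ler_norm _) _.
by apply: le_trans h _; rewrite lerDr.
Qed.

(** With equal exponents the leading terms could cancel. Under the strict inequality the subtracted
    term is eventually at most half of the lower bound of the first one, which explains the constant
    k / 2. *)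
Lemma Th_sub g h x y : x < y -> Th g x -> Th h y -> Th (fun s => g s - h s) x.
Proof.
move=> xy Hg Hh; have [k [K [k0 H]]] := Hg; have [K1 K10 H1] := Th_K Hh.
exists (k / 2), K; split; first by rewrite divr_gt0.
have sm := @ev_small (y - x) (K1 / (k / 2)) (_ : 0 < y - x).
have {}sm := sm (etrans (subr_gt0 _ _) xy).
apply: ev_imp (ev_and sm (ev_and (Th_pos Hh) (ev_and H H1))) => s [s1 [hp [/andP[h1 h2] h3]]].
have e1 := E_gt0 s x.
have h4 : K1 * E s y <= k / 2 * E s x.
  have -> : E s y = E s (y - x) * E s x by rewrite -ED subrK.
  rewrite mulrA ler_pM2r //.
  by move: s1; rewrite mulrAC ler_pdivrMr ?mul1r // divr_gt0.
apply/andP; split; first by rewrite lerBrDr (le_trans _ h1) // [leRHS](_ : _ = k / 2 * E s x + k / 2 * E s x) ?lerD2l ?(le_trans h3) //; field.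
by rewrite (le_trans _ h2) // gerBl ltW.
Qed.

Lemma Th_le g x y : Th g x -> Th g y -> y <= x.
Proof.
move=> [k [K' [k0 H]]] Hy; have [K K0 H1] := Th_K Hy; rewrite leNgt; apply/negP => xy.
have sm := @ev_small (y - x) (2 * (K / k)) (etrans (subr_gt0 _ _) xy).
have [s0 Hs] := ev_and sm (ev_and H H1).
have [a [/andP[b _] c]] := Hs _ (lexx s0).
have e1 := E_gt0 s0 x.
have : k * E s0 x <= K * E s0 y := le_trans b c.
have -> : E s0 y = E s0 (y - x) * E s0 x by rewrite -ED subrK.
rewrite mulrA ler_pM2r // => h.
have : 2 * k <= k.
  have -> : 2 * k = 2 * (K / k) * (k * k / K) by field; rewrite !gt_eqF.
  have h' : 2 * (K * E s0 (y - x)) <= k.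
    by move: a; rewrite -!mulrA [k^-1 * _]mulrC !mulrA ler_pdivrMr // mul1r.
  by apply: le_trans h'; rewrite -mulrA ler_pM2l // [leLHS](_ : _ = k) //; field; rewrite !gt_eqF.
by rewrite mulr_natl mulr2n gerDl leNgt k0.
Qed.

Lemma Th_unique g h x y : eventually (fun s => g s = h s) -> Th g x -> Th h y -> x = y.
Proof.
move=> e Hg Hh; have Hg' := Th_ext e Hg.
by apply/eqP; rewrite eq_le (Th_le Hh Hg') (Th_le Hg' Hh).
Qed.

Lemma Th_exp g x n : Th g x -> Th (fun s => g s ^+ n) (n%:R * x).
Proof.
move=> Hg; elim: n => [|n IH].
  by rewrite mul0r; apply: Th_ext (Th_E 0); exists 0 => s _; rewrite mulr0 oppr0 exp.expR0 expr0.
rewrite -natr1 mulrDl mul1r addrC.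
by apply: Th_ext (Th_mul Hg IH); exists 0 => s _; rewrite exprS.
Qed.

Lemma Th_prod (n : nat) (g : 'I_n -> R -> R) (x : 'I_n -> R) (e : 'I_n -> nat) :
  (forall i, Th (g i) (x i)) ->
  Th (fun s => \prod_(i < n) g i s ^+ e i) (\sum_(i < n) (e i)%:R * x i).
Proof.
elim: n g x e => [|n IH] g x e H.
  by rewrite big_ord0; apply: Th_ext (Th_E 0); exists 0 => s _; rewrite mulr0 oppr0 exp.expR0 big_ord0.
rewrite big_ord_recl; apply: Th_ext (Th_mul (Th_exp (e ord0) (H ord0)) (IH _ _ (fun i => e (lift ord0 i)) (fun i => H (lift ord0 i)))).
by exists 0 => s _; rewrite big_ord_recl.
Qed.

End Theta.

(** * Solving the relations along a chart *)

Definition inp (t : nat) (p : nat * nat) : bool := (t == p.1) || (t == p.2).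
Definition knownp (kn : seq nat) (p : nat * nat) : bool := (p.1 \in kn) && (p.2 \in kn).

(** Reads a chart as a straight-line program: each step must express new coordinates through known
    ones by a relation of [rl]. The result lists the known coordinates and the relations imposed on
    the way. *)
Fixpoint run_chart (rl : seq trel) (st : seq step) (kn : seq nat) (used : seq trel) :
  option (seq nat * seq trel) :=
  match st with
  | [::] => Some (kn, used)
  | Free t :: st' => if t \notin kn then run_chart rl st' (t :: kn) used else None
  | Solve r t :: st' =>
    let: (c, a, b) := nth rel0 rl r in
    if [&& (r < size rl)%N, t \notin kn, inp t c, other c t \in kn, knownp kn a & knownp kn b]
    then run_chart rl st' (t :: kn) ((c, a, b) :: used) else None
  | Open r ta tb :: st' =>
    let: (c, a, b) := nth rel0 rl r in
    if [&& (r < size rl)%N, ta \notin kn, tb \notin kn, ta != tb, inp ta a, inp tb b, knownp kn c,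
           other a ta \in kn & other b tb \in kn]
    then run_chart rl st' (ta :: tb :: kn) ((c, a, b) :: used) else None
  | Dom r t :: st' =>
    let: (c, a, b) := nth rel0 rl r in
    if [&& (r < size rl)%N, t \notin kn & knownp kn c] &&
       ([&& inp t a, other a t \in kn & knownp kn b] || [&& inp t b, other b t \in kn & knownp kn a])
    then run_chart rl st' (t :: kn) ((c, a, b) :: used) else None
  end.

Section Chart.
Variable R : realType.
Local Notation mul2 := (fun (q : nat -> R) (p : nat * nat) => q p.1 * q p.2).

(** The hypothesis that a subtraction needs: the summand containing the new coordinate has the
    strictly smaller exponent. *)
Definition doms_ok (rl : seq trel) (x : nat -> R) (st : step) : Prop :=
  if st is Dom r t then
    let: (c, a, b) := nth rel0 rl r in
    (inp t a -> val2 x a < val2 x b) /\ (inp t b -> val2 x b < val2 x a)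
  else True.

Lemma mul2_other (q : nat -> R) p t : inp t p -> mul2 q p = q t * q (other p t).
Proof.
rewrite /inp /other; have [<- _|ne] := eqVneq p.1 t; first by [].
by move=> /= /eqP ->; rewrite mulrC.
Qed.

Lemma val2_other (x : nat -> R) p t : inp t p -> val2 x p = x t + x (other p t).
Proof.
rewrite /inp /other /val2; have [<- _|ne] := eqVneq p.1 t; first by [].
by move=> /= /eqP ->; rewrite addrC.
Qed.

Definition holds (q : nat -> R) (r : trel) : Prop :=
  let: (c, a, b) := r in mul2 q c = mul2 q a + mul2 q b.

(** Two invariants are kept: known coordinates have the order prescribed by x, and the relations
    used so far hold exactly for large s. Those relations involve known coordinates only, so setting
    a new coordinate cannot spoil them. *)
Lemma chart_Theta rl x st kn used res :
  dr rl x -> (forall i, doms_ok rl x (nth (Free 0) st i)) ->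
  run_chart rl st kn used = Some res ->
  (forall c a b, (c, a, b) \in used -> [/\ knownp kn c, knownp kn a & knownp kn b]) ->
  forall q : R -> nat -> R, (forall t, t \in kn -> Th (fun s => q s t) (x t)) ->
  eventually (fun s => forall r, r \in used -> holds (q s) r) ->
  exists q' : R -> nat -> R, (forall t, t \in res.1 -> Th (fun s => q' s t) (x t)) /\
    eventually (fun s => forall r, r \in res.2 -> holds (q' s) r).
Proof.
move=> drx; elim: st kn used => [|step st IH] kn used /= Hd.
  by move=> [<-] _ q Hq Hu; exists q.
have Hd' i : doms_ok rl x (nth (Free 0) st i) := Hd i.+1.
have {}Hd : doms_ok rl x step := Hd 0%N.
pose upd (q : R -> nat -> R) t (f : R -> R) s u := if u == t then f s else q s u.
have updN q t f s u : u != t -> upd q t f s u = q s u by rewrite /upd => /negPf ->.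
have updE q t f s : upd q t f s t = f s by rewrite /upd eqxx.
have kn_ne (k : seq nat) t u : t \notin k -> u \in k -> u != t by move=> tk uk; apply: contraNneq tk => <-.
have mulN q t f s p (k : seq nat) : t \notin k -> knownp k p -> mul2 (upd q t f s) p = mul2 (q s) p.
  by move=> tk /andP[h1 h2] /=; rewrite !updN ?(kn_ne k).
have grow (k : seq nat) t p : knownp k p -> knownp (t :: k) p.
  by move=> /andP[h1 h2]; rewrite /knownp !inE h1 h2 !orbT.
have growU t c a b : (forall c a b, (c, a, b) \in used -> [/\ knownp kn c, knownp kn a & knownp kn b]) ->
    knownp (t :: kn) c -> knownp (t :: kn) a -> knownp (t :: kn) b ->
   forall c' a' b', (c', a', b') \in (c, a, b) :: used -> [/\ knownp (t :: kn) c', knownp (t :: kn) a' & knownp (t :: kn) b'].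
  move=> Hk h1 h2 h3 c' a' b'; rewrite inE => /predU1P[[-> -> ->]|/Hk[g1 g2 g3]]; first by [].
  by split; apply: grow.
have inpK (k : seq nat) t p : inp t p -> other p t \in k -> knownp (t :: k) p.
  rewrite /inp /other /knownp !inE; have [-> _ ->|ne] := eqVneq p.1 t; first by rewrite orbT.
  by move=> /= /eqP <- ->; rewrite eqxx.
have ThU (k : seq nat) q t f : (forall u, u \in k -> Th (fun s => q s u) (x u)) -> Th f (x t) ->
   forall u, u \in t :: k -> Th (fun s => upd q t f s u) (x u).
  move=> Hq Hf u; rewrite inE; have [->|ne] := eqVneq u t => /= [_|uk].
    by apply: Th_ext Hf; exists 0 => s _; rewrite updE.
  by apply: Th_ext (Hq u uk); exists 0 => s _; rewrite updN.
have holdsU q t f s r : t \notin kn ->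
    (forall c a b, (c, a, b) \in used -> [/\ knownp kn c, knownp kn a & knownp kn b]) ->
    r \in used -> holds (q s) r -> holds (upd q t f s) r.
  move=> tk Hk; case: r => [[c a] b] rin; have [g1 g2 g3] := Hk _ _ _ rin.
  by rewrite /holds !(mulN _ _ _ _ _ kn).
have Th2 q p : knownp kn p -> (forall u, u \in kn -> Th (fun s => q s u) (x u)) -> Th (fun s => mul2 (q s) p) (val2 x p).
  by move=> /andP[h1 h2] Hq; apply: Th_mul; apply: Hq.
case: step Hd => [t|r t|r ta tb|r t] /= Hd.
- case: ifP => // tk run Hk q Hq Hu.
  apply: (IH _ _ Hd' run _ (upd q t (fun s => sequences.expR (- (s * x t))))).
  + by move=> c a b /Hk[h1 h2 h3]; split; apply: grow.
  + by apply: ThU => //; apply: Th_E.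
  + by apply: ev_imp Hu => s H r rin; apply: holdsU => //; apply: H.
- case Er : (nth rel0 rl r) => [[c a] b]; case: ifP => // /and5P[rs tk tc oc /andP[ka kb]] run Hk q Hq Hu.
  have rin : (c, a, b) \in rl by rewrite -Er mem_nth.
  have Ho := Hq _ oc; have Hs := Th_add (Th2 q a ka Hq) (Th2 q b kb Hq).
  apply: (IH _ _ Hd' run _ (upd q t (fun s => (mul2 (q s) a + mul2 (q s) b) * (q s (other c t))^-1))).
  + by apply: growU => //; [exact: inpK | exact: grow | exact: grow].
  + apply: ThU => //; have := Th_mul Hs (Th_inv Ho).
    by rewrite -(drx _ _ _ rin) (val2_other x tc) addrK.
  + apply: ev_imp (ev_and (Th_pos Ho) Hu) => s [po H] r'; rewrite inE => /predU1P[->|r'in]; last by apply: holdsU => //; apply: H.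
    rewrite /holds (mulN _ _ _ _ a kn) // (mulN _ _ _ _ b kn) // (mul2_other _ tc) updE updN ?(kn_ne kn) //.
    by rewrite mulfVK // gt_eqF.
- case Er : (nth rel0 rl r) => [[c a] b]; case: ifP => // /and5P[rs ka kb tab /and5P[ta_a tb_b kc oa ob]] run Hk q Hq Hu.
  have rin : (c, a, b) \in rl by rewrite -Er mem_nth.
  (* The intended quotient of the products a and b. The equations a + b = c and a = w b give a = c w
     / (1 + w) and b = c / (1 + w), with no subtraction. *)
  pose w s := sequences.expR (- (s * (val2 x a - val2 x b))).
  have Hw : Th w (val2 x a - val2 x b) := Th_E _.
  have H1w : Th (fun s => 1 + w s) (Num.min 0 (val2 x a - val2 x b)).
    apply: Th_add Hw; apply: Th_ext (Th_E 0); by exists 0 => s _; rewrite mulr0 oppr0 exp.expR0.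
  have Hc := Th2 q c kc Hq; have Hoa := Hq _ oa; have Hob := Hq _ ob.
  pose fa s := mul2 (q s) c * w s * (1 + w s)^-1 * (q s (other a ta))^-1.
  pose fb s := mul2 (q s) c * (1 + w s)^-1 * (q s (other b tb))^-1.
  have cE := drx _ _ _ rin.
  have Hfa : Th fa (x ta).
    have := Th_mul (Th_mul (Th_mul Hc Hw) (Th_inv H1w)) (Th_inv Hoa).
    congr (Th _ _); have := val2_other x ta_a; rewrite cE minEle minEle.
    by case: ifP => h1; case: ifP => h2; lra.
  have Hfb : Th fb (x tb).
    have := Th_mul (Th_mul Hc (Th_inv H1w)) (Th_inv Hob).
    congr (Th _ _); have := val2_other x tb_b; rewrite cE minEle minEle.
    by case: ifP => h1; case: ifP => h2; lra.
  have ka' : ta \notin tb :: kn by rewrite inE negb_or tab ka.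
  apply: (IH _ _ Hd' run _ (upd (upd q tb fb) ta fa)).
  + move=> c' a' b'; rewrite inE => /predU1P[[-> -> ->]|/Hk[g1 g2 g3]]; last by split; do 2! apply: (grow).
    split; first by do 2! apply: (grow).
      by apply: inpK => //; rewrite inE oa orbT.
    by apply: (grow); apply: (inpK).
  + by apply: (ThU) => //; apply: (ThU).
  + apply: ev_imp (ev_and (ev_and (Th_pos Hoa) (Th_pos Hob)) (ev_and (Th_pos H1w) Hu)) => s [[pa pb] [pw H]] r'.
    rewrite inE => /predU1P[->|r'in]; last first.
      case: r' r'in (H _ r'in) => [[c' a'] b'] r'in; have [g1 g2 g3] := Hk _ _ _ r'in.
      by rewrite /holds !(mulN _ _ _ _ _ kn).
    rewrite /holds (mul2_other _ ta_a) (mul2_other _ tb_b) !(mulN _ _ _ _ c kn) // updE.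
    rewrite [upd _ ta _ _ (other a ta)]updN ?(kn_ne kn) // updN ?(kn_ne kn) //.
    rewrite [upd _ ta _ _ tb]updN; last by rewrite eq_sym.
    rewrite updE [upd _ ta _ _ (other b tb)]updN ?(kn_ne kn) // updN ?(kn_ne kn) //.
    rewrite /fa /fb !mulfVK ?gt_eqF //; field; by rewrite gt_eqF.
- case Er : (nth rel0 rl r) Hd => [[c a] b] [Ha Hb]; case: ifP => // /andP[/and3P[rs tk kc]] cs run Hk q Hq Hu.
  have rin : (c, a, b) \in rl by rewrite -Er mem_nth.
  have cE := drx _ _ _ rin.
  have Hc := Th2 q c kc Hq.
  (* Covers both summands at once: p contains the new coordinate and p' is the other summand. Since
     p strictly dominates, c - p' keeps the order of c. *)
  have main p p' : inp t p -> other p t \in kn -> knownp kn p' -> val2 x p < val2 x p' ->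
      val2 x c = val2 x p -> exists2 f, Th f (x t) & eventually (fun s =>
       mul2 (upd q t f s) c = mul2 (upd q t f s) p + mul2 (upd q t f s) p').
    move=> tp op kp lt E.
    have Ho := Hq _ op; have lt' := lt; rewrite -E in lt'.
    have Hs := Th_sub lt' Hc (Th2 q p' kp Hq).
    exists (fun s => (mul2 (q s) c - mul2 (q s) p') * (q s (other p t))^-1).
      by have := Th_mul Hs (Th_inv Ho); rewrite E (val2_other x tp) addrK.
    apply: ev_imp (Th_pos Ho) => s po.
    rewrite (mulN _ _ _ _ c kn) // (mulN _ _ _ _ p' kn) // (mul2_other _ tp) updE updN ?(kn_ne kn) //.
    by rewrite mulfVK ?subrK // gt_eqF.
  have [f Hf Hrel] : exists2 f, Th f (x t) & eventually (fun s => holds (upd q t f s) (c, a, b)).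
    case/orP: cs => /and3P[tp op kp].
      have lt := Ha tp; have [|f h1 h2] := main a b tp op kp lt; first by rewrite cE min_l // ltW.
      by exists f.
    have lt := Hb tp; have [|f h1 h2] := main b a tp op kp lt; first by rewrite cE min_r // ltW.
    by exists f => //; apply: ev_imp h2 => s; rewrite /holds addrC.
  apply: (IH _ _ Hd' run _ (upd q t f)).
  + apply: growU => //; first exact: grow.
      by case/orP: cs => /and3P[tp op kp]; [exact: inpK | exact: grow].
    by case/orP: cs => /and3P[tp op kp]; [exact: grow | exact: inpK].
  + exact: ThU.
  + apply: ev_imp (ev_and Hrel Hu) => s [Hr H] r'; rewrite inE => /predU1P[->//|r'in].
    by apply: holdsU => //; apply: H.
Qed.

End Chart.
Local Close Scope ring_scope.

(** * Realizations from charts *)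

Local Open Scope classical_set_scope.
Local Open Scope ring_scope.
Local Opaque tix trips.

Section Det.
Variable A : comNzRingType.
Definition det3 (u v w : nat -> A) : A :=
  u 0%N * (v 1%N * w 2%N - v 2%N * w 1%N) - v 0%N * (u 1%N * w 2%N - u 2%N * w 1%N)
  + w 0%N * (u 1%N * v 2%N - u 2%N * v 1%N).

Variable M : 'M[A]_(3, 7).
Definition cl (i : 'I_7) (r : nat) : A := M (inord r) i.

Lemma det_colsub3 (f : 'I_3 -> 'I_7) :
  \det (colsub f M) = det3 (cl (f (inord 0))) (cl (f (inord 1))) (cl (f (inord 2))).
Proof.
pose N (r c : nat) := M (inord r) (f (inord c)).
have -> : colsub f M = \matrix_(r < 3, c < 3) N r c.
  by apply/matrixP => r c; rewrite !mxE /N !inord_val.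
rewrite (expand_det_row _ ord0) !big_ord_recl big_ord0 /cofactor.
rewrite !(expand_det_row _ ord0) !big_ord_recl !big_ord0 /cofactor !det_mx11 !mxE /=.
rewrite /bump /= !addn0 ?add0n ?addn1 ?expr0 ?expr1 /det3 /cl -/(N _ _).
by rewrite /N; ring.
Qed.

Lemma minor_det3 (I : ksubset 3 7) i j k : enum (val I) = [:: i; j; k] ->
  minor M I = det3 (cl i) (cl j) (cl k).
Proof.
move=> E; rewrite /minor det_colsub3 /ksubset_nth !(enum_val_nth ord0) /= !inordK //.
by rewrite E.
Qed.

Lemma enum_of_sorted (I : ksubset 3 7) (a b c : 'I_7) : (a < b)%N -> (b < c)%N ->
  val I = [set a; b; c]%SET -> enum (val I) = [:: a; b; c].
Proof.
move=> ab bc E.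
have [i [j [k [ij jk Ee]]]] := enum_ksubset I; rewrite Ee.
apply: (@irr_sorted_eq _ (relpre val ltn)).
- by move=> x y z; apply: ltn_trans.
- by move=> x; apply: ltnn.
- by rewrite /= ij jk.
- by rewrite /= ab bc.
- by move=> x; rewrite -Ee mem_enum E !inE orbA.
Qed.

(** Parity of the number of inversions of (i, j, k). *)
Definition sgn3 (i j k : nat) : bool := (j < i)%N (+) (k < i)%N (+) (k < j)%N.

Lemma minor_tix (i j k : 'I_7) : i != j -> i != k -> j != k ->
  minor M (tk (tix i j k)) = (-1) ^+ sgn3 i j k * det3 (cl i) (cl j) (cl k).
Proof.
move=> nij nik njk; have E := val_tix nij nik njk.
move: (tk _) E => I E.
have nij' : (i != j :> nat) by []. have nik' : (i != k :> nat) by []. have njk' : (j != k :> nat) by [].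
rewrite /sgn3.
have perm3 (a b c : 'I_7) : ([set i; j; k] = [set a; b; c])%SET -> (a < b)%N -> (b < c)%N ->
    minor M I = det3 (cl a) (cl b) (cl c).
  by move=> Es ab bc; apply: minor_det3; apply: enum_of_sorted => //; rewrite E Es.
case: (ltngtP j i) nij' => // ji _; case: (ltngtP k i) nik' => // ki _; case: (ltngtP k j) njk' => // kj _ /=.
- by rewrite (perm3 k j i) //; [rewrite /det3; ring | apply/setP => x; rewrite !inE; do 3! case: (x == _)].
- by rewrite (perm3 j k i) //; [rewrite /det3; ring | apply/setP => x; rewrite !inE; do 3! case: (x == _)].
- by have := ltn_trans kj (ltn_trans ji ki); rewrite ltnn.
- by rewrite (perm3 j i k) //; [rewrite /det3; ring | apply/setP => x; rewrite !inE; do 3! case: (x == _)].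
- by rewrite (perm3 k i j) //; [rewrite /det3; ring | apply/setP => x; rewrite !inE; do 3! case: (x == _)].
- by have := ltn_trans ki (ltn_trans ji kj); rewrite ltnn.
- by rewrite (perm3 i k j) //; [rewrite /det3; ring | apply/setP => x; rewrite !inE; do 3! case: (x == _)].
- by rewrite (perm3 i j k) //; rewrite /det3; ring.
Qed.

(** For determinants with s in front this is a polynomial identity. Sorting s into place multiplies
    each product by the parity of the number of elements of {a, b, c, d} below s, the same sign in
    all three. *)
Lemma three_term_minors q : q \in quads ->
  let: (p1, p2, p3) := products q in
  let p t := minor M (tk t) in
  p p1.1 * p p1.2 - p p2.1 * p p2.2 + p p3.1 * p p3.2 = 0.
Proof.
case/quadsP=> s [a [b [c [d [-> ab bc cd [sa sb sc sd]]]]]].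
have ac := ltn_trans ab bc; have bd := ltn_trans bc cd; have ad := ltn_trans ab bd.
have sg (i j : nat) : (i < j)%N -> sgn3 s i j = (i < s)%N (+) (j < s)%N.
  by move=> ij; rewrite /sgn3 [(j < i)%N]ltnNge (ltnW ij) addbF.
have Pf (i j : 'I_7) : s != i -> s != j -> (i < j)%N ->
    minor M (tk (tix s i j)) = (-1) ^+ ((i < s)%N (+) (j < s)%N) * det3 (cl s) (cl i) (cl j).
  by move=> si sj ij; rewrite minor_tix ?sg // ord_neq_lt.
have aux (x1 x2 x3 x4 x5 x6 y1 y2 y3 y4 y5 y6 : A) : x1 = y1 -> x2 = y2 -> x3 = y3 -> x4 = y4 ->
    x5 = y5 -> x6 = y6 -> y1 * y2 - y3 * y4 + y5 * y6 = 0 -> x1 * x2 - x3 * x4 + x5 * x6 = 0.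
  by move=> -> -> -> -> -> ->.
apply: (aux _ _ _ _ _ _ _ _ _ _ _ _ (Pf a b sa sb ab) (Pf c d sc sd cd) (Pf a c sa sc ac)
  (Pf b d sb sd bd) (Pf a d sa sd ad) (Pf b c sb sc bc)).
have K (e e' : bool) (x y : A) : (-1) ^+ e * x * ((-1) ^+ e' * y) = (-1) ^+ (e (+) e') * (x * y).
  by rewrite signr_addb; ring.
rewrite !K.
have -> : ((a < s) (+) (c < s) (+) ((b < s) (+) (d < s)))%N = ((a < s) (+) (b < s) (+) ((c < s) (+) (d < s)))%N.
  by do 4! case: (_ < s)%N.
have -> : ((a < s) (+) (d < s) (+) ((b < s) (+) (c < s)))%N = ((a < s) (+) (b < s) (+) ((c < s) (+) (d < s)))%N.
  by do 4! case: (_ < s)%N.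
rewrite /det3; ring.
Qed.
End Det.

Section Real.
Variable R : realType.
Local Notation mul2 := (fun (q : nat -> R) (p : nat * nat) => q p.1 * q p.2).

Definition sminor (chs : seq bool) (M : 'M[R]_(3, 7)) (t : nat) : R :=
  (-1) ^+ nth false chs t * minor M (tk t).

Lemma holds_sminor chs M r : r \in rels chs -> all (fun q => mixed chs (products q)) quads ->
  holds (sminor chs M) r.
Proof.
case/mapP=> q qin -> /allP /(_ _ qin); have := three_term_minors M qin.
case: (products q) => [[p1 p2] p3] /= T; rewrite /mixed /lone_first.
have K p : mul2 (sminor chs M) p = (-1) ^+ prodsign chs p * (minor M (tk p.1) * minor M (tk p.2)).
  by rewrite /sminor /prodsign signr_addb; ring.
move: T (K p1) (K p2) (K p3).
move: (minor M _ * _) (minor M _ * _) (minor M _ * _) => P1 P2 P3 T.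
case: (prodsign chs p1); case: (prodsign chs p2); case: (prodsign chs p3) => //= K1 K2 K3 _;
  rewrite /holds K1 K2 K3 ?expr0 ?expr1; lra.
Qed.

(** The coordinates with at least two indices in the basis {b1, b2, b3}; they determine a matrix
    normalized at that basis. *)
Definition frame_idx (b1 b2 b3 : nat) : seq nat :=
  [seq tix j b2 b3 | j <- iota 0 7 & (j != b2) && (j != b3)] ++
  [seq tix b1 j b3 | j <- iota 0 7 & (j != b1) && (j != b3)] ++
  [seq tix b1 b2 j | j <- iota 0 7 & (j != b1) && (j != b2)].

Definition brk (p : nat -> R) (i j k : nat) : R :=
  if [|| i == j, i == k | j == k] then 0 else (-1) ^+ sgn3 i j k * p (tix i j k).

(** The basis columns form diag(D, 1, 1) with D the bracket of the basis. Dividing only the last two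
    rows by D gives every bracket of the frame its value without a common factor. *)
Definition frame_mx (br : nat -> nat -> nat -> R) (b1 b2 b3 : 'I_7) : 'M[R]_(3, 7) :=
  \matrix_(r < 3, j < 7)
    if val r == 0%N then br j b2 b3
    else if val r == 1%N then br b1 j b3 / br b1 b2 b3 else br b1 b2 j / br b1 b2 b3.

Lemma frame_dets (br : nat -> nat -> nat -> R) (b1 b2 b3 j : 'I_7) :
  (forall i k, br i i k = 0) -> (forall i k, br i k i = 0) -> (forall i k, br k i i = 0) ->
  br b1 b2 b3 != 0 ->
  let M := frame_mx br b1 b2 b3 in
  [/\ det3 (cl M j) (cl M b2) (cl M b3) = br j b2 b3,
      det3 (cl M b1) (cl M j) (cl M b3) = br b1 j b3 &
      det3 (cl M b1) (cl M b2) (cl M j) = br b1 b2 j].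
Proof.
move=> z1 z2 z3 D0 M.
have c0 (i : 'I_7) : cl M i 0 = br i b2 b3 by rewrite /cl mxE /= inordK.
have c1 (i : 'I_7) : cl M i 1 = br b1 i b3 / br b1 b2 b3 by rewrite /cl mxE /= inordK.
have c2 (i : 'I_7) : cl M i 2 = br b1 b2 i / br b1 b2 b3 by rewrite /cl mxE /= inordK.
by split; rewrite /det3 !c0 !c1 !c2 !z1 !z2 !z3; field; exact: D0.
Qed.

Lemma frame_mxP (p : nat -> R) (b1 b2 b3 : 'I_7) t : (b1 < b2)%N -> (b2 < b3)%N ->
  p (tix b1 b2 b3) != 0 -> t \in frame_idx b1 b2 b3 -> minor (frame_mx (brk p) b1 b2 b3) (tk t) = p t.
Proof.
move=> b12 b23 pB; set M := frame_mx (brk p) b1 b2 b3.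
have b13 := ltn_trans b12 b23.
have n12 := ord_neq_lt b12; have n23 := ord_neq_lt b23; have n13 := ord_neq_lt b13.
set D := brk p b1 b2 b3.
have D0 : D != 0.
  rewrite /D /brk (negPf (n12 : (b1 : nat) != b2)) (negPf (n13 : (b1 : nat) != b3)) (negPf (n23 : (b2 : nat) != b3)) /=.
  by rewrite mulf_neq0 // signr_eq0.
have z1 i j : brk p i i j = 0 by rewrite /brk eqxx.
have z2 i j : brk p i j i = 0 by rewrite /brk eqxx orbT.
have z3 i j : brk p j i i = 0 by rewrite /brk eqxx !orbT.
have fin (i j k : 'I_7) : i != j -> i != k -> j != k ->
    det3 (cl M i) (cl M j) (cl M k) = brk p i j k -> minor M (tk (tix i j k)) = p (tix i j k).
  move=> ij ik jk; rewrite minor_tix // => ->; rewrite /brk.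
  rewrite (negPf (ij : (i : nat) != j)) (negPf (ik : (i : nat) != k)) (negPf (jk : (j : nat) != k)) /=.
  by rewrite mulrA -expr2 sqrr_sign mul1r.
rewrite !mem_cat => /or3P[] /mapP[j]; rewrite mem_filter mem_iota /= => /andP[/andP[h1 h2] j7] ->.
- have [E _ _] := frame_dets (Ordinal j7) z1 z2 z3 D0; exact: (fin (Ordinal j7) b2 b3 h1 h2 n23 E).
- have [_ E _] := frame_dets (Ordinal j7) z1 z2 z3 D0.
  by rewrite eq_sym in h1; exact: (fin b1 (Ordinal j7) b3 h1 n13 h2 E).
- have [_ _ E] := frame_dets (Ordinal j7) z1 z2 z3 D0.
  by rewrite eq_sym in h1; rewrite eq_sym in h2; exact: (fin b1 b2 (Ordinal j7) n12 h1 h2 E).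
Qed.

(** Propagates from the frame to the other coordinates through the relations of [used]. Unlike in a
    chart, any of the three products may be solved for, because this step transfers an equality and
    needs no control of signs. *)
Fixpoint run_frame (rl used : seq trel) (fs : seq (nat * nat)) (kn : seq nat) : option (seq nat) :=
  match fs with
  | [::] => Some kn
  | (r, t) :: fs' =>
    let: (c, a, b) := nth rel0 rl r in
    let ok p p1 p2 := [&& inp t p, other p t \in kn, (other p t < 35)%N, knownp kn p1 & knownp kn p2] in
    if ((c, a, b) \in used) && [|| ok c a b, ok a b c | ok b a c]
    then run_frame rl used fs' (t :: kn) else None
  end.

(** Two solutions of the same relations that agree on the frame agree wherever propagation reaches;
    positivity of q allows cancelling the known factor. *)
Lemma run_frameP rl used fs kn res (q q' : nat -> R) :
  (forall t, (t < 35)%N -> 0 < q t) ->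
  (forall r, r \in used -> holds q r /\ holds q' r) ->
  run_frame rl used fs kn = Some res -> (forall t, t \in kn -> q' t = q t) ->
  forall t, t \in res -> q' t = q t.
Proof.
move=> qp H; elim: fs kn => [|[r t] fs IH] kn /=; first by move=> [<-].
case: (nth rel0 rl r) => [[c a] b]; case: ifP => // /andP[rin cs] run Hk.
apply: (IH _ run) => u; rewrite inE => /predU1P[->|]; last exact: Hk.
have [h1 h2] := H _ rin.
have kE p : knownp kn p -> mul2 q' p = mul2 q p by move=> /andP[k1 k2] /=; rewrite !Hk.
have main p : inp t p -> other p t \in kn -> (other p t < 35)%N -> mul2 q' p = mul2 q p -> q' t = q t.
  move=> tp op o35; rewrite !(mul2_other _ tp) (Hk _ op) => /mulIf; apply.
  by rewrite gt_eqF // qp.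
rewrite /holds in h1 h2.
case/or3P: cs => /and5P[tp op o35 k1 k2]; apply: main tp op o35 _.
- by rewrite h1 h2 (kE a) // (kE b).
- by apply: (addIr (mul2 q b)); rewrite -h1 -(kE b k1) -h2 (kE c).
- by apply: (addrI (mul2 q a)); rewrite -h1 -(kE a k1) -h2 (kE c).
Qed.

Definition chart := (seq step * (nat * nat * nat) * seq (nat * nat))%type.

Definition chart_ok (rl : seq trel) (ch : chart) : bool :=
  let: (st, (b1, b2, b3), fs) := ch in
  [&& (b1 < b2)%N, (b2 < b3)%N & (b3 < 7)%N] &&
  match run_chart rl st [::] [::] with
  | None => false
  | Some (kn, used) => all (fun t => t \in kn) (iota 0 35) &&
    match run_frame rl used fs (frame_idx b1 b2 b3) with
    | None => false
    | Some kn' => all (fun t => t \in kn') (iota 0 35)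
    end
  end.

(** The values produced by the chart are known to satisfy only the relations it used, while the
    minors of the frame matrix satisfy all of them. Both are determined by the frame through the
    used relations, so the minors are these values. *)
Lemma chart_realization chs (x : nat -> R) (ch : chart) :
  all (fun q => mixed chs (products q)) quads -> dr (rels chs) x -> chart_ok (rels chs) ch ->
  (forall i, doms_ok (rels chs) x (nth (Free 0) ch.1.1 i)) ->
  exists M : R -> 'M[R]_(3, 7), forall t, (t < 35)%N -> Th (fun s => sminor chs (M s) t) (x t).
Proof.
case: ch => [[st [[b1 b2] b3]] fs] mx drx; rewrite /chart_ok => /andP[/and3P[b12 b23 b3_7]].
case Erun : (run_chart _ _ _ _) => [[kn used]|] // /andP[/allP all1].
case Ef : (run_frame _ _ _ _) => [kn'|] // /allP all2 Hd.
have emp1 c a b : (c, a, b) \in ([::] : seq trel) -> [/\ knownp [::] c, knownp [::] a & knownp [::] b] by [].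
have emp2 t : t \in ([::] : seq nat) -> Th (fun s : R => (fun _ _ => 1) s t) (x t) by [].
have emp3 : eventually (fun s : R => forall r, r \in ([::] : seq trel) -> holds ((fun _ _ => 1 : R) s) r) by exists 0.
have [q [Hq Hu]] := chart_Theta drx Hd Erun emp1 (q := fun _ _ => 1) emp2 emp3.
have usedrl r : r \in used -> r \in rels chs.
  suff H st' kn0 u0 kn1 u1 : run_chart (rels chs) st' kn0 u0 = Some (kn1, u1) ->
      {subset u0 <= rels chs} -> {subset u1 <= rels chs} by apply: (H _ _ _ _ _ Erun).
  elim: st' kn0 u0 => [|[t|r0 t|r0 ta tb|r0 t] st' IH] kn0 u0 /=; first by move=> [_ <-].
  - by case: ifP => // _; apply: IH.
  - case E : (nth rel0 _ r0) => [[c a] b]; case: ifP => // /andP[rs _] run sub.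
    by apply: (IH _ _ run) => z; rewrite inE => /predU1P[->|/sub//]; rewrite -E mem_nth.
  - case E : (nth rel0 _ r0) => [[c a] b]; case: ifP => // /andP[rs _] run sub.
    by apply: (IH _ _ run) => z; rewrite inE => /predU1P[->|/sub//]; rewrite -E mem_nth.
  - case E : (nth rel0 _ r0) => [[c a] b]; case: ifP => // /andP[/and3P[rs _ _] _] run sub.
    by apply: (IH _ _ run) => z; rewrite inE => /predU1P[->|/sub//]; rewrite -E mem_nth.
have b2_7 := ltn_trans b23 b3_7; have b1_7 := ltn_trans b12 b2_7.
pose o1 := Ordinal b1_7; pose o2 := Ordinal b2_7; pose o3 := Ordinal b3_7.
pose p s t := (-1) ^+ nth false chs t * q s t.
exists (fun s => frame_mx (brk (p s)) o1 o2 o3) => t t35.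
have pos : eventually (fun s => forall t, t \in iota 0 35 -> 0 < q s t).
  by apply: ev_all => u uin; apply: Th_pos (Hq u (all1 u uin)).
have t_in : t \in iota 0 35 by rewrite mem_iota.
apply: Th_ext (Hq t (all1 t t_in)).
apply: ev_imp (ev_and pos Hu) => s [ps hs].
apply/esym; apply: (run_frameP _ _ Ef) (all2 t t_in).
- by move=> u u35; apply: ps; rewrite mem_iota.
- by move=> r rin; split; [exact: hs | apply: holds_sminor => //; exact: usedrl].
- move=> u uin; rewrite /sminor frame_mxP //.
    by rewrite /p mulrA -expr2 sqrr_sign mul1r.
  rewrite /p mulf_neq0 ?signr_eq0 // gt_eqF // ps // mem_iota /=.
  by apply: (@tix_lt o1 o2 o3); apply: ord_neq_lt => //; apply: ltn_trans b23.
Qed.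

End Real.
Local Close Scope ring_scope.
Local Close Scope classical_set_scope.
Local Transparent tix trips.

(** * Tropical Grassmannian *)

Local Open Scope classical_set_scope.
Local Open Scope ring_scope.
Local Opaque tix trips.

Section Ideal.
Variable R : realType.
Local Notation N := (npl 3 7).

Lemma mmap1D (S : comNzRingType) k (h : 'I_k -> S) (m1 m2 : 'X_{1..k}) :
  mmap1 h (m1 + m2)%MM = mmap1 h m1 * mmap1 h m2.
Proof. by rewrite /mmap1 -big_split; apply: eq_bigr => i _; rewrite mnmDE exprD. Qed.

(** This yields the inclusion of the tropical Grassmannian in the Dressian. *)
Lemma three_term_ideal (f : {mpoly R[N]}) : three_term_relations f -> pluecker_ideal f.
Proof.
move=> /three_term_relationsP[q qin ->].
have := three_term_minors (generic_mx R 3 7) qin.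
case: (products q) => [[p1 p2] p3] T.
have K p : mmap (@mpolyC (3 * 7) R) (fun j => minor (generic_mx R 3 7) (enum_val j)) 'X_[mon p] =
    minor (generic_mx R 3 7) (tk p.1) * minor (generic_mx R 3 7) (tk p.2).
  by rewrite mmapX /mon mmap1D !mmap1U /pix -!lock !enum_rankK.
by rewrite /pluecker_ideal /tri_poly /= raddfD raddfB /= !K.
Qed.

(** Obtained by specializing the entries of the generic matrix to those of M. *)
Lemma ideal_eval (M : 'M[R]_(3, 7)) (f : {mpoly R[N]}) :
  pluecker_ideal f -> f.@[fun j => minor M (enum_val j)] = 0.
Proof.
rewrite /pluecker_ideal /= => H.
pose h (k : 'I_(3 * 7)) := mxvec M 0 k.
have E I : (minor (generic_mx R 3 7) I).@[h] = minor M I.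
  rewrite /minor -[LHS](det_map_mx (meval h)); congr (\det _).
  by apply/matrixP => i j; rewrite !mxE; exact: etrans (mevalXU h _) (mxvecE M _ _).
have : (mmap (@mpolyC (3 * 7) R) (fun j => minor (generic_mx R 3 7) (enum_val j)) f).@[h] = 0.
  by rewrite H meval0.
rewrite /mmap raddf_sum /= => <-; rewrite mevalE; apply: eq_bigr => m _.
rewrite mevalM mevalC; congr (_ * _).
by rewrite /mmap1 rmorph_prod; apply: eq_bigr => j _; rewrite rmorphXn /= E.
Qed.

Lemma Th_sum (T : eqType) (l : seq T) (g : T -> R -> R) (x : T -> R) : l != [::] ->
  (forall i, i \in l -> Th (g i) (x i)) ->
  exists2 i0, i0 \in l & (forall i, i \in l -> x i0 <= x i) /\ Th (fun s => \sum_(i <- l) g i s) (x i0).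
Proof.
elim: l => // i l IH _ H; have [E|l0] := eqVneq l [::].
  exists i; first exact: mem_head.
  rewrite E; split=> [j|]; first by rewrite inE => /eqP->.
  apply: Th_ext (H i (mem_head _ _)); exists 0 => s _; by rewrite big_seq1.
have [|i0 i0l [xmin Hs]] := IH l0; first by move=> j jl; apply: H; rewrite inE jl orbT.
have Ha := Th_add (H i (mem_head _ _)) Hs.
have Hb y : Num.min (x i) (x i0) = y -> Th (fun s => \sum_(j <- i :: l) g j s) y.
  by move=> <-; apply: Th_ext Ha; exists 0 => s _; rewrite big_cons.
have [le|lt] := leP (x i) (x i0).
  exists i; first exact: mem_head.
  split; last by apply: Hb; rewrite min_l.
  by move=> j; rewrite inE => /predU1P[->//|/xmin]; apply: le_trans.
exists i0; first by rewrite inE i0l orbT.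
split; last by apply: Hb; rewrite min_r // ltW.
by move=> j; rewrite inE => /predU1P[->|/xmin//]; apply: ltW.
Qed.

Section Chi.
Variables (chi : signvec 3 7) (chs : seq bool).
Hypothesis Hc : forall t, (t < 35)%N -> nth false chs t = chi (tk t).

(** The polynomial vanishes at the minors for all s. Moving the terms that are negative at chi to
    the other side equates two sums of eventually positive functions, so no leading terms cancel,
    and the orders of the two sums are the two tropical values. *)
Lemma TropV_realized (x : 'rV[R]_N) (M : R -> 'M[R]_(3, 7)) (f : {mpoly R[N]}) : pluecker_ideal f ->
  (forall t, (t < 35)%N -> Th (fun s => sminor chs (M s) t) (coord x t)) -> TropV chi f x.
Proof.
move=> fI HM.
pose sg (j : 'I_N) : R := sgnval R chi (enum_val j).
(* After the substitution q_I = chi_I p_I, [w m] is the value of the monomial and [e m] its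
   coefficient. *)
pose w (m : 'X_{1..N}) s := \prod_(j < N) (sg j * minor (M s) (enum_val j)) ^+ m j.
pose e (m : 'X_{1..N}) := (term f m).@[sg].
have sg2 j : sg j * sg j = 1 by rewrite /sg /sgnval -expr2 sqrr_sign.
have Hj (j : 'I_N) : Th (fun s => sg j * minor (M s) (enum_val j)) (x 0 j).
  have := HM _ (tn_lt (enum_val j)).
  by rewrite /sminor Hc ?tn_lt // tnK /coord /pix -lock tnK enum_valK.
have Hw m : Th (w m) (mdot m x) by apply: Th_prod.
have eE m : e m = f@_m * \prod_(j < N) sg j ^+ m j.
  rewrite /e /term mevalZ; congr (_ * _); by rewrite mevalX.
have tot s : \sum_(m <- msupp f) e m * w m s = 0.
  apply: etrans (ideal_eval (M s) fI); rewrite mevalE; apply: eq_bigr => m _.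
  rewrite eE -mulrA; congr (_ * _); rewrite /w -big_split /=; apply: eq_bigr => j _.
  by rewrite -exprMn mulrA sg2 mul1r.
have e0 m : m \in msupp f -> e m != 0.
  rewrite mcoeff_msupp eE => f0; rewrite mulf_neq0 //.
  by apply/prodf_neq0 => j _; rewrite expf_neq0 // /sg /sgnval signr_eq0.
pose lp := [seq m <- msupp f | 0 < e m]; pose ln := [seq m <- msupp f | ~~ (0 < e m)].
have bal s : \sum_(m <- lp) e m * w m s = \sum_(m <- ln) (- e m) * w m s.
  apply/eqP; rewrite -subr_eq0 -sumrN /lp /ln !big_filter.
  rewrite -[X in _ == X](tot s) [X in _ == X](bigID (fun m => 0 < e m)) /=; apply/eqP; congr (_ + _).
  by apply: eq_bigr => m _; rewrite mulNr opprK.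
have Thp m : m \in lp -> Th (fun s => e m * w m s) (mdot m x).
  by rewrite mem_filter => /andP[h _]; apply: Th_c.
have Thn m : m \in ln -> Th (fun s => - e m * w m s) (mdot m x).
  rewrite mem_filter => /andP[h /e0 h0]; apply: Th_c => //.
  by rewrite oppr_gt0 lt_neqAle h0 leNgt.
have sgE m : sgn_at chi f m = Num.sg (e m) by [].
have sgp m : m \in msupp f -> (sgn_at chi f m == 1) = (0 < e m).
  move=> /e0; rewrite sgE neq_lt => /orP[h|h]; last by rewrite gtr0_sg // eqxx h.
  by rewrite ltr0_sg // eqNr oner_eq0 lt_gtF.
have sgm m : m \in msupp f -> (sgn_at chi f m == -1) = ~~ (0 < e m).
  move=> /e0; rewrite sgE neq_lt => /orP[h|h]; first by rewrite ltr0_sg // eqxx lt_gtF.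
  by rewrite gtr0_sg // eq_sym eqNr oner_eq0 h.
have lpE m : (m \in msupp (sign_part chi 1 f)) = (m \in lp).
  by rewrite mem_sign_part mem_filter andbC; case mf : (m \in msupp f); rewrite ?andbF // !andbT sgp.
have lnE m : (m \in msupp (sign_part chi (-1) f)) = (m \in ln).
  by rewrite mem_sign_part mem_filter andbC; case mf : (m \in msupp f); rewrite ?andbF // !andbT sgm.
(* If one side has no terms, the other sums to zero, which a nonempty sum of positive functions
   cannot; then both tropical values are +oo. *)
have empty (l : seq 'X_{1..N}) (g : 'X_{1..N} -> R -> R) : (forall m, m \in l -> Th (g m) (mdot m x)) ->
    (forall s, \sum_(m <- l) g m s = 0) -> l = [::].
  move=> Hl H0; apply/eqP; apply: contraT => l0.
  have [i0 _ [_ /Th_pos[s0 /(_ _ (lexx _))]]] := Th_sum l0 Hl.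
  by rewrite H0 ltxx.
have infty (s : R) : (forall m, m \notin msupp (sign_part chi s f)) -> Trop (sign_part chi s f) x = +oo%E.
  by move=> H; apply/eqP; rewrite -leye_eq; apply/Trop_geP => m h; have := H m; rewrite h.
rewrite /TropV /=; have [El|lp0] := eqVneq lp [::].
  have ln0 : ln = [::].
    by apply: (empty ln _ Thn) => s; rewrite -bal El big_nil.
  by rewrite !infty // => m; rewrite ?lpE ?lnE ?El ?ln0.
have ln0 : ln != [::].
  apply: contra_neq lp0 => El; apply: (empty lp _ Thp) => s; by rewrite bal El big_nil.
have [i i_l [imin Hi]] := Th_sum lp0 Thp; have [j j_l [jmin Hj']] := Th_sum ln0 Thn.
have E : mdot i x = mdot j x by apply: Th_unique Hi Hj'; exists 0 => s _; exact: bal.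
have -> : Trop (sign_part chi 1 f) x = (mdot i x)%:E.
  by apply/Trop_attained; [rewrite lpE | move=> m; rewrite lpE; apply: imin].
have -> // : Trop (sign_part chi (-1) f) x = (mdot j x)%:E.
  by apply/Trop_attained; [rewrite lnE | move=> m; rewrite lnE; apply: jmin].
by rewrite E.
Qed.

Lemma realizable_Th (X : nat -> R) (M : R -> 'M[R]_(3, 7)) :
  (forall t, (t < 35)%N -> Th (fun s => sminor chs (M s) t) (X t)) -> realizable R chi.
Proof.
move=> HM.
have [|s0 /(_ _ (lexx _)) H] := @ev_all R _ (iota 0 35) (fun t s => 0 < sminor chs (M s) t).
  by move=> t; rewrite mem_iota /= => t35; apply: Th_pos (HM t t35).
exists (M s0) => I; have := H (tn I); rewrite mem_iota /= add0n tn_lt => /(_ isT).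
rewrite /sminor Hc ?tn_lt // tnK /sgnval; case: (chi I); rewrite ?expr0 ?expr1 ?mul1r ?mulN1r.
  by rewrite oppr_gt0 => /ltr0_sg.
by move=> /gtr0_sg.
Qed.
End Chi.

Lemma Trop_lt (h : {mpoly R[N]}) x (a : R) :
  (forall m, m \in msupp h -> a < mdot m x) -> (a%:E < Trop h x)%E.
Proof.
move=> H; rewrite /Trop big_seq; elim/big_ind: _ => [|u v hu hv|m mh]; first exact: ltry.
  by rewrite lt_min hu hv.
by rewrite lte_fin H.
Qed.

Lemma mdot_line m (x v : 'rV[R]_N) (e : R) : mdot m (x + e *: v) = mdot m x + e * mdot m v.
Proof.
rewrite /mdot mulr_sumr -big_split /=; apply: eq_bigr => j _; rewrite !mxE; ring.
Qed.

(** Tropical values are minima of finitely many linear functions, so a strict inequality between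
    them at x would persist at x + e v for small e. Comparing with one finite monomial also covers
    the value +oo. *)
Lemma TropV_limit (chi : signvec 3 7) (f : {mpoly R[N]}) (x v : 'rV[R]_N) :
  (forall e, 0 < e -> TropV chi f (x + e *: v)) -> TropV chi f x.
Proof.
move=> H.
have half (g h : {mpoly R[N]}) : (forall e, 0 < e -> Trop g (x + e *: v) = Trop h (x + e *: v)) ->
    (Trop g x <= Trop h x)%E.
  move=> E; apply/Trop_geP => m mh; rewrite leNgt; apply/negP => lt.
  have pos m' : m' \in msupp g -> mdot m x < mdot m' x.
    move=> m'g; rewrite -lte_fin; apply: (lt_le_trans lt).
    by have /Trop_geP := lexx (Trop g x); apply.
  have [|e e0 He] := @small_eps R [seq (mdot m' x - mdot m x, mdot m v - mdot m' v) | m' <- msupp g].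
    move=> u w /mapP[m' m'g [-> ->]]; have := pos _ m'g; rewrite -subr_gt0 => h1.
    by split; [exact: ltW | move=> h2; rewrite h2 ltxx in h1].
  have e2 : 0 < e / 2 by rewrite divr_gt0.
  have : ((mdot m (x + (e / 2) *: v))%:E < Trop g (x + (e / 2) *: v))%E.
    apply: Trop_lt => m' m'g; rewrite !mdot_line.
    have h1 := pos _ m'g; have h2 := He _ _ (map_f _ m'g); lra.
  rewrite (E _ e2) ltNge => /negP; apply.
  by have /Trop_geP := lexx (Trop h (x + (e / 2) *: v)); apply.
by rewrite /TropV /=; apply/eqP; rewrite eq_le !half // => e e0; have := H e e0; rewrite /TropV /= => ->.
Qed.
End Ideal.
Local Close Scope ring_scope.
Local Close Scope classical_set_scope.
Local Transparent tix trips.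

(** * Certificates *)

Local Open Scope classical_set_scope.
Local Open Scope ring_scope.
Local Opaque tix trips.

Section Zr.
Variable R : realType.
Definition zr (z : Z) : R := (int_of_Z z)%:~R.

Lemma zrD a b : zr (Z.add a b) = zr a + zr b.
Proof. by rewrite /zr -intrD; congr (_%:~R); lia. Qed.
Lemma zrB a b : zr (Z.sub a b) = zr a - zr b.
Proof. by rewrite /zr -intrB; congr (_%:~R); lia. Qed.
Lemma zrM a b : zr (Z.mul a b) = zr a * zr b.
Proof. by rewrite /zr -intrM; congr (_%:~R); lia. Qed.
Lemma zr0 : zr Z0 = 0. Proof. by []. Qed.
Lemma zr_lt a b : (zr a < zr b) = Z.ltb a b.
Proof. by rewrite /zr ltr_int; lia. Qed.
Lemma zr_le a b : (zr a <= zr b) = Z.leb a b.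
Proof. by rewrite /zr ler_int; lia. Qed.
Lemma zr_eq a b : (zr a == zr b) = Z.eqb a b.
Proof. by rewrite /zr eqr_int; lia. Qed.
Lemma zr_min a b : zr (Z.min a b) = Num.min (zr a) (zr b).
Proof.
case: (leP (zr a) (zr b)); rewrite ?zr_le ?zr_lt => h; congr zr; lia.
Qed.

Definition zsum (s : seq Z) : Z := foldr Z.add Z0 s.
Lemma zr_sum (T : Type) (s : seq T) (F : T -> Z) : zr (zsum [seq F j | j <- s]) = \sum_(j <- s) zr (F j).
Proof. by elim: s => [|j s IH] /=; rewrite ?big_nil // big_cons zrD IH. Qed.

(** An integer matrix fb and a nonzero d with fa fb = d I certify invertibility without
    fractions. *)
Definition unit_check (n : nat) (fa fb : nat -> nat -> Z) (d : Z) : bool :=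
  ~~ Z.eqb d Z0 && all (fun k => all (fun l =>
    Z.eqb (zsum [seq Z.mul (fa k j) (fb j l) | j <- index_iota 0 n]) (if k == l then d else Z0))
    (iota 0 n)) (iota 0 n).

Lemma unit_checkP n fa fb d : unit_check n fa fb d -> (\matrix_(k < n, j < n) zr (fa k j)) \in unitmx.
Proof.
case/andP=> d0 /allP H; set A := \matrix_(_, _) _.
have dn : zr d != 0 by rewrite -zr0 zr_eq.
suff /mulmx1_unit[] : A *m ((zr d)^-1 *: \matrix_(j < n, l < n) zr (fb j l)) = 1%:M by [].
rewrite -scalemxAr; apply/matrixP => k l; rewrite !mxE.
have kin : (k : nat) \in iota 0 n by rewrite mem_iota /=.
have lin : (l : nat) \in iota 0 n by rewrite mem_iota /=.
have := allP (H _ kin) _ lin; rewrite -zr_eq zr_sum big_mkord => /eqP E.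
have -> : \sum_(j < n) A k j * (\matrix_(j0 < n, l0 < n) zr (fb j0 l0)) j l = \sum_(j < n) zr (Z.mul (fa k j) (fb j l)).
  by apply: eq_bigr => j _; rewrite !mxE zrM.
rewrite E (_ : ((k : nat) == l) = (k == l)) //; case: (k == l); first by rewrite mulVf.
by rewrite zr0 mulr0.
Qed.

Definition par (X : nat -> R) (f : seq nat * seq nat) : R :=
  \sum_(t <- f.1) X t - \sum_(t <- f.2) X t.
End Zr.

Definition zpar (v : seq Z) (f : seq nat * seq nat) : Z :=
  Z.sub (zsum [seq nth Z0 v t | t <- f.1]) (zsum [seq nth Z0 v t | t <- f.2]).

(** The parameters of a chart as linear forms in the coordinates, in the order in which [lift_ray]
    consumes them. *)
Fixpoint pforms (rl : seq trel) (st : seq step) : seq (seq nat * seq nat) :=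
  match st with
  | [::] => [::]
  | Free t :: st' => ([:: t], [::]) :: pforms rl st'
  | Open r _ _ :: st' =>
    let: (_, a, b) := nth rel0 rl r in ([:: a.1; a.2], [:: b.1; b.2]) :: pforms rl st'
  | _ :: st' => pforms rl st'
  end.

Definition nodom (st : step) : bool := if st is Dom _ _ then false else true.

Section Unique.
Variable R : realType.

Lemma run_used rl st kn used kn' used' :
  run_chart rl st kn used = Some (kn', used') -> {subset used <= used'}.
Proof.
elim: st kn used => [|[t|r t|r ta tb|r t] st IH] kn used /=; first by move=> [_ <-].
- by case: ifP => // _; apply: IH.
- by case: (nth rel0 rl r) => [[c a] b]; case: ifP => // _ /IH H x xin; apply: H; rewrite inE xin orbT.
- by case: (nth rel0 rl r) => [[c a] b]; case: ifP => // _ /IH H x xin; apply: H; rewrite inE xin orbT.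
- by case: (nth rel0 rl r) => [[c a] b]; case: ifP => // _ /IH H x xin; apply: H; rewrite inE xin orbT.
Qed.

(** The tropical chart is injective. In an [Open] step c gives the minimum of a and b while their
    difference is a parameter, and these two numbers determine a and b. *)
Lemma chart_unique rl st kn used kn' used' (X Y : nat -> R) :
  run_chart rl st kn used = Some (kn', used') -> all nodom st ->
  dr used' X -> dr used' Y -> (forall f, f \in pforms rl st -> par X f = par Y f) ->
  (forall t, t \in kn -> X t = Y t) -> forall t, t \in kn' -> X t = Y t.
Proof.
move=> run nd dX dY; elim: st kn used run nd => [|[t|r t|r ta tb|r t] st IH] kn used //=.
- by move=> [<- _].
- case: ifP => // _ run nd Hp Hk; apply: (IH _ _ run nd) => [f fin|u].
    by apply: Hp; rewrite inE fin orbT.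
  rewrite inE => /predU1P[->|]; last exact: Hk.
  by have := Hp _ (mem_head _ _); rewrite /par /= !big_seq1 !big_nil !subr0.
- case: (nth rel0 rl r) => [[c a] b]; case: ifP => // /and5P[_ _ tc oc /andP[ka kb]] run nd Hp Hk.
  apply: (IH _ _ run nd) => [f fin|u]; first exact: Hp.
  rewrite inE => /predU1P[->|]; last exact: Hk.
  have rin := run_used run (mem_head _ _).
  have kE p : knownp kn p -> val2 X p = val2 Y p by move=> /andP[k1 k2]; rewrite /val2 !Hk.
  have : val2 X c = val2 Y c by rewrite (dX _ _ _ rin) (dY _ _ _ rin) (kE a) // (kE b).
  by rewrite !(val2_other _ tc) (Hk _ oc) => /addIr.
- case E : (nth rel0 rl r) => [[c a] b]; case: ifP => // /and5P[_ _ _ _ /and5P[iA iB kc oa ob]] run nd Hp Hk.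
  have rin := run_used run (mem_head _ _).
  have kE p : knownp kn p -> val2 X p = val2 Y p by move=> /andP[k1 k2]; rewrite /val2 !Hk.
  have := Hp _ (mem_head _ _); rewrite /par /= !big_cons !big_nil !addr0 -!/(val2 _ _) => Eu.
  have Ec := kE c kc; rewrite (dX _ _ _ rin) (dY _ _ _ rin) in Ec.
  have [Ea Eb] : val2 X a = val2 Y a /\ val2 X b = val2 Y b.
    by move: Ec; case: (leP (val2 X a) (val2 X b)) => h1; case: (leP (val2 Y a) (val2 Y b)) => h2 e; split; lra.
  apply: (IH _ _ run nd) => [f fin|u]; first by apply: Hp; rewrite inE fin orbT.
  rewrite !inE => /or3P[/eqP->|/eqP->|]; last exact: Hk.
    by move: Ea; rewrite !(val2_other _ iA) (Hk _ oa) => /addIr.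
  by move: Eb; rewrite !(val2_other _ iB) (Hk _ ob) => /addIr.
Qed.
End Unique.

Definition sbit (o : bool) (v : seq Z) (r : trel) : bool :=
  let: (_, a, b) := r in
  if o then Z.ltb (zval v a) (zval v b) else Z.ltb (zval v b) (zval v a).

Lemma nth_sigma rl v b : nth false (sigma rl v) b = (b./2 < size rl)%N && sbit (odd b) v (nth rel0 rl b./2).
Proof.
elim: rl b => [|[[c a] b'] rl IH] b /=; first by rewrite nth_nil.
by case: b => [|[|b]] //=; rewrite IH negbK.
Qed.

Fixpoint noconf (s : seq bool) : bool :=
  if s is b1 :: b2 :: s' then ~~ (b1 && b2) && noconf s' else true.

Lemma noconfP s k : noconf s -> nth false s k.*2 -> nth false s k.*2.+1 = false.
Proof.
have [n] := ubnP (size s); elim: n s k => // n IH [|b1 [|b2 s]] k //=.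
  by rewrite nth_nil.
rewrite ltnS => sn /andP[nb h]; case: k => [|k] /=; first by move=> b1t; move: nb; rewrite b1t; case: b2.
by apply: IH => //; apply: leq_trans sn; rewrite leqnSn.
Qed.

Section Compat.
Variables (F : seq trel) (vs : seq (seq Z)).
Local Notation m := (size vs).
Lemma join_sigma C (o : bool) k : size C = m -> (k < size F)%N ->
  nth false (join C [seq sigma F v | v <- vs]) (o + k.*2) <->
  exists2 l, nth false C l & sbit o (nth [::] vs l) (nth rel0 F k).
Proof.
move=> sC kF; rewrite (@join_spec m) ?size_map //.
have Eh : (o + k.*2)./2 = k by rewrite halfD odd_double andbF doubleK; case: o.
have Eo : odd (o + k.*2) = o by rewrite oddD odd_double addbF oddb.
split=> -[l Cl b]; exists l => //.
  have lm : (l < m)%N by rewrite -sC ltnNge; apply: contraL Cl => h; rewrite nth_default.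
  by move: b; rewrite (nth_map [::]) // nth_sigma Eh Eo => /andP[].
have lm : (l < m)%N by rewrite -sC ltnNge; apply: contraL Cl => h; rewrite nth_default.
by rewrite (nth_map [::]) // nth_sigma Eh Eo kF.
Qed.

Lemma noconf_compat C i j r o : size C = m -> noconf (join C [seq sigma F v | v <- vs]) ->
  nth false C i -> nth false C j -> r \in F -> sbit o (nth [::] vs i) r -> sbit (~~ o) (nth [::] vs j) r = false.
Proof.
move=> sC nc Ci Cj rF; rewrite -(nth_index rel0 rF).
have kF : (index r F < size F)%N by rewrite index_mem.
move=> hi; apply/negP => hj.
have bit o' l : nth false C l -> sbit o' (nth [::] vs l) (nth rel0 F (index r F)) ->
    nth false (join C [seq sigma F v | v <- vs]) (o' + (index r F).*2).
  by move=> Cl h; apply/join_sigma => //; exists l.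
have := noconfP nc (k := index r F).
have b1 := bit _ _ Ci hi; have b2 := bit _ _ Cj hj.
by case: o hi hj b1 b2 => _ _ /= b1 b2; rewrite ?add0n ?add1n in b1 b2; rewrite ?b1 ?b2 => /(_ isT).
Qed.
End Compat.
Local Close Scope ring_scope.
Local Close Scope classical_set_scope.
Local Transparent tix trips.

(** * Rays, lineality and circuits over the reals *)

Local Open Scope classical_set_scope.
Local Open Scope ring_scope.
Local Opaque tix trips.

Definition lt35 (p : nat * nat) : bool := (p.1 < 35)%N && (p.2 < 35)%N.
Definition rel35 (r : trel) : bool := [&& lt35 r.1.1, lt35 r.1.2 & lt35 r.2].
Definition zdr1 (v : seq Z) (r : trel) : bool :=
  let: (c, a, b) := r in Z.eqb (zval v c) (Z.min (zval v a) (zval v b)).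
Definition incid (i : nat) (p : nat * nat) : nat :=
  ((i \in nth [::] trips p.1) + (i \in nth [::] trips p.2))%N.
(** Each index occurs equally often in the three products, so they change by the same amount along
    the lineality space. *)
Definition hom (r : trel) : bool :=
  all (fun i => (incid i r.1.1 == incid i r.1.2) && (incid i r.1.2 == incid i r.2)) (iota 0 7).

Section Geo.
Variable R : realType.
Local Notation N := (npl 3 7).
Local Notation V := 'rV[R]_N.
Local Notation Lm := (lineality_mx R 3 7).

Definition fv (p : nat * nat) : 'cV[R]_N := delta_mx (pix p.1) 0 + delta_mx (pix p.2) 0.

Lemma ev_fv (x : V) p : ev x (fv p) = val2 (coord x) p.
Proof. by rewrite /ev /fv mulmxDr mxE -!colE !mxE. Qed.

Definition gl_of (F : seq trel) := [seq (fv r.1.1, fv r.1.2, fv r.2) | r <- F].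

Lemma gl_ofP F c a b : (c, a, b) \in gl_of F -> exists2 r, r \in F & [/\ c = fv r.1.1, a = fv r.1.2 & b = fv r.2].
Proof. by move=> /mapP[r rin [-> -> ->]]; exists r. Qed.

Lemma mem_gl_of F c a b : (c, a, b) \in F -> (fv c, fv a, fv b) \in gl_of F.
Proof. exact: (map_f (fun r : trel => (fv r.1.1, fv r.1.2, fv r.2))). Qed.

Lemma DR_dr F (x : V) : DR (gl_of F) x <-> dr F (coord x).
Proof.
split=> H c a b; first by move=> /mem_gl_of/H; rewrite !ev_fv.
by move=> /gl_ofP[[[c' a'] b'] rin [-> -> ->]]; rewrite !ev_fv; apply: H.
Qed.

Lemma FL_face F (x y : V) : FL (gl_of F) x y <-> face_le F (coord x) (coord y).
Proof.
split=> H c a b; first by move=> /mem_gl_of/H; rewrite !ev_fv.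
by move=> /gl_ofP[[[c' a'] b'] rin [_ -> ->]]; rewrite !ev_fv; apply: H rin.
Qed.

Definition ray (v : seq Z) : V := \row_j zr R (nth Z0 v (tn (enum_val j))).

Lemma coord_ray v t : (t < 35)%N -> coord (ray v) t = zr R (nth Z0 v t).
Proof. by move=> h; rewrite /coord mxE /pix -lock enum_rankK tkK. Qed.

Lemma val2_ray v p : lt35 p -> val2 (coord (ray v)) p = zr R (zval v p).
Proof. by case/andP=> h1 h2; rewrite /val2 !coord_ray // /zval zrD. Qed.

Lemma coord_ext (x y : V) : (forall t, (t < 35)%N -> coord x t = coord y t) -> x = y.
Proof.
move=> H; apply/rowP => j; have := H _ (tn_lt (enum_val j)).
by rewrite /coord /pix -lock tnK enum_valK.
Qed.

Lemma zdr_dr F v : all rel35 F -> all (zdr1 v) F -> dr F (coord (ray v)).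
Proof.
move=> /allP F35 /allP H c a b rin; have /and3P[/= h1 h2 h3] := F35 _ rin.
by rewrite !val2_ray // -zr_min; apply/eqP; rewrite zr_eq; have := H _ rin.
Qed.

Lemma sbit_ev o v r : rel35 r -> sbit o v r =
  if o then ev (ray v) (fv r.1.2) < ev (ray v) (fv r.2) else ev (ray v) (fv r.2) < ev (ray v) (fv r.1.2).
Proof.
case: r => [[c a] b] /and3P[/= h1 h2 h3]; rewrite !ev_fv !val2_ray //.
by case: o; rewrite zr_lt.
Qed.

Lemma coordD (x y : V) t : coord (x + y) t = coord x t + coord y t. Proof. by rewrite /coord mxE. Qed.
Lemma coordB (x y : V) t : coord (x - y) t = coord x t - coord y t. Proof. by rewrite /coord !mxE. Qed.
Lemma coordZ k (x : V) t : coord (k *: x) t = k * coord x t. Proof. by rewrite /coord mxE. Qed.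
Lemma coord_comb m (rf : nat -> V) M k t :
  coord (comb m rf M k) t = \sum_(i < m | nth false M i) k i * coord (rf i) t.
Proof. by rewrite /coord /comb summxE; apply: eq_bigr => i _; rewrite mxE. Qed.

Lemma par_sum m (Q : pred 'I_m) (k : 'I_m -> R) (Y : 'I_m -> nat -> R) f X :
  (forall t, t \in f.1 ++ f.2 -> X t = \sum_(i < m | Q i) k i * Y i t) ->
  par X f = \sum_(i < m | Q i) k i * par (Y i) f.
Proof.
move=> H; rewrite /par; under [RHS]eq_bigr do rewrite mulrBr !mulr_sumr.
rewrite sumrB; congr (_ - _); rewrite exchange_big /=; apply: eq_big_seq => t tin; apply: H;
  by rewrite mem_cat tin ?orbT.
Qed.

Lemma par_ray v f : all (fun t => t < 35)%N (f.1 ++ f.2) -> par (coord (ray v)) f = zr R (zpar v f).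
Proof.
move=> /allP H; rewrite /par /zpar zrB !zr_sum; congr (_ - _); apply: eq_big_seq => t tin; apply: coord_ray;
  by apply: H; rewrite mem_cat tin ?orbT.
Qed.

Lemma lin_pix i t : (t < 35)%N -> Lm i (pix t) = (val i \in nth [::] trips t)%:R.
Proof. by move=> t35; rewrite mxE /pix -lock enum_rankK val_tk // /tset inE. Qed.

Lemma gl_HL F : all rel35 F -> all hom F -> forall c a b, (c, a, b) \in gl_of F ->
  Lm *m c = Lm *m a /\ Lm *m a = Lm *m b.
Proof.
move=> /allP F35 /allP Fh c a b /gl_ofP[r rin [-> -> ->]].
have Lf p : lt35 p -> Lm *m fv p = \col_i (incid i p)%:R.
  move=> /andP[h1 h2]; apply/colP => i; rewrite /fv mulmxDr mxE -!colE mxE [in X in _ + X]mxE !lin_pix // mxE.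
  by rewrite /incid natrD.
have /and3P[h1 h2 h3] := F35 _ rin; rewrite !Lf //; have /allP H := Fh _ rin.
split; apply/colP => i; rewrite !mxE; congr (_%:R);
  by have /andP[/eqP e1 /eqP e2] : (incid i r.1.1 == incid i r.1.2) && (incid i r.1.2 == incid i r.2)
    by apply: H; rewrite mem_iota /=.
Qed.

Lemma coord_lin (u : 'rV[R]_7) t : (t < 35)%N ->
  coord (u *m Lm) t = \sum_i u 0 i * (val i \in nth [::] trips t)%:R.
Proof. by move=> t35; rewrite /coord mxE; apply: eq_bigr => i _; rewrite lin_pix. Qed.

Section Norm.
Variable norm : seq nat.
(** The lineality map restricted to the seven normalized coordinates. When it is invertible, every
    class modulo lineality has exactly one representative that vanishes at them. *)
Definition inc01 (i k : nat) : Z := if i \in nth [::] trips (nth 0%N norm k) then Zpos xH else Z0.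
Hypothesis norm35 : all (fun t => t < 35)%N norm.
Hypothesis norm7 : size norm = 7%N.
Hypothesis norm_unit : (\matrix_(i < 7, k < 7) zr R (inc01 i k)) \in unitmx.

Lemma coord_norm (u : 'rV[R]_7) (k : 'I_7) :
  coord (u *m Lm) (nth 0%N norm k) = (u *m \matrix_(i < 7, k < 7) zr R (inc01 i k)) 0 k.
Proof.
rewrite coord_lin; last by apply: (allP norm35); rewrite mem_nth ?norm7.
by rewrite [RHS]mxE; apply: eq_bigr => i _; rewrite mxE /inc01; case: ifP.
Qed.

Lemma norm_exists (x : V) : exists u, forall t, t \in norm -> coord (x - u *m Lm) t = 0.
Proof.
exists ((\row_k coord x (nth 0%N norm k)) *m invmx (\matrix_(i < 7, k < 7) zr R (inc01 i k))) => t tin.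
have tl : (index t norm < 7)%N by rewrite -norm7 index_mem.
rewrite -(nth_index 0%N tin) coordB (coord_norm _ (Ordinal tl)) mulmxKV // mxE; exact: subrr.
Qed.

Lemma norm_inj (u : 'rV[R]_7) : (forall t, t \in norm -> coord (u *m Lm) t = 0) -> u = 0.
Proof.
move=> H; rewrite -[u](mulmxK norm_unit).
have -> : u *m \matrix_(i < 7, k < 7) zr R (inc01 i k) = 0.
  by apply/rowP => k; rewrite -coord_norm H ?mem_nth ?norm7 // mxE.
by rewrite mul0mx.
Qed.
End Norm.
End Geo.

(** Rays are compared through their six parameters, so the circuits live in R^6. The last condition
    is the local convexity of the heights required of a wall. *)
Definition circ_ok (rhos : seq (seq Z)) (ph : seq Z) (m : nat) (c : seq nat * seq nat) : bool :=
  let ng := drop 2 c.1 in let i := nth 0%N c.1 0 in let j := nth 0%N c.1 1 in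
  [&& all (fun l => l < m)%N [:: i, j & ng ++ c.2], i \notin ng ++ c.2, j \notin ng ++ c.2,
      all (fun k => Z.eqb (zsum [seq nth Z0 (nth [::] rhos l) k | l <- [:: i, j & ng]])
                          (zsum [seq nth Z0 (nth [::] rhos l) k | l <- c.2])) (iota 0 6)
    & Z.ltb (zsum [seq nth Z0 ph l | l <- [:: i, j & ng]]) (zsum [seq nth Z0 ph l | l <- c.2])].

Section Circ.
Variables (R : realType) (rhos : seq (seq Z)) (ph : seq Z) (m : nat).
Definition rho (i : nat) : 'rV[R]_6 := \row_k zr R (nth Z0 (nth [::] rhos i) k).
Definition phi (i : nat) : R := zr R (nth Z0 ph i).

Lemma sum_count (W : lmodType R) (F : nat -> W) (Q : pred nat) (s : seq nat) :
  all (fun l => (l < m)%N && Q l) s ->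
  \sum_(l < m | Q l) (count_mem (l : nat) s)%:R *: F l = \sum_(l <- s) F l.
Proof.
elim: s => [|a s IH] /=; first by move=> _; rewrite big_nil big1 // => l _; rewrite scale0r.
move=> /andP[/andP[am Qa] /IH {}IH]; rewrite big_cons -IH.
under eq_bigr do rewrite natrD scalerDl.
rewrite big_split /=; congr (_ + _); rewrite (bigD1 (Ordinal am)) //= eqxx scale1r big1 ?addr0 // => l /andP[_ ne].
by rewrite -val_eqE /= eq_sym in ne; rewrite (negPf ne) scale0r.
Qed.

(** Compatibility only steers the choice of the entering ray; a crossing is a wall by virtue of its
    circuit, whatever the table contains. *)
Variables (compat : seq (seq bool)) (cs : seq (seq nat * seq nat)).
Hypothesis cs_ok : all (circ_ok rhos ph m) cs.
Local Notation tab := (table m compat cs).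

Lemma wall_of_circ C i j ng ps : size C = m -> (i < m)%N -> (j < m)%N -> nth false C i -> nth false C j = false ->
  all (fun l => l < m)%N (ng ++ ps) -> i \notin ng ++ ps -> bsubR (bmask m (ng ++ ps)) C ->
  (rho i + rho j + \sum_(l <- ng) rho l = \sum_(l <- ps) rho l) ->
  (phi i + phi j + \sum_(l <- ng) phi l < \sum_(l <- ps) phi l) ->
  wall m rho phi C i j.
Proof.
move=> sC im jm Ci Cj lm iN sub Er Ep.
(* Multiplicities on the right minus those on the left express r_i + r_j through the rays that
   stay. *)
exists (fun l => (count_mem l ps)%:R - (count_mem l ng)%:R); split=> //.
have H s : {subset s <= ng ++ ps} -> all (fun l => (l < m)%N && (nth false C l && (l != i))) s.
  move=> ss; apply/allP => l /ss lin; have lm' := allP lm _ lin; rewrite lm' /=.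
  rewrite sub ?nth_bmask ?lm' //=; by apply: contraNneq iN => <-.
have Hn := H ng (fun l h => etrans (mem_cat _ _ _) (introT orP (or_introl h))).
have Hp := H ps (fun l h => etrans (mem_cat _ _ _) (introT orP (or_intror h))).
have D (W : lmodType R) (F : nat -> W) : \sum_(l < m | nth false C l && (l != i :> nat))
    ((count_mem (l : nat) ps)%:R - (count_mem (l : nat) ng)%:R) *: F l = \sum_(l <- ps) F l - \sum_(l <- ng) F l.
  under eq_bigr do rewrite scalerBl.
  by rewrite sumrB (sum_count F Hp) (sum_count F Hn).
split; first by rewrite D -Er addrK.
by have := D R^o phi => /= ->; rewrite ltrBrDr.
Qed.

Lemma edge_wall C i D : size C = m -> nth false C i -> (i < size tab)%N ->
  nbr C i (nth [::] tab i) = Some D -> exists2 j, wall m rho phi C i j & D = flip C i j.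
Proof.
move=> sC Ci; rewrite size_map size_iota => im /nbrP[j [g [cm [ein Cj gC _ ->]]]]; exists j => //.
move: ein; rewrite (nth_map 0%N) ?size_iota // nth_iota // add0n mem_pmap => /mapP[[[i' j'] g'] cin].
have [ng [ps [Eg ok]]] : exists ng ps : seq nat, g' = bmask m (ng ++ ps) /\
   [&& all (fun l => l < m)%N [:: i', j' & ng ++ ps], i' \notin ng ++ ps, j' \notin ng ++ ps,
      all (fun k => Z.eqb (zsum [seq nth Z0 (nth [::] rhos l) k | l <- [:: i', j' & ng]])
                          (zsum [seq nth Z0 (nth [::] rhos l) k | l <- ps])) (iota 0 6)
    & Z.ltb (zsum [seq nth Z0 ph l | l <- [:: i', j' & ng]]) (zsum [seq nth Z0 ph l | l <- ps])].
  move/mapP: cin => [[lh rh] cin [-> -> ->]]; exists (drop 2 lh), rh; split=> //.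
  exact: (allP cs_ok _ cin).
move: ok => /and5P[i'j'm ni nj /allP Er Ep].
move: i'j'm => /= /and3P[i'm j'm nm].
have {}Er : rho i' + rho j' + \sum_(l <- ng) rho l = \sum_(l <- ps) rho l.
  apply/rowP => k; have := Er (k : nat); rewrite mem_iota leq0n ltn_ord => /(_ isT).
  rewrite -(zr_eq R) /zsum !map_cons /= -!/(zsum _) !zrD !zr_sum => /eqP; rewrite !mxE !summxE addrA => e.
  by under eq_bigr do rewrite mxE; under [RHS]eq_bigr do rewrite mxE.
have {}Ep : phi i' + phi j' + \sum_(l <- ng) phi l < \sum_(l <- ps) phi l.
  by move: Ep; rewrite -(zr_lt R) !zrD !zr_sum addrA.
have Cj' : nth false C j = false.
  have [jm|jm] := ltnP j (size C); last by rewrite nth_default.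
  by rewrite -Cj; apply: set_nth_default.
case: ifP => [/eqP Ei [Ej Eg' _]|_].
  rewrite Ei in i'm ni Er Ep; rewrite -Ej in j'm nj Er Ep; rewrite Eg' Eg in gC.
  by apply: (wall_of_circ (ng := ng) (ps := ps)) => //.
case: ifP => // /eqP Ei [Ej Eg' _].
rewrite Ei in j'm nj Er Ep; rewrite -Ej in i'm ni Er Ep; rewrite Eg' Eg in gC.
by apply: (wall_of_circ (ng := ng) (ps := ps)) => //; rewrite ?[rho i + _]addrC ?[phi i + _]addrC.
Qed.

Variable s0 : seq nat.
Hypothesis s0_uniq : uniq s0.
Hypothesis s0_lt : all (fun l => l < m)%N s0.
Hypothesis s0_size : size s0 = 6%N.
Hypothesis s0_unit : (\matrix_(k < 6, j < 6) zr R (nth Z0 (nth [::] rhos (nth 0%N s0 k)) j)) \in unitmx.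

Lemma lcomb_start c : lcomb m rho (bmask m s0) c =
  (\row_(k < 6) c (nth 0%N s0 k)) *m \matrix_(k < 6, j < 6) zr R (nth Z0 (nth [::] rhos (nth 0%N s0 k)) j).
Proof.
rewrite /lcomb mulmx_sum_row.
have -> : \sum_(l < m | nth false (bmask m s0) l) c l *: rho l = \sum_(l <- s0) c l *: rho l.
  rewrite (eq_bigl (fun l : 'I_m => (l : nat) \in s0)); last by move=> l; rewrite nth_bmask ltn_ord.
  rewrite -(big_mkord (fun l => l \in s0) (fun l => c l *: rho l)) -big_filter; apply: perm_big.
  apply: uniq_perm => [||l]; rewrite ?filter_uniq ?iota_uniq // mem_filter mem_index_iota /=.
  by case lin : (l \in s0) => //=; exact: (allP s0_lt _ lin).
rewrite (big_nth 0%N) s0_size big_mkord; apply: eq_bigr => k _; rewrite mxE; congr (_ *: _).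
by apply/rowP => j; rewrite !mxE.
Qed.

Lemma start_free : lfree m rho (bmask m s0).
Proof.
move=> c; rewrite lcomb_start => E.
have : \row_(k < 6) c (nth 0%N s0 k) = 0 by rewrite -[LHS](mulmxK s0_unit) E mul0mx.
move=> /rowP H l lm; rewrite nth_bmask lm /= => lin.
have kl : (index l s0 < 6)%N by rewrite -s0_size index_mem.
by have := H (Ordinal kl); rewrite !mxE /= nth_index.
Qed.

Lemma start_span y : exists c, y = lcomb m rho (bmask m s0) c.
Proof.
pose w := y *m invmx (\matrix_(k < 6, j < 6) zr R (nth Z0 (nth [::] rhos (nth 0%N s0 k)) j)).
exists (fun l => w 0 (inord (index l s0))); rewrite lcomb_start.
have -> : \row_(k < 6) w 0 (inord (index (nth 0%N s0 k) s0)) = w.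
  by apply/rowP => k; rewrite mxE index_uniq ?s0_size // inord_val.
by rewrite mulmxKV.
Qed.
End Circ.
Local Close Scope ring_scope.
Local Close Scope classical_set_scope.
Local Transparent tix trips.

(** * Verification of a certificate *)

Local Open Scope classical_set_scope.
Local Open Scope ring_scope.
Local Opaque tix trips.

(** The first seven parameters of the chart are free coordinates; setting them to zero fixes the
    seven-dimensional lineality. The remaining six parameters are the coordinates of R^6. *)
Definition norm_of (pfs : seq (seq nat * seq nat)) : seq nat := [seq head 0%N f.1 | f <- take 7 pfs].
Definition rhos_of (pfs : seq (seq nat * seq nat)) (vs : seq (seq Z)) : seq (seq Z) :=
  [seq [seq zpar v f | f <- drop 7 pfs] | v <- vs].
Definition actb_of (rl : seq trel) (vs : seq (seq Z)) : seq bool := [seq all (zdr1 v) rl | v <- vs].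
(** The active rays at which every bounding relation has c = a, so that the summand containing J may
    grow. *)
Definition Zb_of (rl jr : seq trel) (vs : seq (seq Z)) : seq bool :=
  [seq all (zdr1 v) rl && all (fun r : trel => Z.eqb (zval v r.1.2) (zval v r.1.1)) jr | v <- vs].
(** Puts c in the place of b, so that the signature code records on which side of a = c a vector
    lies; J does not occur in this comparison. *)
Definition dforms (jr : seq trel) : seq trel := [seq (r.1.1, r.1.2, r.1.1) | r <- jr].
(** The first selection keeps the active rays of a cone. The second exists only when a coordinate is
    missing, that is J < 35; it keeps the rays above which J is free and adds the vertical ray,
    stored last. *)
Definition gs_of (rl jr : seq trel) (vs : seq (seq Z)) (J : nat) : seq (seq bool * seq bool) :=
  (actb_of rl vs, nseq (size vs) false) ::
  (if (J < 35)%N then [:: (Zb_of rl jr vs, bmask (size vs) [:: (size vs).-1])] else [::]).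
Definition MM_of (gs : seq (seq bool * seq bool)) (L : seq (seq bool * seq (nat * seq bool))) : seq (seq bool) :=
  flatten [seq [seq restr g x.1 | x <- L] | g <- gs].
(** A [Dom] step is safe inside the cone of a mask once the required strict sign occurs at one ray:
    without conflicts no ray of the mask has the opposite one. *)
Definition fits (rl : seq trel) (j : seq bool) (ch : chart) : bool :=
  all (fun s => if s is Dom r t then
     let: (c, a, b) := nth rel0 rl r in
     [&& (r < size rl)%N, inp t a ==> nth false j (true + r.*2)%N & inp t b ==> nth false j (false + r.*2)%N]
   else true) ch.1.1.

(** Under call-by-value evaluation [find] stops at the first hit, whereas [has] would visit the
    whole list; the nested conditionals serve the same purpose. *)
Definition mask_ok (rl : seq trel) (sigs : seq (seq bool)) (charts : seq chart) (M6 : seq (seq bool))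
    (M : seq bool) : bool :=
  let j := join M sigs in
  if noconf j then
    let k := count id M in
    if k == 6%N then (find (fits rl j) charts < size charts)%N
    else if (k < 6)%N then (find (bsub M) M6 < size M6)%N else false
  else false.

Lemma nodup_uniq (l : seq (positive * nat)) :
  SetoidList.NoDupA (@PositiveMap.eq_key nat) l -> uniq [seq dec x.1 | x <- l].
Proof.
have mem (x : positive * nat) (s : seq (positive * nat)) : dec x.1 \in [seq dec y.1 | y <- s] -> SetoidList.InA (@PositiveMap.eq_key nat) x s.
  elim: s => //= y s IH; rewrite inE => /predU1P[/(can_inj decK) E|/IH h]; first by constructor 1.
  by constructor 2.
elim=> //= x s nx _ ->; rewrite andbT; apply/negP => /mem; exact: nx.
Qed.

Lemma mem_elements (l : seq (positive * nat)) S d :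
  (S, d) \in [seq (dec x.1, x.2) | x <- l] <-> List.In (enc S, d) l.
Proof.
elim: l => //= -[k d'] l IH; rewrite inE xpair_eqE /=; split.
  by case/orP=> [/andP[/eqP-> /eqP->]|/IH]; [left; rewrite decK | right].
by case=> [[-> ->]|/IH->]; rewrite ?encK ?eqxx ?orbT.
Qed.

Lemma take_mem (T : eqType) n (s : seq T) x : x \in take n s -> x \in s.
Proof. by move=> h; rewrite -(cat_take_drop n s) mem_cat h. Qed.

Lemma drop_mem (T : eqType) n (s : seq T) x : x \in drop n s -> x \in s.
Proof. by move=> h; rewrite -(cat_take_drop n s) mem_cat h orbT. Qed.

Section Body.
Variables (R : realType) (neg : seq (seq nat)).
Local Notation N := (npl 3 7).
Local Notation Lm := (lineality_mx R 3 7).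
Local Notation rl := (rels (signs neg)).
Variables (st : seq step) (kn : seq nat) (used : seq trel) (vs : seq (seq Z)) (J : nat) (jr : seq trel).
Variables (cs : seq (seq nat * seq nat)) (ph : seq Z) (compat : seq (seq bool)) (s0 : seq nat).
Variables (L : seq (seq bool * seq (nat * seq bool))) (charts : seq chart) (fuel : nat).
Variables (ninv sinv : nat -> nat -> Z) (nden sden : Z).
Local Notation m := (size vs).
Local Notation pfs := (pforms rl st).
Local Notation norm := (norm_of pfs).
Local Notation rhos := (rhos_of pfs vs).
Local Notation actb := (actb_of rl vs).
Local Notation Zb := (Zb_of rl jr vs).
Local Notation e := (size vs).-1.
Local Notation gs := (gs_of rl jr vs J).
Local Notation MM := (MM_of gs L).
Local Notation sigs := [seq sigma rl v | v <- vs].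
Local Notation rf := (fun i : nat => ray R (nth [::] vs i)).
Local Notation act := (nth false actb).
Local Notation gl := (gl_of R rl).
Local Notation V := (map fst L).
Local Notation C0 := (bmask m s0).
Local Notation tab := (table m compat cs).
Local Notation Rho := (rho R rhos).
Local Notation Phi := (phi R ph).

Hypothesis mx : all (fun q => mixed (signs neg) (products q)) quads.
Hypothesis rl35 : all rel35 rl.
Hypothesis jr35 : all rel35 jr.
Hypothesis used_sub : all (fun r => r \in rl) used.
Hypothesis rl_hom : all hom rl.
Hypothesis run : run_chart rl st [::] [::] = Some (kn, used).
Hypothesis nd : all nodom st.
Hypothesis kn_all : all (fun t => (t == J) || (t \in kn)) (iota 0 35).
Hypothesis pf_norm : take 7 pfs == [seq ([:: t], [::]) | t <- norm].
Hypothesis norm7 : size norm == 7%N.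
Hypothesis pf35 : all (fun f => all (fun t => t < 35)%N (f.1 ++ f.2)) pfs.
Hypothesis pf13 : size pfs == 13%N.
Hypothesis norm_chk : unit_check 7 (inc01 norm) ninv nden.
Hypothesis vs_ok : all (fun v => all (zdr1 v) used && all (fun t => Z.eqb (nth Z0 v t) Z0) norm) vs.
Hypothesis cs_ok : all (circ_ok rhos ph m) cs.
Hypothesis s0_uniq : uniq s0.
Hypothesis s0_lt : all (fun l => l < m)%N s0.
Hypothesis s0_size : size s0 == 6%N.
Hypothesis s0_chk : unit_check 6 (fun k j => nth Z0 (nth [::] rhos (nth 0%N s0 k)) j) sinv sden.
(** A ray of the complete fan that is not in the Dressian violates a bound strictly, a < c. This is
    what eliminates it from decompositions of points of the Dressian. *)
Hypothesis inf_ok : all (fun v => all (zdr1 v) rl || has (fun r : trel => Z.ltb (zval v r.1.2) (zval v r.1.1)) jr) vs.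
Hypothesis bfs_ok : bfs fuel tab [:: C0] (PositiveMap.add (enc C0) tt (PositiveMap.empty unit)) [::] = Some L.
Hypothesis L_ok : all (fun x => noconf (join x.1 [seq sigma (used ++ dforms jr) v | v <- vs])) L.
(** On each cone one bound on J is attained at all rays of [Zb] simultaneously, so the lift has the
    least possible J above that part of the cone. *)
Hypothesis J_ok : (J < 35)%N ==> all (fun x => ~~ nth false x.1 e && has (fun r : trel =>
  all (fun i => nth false x.1 i && nth false Zb i ==>
    Z.eqb (zval (nth [::] vs i) r.2) (zval (nth [::] vs i) r.1.1)) (iota 0 m)) jr) L.
Hypothesis e_ok : (J < 35)%N ==> [&& (0 < m)%N,
   all (fun t => Z.eqb (nth Z0 (nth [::] vs e) t) (if t == J then Zpos xH else Z0)) (iota 0 35)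
   & all (fun k => Z.eqb (nth Z0 (nth [::] rhos e) k) Z0) (iota 0 6)].
Hypothesis jr_ok : all (fun r : trel => [&& ((r.1.1, r.1.2, r.2) \in rl) || ((r.1.1, r.2, r.1.2) \in rl),
   inp J r.2, other r.2 J != J, ~~ inp J r.1.1 & ~~ inp J r.1.2]) jr.
Hypothesis gs_ok : all (fun g => bsub g.1 actb && bsub g.2 actb) gs.
Hypothesis MM_ok : all (mask_ok rl sigs charts [seq M <- MM | count id M == 6%N]) MM.
Hypothesis charts_ok : all (chart_ok rl) charts.

Lemma HLrl : forall c a b, (c, a, b) \in gl -> Lm *m c = Lm *m a /\ Lm *m a = Lm *m b.
Proof. exact: gl_HL. Qed.

Lemma bfs_facts : [/\ C0 \in V,
   forall C l, (C, l) \in L -> nbrs C 0 C tab = Some l /\ {subset map snd l <= V} &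
   forall Pr : seq bool -> Prop, Pr C0 -> (forall C D, Pr C -> edge tab C D -> Pr D) -> forall C, C \in V -> Pr C].
Proof.
have [||h1 _ h3 h4] := bfs_spec bfs_ok.
- move=> k; rewrite find_add; case: eqP => [-> _|_]; first by left; rewrite encK mem_head.
  by rewrite PositiveMap.gempty.
- by [].
split=> // [|Pr P0 Pe]; first by apply: h1; rewrite mem_head.
by apply: h4 => // C; rewrite inE => /eqP->.
Qed.

Lemma edge_flip C D : size C = m -> edge tab C D -> exists i j, wall m Rho Phi C i j /\ D = flip C i j.
Proof.
move=> sC [i [Ci it nb]]; have [j w ->] := edge_wall R cs_ok sC Ci it nb.
by exists i, j.
Qed.

Lemma V_size C : C \in V -> size C = m.
Proof.
have [_ _ ind] := bfs_facts; move: C; apply: ind; first by rewrite size_map size_iota.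
by move=> C D sC /(edge_flip sC)[i [j [_ ->]]]; rewrite /flip !size_setb.
Qed.

Lemma V_mem C : C \in V -> exists l, (C, l) \in L.
Proof. by move=> /mapP[[C' l] h ->]; exists l. Qed.

Lemma V_wall C i : C \in V -> (i < m)%N -> nth false C i -> exists2 j, wall m Rho Phi C i j & flip C i j \in V.
Proof.
move=> CV im Ci; have sC := V_size CV; have [_ Hn _] := bfs_facts; have [l Cl] := V_mem CV.
have [En sub] := Hn _ _ Cl; have [H1 _] := nbrs_spec En.
have it : (i < size tab)%N by rewrite size_map size_iota.
have [D nb Dl] := H1 i Ci it; have [j w E] := edge_wall R cs_ok sC Ci it nb.
by exists j => //; rewrite -E; apply: sub; apply: (map_f snd Dl).
Qed.

Lemma V_ind (Pr : seq bool -> Prop) : Pr C0 ->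
  (forall C i j, C \in V -> Pr C -> wall m Rho Phi C i j -> flip C i j \in V -> Pr (flip C i j)) ->
  forall C, C \in V -> Pr C.
Proof.
move=> P0 Pw C CV; have [C0V Hn ind] := bfs_facts.
suff [] : C \in V /\ Pr C by [].
move: C CV; apply: ind => // C D [CV PC] ed; have [l Cl] := V_mem CV; have [En sub] := Hn _ _ Cl.
have [H1 _] := nbrs_spec En; have [i [Ci it nb]] := ed.
have [D' nb' Dl] := H1 i Ci it; rewrite add0n nb in nb'; case: nb' => ED.
have DV : D \in V by rewrite ED; apply: sub; apply: (map_f snd Dl).
split=> //; have [i' [j [w E]]] := edge_flip (V_size CV) ed.
by rewrite E in DV *; apply: Pw.
Qed.

Lemma V_lfree C : C \in V -> lfree m Rho C.
Proof.
apply: (V_free (phi := Phi) V_size V_ind).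
exact: start_free s0_uniq s0_lt (eqP s0_size) (unit_checkP R s0_chk).
Qed.

Lemma act_lt i : act i -> (i < m)%N.
Proof. by rewrite ltnNge; apply: contraL => h; rewrite nth_default // size_map. Qed.

Lemma act_zdr i : act i -> all (zdr1 (nth [::] vs i)) rl.
Proof. by move=> h; have im := act_lt h; move: h; rewrite (nth_map [::]). Qed.

Lemma act_DR i : act i -> DR gl (rf i).
Proof. by move=> /act_zdr h; apply/DR_dr; apply: zdr_dr. Qed.

Lemma MM_P M : M \in MM -> exists g C, [/\ g \in gs, C \in V & M = restr g C].
Proof.
move=> /flatten_mapP[g gin /mapP[x xin ->]]; exists g, x.1; split=> //; exact: map_f.
Qed.

Lemma MM_mem g C : g \in gs -> C \in V -> restr g C \in MM.
Proof. by move=> gin /mapP[x xin ->]; apply/flatten_mapP; exists g => //; apply: (map_f (fun x => restr g x.1)). Qed.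

Lemma gs_sizes g : g \in gs -> size g.1 = m /\ size g.2 = m.
Proof.
rewrite inE => /predU1P[->|] /=; first by rewrite size_map size_nseq.
by case: ifP => // _; rewrite inE => /eqP->; rewrite /= !size_map size_iota.
Qed.

Lemma restr_size g C : g \in gs -> C \in V -> size (restr g C) = m.
Proof.
move=> /gs_sizes[h1 h2] /V_size h3; have hb : size (band C g.1) = m by rewrite size_band ?h3.
by rewrite /restr size_bor hb ?h2.
Qed.

Lemma MM_size M : M \in MM -> size M = m.
Proof. by move=> /MM_P[g [C [gin CV ->]]]; apply: restr_size. Qed.

Lemma restr_act g C : g \in gs -> bsubR (restr g C) actb.
Proof.
move=> gin i; rewrite nth_restr; have /andP[/bsubP h1 /bsubP h2] := allP gs_ok _ gin.
by case/orP=> [/andP[_ /h1]|/h2].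
Qed.

Lemma MM_act M i : M \in MM -> nth false M i -> act i.
Proof. by move=> /MM_P[g [C [gin CV ->]]]; apply: restr_act. Qed.

Lemma compat_of (F : seq trel) (C : seq bool) i j c a b : all rel35 F -> size C = m ->
  noconf (join C [seq sigma F v | v <- vs]) -> nth false C i -> nth false C j ->
  (c, a, b) \in gl_of R F -> ev (rf i) a < ev (rf i) b -> ev (rf j) a <= ev (rf j) b.
Proof.
move=> F35 sC nc Ci Cj /gl_ofP[r rin [_ -> ->]]; have r35 := allP F35 _ rin.
move=> lt; have := noconf_compat sC nc Ci Cj rin (o := true); rewrite !(sbit_ev R) // lt => /(_ isT) /= h.
by rewrite leNgt h.
Qed.

Lemma compat_of' (F : seq trel) (C : seq bool) i j c a b : all rel35 F -> size C = m ->
  noconf (join C [seq sigma F v | v <- vs]) -> nth false C i -> nth false C j ->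
  (c, a, b) \in gl_of R F -> ev (rf i) b < ev (rf i) a -> ev (rf j) b <= ev (rf j) a.
Proof.
move=> F35 sC nc Ci Cj /gl_ofP[r rin [_ -> ->]]; have r35 := allP F35 _ rin.
move=> lt; have := noconf_compat sC nc Ci Cj rin (o := false); rewrite !(sbit_ev R) // lt => /(_ isT) /= h.
by rewrite leNgt h.
Qed.

Lemma MM_noconf M : M \in MM -> noconf (join M sigs).
Proof. by move=> Min; have := allP MM_ok _ Min; rewrite /mask_ok; case: ifP. Qed.

Lemma MM_compat M i j c a b : M \in MM -> nth false M i -> nth false M j ->
  (c, a, b) \in gl -> ev (rf i) a < ev (rf i) b -> ev (rf j) a <= ev (rf j) b.
Proof. by move=> Min; apply: compat_of rl35 (MM_size Min) (MM_noconf Min). Qed.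

Lemma MM_compat' M i j c a b : M \in MM -> nth false M i -> nth false M j ->
  (c, a, b) \in gl -> ev (rf i) b < ev (rf i) a -> ev (rf j) b <= ev (rf j) a.
Proof. by move=> Min; apply: compat_of' rl35 (MM_size Min) (MM_noconf Min). Qed.

(** One ray with the strict sign and a positive coefficient suffices, as the other rays have the
    same weak sign. *)
Lemma strict_comb M T k l r (o : bool) : M \in MM -> smask T M -> (forall i, 0 < k i) -> (l < m)%N -> nth false T l ->
  r \in rl ->
  let a := if o then fv R r.1.2 else fv R r.2 in let b := if o then fv R r.2 else fv R r.1.2 in
  ev (rf l) a < ev (rf l) b -> ev (comb m rf T k) a < ev (comb m rf T k) b.
Proof.
move=> Min TM k0 lm Tl rin a b lt; rewrite !ev_comb -subr_gt0 -sumrB (bigD1 (Ordinal lm)) //=.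
rewrite -mulrBr ltr_wpDr //; last by rewrite mulr_gt0 // subr_gt0.
apply: sumr_ge0 => i /andP[Ti _]; rewrite -mulrBr mulr_ge0 ?(ltW (k0 _)) // subr_ge0.
have gin : (fv R r.1.1, fv R r.1.2, fv R r.2) \in gl by apply: map_f rin.
move: lt; rewrite /a /b; case: (o); [exact: (MM_compat Min (TM _ Tl) (TM _ Ti) gin) | exact: (MM_compat' Min (TM _ Tl) (TM _ Ti) gin)].
Qed.

Lemma norm_facts : [/\ all (fun t => t < 35)%N norm, size norm = 7%N &
  (\matrix_(i < 7, k < 7) zr R (inc01 norm i k)) \in unitmx].
Proof.
split; [|exact: eqP norm7 | exact: unit_checkP norm_chk].
apply/allP => t tin; have fin : ([:: t], [::]) \in pfs.
  by apply: (@take_mem _ 7); rewrite (eqP pf_norm); apply: (map_f (fun t => ([:: t], [::]))).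
by have := allP pf35 _ fin; rewrite /= andbT.
Qed.

Lemma coord_rf_norm i t : t \in norm -> coord (rf i) t = 0.
Proof.
have [n35 _ _] := norm_facts => tin; rewrite coord_ray ?(allP n35) //.
have [im|im] := ltnP i m; last by rewrite (nth_default [::] im) nth_nil zr0.
by have /andP[_ /allP/(_ _ tin)] := allP vs_ok _ (mem_nth [::] im); rewrite -(zr_eq R) zr0 => /eqP.
Qed.

Lemma rho_par i k : (i < m)%N -> (k < 6)%N ->
  par (coord (rf i)) (nth ([::], [::]) (drop 7 pfs) k) = zr R (nth Z0 (nth [::] rhos i) k).
Proof.
move=> im k6; have sz : size (drop 7 pfs) = 6%N by rewrite size_drop (eqP pf13).
rewrite par_ray; last by apply: (allP pf35); apply: (@drop_mem _ 7); rewrite mem_nth ?sz.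
by rewrite (nth_map [::]) // (nth_map ([::], [::])) ?sz.
Qed.

Lemma lcomb_par C k (k6 : 'I_6) : (lcomb m Rho C k) 0 k6 =
  \sum_(i < m | nth false C i) k i * par (coord (rf i)) (nth ([::], [::]) (drop 7 pfs) k6).
Proof. by rewrite /lcomb summxE; apply: eq_bigr => i _; rewrite !mxE rho_par. Qed.

Lemma comb_par M k f : par (coord (comb m rf M k)) f = \sum_(i < m | nth false M i) k i * par (coord (rf i)) f.
Proof. by apply: (par_sum (Y := fun i : 'I_m => coord (rf i))) => t _; rewrite coord_comb. Qed.

Lemma gsP g i : g \in gs -> nth false g.2 i -> [/\ (J < 35)%N, i = e & g = (Zb, bmask m [:: e])].
Proof.
rewrite inE => /predU1P[->|] /=; first by rewrite nth_nseq; case: ifP.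
by case: ifP => // J35; rewrite inE => /eqP-> /=; rewrite nth_bmask inE => /andP[_ /eqP].
Qed.

Lemma e_facts : (J < 35)%N -> [/\ (e < m)%N, forall t, (t < 35)%N -> coord (rf e) t = (t == J)%:R
  & forall k, (k < 6)%N -> zr R (nth Z0 (nth [::] rhos e) k) = 0].
Proof.
move=> J35; have /and3P[m0 /allP h1 /allP h2] := implyP e_ok J35; split.
- by rewrite ltn_predL.
- move=> t t35; rewrite coord_ray //; have := h1 t; rewrite mem_iota t35 => /(_ isT).
  by rewrite -(zr_eq R) => /eqP->; case: eqP.
- by move=> k k6; have := h2 k; rewrite mem_iota k6 => /(_ isT); rewrite -(zr_eq R) zr0 => /eqP.
Qed.

Lemma J_facts C l : (J < 35)%N -> (C, l) \in L -> nth false C e = false /\ exists2 r, r \in jr &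
   forall i, (i < m)%N -> nth false C i -> nth false Zb i -> zval (nth [::] vs i) r.2 = zval (nth [::] vs i) r.1.1.
Proof.
move=> J35 Cl; have /andP[/negbTE h1 /hasP[r rin /allP h2]] := allP (implyP J_ok J35) _ Cl.
split=> //; exists r => // i im Ci Zi; have := h2 i; rewrite mem_iota im /= in Ci *.
by rewrite Ci Zi => /(_ isT) /Z.eqb_eq.
Qed.

(** All rays vanish at the normalized coordinates, which forces u = 0. The six parameters then give
    independence inside the simplicial cone. The vertical ray has zero parameters, so its
    coefficient is read off at coordinate J at the end. *)
Lemma MM_free M k u : M \in MM -> comb m rf M k = u *m Lm -> forall i, nth false M i -> k i = 0.
Proof.
move=> Min E; have [g [C [gin CV EM]]] := MM_P Min; have [n35 n7 nu] := norm_facts.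
have u0 : u = 0.
  apply: (norm_inj n35 n7 nu) => t tin; rewrite -E coord_comb big1 // => i _.
  by rewrite coord_rf_norm // mulr0.
rewrite u0 mul0mx in E.
have [l Cl] := V_mem CV.
pose k' i := if nth false M i then k i else 0.
have lc : lcomb m Rho C k' = 0.
  apply/rowP => k6; rewrite lcomb_par mxE.
  have Ep : par (coord (comb m rf M k)) (nth ([::], [::]) (drop 7 pfs) k6) = 0.
    by rewrite E /par /coord; under eq_bigr do rewrite mxE; under [X in _ - X]eq_bigr do rewrite mxE;
       rewrite !big1_eq subrr.
  rewrite comb_par in Ep; rewrite -[RHS]Ep big_mkcond [RHS]big_mkcond /=; apply: eq_bigr => i _; rewrite /k'.
  case Mi : (nth false M i); last by rewrite mul0r; case: ifP.
  case Ci : (nth false C i) => //; move: Mi; rewrite EM nth_restr Ci /= => /(gsP gin)[J35 ie _].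
  by rewrite ie; have [em _ r0] := e_facts J35; rewrite rho_par // r0 ?mulr0.
have kC i : nth false M i -> nth false C i -> k i = 0.
  move=> Mi Ci; have im : (i < m)%N by rewrite act_lt // (MM_act Min).
  by have := V_lfree CV lc im Ci; rewrite /k' Mi.
move=> i Mi; case Ci : (nth false C i); first exact: kC.
have := Mi; rewrite EM nth_restr Ci /= => /(gsP gin)[J35 ie _]; have [em ce _] := e_facts J35.
have := congr1 (fun x => coord x J) E; rewrite coord_comb /coord [RHS]mxE (bigD1 (Ordinal em)) /=; last by rewrite -ie.
rewrite -/(coord (rf e) J) ce // eqxx mulr1 big1 ?addr0 -?ie // => j /andP[Mj je].
rewrite kC ?mul0r //; move: Mj; rewrite EM nth_restr => /orP[/andP[]//|/(gsP gin)[_ je' _]].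
by rewrite -val_eqE /= je' eqxx in je.
Qed.

Lemma val2_comb M k p : val2 (coord (comb m rf M k)) p = \sum_(i < m | nth false M i) k i * val2 (coord (rf i)) p.
Proof. by rewrite -ev_fv ev_comb; apply: eq_bigr => i _; rewrite ev_fv. Qed.

Lemma comb_restrict (M C : seq bool) (k : nat -> R) : (forall i, nth false M i -> nth false C i) ->
  (forall i, (i < m)%N -> nth false C i -> nth false M i = false -> k i = 0) -> comb m rf C k = comb m rf M k.
Proof.
move=> MC H; rewrite /comb big_mkcond [RHS]big_mkcond /=; apply: eq_bigr => i _.
case Mi : (nth false M i); first by rewrite MC.
by case Ci : (nth false C i) => //; rewrite (H i) ?scale0r.
Qed.

Lemma jr_dr (z : nat -> R) r : dr rl z -> r \in jr ->
  val2 z r.1.1 = Num.min (val2 z r.1.2) (val2 z r.2).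
Proof.
move=> dz rin; have /and5P[h _ _ _ _] := allP jr_ok _ rin.
by case/orP: h => /dz -> //; rewrite minC.
Qed.

Lemma sum0_terms (M : seq bool) (k d : nat -> R) i : (forall j, 0 <= k j) -> (forall j, (j < m)%N -> nth false M j -> 0 <= d j) ->
  \sum_(j < m | nth false M j) k j * d j <= 0 -> (i < m)%N -> nth false M i -> d i != 0 -> k i = 0.
Proof.
move=> k0 d0 le im Mi di.
have nn (j : 'I_m) : nth false M j -> 0 <= k j * d j by move=> Mj; rewrite mulr_ge0 ?d0.
have s0' : \sum_(j < m | nth false M j) k j * d j = 0 by apply/eqP; rewrite eq_le le sumr_ge0.
by have /eqP := psumr_eq0P nn s0' (i := Ordinal im) Mi; rewrite mulf_eq0 (negPf di) orbF => /eqP.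
Qed.

Lemma used35 : all rel35 used.
Proof. by apply/allP => r rin; apply: (allP rl35); apply: (allP used_sub). Qed.

(** The simplicial cone that contains the parameters of x gives a lift X that agrees with the
    normalized x except perhaps at J. If they differ there, all bounding relations have c = a at x,
    and x lies above X in the direction of the vertical ray. *)
Lemma MM_cover x : DR gl x -> exists M k u,
  [/\ M \in MM, forall i, 0 <= k i & x = comb m rf M k + u *m Lm].
Proof.
move=> dx; have [n35 n7 nu] := norm_facts; have [u Hu] := norm_exists n35 n7 nu x.
set x0 := x - u *m Lm in Hu.
have xE : x = x0 + u *m Lm by rewrite subrK.
have dx0 : dr rl (coord x0).
  apply/DR_dr; have [] := Kc_lin HLrl (- u) (Kc_self dx); by rewrite mulNmx.
pose y : 'rV[R]_6 := \row_(k < 6) par (coord x0) (nth ([::], [::]) (drop 7 pfs) k).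
have [C0V _ _] := bfs_facts.
have [C [c [CV cpos Ey]]] := descent V_size V_wall C0V V_ind
  (start_free s0_uniq s0_lt (eqP s0_size) (unit_checkP R s0_chk))
  (start_span s0_uniq s0_lt (eqP s0_size) (unit_checkP R s0_chk) y).
have [l Cl] := V_mem CV; have sC := V_size CV.
pose k i := if (i < m)%N && nth false C i then c i else 0.
have k0 i : 0 <= k i by rewrite /k; case: ifP => // /andP[h1 h2]; apply: cpos.
have kE (i : 'I_m) : nth false C i -> k i = c i by move=> Ci; rewrite /k ltn_ord Ci.
have Clt i : nth false C i -> (i < m)%N by rewrite -sC ltnNge; apply: contraL => h; rewrite nth_default.
pose X := comb m rf C k.
have ncC := allP L_ok _ Cl.
have F35 : all rel35 (used ++ dforms jr).
  rewrite all_cat used35 /= /dforms all_map; apply/allP => r rin /=.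
  by have /and3P[h1 h2 _] := allP jr35 _ rin; rewrite /rel35 /= h1 h2.
(* The cone may contain rays outside the Dressian, so at first only the relations of the chart are
   linear on it. *)
have dX : dr used (coord X).
  apply/DR_dr; apply: (@comb_DR _ _ _ _ _ (fun i => (i < m)%N) [:: C]) k0.
  - by move=> M i; rewrite inE => /eqP->; apply: Clt.
  - move=> i im; apply/DR_dr; apply: zdr_dr used35 _.
    by have /andP[] := allP vs_ok _ (mem_nth [::] im).
  - move=> M i j c' a b; rewrite inE => /eqP-> Ci Cj rin.
    have rin' : (c', a, b) \in gl_of R (used ++ dforms jr).
      by move: rin => /mapP[r rin ->]; apply: map_f; rewrite mem_cat rin.
    exact: (compat_of F35 sC ncC Ci Cj rin').
  - by rewrite mem_head.
have EU t : t \in kn -> coord x0 t = coord X t.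
  move: t; apply: (chart_unique run nd _ dX) => //.
    by move=> c' a b rin; apply: dx0; apply: (allP used_sub).
  move=> f; rewrite -{1}(cat_take_drop 7 pfs) mem_cat => /orP[].
    rewrite (eqP pf_norm) => /mapP[t tin ->]; rewrite /par /= !big_seq1 !big_nil !subr0 Hu //.
    by rewrite coord_comb big1 // => i _; rewrite coord_rf_norm // mulr0.
  move=> fin; have f6 : (index f (drop 7 pfs) < 6)%N by rewrite -index_mem size_drop (eqP pf13) in fin.
  have := congr1 (fun w : 'rV[R]_6 => w 0 (Ordinal f6)) Ey; rewrite mxE lcomb_par /= nth_index // => ->.
  by rewrite comb_par; apply: eq_bigr => i Ci; rewrite kE.
have agree t : (t < 35)%N -> t != J -> coord x0 t = coord X t.
  move=> t35 tJ; apply: EU; have := allP kn_all t; rewrite mem_iota t35 => /(_ isT).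
  by rewrite (negPf tJ).
have agree2 p : lt35 p -> ~~ inp J p -> val2 (coord x0) p = val2 (coord X) p.
  by move=> /andP[h1 h2]; rewrite /inp negb_or => /andP[j1 j2]; rewrite /val2 !agree // eq_sym.
have jrP r : r \in jr -> [/\ lt35 r.1.1, lt35 r.1.2, lt35 r.2,
    val2 (coord x0) r.1.1 = val2 (coord X) r.1.1 & val2 (coord x0) r.1.2 = val2 (coord X) r.1.2].
  move=> rin; have /and3P[h1 h2 h3] := allP jr35 _ rin; have /and5P[_ _ _ j1 j2] := allP jr_ok _ rin.
  by split=> //; apply: agree2.
have x0le r : r \in jr -> val2 (coord x0) r.1.1 <= val2 (coord x0) r.1.2.
  by move=> rin; rewrite (jr_dr dx0 rin) ge_min lexx.
have zv i p : lt35 p -> val2 (coord (rf i)) p = zr R (zval (nth [::] vs i) p) by move=> h; rewrite val2_ray.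
(* For a suitable bound, c - a is nonnegative on the cone and positive at ray i, yet at most zero at
   x; hence the coefficient of i vanishes. *)
have kinf i : (i < m)%N -> nth false C i -> act i = false -> k i = 0.
  move=> im Ci; rewrite (nth_map [::]) // => nact.
  have := allP inf_ok _ (mem_nth [::] im); rewrite nact /= => /hasP[r rin lt].
  have [h1 h2 h3 e1 e2] := jrP r rin.
  have fin : (r.1.1, r.1.2, r.1.1) \in used ++ dforms jr.
    by rewrite mem_cat (map_f (fun r : trel => (r.1.1, r.1.2, r.1.1)) rin) orbT.
  apply: (sum0_terms (M := C) (d := fun j => val2 (coord (rf j)) r.1.1 - val2 (coord (rf j)) r.1.2)) => //.
  - move=> j jm Cj; rewrite subr_ge0 -!ev_fv; apply: (compat_of F35 sC ncC Ci Cj (mem_gl_of R fin)).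
    by rewrite !ev_fv !zv // zr_lt.
  - under eq_bigr do rewrite mulrBr.
    by rewrite sumrB -!val2_comb -e1 -e2 subr_le0; apply: x0le.
  - by rewrite subr_eq0 eq_sym !zv // zr_eq; apply: contraTN lt => /Z.eqb_eq->; rewrite Z.ltb_irrefl.
pose g1 := (actb, nseq m false); have g1in : g1 \in gs by rewrite mem_head.
have M1in := MM_mem g1in CV; set M1 := restr g1 C in M1in.
have M1E i : nth false M1 i = nth false C i && act i by rewrite nth_restr /= nth_nseq; case: ifP; rewrite orbF.
have X1 : X = comb m rf M1 k.
  apply: comb_restrict => [i|i im Ci]; first by rewrite M1E => /andP[].
  by rewrite M1E Ci /=; apply: kinf.
have dX' : dr rl (coord X).
  by apply/DR_dr; rewrite X1; apply: (comb_DR m MM_act act_DR MM_compat M1in k0).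
have [same|nsame] := pselect (forall t, (t < 35)%N -> coord x0 t = coord X t).
  by exists M1, k, u; split=> //; rewrite -X1 -(coord_ext same).
have [J35 neJ] : (J < 35)%N /\ coord x0 J != coord X J.
  move/existsNP: nsame => [t /not_implyP[t35 ne]].
  have tJ : t = J by apply/eqP; apply: contraT => tJ; case: ne; apply: agree.
  by rewrite -tJ; split=> //; apply/eqP.
have bE (z : nat -> R) r : r \in jr -> val2 z r.2 = z J + z (other r.2 J).
  by move=> rin; have /and5P[_ h _ _ _] := allP jr_ok _ rin; rewrite (val2_other _ h).
have oE r : r \in jr -> coord x0 (other r.2 J) = coord X (other r.2 J).
  move=> rin; have /and5P[_ _ oJ _ _] := allP jr_ok _ rin; have [_ _ /andP[b1 b2] _ _] := jrP r rin.
  by apply: agree => //; rewrite /other; case: ifP.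
(* With c < a the summand b would equal c both at x0 and at X, which determines coordinate J and
   contradicts the difference there. *)
have x0eq r : r \in jr -> val2 (coord x0) r.1.1 = val2 (coord x0) r.1.2.
  move=> rin; apply/eqP; rewrite eq_le x0le //= leNgt; apply/negP => lt.
  have [_ _ _ e1 e2] := jrP r rin.
  have h1 := jr_dr dx0 rin; have h2 := jr_dr dX' rin; rewrite -e1 -e2 in h2.
  have b1 : val2 (coord x0) r.2 = val2 (coord x0) r.1.1.
    by move: h1; case: leP => // h h'; rewrite h' ltxx in lt.
  have b2 : val2 (coord X) r.2 = val2 (coord x0) r.1.1.
    by move: h2; case: leP => // h h'; rewrite h' ltxx in lt.
  move: b1; rewrite -b2 !bE // oE // => /addIr /eqP; by rewrite (negPf neJ).
(* The difference a - c is nonnegative at active rays and zero at X, so rays where it is positive do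
   not contribute. *)
have kZ i : (i < m)%N -> nth false M1 i -> nth false Zb i = false -> k i = 0.
  move=> im M1i; have ai : act i by rewrite M1E in M1i; case/andP: M1i.
  rewrite (nth_map [::]) // act_zdr //= => /allPn[r rin ne]; have [h1 h2 h3 e1 e2] := jrP r rin.
  apply: (sum0_terms (M := M1) (d := fun j => val2 (coord (rf j)) r.1.2 - val2 (coord (rf j)) r.1.1)) => //.
  - move=> j jm M1j; rewrite subr_ge0; have /act_DR/DR_dr dj := MM_act M1in M1j.
    by rewrite (jr_dr dj rin) ge_min lexx.
  - under eq_bigr do rewrite mulrBr.
    by rewrite sumrB -!val2_comb -X1 -e1 -e2 x0eq // subrr.
  - by rewrite subr_eq0 !zv // zr_eq.
pose g2 := (Zb, bmask m [:: e]); have g2in : g2 \in gs by rewrite /gs_of J35 !inE eqxx orbT.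
have M2in := MM_mem g2in CV; set M2 := restr g2 C in M2in.
have [em ce _] := e_facts J35; have [Ce [r rin rE]] := J_facts J35 Cl.
have ZbA i : nth false Zb i -> act i.
  move=> Zi; have im : (i < m)%N by rewrite ltnNge; apply: contraL Zi => h; rewrite nth_default // size_map.
  by move: Zi; rewrite !(nth_map [::]) // => /andP[].
have X2 : X = comb m rf (band C Zb) k.
  rewrite X1; apply: comb_restrict => [i|i im M1i].
    by rewrite nth_band M1E => /andP[-> /ZbA->].
  by rewrite nth_band => h; apply: kZ => //; move: M1i h; rewrite M1E => /andP[-> _].
(* The bound attained at all remaining rays is attained at X, while at x0 it still holds as an
   inequality. *)
have leJ : coord X J <= coord x0 J.
  have [h1 h2 h3 e1 e2] := jrP r rin.
  have E2 : val2 (coord X) r.2 = val2 (coord X) r.1.1.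
    rewrite X2 !val2_comb; apply: eq_bigr => i; rewrite nth_band => /andP[Ci Zi]; congr (_ * _).
    by rewrite !zv // rE.
  have : val2 (coord X) r.2 <= val2 (coord x0) r.2 by rewrite E2 -e1 (jr_dr dx0 rin) ge_min lexx orbT.
  by rewrite !bE // oE // lerD2r.
pose dl := coord x0 J - coord X J.
pose k2 i := if i == e then dl else k i.
have k2e : k2 e = dl by rewrite /k2 eqxx.
exists M2, k2, u; split=> //; first by move=> i; rewrite /k2; case: ifP => // _; rewrite subr_ge0.
rewrite {1}xE; congr (_ + _).
have M2E i : nth false M2 i = nth false (band C Zb) i || (i == e) && (i < m)%N.
  by rewrite nth_restr nth_band /= nth_bmask inE; congr (_ || _); apply: andbC.
have -> : comb m rf M2 k2 = dl *: rf e + comb m rf (band C Zb) k.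
  rewrite /comb (bigD1 (Ordinal em)) /=; last by rewrite M2E eqxx em orbT.
  rewrite k2e; congr (_ + _); apply: eq_big => i.
    rewrite M2E -val_eqE /=; have [->|ne] := eqVneq (i : nat) e; last by rewrite orbF andbT.
    by rewrite nth_band Ce andbF.
  by rewrite -val_eqE /= /k2 => /andP[_ /negPf->].
rewrite -X2.
apply: coord_ext => t t35; rewrite (coordD (dl *: ray R (nth [::] vs e)) X) coordZ ce // /dl; have [->|ne] := eqVneq t J.
  by rewrite mulr1 subrK.
by rewrite mulr0 add0r agree.
Qed.

(** * The computed list of cells *)

Definition cell_map := cells_of m sigs actb gs L (PositiveMap.empty unit) (PositiveMap.empty nat).
Definition cell_list : seq (seq bool * nat) := [seq (dec x.1, x.2) | x <- PositiveMap.elements cell_map].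

Lemma bary_strict M T r (o : bool) : M \in MM -> smask T M -> r \in rl ->
  let a := if o then fv R r.1.2 else fv R r.2 in let b := if o then fv R r.2 else fv R r.1.2 in
  ev (bary m rf T) a < ev (bary m rf T) b <-> exists2 l, nth false T l & sbit o (nth [::] vs l) r.
Proof.
move=> Min TM rin a b; have r35 := allP rl35 _ rin.
have sE l : sbit o (nth [::] vs l) r = (ev (rf l) a < ev (rf l) b) by rewrite (sbit_ev R) // /a /b; case: (o).
split=> [lt|[l Tl]]; last first.
  rewrite sE => lt; have lm : (l < m)%N by apply: act_lt; apply: (MM_act Min); apply: TM.
  by apply: (strict_comb (o := o) Min TM _ lm Tl rin lt).
apply: contrapT => H; move: lt; rewrite ltNge => /negP; apply; rewrite /bary !ev_comb.
apply: ler_sum => i Ti; rewrite !mul1r leNgt; apply/negP => h; apply: H; exists i => //; by rewrite sE.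
Qed.

(** Connects bits with geometry: an active ray lies in the cell of T exactly when each of its strict
    signs occurs at some ray of T. *)
Lemma cls_clo M T : M \in MM -> smask T M -> size T = m -> cls m sigs actb T = clo gl m rf act T.
Proof.
move=> Min TM sT; rewrite /cls /clo; apply: (@eq_from_nth _ false); rewrite ?size_mkseq // => i im.
rewrite !nth_mkseq //; congr (_ && _); apply/bsubP/asboolP => H.
  have key r (o : bool) : r \in rl -> let a := if o then fv R r.1.2 else fv R r.2 in
      let b := if o then fv R r.2 else fv R r.1.2 in
      ev (rf i) a < ev (rf i) b -> ev (bary m rf T) a < ev (bary m rf T) b.
    move=> rin a b lt; apply/(bary_strict o Min TM rin).
    have r35 := allP rl35 _ rin; have kF : (index r rl < size rl)%N by rewrite index_mem.
    rewrite -(nth_index rel0 rin); apply/(join_sigma o sT kF); apply: H.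
    rewrite (nth_map [::]) // nth_sigma halfD odd_double andbF doubleK oddD odd_double addbF oddb.
    have -> : (o./2 = 0)%N by case: (o).
    by rewrite !add0n kF nth_index // (sbit_ev R) //; move: lt; rewrite /a /b; case: (o).
  move=> c a b /gl_ofP[r rin [_ -> ->]]; split=> le; rewrite leNgt; apply/negP.
    by move=> /(key r false rin) /=; rewrite ltNge le.
  by move=> /(key r true rin) /=; rewrite ltNge le.
move=> b; rewrite (nth_map [::]) // nth_sigma => /andP[kF sb].
have rin : nth rel0 rl b./2 \in rl by rewrite mem_nth.
have r35 := allP rl35 _ rin.
have -> : b = (odd b + b./2.*2)%N by rewrite odd_double_half.
apply/(join_sigma (odd b) sT kF); apply/(bary_strict (odd b) Min TM rin).
have gin : (fv R (nth rel0 rl b./2).1.1, fv R (nth rel0 rl b./2).1.2, fv R (nth rel0 rl b./2).2) \in gl by apply: map_f rin.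
have [H1 H2] := H _ _ _ gin; move: sb; rewrite (sbit_ev R) //.
by case: (odd b) => /= lt; rewrite ltNge; apply/negP => /[dup] ?; [move/H2 | move/H1]; rewrite leNgt lt.
Qed.

Lemma cells_facts : sound_cell m sigs actb (fun M => M \in MM) cell_map /\
  forall M T, M \in MM -> smask T M -> size T = m -> has_cell m sigs actb cell_map T.
Proof.
have [_ Hn _] := bfs_facts.
have ss : size sigs = m by rewrite size_map.
have sa : size actb = m by rewrite size_map.
have [|||h1 [_ h3]] := @cells_of_spec m sigs actb ss sa gs (fun M => M \in MM) L (PositiveMap.empty unit) (PositiveMap.empty nat).
- move=> C l Cl i D iD k; have [En _] := Hn _ _ Cl; have [_ H2] := nbrs_spec En.
  have [k' [_ _ _ /nbrP[j [g [cm [_ _ _ _ ->]]]]]] := H2 _ _ iD.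
  by rewrite [in X in _ -> X]nth_setb; case: ifP.
- move=> C l g Cl gin; have CV : C \in V := map_f fst Cl.
  by split; [exact: restr_size | exact: restr_act | exact: MM_mem].
- by move=> C; rewrite PositiveMap.gempty.
split; first by apply: h1 => k d; rewrite PositiveMap.gempty.
move=> M T /MM_P[g [C [gin CV ->]]] TM sT; have [l Cl] := V_mem CV.
exact: (h3 C l g).
Qed.

Lemma ce_uniq : uniq [seq x.1 | x <- cell_list].
Proof. by rewrite -map_comp; apply: nodup_uniq; apply: PositiveMap.elements_3w. Qed.

Lemma ce_sound S d : (S, d) \in cell_list -> exists M T,
  [/\ M \in MM, smask T M, size T = m, S = clo gl m rf act T & count id T = d].
Proof.
move=> h0; have h1 : List.In (enc S, d) (PositiveMap.elements cell_map) by apply/mem_elements.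
have h := PositiveMap.elements_complete _ _ _ h1.
have [snd_ _] := cells_facts.
have [M [T [t1 t2 t3 /enc_inj t4 t5]]] := snd_ _ _ h; exists M, T; split=> //.
by rewrite t4; apply: cls_clo t2 t3.
Qed.

Lemma ce_complete M T : M \in MM -> smask T M -> size T = m ->
  exists2 d, (clo gl m rf act T, d) \in cell_list & (count id T <= d)%N.
Proof.
move=> Min TM sT; have [_ cpl] := cells_facts; have [d h1 h2] := cpl _ _ Min TM sT.
exists d => //; apply/mem_elements; apply: PositiveMap.elements_correct.
by rewrite -(cls_clo Min TM sT).
Qed.

Lemma MM_le6 M : M \in MM -> (count id M <= 6)%N.
Proof.
move=> Min; have := allP MM_ok _ Min; rewrite /mask_ok; case: ifP => // _.
by case: eqP => [->//|_]; case: ifP => // /ltnW.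
Qed.

Lemma MM_full M : M \in MM -> exists2 M', M' \in MM & smask M M' /\ count id M' = 6%N.
Proof.
move=> Min; have := allP MM_ok _ Min; rewrite /mask_ok; case: ifP => // _.
case: eqP => [h _|_]; first by exists M => //; split.
case: ifP => // _; rewrite -has_find => /hasP[M']; rewrite mem_filter => /andP[/eqP h M'in] /bsubP s.
by exists M' => //; split.
Qed.

Lemma cert_pure : pure_dim (fan Lm gl) 6.
Proof.
exact: (fan_pure HLrl MM_size MM_act act_DR MM_compat MM_free MM_cover ce_uniq ce_sound ce_complete MM_le6 MM_full).
Qed.

Lemma cert_count d : num_cones (fan Lm gl) d (count (fun x => x.2 == d) cell_list).
Proof.
exact: (fan_count HLrl MM_size MM_act act_DR MM_compat MM_free MM_cover ce_uniq ce_sound ce_complete).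
Qed.

(** * Realizability and the tropical Grassmannian *)

Local Notation chi := (signvec_of_negatives neg : signvec 3 7).

Lemma chi_nth t : (t < 35)%N -> nth false (signs neg) t = chi (tk t).
Proof. by move=> h; rewrite -chs_signs (nth_map 0%N) ?size_iota // nth_iota. Qed.

(* Points in the relative interior of a full-dimensional cone are realized; the others
   are limits of such points along the barycentre of the cone. *)
Lemma full_realized M k u : M \in MM -> count id M = 6%N -> (forall i, 0 < k i) ->
  exists B : R -> 'M[R]_(3, 7), forall t, (t < 35)%N ->
    Th (fun s => sminor (signs neg) (B s) t) (coord (comb m rf M k + u *m Lm) t).
Proof.
move=> Min c6 k0; have k0' i : 0 <= k i by apply: ltW.
have dz : DR gl (comb m rf M k) := comb_DR m MM_act act_DR MM_compat Min k0'.
have [dz' _] := Kc_lin HLrl u (Kc_self dz).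
have hf : has (fits rl (join M sigs)) charts.
  have := allP MM_ok _ Min; rewrite /mask_ok; case: ifP => // _.
  by case: eqP => [_|ne]; [rewrite -has_find | case: ne].
pose ch0 : chart := ([::], (0%N, 0%N, 0%N), [::]).
have fit := nth_find ch0 hf; rewrite has_find in hf.
set ch := nth ch0 charts _ in fit.
have chok : chart_ok rl ch by move/(all_nthP ch0): charts_ok => /(_ _ hf).
apply: (chart_realization mx _ chok); first by apply/DR_dr.
move=> i; case E : (nth _ _ i) => [|||r t] //.
have ii : (i < size ch.1.1)%N by rewrite ltnNge; apply/negP => h; rewrite nth_default in E.
rewrite /fits in fit; move/(all_nthP (Free 0)): fit => /(_ _ ii); rewrite E.
case Er : (nth rel0 rl r) => [[c a] b] /and3P[rs ha hb].
have rin : (c, a, b) \in rl by rewrite -Er mem_nth.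
have idM : smask M M by [].
have gin := mem_gl_of R rin; have [e1 e2] := ev_lin HLrl u gin.
have key (o : bool) : nth false (join M sigs) (o + r.*2)%N ->
    ev (comb m rf M k + u *m Lm) (if o then fv R a else fv R b) < ev (comb m rf M k + u *m Lm) (if o then fv R b else fv R a).
  move=> /(join_sigma o (MM_size Min) rs)[l Ml]; rewrite Er (sbit_ev R); last exact: (allP rl35).
  have lm : (l < m)%N by apply: act_lt; apply: (MM_act Min).
  move=> lt; rewrite !evD; have -> : ev (u *m Lm) (if o then fv R a else fv R b) = ev (u *m Lm) (if o then fv R b else fv R a).
    by case: (o); rewrite e2.
  rewrite ltrD2r; apply: (strict_comb (o := o) Min idM k0 lm Ml rin).
  by move: lt; case: (o).
rewrite /doms_ok Er; split=> h; rewrite -!ev_fv.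
  by apply: (key true); move: ha; rewrite h.
by apply: (key false); move: hb; rewrite h.
Qed.

(** Any interior point of a cone with six rays will do: for large s the realizing matrix has minors
    of the prescribed signs. *)
Lemma cert_realizable : realizable R chi.
Proof.
have [C0V _ _] := bfs_facts; have [|M Min [_ c6]] := @MM_full (restr (actb, nseq m false) C0).
  by apply: MM_mem => //; rewrite mem_head.
have [B HB] := @full_realized M (fun=> 1) 0 Min c6 (fun=> ltr01).
exact: (@realizable_Th R (signvec_of_negatives neg) (signs neg) chi_nth _ B HB).
Qed.

Lemma DR_Dressian (x : 'rV[R]_N) : chi_Dressian R chi x <-> DR gl x.
Proof. by rewrite chi_DressianP // DR_dr. Qed.

Lemma cert_trop : chi_Dressian R chi = chi_TropGr R chi.
Proof.
apply/seteqP; split=> x; last by move=> H f /three_term_ideal; apply: H.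
move=> /DR_Dressian /MM_cover[M [k [u [Min k0 ->]]]] f fI.
have [M' Min' [MM' c6]] := MM_full Min.
(* The coefficients are extended by zero to a mask with six rays; adding ep times its barycentre
   then makes all of them positive. *)
pose k' i := if nth false M i then k i else 0.
have k0' i : 0 <= k' i by rewrite /k'; case: ifP.
have -> : comb m rf M k = comb m rf M' k'.
  have -> : comb m rf M k = comb m rf M k' by apply: eq_bigr => i Mi; rewrite /k' Mi.
  by apply/esym; apply: comb_restrict => [//|i _ _ Mi]; rewrite /k' Mi.
apply: (@TropV_limit _ _ _ _ (bary m rf M')) => ep ep0.
have -> : comb m rf M' k' + u *m Lm + ep *: bary m rf M' = comb m rf M' (fun i => k' i + ep) + u *m Lm.
  rewrite addrAC; congr (_ + _); rewrite /bary /comb scaler_sumr -big_split /=; apply: eq_bigr => i _.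
  by rewrite scale1r scalerDl.
have kp i : 0 < k' i + ep by rewrite ltr_wpDl.
have [B HB] := full_realized u Min' c6 kp.
exact: (@TropV_realized R (signvec_of_negatives neg) (signs neg) chi_nth _ B f fI HB).
Qed.

Lemma fan_Dressian : Dressian_fan R chi = fan Lm gl.
Proof.
have KE x : DR gl x -> Dressian_cone x = Kc gl x.
  move=> dx; apply/seteqP; split=> y.
    by move/(Dressian_coneP _ (proj1 (DR_dr _ _) dx)) => [h1 h2]; split; [apply/DR_dr | apply/FL_face].
  by move=> [h1 h2]; apply/(Dressian_coneP _ (proj1 (DR_dr _ _) dx)); split; [apply/DR_dr | apply/FL_face].
apply/seteqP; split=> C [x dx <-]; exists x.
- exact/DR_Dressian.
- by rewrite -KE //; apply/DR_Dressian.
- exact/DR_Dressian.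
- by rewrite KE.
Qed.

Lemma cert_conclusion (fvec : seq nat) :
  [seq count (fun x : seq bool * nat => x.2 == d) cell_list | d <- iota 1 6] == fvec ->
  [/\ realizable R chi,
      [/\ polyhedral_fan (Dressian_fan R chi),
          \bigcup_(C in Dressian_fan R chi) C = @mod_lineality R 3 7 @` chi_Dressian R chi
        & pure_dim (Dressian_fan R chi) 6],
      chi_Dressian R chi = chi_TropGr R chi
    & forall d : nat, (1 <= d <= 6)%N -> num_cones (Dressian_fan R chi) d (nth 0%N fvec d.-1)].
Proof.
move=> /eqP <-; rewrite fan_Dressian; split; [exact: cert_realizable | | exact: cert_trop |].
  split; [exact: (fan_polyhedral HLrl) | | exact: cert_pure].
  rewrite fan_support; congr (_ @` _); apply/seteqP; split=> x /DR_Dressian //.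
case=> [|d] // /andP[_ d6]; rewrite -[d.+1.-1]/d (nth_map 0%N) ?size_iota // nth_iota // add1n; exact: cert_count.
Qed.
End Body.
Local Close Scope ring_scope.
Local Close Scope classical_set_scope.
Local Transparent tix trips.

(** * The eleven chirotopes *)

Local Open Scope classical_set_scope.
Local Open Scope ring_scope.

Local Open Scope classical_set_scope.
Local Open Scope ring_scope.




Delimit Scope Z_scope with coqZ.

(** [c_rays] holds six parameters per ray. [c_ninv] and [c_sinv] are integer inverses up to the
    denominators [c_nden] and [c_sden], for the normalization and for the starting cone [c_start].
    [c_missing] is the coordinate J, or 35 if there is none, and [c_bounds] numbers the relations
    that bound it below. *)
Record cert := Cert {
  c_steps : seq step; c_ninv : seq (seq Z); c_nden : Z; c_rays : seq (seq Z);
  c_missing : nat; c_bounds : seq nat; c_phi : seq Z; c_circuits : seq string;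
  c_start : seq nat; c_sinv : seq (seq Z); c_sden : Z; c_charts : seq chart }.

Definition jrel (rl : seq trel) (J r : nat) : trel :=
  let: (c, a, b) := nth rel0 rl r in if inp J b then (c, a, b) else (c, b, a).

(** Gives J the largest of its lower bounds, each being c minus the partner of J. *)
Definition jfix (jr : seq trel) (J : nat) (v : seq Z) : seq Z :=
  if [seq Z.sub (zval v r.1.1) (nth Z0 v (other r.2 J)) | r <- jr] is b :: bs
  then set_nth Z0 v J (foldr Z.max b bs) else v.

(** The seven leading zeros are the normalized coordinates; the vertical ray, if any, comes last. *)
Definition vecs (rl jr : seq trel) (K : cert) : seq (seq Z) :=
  let J := c_missing K in
  [seq jfix jr J (lift_ray rl (c_steps K) (nseq 7 Z0 ++ p) (nseq 35 Z0)) | p <- c_rays K] ++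
  (if (J < 35)%N then [:: set_nth Z0 (nseq 35 Z0) J (Zpos xH)] else [::]).

(** When a coordinate is missing, an inactive ray has no meaningful value of J. Pairs containing
    such a ray are compared only on relations without J and on the sides of a = c. *)
Definition compat_table (rl jr : seq trel) (J : nat) (vs : seq (seq Z)) : seq (seq bool) :=
  let F := if (J < 35)%N then [seq r <- rl | J \notin tri_idx r] ++ dforms jr else [::] in
  let f := zip (zip (actb_of rl vs) [seq sigma F v | v <- vs]) [seq sigma rl v | v <- vs] in
  [seq [seq bcompat x.1.2 y.1.2 && (x.1.1 && y.1.1 ==> bcompat x.2 y.2) | y <- f] | x <- f].

Definition mat (M : seq (seq Z)) (i j : nat) : Z := nth Z0 (nth [::] M i) j.

(** A single boolean, so that one evaluation suffices and the tables bound by [let] are computed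
    once. *)
Definition cert_ok (neg : seq (seq nat)) (fvec : seq nat) (K : cert) : bool :=
  let rl := rels (signs neg) in
  let st := c_steps K in let J := c_missing K in
  let jr := [seq jrel rl J r | r <- c_bounds K] in
  let vs := vecs rl jr K in let m := size vs in
  let pfs := pforms rl st in
  let cs := parse_circuits (c_circuits K) in let s0 := c_start K in
  let compat := compat_table rl jr J vs in
  let C0 := bmask m s0 in
  let rhos := rhos_of pfs vs in let norm := norm_of pfs in
  let actb := actb_of rl vs in let Zb := Zb_of rl jr vs in let e := m.-1 in
  let gs := gs_of rl jr vs J in let sigs := [seq sigma rl v | v <- vs] in
  if run_chart rl st [::] [::] is Some (kn, used) then
  (* The fuel suffices for the complete fan of every certificate; if it ran out the test would
     fail. *)
  if bfs 2000 (table m compat cs) [:: C0] (PositiveMap.add (enc C0) tt (PositiveMap.empty unit)) [::]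
    is Some L then
  let MM := MM_of gs L in
  [&& all (fun q => mixed (signs neg) (products q)) quads,
      all rel35 rl, all rel35 jr, all (fun r => r \in rl) used, all hom rl, all nodom st,
      all (fun t => (t == J) || (t \in kn)) (iota 0 35),
      take 7 pfs == [seq ([:: t], [::]) | t <- norm], size norm == 7%N,
      all (fun f => all (fun t => t < 35)%N (f.1 ++ f.2)) pfs, size pfs == 13%N,
      unit_check 7 (inc01 norm) (mat (c_ninv K)) (c_nden K),
      all (fun v => all (zdr1 v) used && all (fun t => Z.eqb (nth Z0 v t) Z0) norm) vs,
      all (circ_ok rhos (c_phi K) m) cs,
      uniq s0, all (fun l => l < m)%N s0, size s0 == 6%N,
      unit_check 6 (fun k j => nth Z0 (nth [::] rhos (nth 0%N s0 k)) j) (mat (c_sinv K)) (c_sden K),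
      all (fun v => all (zdr1 v) rl ||
        has (fun r : trel => Z.ltb (zval v r.1.2) (zval v r.1.1)) jr) vs,
      all (fun x => noconf (join x.1 [seq sigma (used ++ dforms jr) v | v <- vs])) L,
      (J < 35)%N ==> all (fun x => ~~ nth false x.1 e && has (fun r : trel =>
        all (fun i => nth false x.1 i && nth false Zb i ==>
          Z.eqb (zval (nth [::] vs i) r.2) (zval (nth [::] vs i) r.1.1)) (iota 0 m)) jr) L,
      (J < 35)%N ==> [&& (0 < m)%N,
        all (fun t => Z.eqb (nth Z0 (nth [::] vs e) t) (if t == J then Zpos xH else Z0)) (iota 0 35)
        & all (fun k => Z.eqb (nth Z0 (nth [::] rhos e) k) Z0) (iota 0 6)],
      all (fun r : trel => [&& ((r.1.1, r.1.2, r.2) \in rl) || ((r.1.1, r.2, r.1.2) \in rl),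
        inp J r.2, other r.2 J != J, ~~ inp J r.1.1 & ~~ inp J r.1.2]) jr,
      all (fun g => bsub g.1 actb && bsub g.2 actb) gs,
      (let M6 := [seq M <- MM | count id M == 6%N] in all (mask_ok rl sigs (c_charts K) M6) MM),
      all (chart_ok rl) (c_charts K)
    & let ce := [seq x.2 | x <- PositiveMap.elements
          (cells_of m sigs actb gs L (PositiveMap.empty unit) (PositiveMap.empty nat))] in
      [seq count (pred1 d) ce | d <- iota 1 6] == fvec]
  else false else false.

Lemma cert_okP (R : realType) neg fvec K : cert_ok neg fvec K ->
  let chi : signvec 3 7 := signvec_of_negatives neg in
  let Sigma := Dressian_fan R chi in
  [/\ realizable R chi,
      [/\ polyhedral_fan Sigma,
          \bigcup_(C in Sigma) C = @mod_lineality R 3 7 @` chi_Dressian R chi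
        & pure_dim Sigma 6],
      chi_Dressian R chi = chi_TropGr R chi
    & forall d : nat, (1 <= d <= 6)%N -> num_cones Sigma d (nth 0%N fvec d.-1)].
Proof.
rewrite /cert_ok; case E1 : (run_chart _ _ _ _) => [[kn used]|] //; case E2 : (bfs _ _ _ _ _) => [L|] //.
move=> /andP[h1 /andP[h2 /andP[h3 /andP[h4 /andP[h5 /andP[h6 /andP[h7 /andP[h8 /andP[h9]]]]]]]]].
move=> /andP[h10 /andP[h11 /andP[h12 /andP[h13 /andP[h14 /andP[h15 /andP[h16 /andP[h17 /andP[h18]]]]]]]]].
move=> /andP[h19 /andP[h20 /andP[h21 /andP[h22 /andP[h23 /andP[h24 /andP[h25 /andP[h26 h27]]]]]]]].
apply: (cert_conclusion R h1 h2 h3 h4 h5 E1 h6 h7 h8 h9 h10 h11 h12 h13 h14 h15 h16 h17 h18 h19 E2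
  h20 h21 h22 h23 h24 h25 h26).
rewrite -(eqP h27); apply/eqP; apply: eq_map => d.
by rewrite /cell_list /cell_map !count_map; apply: eq_count.
Qed.

Local Open Scope nat_scope.
(** Coordinates are numbered from 0 by their positions in [trips], and relations by their positions
    in [rels]. *)
Definition cert1 : cert := Cert
  [:: Free 0; Free 2; Free 4; Free 9; Free 15; Free 16; Free 22; Free 19; Free 25; Free 28; Free 29;
  Free 32; Free 33; Solve 15 1; Solve 45 5; Solve 60 6; Solve 61 12; Solve 66 31; Solve 67 13; Solve
  68 34; Solve 71 23; Solve 4 8; Solve 7 11; Solve 19 18; Solve 22 21; Solve 37 27; Solve 54 10;
  Solve 58 20; Solve 59 26; Solve 81 7; Solve 84 14; Solve 85 17; Solve 88 24; Solve 98 30; Solve 5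
  3]
  [:: [:: 2; -1; 2; -1; -1; 2; -1]; [:: 0; 3; -3; 0; 0; -3; -3]; [:: 0; 0; 0; 0; 0; 0; 3]; [:: 1;
  -2; 1; 1; 1; 1; 1]; [:: -1; 2; -1; 2; -1; -1; -1]; [:: -1; -1; 2; -1; 2; -1; 2]; [:: 0; 0; 0; 0;
  0; 3; 0]]%coqZ
  3%coqZ
  [:: [:: -1; 1; 1; 2; 1; 0]; [:: -1; 0; 1; 1; 0; 0]; [:: -1; 1; 2; 2; 1; 1]; [:: 0; -1; -1; -2; -1;
  -2]; [:: 0; -1; -1; -1; -1; -2]; [:: 0; -1; -1; -1; 0; -1]; [:: 0; -1; -1; 0; -1; -2]; [:: 0; 0;
  -1; 0; 0; -1]; [:: 0; 0; 0; 0; 0; -1]; [:: 0; 0; 0; 0; 1; 0]; [:: 0; 0; 0; 1; 0; -1]; [:: 0; 1; 0;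
  1; 1; 0]; [:: 0; 0; 0; -1; -1; -1]; [:: 0; -1; -1; 0; 0; -1]; [:: 0; -1; -1; 0; 0; 0]; [:: 0; -1;
  -1; -1; -1; -1]; [:: 0; 0; 0; 1; 1; 0]; [:: 0; 0; 0; 0; 0; 1]; [:: 0; 0; 0; 1; 0; 0]; [:: 0; 0; 1;
  0; 0; 0]; [:: 0; 0; 1; 1; 0; 0]; [:: 0; 1; 1; 1; 1; 1]; [:: 0; 0; 1; 0; -1; 0]; [:: 0; 0; 1; 1; 0;
  1]; [:: 1; 0; -1; -1; 0; -1]; [:: 1; 0; -1; 0; 0; -1]; [:: 1; 0; -1; 0; 0; 0]; [:: 1; 0; 0; 0; 0;
  -1]; [:: 1; 0; -1; 0; 1; 0]; [:: 1; 0; 0; 0; 0; 0]]%coqZ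
  35
  [::]
  [:: -5004; -2030; -3017; -2634; 599; -1637; 416; -2082; 1577; -1868; 1379; -2984; -1635; 272;
  -2408; -992; 1202; -3795; -298; -1029; 812; -1003; -3059; -1828; -1259; -127; -3491; 875; -263;
  -807]%coqZ
  [:: "F[=P],HTR=,JP=F,ER=P,OY=P],D]=FY,FM=D,BYR=,DO=FP,BYP=E,DN=EF,HTP=E,IP=E,BY=I,EJ=FI,HT=I,";
  "DU=ET,DG=EE,EJM=DI,CD=BJM,IR=,AD=BHJM,DQ=FI,DQR=F,B]=Q,CF=BJ,JN=FQ,AF=BHJ,IO=N,B]E=IN,";
  "FG=EN,B]P=N,EO=NP,FU=NT,MN=E,GT=EU,B\P=EU,EW=MPU,EX=PU,NW=PU,PQ=N,ST=U,OU=NX,NR=O,STO=NX,";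
  "FX=OT,HTO=N,FS=N,FSR=O,JO=FQR,PQR=O,B]PR=O,IX=U,CN=BQ,IS=K,GQ=KN,HU=K,AN=BHQ,B]G=KN,";
  "MNK=GI,BZ=K,AG=BHK,MNS=G,GO=NPS,GR=PS,GW=MPSU,CG=BK,GX=PSU,HX=S,KO=NS,BL=A,CH=A,KR=S,";
  "MQS=K,JK=IQ,MQ=I,JKM=II,JS=Q,MQR=,JSMR=,AP=BH,AV=CL,LN=HQ,QZ=K],GL=HK,M]K=IZ,GY=EZ,M]G=EZ,";
  "H\P=EZ,N\=EU],EZU=G\,UZE=G\,M]U=\,EUZ=G\,M]=Y,D\=ETY,DZ=EY,DV=JM,DL=HJM,FV=J,QY=I],FL=HJ,";
  "FZ=E],NY=E],F\=ET],N^=PU],F^=PT],DW=MPT,JPM=D,DSR=P,JW=T,JUM=IT,JU=QT,IW=MU,CP=B,MX=W,";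
  "RUM=W,STMR=W,KW=MSU,KX=SU,QW=U,RU=X,CO=BQR,QWR=X,STR=X,JX=QRT,QYR=],LTR=V,C]=QV,LT=IV,";
  "CY=IV,LU=KV,CZ=KV,C^=UV,C^MR=VW,CYR=V,C[=SV,LW=MSV,C^R=VX,LX=SV,Q[=S],LO=HQR,JZ=I],JZM=IY,";
  "I[=Z,E[=PZ,I^=\,J\=IT],J\M=ITY,GV\=IUZ,K\=IUZ,GV=K,M]S=Z,G[=PSZ,G^=PUZ,IPUZ=G\,PV=,U[=S^,";
  "WZ=MS^,B^=U,B^MR=W,HW=MS,B[=S,MO=P,AO=BHQR,NV=Q,K[=SZ,LP=H,SY=Z,RZ=[,M]RS=[,SYR=[,J[M=Y,";
  "J[=],H^R=[,O[=PRS],D[=PY,D^=PTY,R\=^,T[=^,WY=M^,B^R=X,OW=PX,J^M=TY,J^=T],XY=^,W]=^,Q^R=X],";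
  "OV=QR,W[=MRS^,L^R=V[,L^=VZ,W\=MU^,X\=U^,[\=Z^,H^=Z,X[=RS^,O^=PX],Q^=U],XZ=S^,FK=IN,TZ=\,";
  "BZP=G,S\=UZ,EQ=IN,H\=IZ,B\=IU,CE=BI,BV=C,HV=L,Q\=IU],EL=HI,UY=\,HUP=G,NZ=G],ATR=C,A]=LQ,";
  "AT=CI,AY=IL,AU=CK,L\=IVZ,AZ=KL,C\=IUV,AYR=L,A[=LS,AW=CMS,AX=CS,K^=UZ,EK=GI,EV=I,E^=P\,";
  "KP=G,KT=IU,ES=G,HUE=GI,BZE=GI,KY=IZ,"]%string
  [:: 5; 7; 15; 17; 24; 28]
  [:: [:: -1; -1; 1; -1; 0; 1]; [:: 0; 1; -1; 1; 1; -1]; [:: 0; -1; 0; -1; 0; 0]; [:: -1; 0; 1; -1;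
  -1; 1]; [:: 1; 0; -1; 0; 0; 0]; [:: 0; 0; 0; 1; 0; 0]]%coqZ
  1%coqZ
  [:: ([:: Free 0; Free 2; Free 4; Free 9; Free 15; Free 16; Free 19; Free 22; Free 25; Free 28;
  Free 29; Free 32; Free 33; Solve 60 6; Solve 70 31; Solve 74 34; Solve 73 23; Solve 67 13; Solve 4
  8; Solve 30 5; Solve 11 11; Solve 61 12; Solve 93 21; Solve 58 20; Solve 103 24; Solve 37 27;
  Solve 104 30; Solve 19 18; Solve 2 1; Solve 59 26; Solve 23 3; Solve 54 10; Solve 85 17; Solve 84
  14; Solve 1 7], (2, 3, 4), [:: (60, 2); (70, 22); (74, 34); (73, 23); (67, 13); (30, 0); (61, 12);
  (37, 8); (59, 33); (4, 4); (11, 11); (93, 21); (58, 20); (103, 24); (104, 30); (19, 18); (2, 1);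
  (23, 3); (54, 10); (85, 17); (84, 14); (1, 7)])].

Definition cert2 : cert := Cert
  [:: Free 0; Free 5; Free 6; Free 7; Free 9; Free 14; Free 15; Free 12; Free 27; Free 28; Free 29;
  Free 31; Solve 10 10; Solve 66 25; Solve 81 26; Solve 30 16; Solve 31 17; Solve 37 8; Solve 39 30;
  Solve 41 18; Solve 82 33; Solve 83 34; Solve 98 13; Solve 104 32; Solve 11 11; Open 102 23 24;
  Solve 28 22; Solve 77 3; Solve 78 20; Solve 92 4; Solve 93 21; Solve 1 1; Solve 3 2; Solve 45 19]
  [:: [:: 2; 2; -1; -1; -1; -1; -1]; [:: 1; -2; 1; 1; -2; -2; 1]; [:: -1; -1; 2; -1; 2; -1; 2]; [::
  0; 0; 0; 0; 0; 3; -3]; [:: 1; 1; -2; 1; 1; 1; -2]; [:: 0; 0; 0; 0; 0; 0; 3]; [:: -2; 1; 1; 1; 1;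
  1; 1]]%coqZ
  3%coqZ
  [:: [:: -1; 1; -1; 1; -1; -1]; [:: -1; 1; -1; 1; -1; 0]; [:: -1; 1; 0; 1; -1; 0]; [:: -1; 1; 1; 1;
  0; -1]; [:: -1; 2; 0; 2; 0; -1]; [:: -1; 2; 0; 2; 0; 0]; [:: 0; -1; -1; -2; -1; 0]; [:: 0; -1; -1;
  -1; -1; 0]; [:: 0; -1; 0; -1; 0; -1]; [:: 0; -1; 0; -1; 0; 0]; [:: 0; -1; 1; 0; 0; -1]; [:: 0; -1;
  1; 0; 0; 0]; [:: 0; 0; -1; -1; -1; 0]; [:: 0; 0; 0; 0; 0; -1]; [:: 0; 0; 0; 0; 0; 1]; [:: 0; 0; 0;
  0; 1; 0]; [:: 0; 0; 0; 1; 0; -1]; [:: 0; 0; 0; 1; 0; 0]; [:: 0; 0; 1; 0; 0; 0]; [:: 0; 0; 1; 0; 1;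
  -1]; [:: 0; 0; 1; 1; 0; 0]; [:: 0; 1; 0; 0; 0; 0]; [:: 0; 1; 0; 1; 0; 0]; [:: 0; 1; 1; 1; 0; 0];
  [:: 0; 1; 1; 1; 1; 0]; [:: 1; -2; 1; -1; 1; -1]; [:: 1; -1; 1; -1; 1; 0]; [:: 1; -1; 1; 0; 1; 0];
  [:: 1; 0; 1; 0; 1; 0]; [:: 1; 0; 1; 1; 1; 0]; [:: 1; 0; 2; 0; 2; 0]]%coqZ
  35
  [::]
  [:: -1062; -786; -369; -694; -959; -1042; -2358; -2633; -154; -76; -927; -981; -2462; -316; -5002;
  -4029; -1122; -1236; -283; -385; -1013; -2204; -542; -773; -265; -826; -202; -698; -456; -1234;
  -461]%coqZ
  [:: "AF=BE,BN=A,EH=A,CPAW=BE,QVB=AW,IWB=A,CPAA=BBEI,QVBBI=AA,EM=AV,CPMW=BV,HV=M,AG=BIM,";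
  "CPAM=BBIV,CPAH=BBI,MQBBI=AAH,AR=BQ,CPHW=B,MQB=AHW,A^=QW,CPHNW=A,MQ=HNW,IW=N,AZ=IQ,";
  "CPHNN=AI,MQI=HNN,A[=N,AS=CN,AK=CIQ,AU=CQ,AX=CNW,CPMNW=AV,CPMNN=AIV,AD=CEI,CPNN=EI,QVI=NN,";
  "AY=E,CPNW=E,QV=NW,AT=EI,E^=QWY,FN=E,TW=NY,E\=QY,JNY=T,DPNNY=ETT,QVT=NNY,IY=T,EZ=QT,JN=I,";
  "DPNN=EIT,E[I=NT,ESI=DN,CT=D,EK=DQ,IYC=D,BD=CEJ,ESJ=D,QVJJ=I,DF=CEJY,JNCY=D,QVCJJY=D,";
  "DW=CNY,ES=CNY,QVD=CNNY,DU=CKY,QSD=CKNY,DH=CI,QSI=KN,KV=NS,KVJ=IS,QSJ=K,DL=CJKY,KVCJY=DS,";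
  "DO=CJY,DG=CIJV,DM=CIV,DX=CNSY,C\=U,KX=NSU,LN=K,QS=NU,HY=,IU=K,CZ=K,KM=HNS,IL=JK,BK=CJQ,";
  "GK=HIS,C[=S,HVJ=G,IO=J,JM=G,BS=C,CPH=BJ,GQJ=HI,CPHM=BG,IOM=G,GR=H,CPG=BJJV,FG=BJV,";
  "CPMM=BGV,BX=CW,FM=BV,MR=HW,BU=CR,FH=B,OQ=R,JW=,BL=CJR,IR=JQ,EHJ=BI,CPI=EJJ,FI=EJ,BY=F,";
  "CP=FJ,EO=F,QVFJ=E,ER=FQ,CPW=F,QVF=EW,RV=W,RVJ=,A]=NW,M^=HW],NO=,PXH=,W[=],M\=H],PSH]=[,";
  "I]=N[,MZ=HN[,PSHN=I,IX=NS,GX=MS,GL=HJS,GY=JV,MY=V,C^=UW,QX=NUW,NR=Q,KW=NU,KR=LQ,QSL=KU,";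
  "JU=L,C\J=L,KO=L,RSJ=L,LW=U,RS=U,LX=SU,FL=CJRY,LV=S,C_=SY,JX=S,FS=CY,EU=CQY,EX=CNWY,MT=IV,";
  "PSMN=IV,PSMM=GV,B[=,BT=EJ,BZ=JQ,B\=R,B^=RW,B]=W,F]=WY,F_=YY,F\=RY,RX=UW,FX=CWY,PXM=V,";
  "M_=V[,PSM]=V[,G]=M[,PSHM=G,GZ=HI[,PSH=J,G\=H[,G_=JV[,PSG=JJV,GT=IJV,PSI=JT,VZJ=I[,E[J=T,";
  "DPI=EJJT,DP=EJJY,QVJJY=T,EST=DNY,D_=STY,D[=ST,DZ=KT,KVJY=ST,D\=KY,QST=KNY,TU=KY,K[=SZ,";
  "JN\=Z,QSZ=KN\,HT\=Z,I\=Z,HT=I,KPHNN=IIQ,KPH=JJQ,Q[J=Z,Q[I=NZ,PSHN\=Z,UZ=K\,K]=NS\,K^=NU\,";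
  "KPHNN\\=QZZ,LZ=JK\,J]=[,L[=JS\,LPH=JJR,J^=\,RZ=JQ\,R[=\,PUH^=R\,PUHW=R,X[=S],U[=S\,S^=U],";
  "X\=U],UW]=X^,W]U=X^,U]W=X^,PUHNW=Q,PUHN^=Q\,Z^=N\\,Q[=N\,[^=\],PUH]=\,L^=U\,L]=S\,PU]=Y\,";
  "U_=SY\,KPNNY=QTT,KPNN\=QTZ,KPNN=IQT,KPI=JJQT,PSN=T,PSZ=JT\,Z_=T[\,KPZ=JJQT\,KP=JJQY,";
  "RT=JQY,FT=EJY,F^=RWY,FU=CRY,PUW=RY,PU^=RY\,LP=JJRY,L_=JSY\,LT=JKY,PS=JY,OT=JY,Y[=_,V\JY=_,";
  "JN_=T[,PS[=J_,OT[=J_,V\J=[,T]=N_,V\T=N_,PS]=_,V\=],X_=SY],V^=W],PX=Y,W_=Y],E]=NWY,E_=NYY,";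
  "E_J=TY,J]Y=_,R_=Y\,^_=Y\],Q_=NY\,T^=NY\,PUN^=QY\,PUNW=QY,GN=IM,GW=M,EG=BIV,AJ=BI,AO=B,";
  "MU=HX,C]=X,Q]=N^,R]=^,K_=ST\,H_=[,I_=T[,Q_J=T\,SW=X,W\=^,YZ=T\,OZ=J\,Z]=N[\,VZ=N[,UV=X,"]%string
  [:: 0; 1; 4; 15; 16; 22]
  [:: [:: 1; -1; -1; 0; 0; 2]; [:: 1; -1; 0; 0; -1; 1]; [:: -1; 0; 1; -1; 0; -1]; [:: -1; 1; 0; 0;
  1; 0]; [:: 0; 0; 0; 1; 0; 0]; [:: -1; 1; 0; 0; 0; 0]]%coqZ
  1%coqZ
  [:: ([:: Free 0; Free 5; Free 6; Free 7; Free 9; Free 12; Free 14; Free 15; Free 27; Free 28; Free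
  29; Free 31; Solve 66 25; Solve 10 10; Solve 30 16; Solve 37 8; Solve 81 26; Solve 39 30; Solve 82
  33; Solve 53 11; Solve 83 34; Solve 31 17; Solve 104 32; Solve 14 13; Solve 32 18; Open 102 23 24;
  Solve 87 22; Solve 77 3; Solve 18 2; Solve 63 19; Solve 25 20; Solve 15 1; Solve 95 4; Solve 101
  21], (0, 2, 5), [:: (10, 9); (81, 31); (39, 29); (82, 33); (83, 34); (31, 15); (77, 24); (66, 25);
  (30, 16); (37, 27); (53, 11); (104, 32); (14, 13); (32, 18); (102, 23); (87, 22); (18, 2); (63,
  19); (25, 20); (15, 1); (95, 4); (101, 21)])].

Definition cert3 : cert := Cert
  [:: Free 0; Free 3; Free 4; Free 12; Free 16; Free 17; Free 19; Free 22; Free 25; Free 28; Free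
  30; Free 33; Free 34; Solve 18 2; Solve 61 6; Solve 70 31; Solve 76 7; Solve 83 14; Solve 84 10;
  Solve 87 24; Solve 88 20; Solve 89 26; Solve 5 8; Solve 9 13; Solve 20 18; Solve 24 23; Solve 36
  5; Solve 38 27; Solve 39 29; Solve 40 15; Solve 53 11; Solve 57 21; Solve 59 32; Solve 60 9; Solve
  0 1]
  [:: [:: 2; -1; 2; 2; -1; -1; -1]; [:: 0; 3; -3; -3; 0; 0; -3]; [:: 0; 0; 0; 0; 0; 0; 3]; [:: 1;
  -2; 1; 1; 1; 1; 1]; [:: -1; 2; -1; -4; 2; -1; -1]; [:: -1; -1; 2; 2; -1; 2; 2]; [:: 0; 0; 0; 3; 0;
  0; 0]]%coqZ
  3%coqZ
  [:: [:: 0; -1; -1; -2; -2; -1]; [:: 0; -1; -1; -1; -2; -1]; [:: 1; -1; 0; -1; -1; 0]; [:: 0; 0; 0;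
  0; -1; 0]; [:: 0; 0; 0; 0; 0; 1]; [:: 1; -1; 0; 0; -1; 0]; [:: 1; -1; 0; 0; 0; 0]; [:: 0; 0; 1; 1;
  0; 1]; [:: 0; 0; 0; -1; -1; -1]; [:: 1; 0; 0; 0; -1; 0]; [:: -1; 2; 1; 2; 2; 1]; [:: 0; -1; -1;
  -1; -1; 0]; [:: 0; -1; -1; 0; -1; 0]; [:: 0; -1; 0; 0; -1; 0]; [:: 1; -1; 0; 0; 0; 1]; [:: -1; 1;
  0; 1; 1; 0]; [:: 0; -1; -1; -1; -1; -1]; [:: -1; 1; 0; 2; 2; 0]; [:: 0; 0; 0; 0; 1; 0]; [:: 0; 0;
  0; 1; 0; 0]; [:: 0; 0; 0; 1; 1; 1]; [:: 0; 0; 0; 1; 1; 0]; [:: 0; 1; 0; 0; 0; 0]; [:: 1; 0; 0; 0;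
  0; 0]; [:: 0; 1; 0; 1; 1; 0]; [:: 0; 1; 1; 1; 1; 1]; [:: 0; -1; -1; 0; 0; 0]; [:: 1; 0; 0; 1; 1;
  1]]%coqZ
  35
  [::]
  [:: -2129; -584; -1198; -109; -317; 123; -111; -2091; -2429; -679; -1448; -705; -502; -1331; 49;
  -819; -520; -768; -4992; 198; 54; 16; -821; -648; -683; -1358; -461; -570]%coqZ
  [:: "AZ=EI,CP=,DS=,BEI=AD,IL=A,NW=D,AH=EIN,AO=CL,BE=DL,DQ=B,AF=BC,AJ=BCW,BS=Q,NWQ=B,AM=BL,AT=B,";
  "AY=QW,EQI=A,NWS=,AR=PQ,AK=EIP,AU=L,EQ=L,AG=CQ,AX=CQW,A[=LQ,EYI=W,IU=,PZ=K,ERI=P,HP=KN,";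
  "ETI=D,CKN=H,NZ=H,HW=DZ,CK=Z,EFI=CD,IO=C,CU=O,EF=DO,HL=EN,EJ=DOW,LZ=E,CM=BO,FL=BO,JL=BOW,";
  "BZ=D,CTW=J,FW=J,CT=F,JN=DF,BH=DN,BG=FQ,JNQ=BF,BX=JQ,IOTW=J,JP=TW,IOT=F,FP=T,FM=BOT,";
  "JM=BOTW,BU=M,OPB=M,LT=M,B[=MQ,IM=B,BK=DP,BR=PQT,BV=QT,BY=QTW,I[=Q,PX=Y,KQ=P,STW=Y,RW=PY,";
  "PV=R,STP=R,NY=T,NYPS=R,DR=PT,DV=T,FKN=HT,FK=TZ,HJ=DFZ,DG=F,CV=G,FS=G,HQ=N,HX=FZ,GJ=FX,QZ=,";
  "NX=F,DX=J,EJI=CDW,EXI=CW,HWS=Z,EGI=C,EG=O,EX=OW,C[=OQ,GL=OQ,LX=OQW,C\=OX,JS=X,GW=X,NXS=G,";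
  "HXS=GZ,GR=VV,IOV=G,GT=FV,FY=TX,JV=TX,FR=TV,FU=OT,JK=TWZ,DY=TW,ET=DU,KO=UZ,KL=EP,KON=HU,";
  "EM=DLU,OP=U,D\=OTW,JU=OTW,MZ=DU,D[=M,HM=DNU,MS=[,QU=[,NW[=M,OPQ=[,L\=OW[,LV=[,E[=LU,";
  "E\=OUW,EV=U,EVI=,EY=UW,ER=PU,K[=PU,KM=DPU,H[=NU,ST=V,GU=OV,GKN=HV,GK=VZ,G\=OVX,G[=OQV,";
  "N\S=OV,ORQ=V[,N\=OT,MV=T[,F[=OQT,F\=OTX,JY=TWX,CY=X,I\=X,VW=Y,KX=YZ,HYS=VZ,RZ=KV,KQV=R,";
  "NYS=V,HR=KNV,HY=TZ,H\S=OVZ,H\=OTZ,OY=\,UX=\,VWO=\,Z[=U,OR=UV,MR=PT[,K\=UYZ,K[V=RU,RX=VY,";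
  "GY=VX,X[=Q\,STOW=\,M\=OTW[,MY=TW[,P\Q=Y[,LR=P[,LY=W[,J\=OTWX,R\Q=VY[,R\=UVY,P\=UY,"]%string
  [:: 0; 2; 3; 4; 8; 22]
  [:: [:: 0; 1; 0; -1; -1; 1]; [:: 0; 0; 0; 0; 0; 1]; [:: -1; 0; 0; 1; 2; -1]; [:: 0; 0; 1; -1; -1;
  0]; [:: 0; 0; -1; 0; 0; 0]; [:: 0; 0; 0; 1; 0; 0]]%coqZ
  1%coqZ
  [:: ([:: Free 0; Free 3; Free 4; Free 12; Free 16; Free 17; Free 19; Free 22; Free 25; Free 28;
  Free 30; Free 33; Free 34; Solve 70 31; Solve 89 26; Solve 18 2; Solve 87 24; Solve 24 23; Solve
  40 15; Solve 85 20; Solve 15 1; Solve 61 6; Solve 3 7; Solve 31 5; Solve 65 13; Solve 80 14; Solve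
  84 10; Solve 23 21; Solve 45 9; Solve 20 18; Solve 102 29; Solve 67 32; Solve 7 11; Solve 91 8;
  Solve 38 27], (1, 4, 5), [:: (70, 25); (18, 0); (87, 30); (24, 4); (85, 26); (61, 6); (3, 7); (65,
  13); (80, 14); (20, 18); (102, 29); (91, 8); (89, 33); (40, 15); (15, 1); (31, 5); (84, 10); (23,
  21); (45, 9); (67, 32); (7, 11); (38, 27)])].

(** The missing coordinate 0 is the subset 123, bounded below by relation 17. The first realization
    chart finds it by subtraction in that relation, which is impossible on cones with the vertical
    ray; the second chart takes it as a parameter. *)
Definition cert4 : cert := Cert
  [:: Free 1; Free 3; Free 4; Free 9; Free 14; Free 15; Free 20; Free 22; Free 24; Free 26; Free 29;
  Free 32; Free 33; Solve 23 21; Solve 57 27; Solve 79 10; Solve 94 11; Solve 46 5; Solve 49 19;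
  Solve 52 25; Solve 54 31; Solve 78 12; Solve 84 34; Solve 104 30; Solve 6 2; Solve 9 13; Solve 24
  23; Solve 44 28; Solve 66 6; Solve 70 16; Solve 81 7; Solve 85 17; Solve 96 8; Solve 100 18]
  [:: [:: 2; -1; -1; 2; -4; -1; -1]; [:: 1; 1; 1; -2; 1; 1; -2]; [:: -1; 2; -1; -1; 2; -1; 2]; [::
  0; 0; 0; 0; 3; 0; 0]; [:: 1; -2; 1; 1; -2; 1; 1]; [:: 0; 0; 3; 0; 0; 0; 0]; [:: -2; 1; -2; 1; 1;
  1; 1]]%coqZ
  3%coqZ
  [:: [:: -1; -1; 0; -2; -1; -1]; [:: -1; -1; 1; -1; -1; 0]; [:: -1; -1; 2; 0; -1; 1]; [:: -1; 0; 0;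
  -2; -1; 0]; [:: -1; 0; 0; -2; -1; 1]; [:: -1; 0; 0; -1; -1; 0]; [:: -1; 0; 0; -1; 0; 0]; [:: -1;
  0; 0; -1; 0; 1]; [:: -1; 0; 0; 0; 0; 1]; [:: -1; 0; 1; -1; 0; 1]; [:: -1; 0; 1; 0; 0; 1]; [:: 0;
  0; -1; -1; 0; 0]; [:: 0; 0; 0; -1; 0; 0]; [:: 0; 0; 0; -1; 0; 1]; [:: 0; 0; 0; 0; 0; 1]; [:: 0; 0;
  0; 0; 1; 0]; [:: 0; 0; 0; 0; 1; 1]; [:: 0; 0; 0; 1; 0; 0]; [:: 0; 0; 1; 0; 0; 0]; [:: 0; 0; 1; 0;
  0; 1]; [:: 0; 0; 1; 1; 0; 1]; [:: 0; 0; 1; 1; 1; 1]; [:: 0; 1; 0; 0; 0; 0]; [:: 1; 0; -1; 0; 0;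
  -1]; [:: 1; 0; 0; 0; 0; 0]; [:: 1; 0; 0; 0; 1; 1]; [:: 1; 0; 1; 1; 1; 1]; [:: 1; 1; -1; 0; 0; 0];
  [:: 1; 1; -1; 0; 1; 0]; [:: 1; 1; -1; 1; 0; 0]; [:: 1; 1; 0; 0; 0; 0]; [:: 1; 1; 0; 1; 0; 0]; [::
  1; 1; 0; 1; 1; 0]; [:: 2; 1; -2; 0; 0; 0]; [:: 2; 1; -1; 0; 0; 0]; [:: 2; 1; -1; 1; 0; 0]; [:: 2;
  1; -1; 1; 1; 0]; [:: 2; 1; 0; 0; 0; 0]; [:: 2; 1; 0; 1; 0; 0]; [:: 2; 1; 0; 1; 1; 0]; [:: 2; 1; 0;
  1; 1; 1]; [:: 2; 1; 0; 2; 0; 0]; [:: 2; 1; 0; 2; 1; 0]; [:: 2; 1; 0; 2; 2; 0]]%coqZ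
  0
  [:: 17]
  [:: -44663; -29620; -20299; -4513; -7036; 492; -25239; -27711; -50000; -18732; -13853; -15048;
  -5751; -8256; -2731; -29259; -30099; -22618; -4834; 6342; -6892; -15152; -12769; -27193; 11213;
  -18475; -3530; -1365; -29040; -23742; 7552; -4039; -14097; -9872; 10159; -10542; -4141; 19044;
  7740; 5072; 2513; -14164; -5898; -18497]%coqZ
  [:: "B]R=,IP=GQR,B\GIQ=HH,GO=H,IM=H,FQ=H,B\GI=FH,DI=FH,KL=H,FV=K,IJ=HK,B\GK=FJ,B\G=D,JLF=DH,";
  "AH=BGL,BXG=A,DR=F,GYF=D,LSF=D,AJF=BDG,ATF=BD,BXD=AFY,AN=BLM,BXM=AY,DPY=MM,LS=M,GY=M,DP=GM,";
  "AJ=BGM,AT=BM,A[=BPY,AV=BP,AQ=BLP,GYR=,LSR=,FP=G,AI=BGLR,AK=BG,AC=BB,BX=ARY,FPRY=,AO=BL,";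
  "AZ=BLPY,Ae=MX,A]=GMX,A\=DX,A_=DSX,Af=DSXY,Ac=DXY,Aa=GSX,AeR=X,A]R=GX,A^=FX,AW=FGSX,";
  "Aj=FRSXY,Ab=FLXY,FeLRY=b,Ld=b,RcL=b,OX=LRY,Y^L=b,FeR=^,R\=^,OX^=Rb,GbR=L^,F]R=G^,LWR=G^,";
  "IX=LR,IS=K,BW=FS,CG=BK,JR=K,B_G=DS,B_J=DST,JYF=DT,B_EJ=DDTT,FN=E,B\H=E,DTH=EJ,BfE=DFTYY,";
  "BfN=DTYY,EM=DN,JYE=DNT,JLE=DHN,DZ=MN,B\HM=DN,DQ=HM,JL=HM,GN=HM,JY=MT,NS=MT,B_JN=DMTT,";
  "B\HMV=JN,JQ=HMV,B\GV=J,B\GIV=HK,KQ=HV,B\GQ=HM,GZ=MQ,GZR=Q,JP=GMV,BWV=KS,KQR=IV,IZ=OQ,";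
  "B\IQ=HO,IN=HO,B\I=FO,EI=FHO,IT=KO,B\K=FT,CH=BKO,EK=FHT,JO=HT,ER=FO,CE=BFOT,EV=HT,NR=O,";
  "HZ=NQ,B\Q=N,KN=HT,EX\=FLc,EX=FLY,DTc=Ef,Y_=f,TcD=Ef,DcT=Ef,JfF=DT_,DT\=E_,JfE=DNT_,DW=FG_,";
  "JXF=D,GcF=D\,Db=FLc,Jf=MT_,Da=G_,JX=M,Dh=M_,TcM=Nf,DhY=Mf,D[=MT,BfM=DSYY,Bf=FSYY,CD=BFT,";
  "BU=C,F[=T,OS=T,RTB=C,KY=T,CJ=BKT,KYBR=C,OSBR=C,CI=BKOR,CL=BO,F[BR=C,CPY=B[,VY=[,CP=BV,";
  "K[BR=CV,K[=TV,CM=BT,CN=BOT,CZ=BO[,OPY=Z,FZR=O,Bb=FLRYY,IY=O,B^I=FOR,B^IV=KOR,B\IV=KO,";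
  "HW=GK\,G_K=JW,IJW=GKK\,S\GK=JW,JXW=G_,^_G=W\,IXW=G^,G^K=IW,R\GK=IW,I`=K^,OWR=K^,Eb=FLOc,";
  "Eg=FTc,EK_=FJT\,EV_=JT\,Ei=NT\,FkY=g,Td=Og,Uc=Og,Tj=Ug,Y`=g,CgO=FUUYY,RT=U,C`KO=FTUU,";
  "C`KOR=FUUU,KYR=U,OSR=U,C`K=FSUU,CgT=FSUUYY,Cj=FRRSUYY,F[R=U,CjO=FRUUYY,CkO=UUY,CkOV=UU[,";
  "K[R=UV,C`ORV=UUU,C`OV=TUU,C`V=SUU,CkV=RSU[,Ck=RSUY,CkT=SUUY,CkTV=SUU[,Ui=OTk,[g=TYk,U\=O`,";
  "Vg=Tk,Fk=`,Kg=T`,T^=O`,Kd=O`,U^=OR`,Kj=U`,UW=K`,R_=`,S^=`,^_=\`,Ka=VW,G^V=Ia,ISa=VW,";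
  "R\GV=Ia,V^G=Ia,W]RV=Iaa,IPa=GRV],Qa=V],G^Q=I],R\GQ=I],IM]=GQ\,H]=GQ\,P\=],QXG=LP,Gc=M\,";
  "[_=Th,Jh=MV_,B_V=ST,J[=MTV,B_NV=MTT,BhNV=MT[,BhN=MTY,BhZ=MY[,NPY=MZ,NP=MQ,OP=Q,Q[=VZ,";
  "OhZ=N[e,Zi=N[e,Nb=LOc,KQ^=IV\,I`a=VW^,GV^=Ia,Iea=V]^,Ie=Q^,O]R=Q^,Ib=LO^,FeY=c,OXc=Yb,";
  "Fe=\,OX\=b,^cL=\b,Gb=L\,IX\=L^,IXa=R],W]R=G^a,W]=G\a,IJaa=GVVW\,IMa=GV\,GhQ=MV],VXG=P,";
  "S]=Ma,MW=G_,GV_=Ja,V_G=Ja,G_V=Ja,MWV=Ja,S\GV=Ja,JRa=VW,Wg=_`,Wj=``,Rg=j,SdR=j,UX`=j,Y`R=j,";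
  "FkRY=j,UX=RY,Ud=Oj,OXj=RYd,bj=dd,FeRY=d,OXd=RYb,Rc=d,Y^=d,`bR=^d,OX`=d,^j=R`d,\j=`d,`c=\g,";
  "^g=`d,`b=\d,^c=\d,bg=cd,Fkc=\g,OX\g=cd,TX`=g,TW=K_,J`=K_,B_K=FST,U_=T`,Uf=Tg,Fkf=_g,_j=`g,";
  "fj=gg,Sd=g,UXg=Yj,OSj=Ug,Vj=Uk,[`R=Uk,PW=Ga,BlV=PRS[,Bl=PRSY,OP[=VZ,BhQQ=MVZ,BhVZ=M[[,";
  "NP[=MVZ,SZ=M[,BhV=S[,PT=MV,Bh=SY,PTY=M[,Me[=Zh,Lh=Me,XZM=LPYY,Pc=Me,Y]=Me,QX]=LPe,Z]=MQe,";
  "NX\=Lc,De=M\,DeY=Mc,NX=LY,NX_=Mc,NXf=MYc,KN_=JT\,J`a=VW_,VX_=h,Mea=]h,VXM\a=]h,MeV=Qh,";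
  "VeM=Qh,Z\MV=NQh,Mb=Lc,]c=M\e,QX\=Le,QX^=LRe,Z]R=Qe,IX\a=]^,Wk=`a,Wd=\`,WdR=^`,_d=\g,";
  "OXg=Yd,cj=dg,ag=_k,VX`=k,NX\h=Mce,QX\h=Mee,VXMa=Ph,QX]h=MPee,Pf=Mh,Ah=MSX,[a=Vh,Uh=Tk,";
  "[`=Tk,gh=fk,`l=ak,Ul=Vk,UlY=[k,[j=UYk,aj=`k,RhQ=Ve,XZ=LPRYY,Pb=Le,]bR=L^e,Zb=LOYe,Z^=Oe,";
  "Qb=LOe,]b=L\e,^h]=\ae,^h=\k,ad=\k,`e=\k,VX^=Re,Rh]=ae,]l=Pae,Pk=l,RhP=l,VXa=l,YaPR=l,";
  "SePR=l,X[=PRYY,[aPR=Vl,Z]V=QQh,MVe=Qh,NPVe=QQh,OhQ=NVe,Nk=i,Vc=i,[c=Yi,NP[[e=VZZh,T\h=_i,";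
  "\hT=_i,Th\=_i,Y_i=Tch,fi=Tch,Nkf=Tch,NPY[e=ZZh,Zl=P[e,RhZ=[e,X[h=YYl,Rh=k,[aR=Vk,SeR=k,";
  "Ri=Ok,[^=Ok,Ue=Ok,W]V^=I\aa,`i=T\k,di=Ock,OX\k=de,eg=ck,bk=de,Vd=Ok,^i=O\k,NXh=MYe,dh=ck,";
  "OXck=Yde,OXk=RYe,dl=ek,ej=dk,jl=kk,X[k=RYYl,YaR=k,[d=OYk,OX^k=Rde,`eR=^k,^hQ=V\e,";
  "N]Ve=QQ\h,ilY=[eh,il=Veh,adR=^k,OW=K\,O]=Q\,F]=G\,BWI=FK,D^=F\,LW=G\,Fa=W,L_F=D\,AE=BDL,";
  "FQR=I,KLR=I,HYF=E,FM=D,Bc=FYY,BcM=DYY,BcN=EYY,MTH=JN,L_E=DN\,EZ=NN,D]=GM\,EQ=HN,L_=M\,";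
  "EG=DH,N]=MQ\,HY=N,ES=DT,J]=GMV\,BWIV=KK,B]=M,G[=MV,G[R=V,P_=Ma,Ba=S,B^Q=O,N^=O\,O_=T\,";
  "MTc=Nf,McT=Nf,JcF=E_,GfF=D_,Jc=N_,EhY=Nf,E[=NT,QY=Z,OlY=[e,VXW=a,Dg\=F_c,Dg=Ff,DK=FJ,DV=J,";
  "Eh=N_,Ua=V`,S^G=W,K^G=IW,P^=R],Q^G=I],HR=I,Ha=GV\,HP=GQ,\l=ae,Gf=M_,[\=i,Ji=NV_,Gh=Ma,";
  "H[=NV,B\V=T,BiV=T[,Bi=TY,Be=Y,Qi=NVe,GK^=IW,GQ^=I],OaR=V^,GOR=I,QXG\=L],GK_=JW,K_G=JW,";
  "R_G=W,`f=_g,H`=K\,KP=GV,Ol=Ve,BeQ=Z,BeV=[,QS=MV,Se=h,Tl=Vh,TlY=[h,LV=Q,cl=eh,Ya=h,Ee=N\,";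
  "EeY=Nc,EX_=Dc,EXf=DYc,KM=J,G`=W,[eM=Zh,aeM=]h,ac=\h,VXG\=],Kk=V`,df=cg,Xi\=ce,VX\=e,";
  "VX]=Pe,fl=hh,Al=PSX,gi=Tck,]k=ae,Y]R=e,SZR=[,S]R=a,M[e=Zh,Mae=]h,Zk=[e,Qc=Ne,Vf=Th,[f=TYh,";
  "Zc=NYe,Y\=c,\f=_c,MR=,XZh=PYYe,`h=_k,Xi=Ye,M^=\,Oa=V\,GO^=I\,FQ^=I\,B^G=F,KL^=I\,LfF=Dc,";
  "LfE=DNc,Lf=Mc,Na=MV\,Sc=f,]_=M\a,_l=ah,Oh=i,HcF=E\,Hc=N\,EiY=NTc,KX=,^l=Rae,H^=I\,Z\=Ne,";
  "Hh=MV\,Ge=],HX=L,H_=J\,L[=Z,La=],TX_=f,TX=Y,af=_h,gh\=_ck,Mk=h,QSR=V,Mi=Nh,Ml=Ph,Qk=Ve,";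
  "VcM=Nh,T\M=N_,T\D=E_,D\T=E_,X[M=PYY,LTF=E,LT=N,ai=V\h,GN_=JM\,Si=Th,Q_=MV\,Of=Tc,He=Q\,";
  "Gl=Pa,Li=Ne,Ll=Pe,Xi_=ch,MT\=N_,HTM=JN,HTD=EJ,DHT=EJ,M\T=N_,Ta=V_,EG_=DJ\,S\=_,_e=\h,DO=E,";
  "Hi=NV\,TX\=c,HMT=JN,GT=J,HS=J,Te=i,MO=N,TZ=N[,ef=ch,QT=NV,"]%string
  [:: 1; 6; 8; 11; 16; 17]
  [:: [:: 0; -1; 0; 0; 0; -1]; [:: -1; 0; 1; -1; -1; -2]; [:: 0; 0; 0; -1; 0; -1]; [:: 0; 0; 0; 0;
  0; 1]; [:: 0; 1; -1; 0; 1; 1]; [:: 0; -1; 1; 0; 0; -1]]%coqZ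
  1%coqZ
  [:: ([:: Free 1; Free 3; Free 4; Free 9; Free 14; Free 15; Free 20; Free 22; Free 24; Free 26;
  Free 29; Free 32; Free 33; Solve 79 10; Solve 23 21; Solve 57 27; Solve 94 11; Solve 54 31; Solve
  48 19; Solve 78 12; Solve 88 34; Solve 55 25; Solve 6 2; Solve 47 5; Solve 24 23; Solve 69 13;
  Solve 67 6; Solve 104 30; Solve 102 18; Solve 74 28; Solve 90 8; Solve 61 16; Solve 12 7; Dom 17
  0; Solve 85 17], (1, 3, 5), [:: (79, 14); (23, 4); (57, 27); (94, 11); (48, 9); (78, 12); (88,
  34); (55, 25); (6, 2); (47, 5); (24, 23); (85, 28); (54, 32); (69, 13); (74, 29); (67, 6); (104,
  30); (102, 18); (90, 8); (61, 16); (12, 7); (17, 0)]); ([:: Free 33; Free 0; Free 3; Free 26; Free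
  29; Free 22; Free 9; Free 5; Free 10; Free 15; Free 28; Free 14; Free 7; Solve 1 1; Solve 82 30;
  Solve 31 17; Solve 75 20; Solve 76 12; Solve 79 24; Solve 85 31; Solve 6 2; Solve 63 19; Solve 51
  25; Solve 88 34; Solve 44 27; Solve 15 16; Solve 66 6; Solve 37 8; Solve 35 18; Solve 27 21; Solve
  29 23; Solve 100 32; Solve 69 13; Solve 52 11; Dom 2 4], (2, 3, 5), [:: (82, 14); (31, 0); (75,
  3); (79, 24); (85, 22); (51, 9); (88, 34); (44, 29); (1, 1); (76, 12); (6, 2); (63, 19); (15, 16);
  (66, 6); (37, 8); (35, 18); (27, 21); (29, 23); (100, 32); (69, 13); (52, 11); (2, 4)])].

(** The missing coordinate 29 is the subset 357, with two lower bounds, from relations 74 and 37.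
    The first two realization charts find it by subtraction in one of them; the last two take it as
    a parameter and serve the cones with the vertical ray. *)
Definition cert5 : cert := Cert
  [:: Free 0; Free 3; Free 4; Free 5; Free 7; Free 9; Free 15; Free 10; Free 14; Free 22; Free 26;
  Free 28; Solve 1 1; Solve 5 8; Solve 8 11; Solve 31 17; Solve 46 20; Solve 76 12; Solve 81 31;
  Solve 6 2; Solve 9 13; Solve 10 6; Solve 33 16; Solve 36 25; Solve 45 19; Open 54 33 32; Solve 50
  21; Solve 53 27; Solve 79 24; Solve 82 30; Solve 83 34; Solve 17 18; Solve 24 23]
  [:: [:: 1; 1; 1; -2; 1; -2; -2]; [:: 1; 1; -2; 1; -2; 1; -2]; [:: 0; 0; 0; 0; 0; 0; 3]; [:: 2; -1;
  -1; 2; -4; -1; -1]; [:: -1; -1; 2; -1; 2; 2; 2]; [:: 0; 0; 0; 0; 3; 0; 0]; [:: -2; 1; 1; 1; 1; 1;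
  1]]%coqZ
  3%coqZ
  [:: [:: -1; 0; 0; 0; 0; 0]; [:: -1; 0; 0; 0; 0; 1]; [:: -1; 0; 0; 0; 0; 2]; [:: -1; 0; 0; 0; 1;
  0]; [:: -1; 0; 0; 0; 1; 1]; [:: -1; 0; 0; 0; 2; 1]; [:: -1; 0; 0; 1; 1; 1]; [:: -1; 0; 1; 0; 1;
  -1]; [:: -1; 0; 1; 0; 1; 0]; [:: -1; 0; 1; 0; 1; 1]; [:: -1; 0; 1; 0; 2; 0]; [:: -1; 0; 2; 0; 2;
  0]; [:: -1; 1; 1; 0; 2; 0]; [:: 0; -1; 0; 0; 0; 0]; [:: 0; 0; -1; -1; -1; 0]; [:: 0; 0; -1; 0; -1;
  0]; [:: 0; 0; -1; 0; -1; 1]; [:: 0; 0; -1; 1; 0; 0]; [:: 0; 0; -1; 1; 0; 1]; [:: 0; 0; 0; 0; 0;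
  -1]; [:: 0; 0; 0; 0; 0; 1]; [:: 0; 0; 0; 0; 1; 0]; [:: 0; 0; 0; 1; 0; 0]; [:: 0; 0; 0; 1; 0; 1];
  [:: 0; 0; 0; 1; 1; 0]; [:: 0; 0; 1; 0; 0; 0]; [:: 0; 0; 1; 0; 1; 0]; [:: 0; 0; 1; 1; 1; 0]; [:: 0;
  1; -1; 1; 0; 1]; [:: 0; 1; 0; 0; 0; 0]; [:: 0; 1; 0; 0; 0; 1]; [:: 0; 1; 0; 0; 1; 1]; [:: 0; 1; 0;
  1; 0; 1]; [:: 0; 1; 0; 1; 1; 0]; [:: 0; 1; 1; 0; 0; 1]; [:: 0; 1; 1; 0; 1; 0]; [:: 0; 1; 1; 1; 0;
  1]; [:: 0; 1; 1; 1; 1; -1]; [:: 0; 1; 1; 1; 1; 0]; [:: 0; 1; 1; 1; 1; 1]; [:: 1; 0; 0; 0; 0; 0];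
  [:: 1; 0; 0; 1; 0; 0]; [:: 1; 0; 0; 2; 0; 1]; [:: 1; 1; -1; 1; -1; 0]; [:: 1; 1; 0; 0; 0; 0]; [::
  1; 1; 0; 1; 0; 0]; [:: 1; 2; 0; 0; 0; 1]]%coqZ
  29
  [:: 74; 37]
  [:: -278232; -161474; -94881; -256280; -182368; -353109; -121221; -623230; -261063; -194337;
  -334187; -355405; -264764; -999983; -712412; -314583; -192022; -251830; -163038; -455811; -23004;
  -175010; 49095; 127798; -4330; -410020; -188230; -25374; -93686; 56671; 143183; -27449; 204451;
  65264; -261971; -11597; -200748; -304926; 57373; 123971; -347710; -107543; 29690; -236796;
  -162359; 74604; -9072]%coqZ
  [:: "`g=Y_d,Ub=Y_,Sd=Y_,Kn=Yd,KS=EY,OYKU_=E`,OYJ=E,Eg=IY_,Jb=IY_,Ka=IY_,Ec=J_,OaJ=B_,EXI=GJ,";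
  "IXE=GJ,NaEI=GJ,Bb=Da,BS=GQ,E^=D_,OaE=DQ_,B`=E_,AE=BD,BM=DI_,OaEI=BD_,Dc=I_,OaI=B^,A_=B^,";
  "BH=AI,DZ=I,OWI=A,N^=,AG=BDW,Aa=BW^,BP=AQ,DZQ=B,OWB=AQ,Ac=BZ^,AJ=BI,AX=BW,Ae=BWZ^,Ad=I^,";
  "AL=II,AK=DI,AY=DW,Ab=DW^,AM=DI^,AMT=DH^,DZT=H,HP=AT,OWH=AT,AKT=DH,AR=DPW,DZP=A,QT=P,OW=P,";
  "AV=D,Am=^,Ai=,Aj=W,A\T=HW,ALTT=HH,AdT=H^,Ag=IW^,A\=IW,HX=IW,Ng=\,KW=IY,D\=IY,GH=DIW,Nb=Y,";
  "EH=DI,ObIK=DM,Ha=IW^,H_=I^,ObI=D^,HV^=MT,ObH=DT^,ObHK=DMT,KWT=HY,D\T=HY,D[=K,KP=D,FT=DV,";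
  "EV=F,D`Y=Fb,D`K=FM,K`D=FM,ObEKK=DFM,DK`=FM,MQF=DE`,ObEFM=DDD``,F]=DS`,QbF=DS`,OSEE=DFQQ,";
  "FGQ=EES,MQ=D_,DK_=EM,ObEEM=DDD_`,ObEI=DD_,DaY=Gb,YaD=Gb,DYa=Gb,G]=DSa,QbG=DSa,FG=EEY,";
  "KSV=FY,OSF=DQQVV,FP=DQV,MQV=D`,ObFFM=DDDV``,ObKK=DMV,KR=DY,MP=D^,ObM=DV^^,T`=V^,ObM_=D^^`,";
  "DS_=E],S_D=E],`aD=E_b,Qb=],`aDQ=E]_,D_S=E],EV]=DS`,`aDDQS=EE]],EW]=DSa,`aDDS=EE]b,M]=D_b,";
  "HR=DTW,Dj=Y,ST=R,VW=Y,PY=R,DjP=R,VWP=R,OR=PPV,PS=QR,DjQ=S,VWQ=S,DcQ=B_,Oa=Q^,B`^=D__,";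
  "Bo=__,BoZZ=cc,Oe=QZ^,JQ=C,EZQ=C,CG=BEX,Na=X,BX_=Ca,EcQ=C_,OaC=BQ_,Ne=XZ,_e=ac,BXc=Ce,Za=e,";
  "XcB=Ce,BcX=Ce,Co=U__,C`=EU_,Ua=X_,Nc=UZ,ChZ=JXc,Ch=JX_,Ck=UXX,Ci=UU,CoZZ=Ucc,CnZ=Xc,Cn=X_,";
  "Cne=Xac,Che=JXac,Xgc=eh,cgX=eh,Xg_=ah,JS=EX,EIX=GJ,JQG=BEX,GZ=IX,JW=IX,Ge=IXa,Bk=XX,";
  "Al=PW^,Po=Q^m,VZP=,Oj=Pi,PU=Q,Nm=i,Di=V,Dm=V^,P`=QV^,Do=^`,O]`=QQVV^^,O]__=QQ^^`,`aQ^=]__,";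
  "Ra=W],VWQ^=],P]=QR^,R`=V],Dl=R^,Pb=R^,T]=R^,VW^=b,Nn=j,R[=Y,RZ=W,Pk=QWj,P\=W,P[=,Oj[=i,";
  "TU=,VZ=[,Ki=V[,Nd=[,OY[=V,KZ=L,H[=LT,NdH=LT,HJ=II,Id\=Lg,\dI=Lg,I\d=Lg,LM=IKd,OgL=Id,";
  "OgK=M,Ibd=Mg,bdI=Mg,Idb=Mg,\b=Yg,Lf=H\d,TgL=H\d,LMT=HKd,ObHKd=MMT,Mf=Hbd,TgM=Hbd,";
  "H_Kbd=MMg,HYd=Kf,K^f=Hbd,\bHd=Kfg,YdH=Kf,Tg=f,\bHTd=Kff,HdY=Kf,\bT=Yf,KZf=H\d,HJ\\dd=LLgg,";
  "L^=Id,Hc=IZ^,Og=^,MZ=Id,He=IWZ^,KWf=HYg,Hj=T\,\^T=f,ZbT=f,ObHd=MT^,Hm=Td,Lm=[d,Li=[[,";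
  "J[=LU,NdJ=LU,Kc=Jd,OgJ=I_,G\=IXY,JbG=EIYa,EnQ=S_,X`Q=SU_,EkQ=SUX,N`E=FU,OSEU=FQQ,OYKU=F,";
  "UbF=EY`,ObEKKK`=FFMM,Ek=UXY,En=Y_,X`=UY_,OSU_=QQ`,Eo=_`,Lh=J\d,UgL=J\d,JdY=Kh,YdJ=Kh,";
  "JYd=Kh,KZh=J\d,BL=IJ,\e=XZg,B\=IX,BdZ=Ic,J^Z=Ic,Bd=I_,J^=I_,Bg=Ia,EgM=IK_b,ObIKK_=EMM,";
  "ObKKK__=EMM`,`gM=K_bd,ObKK_d=MM`,Ye=Xg,\a=Xg,VW]=Sb,Rf=TWb,bj=Yn,R\=WY,Yl=Rn,Rk=SWj,RU=S,";
  "Si=QVj,VkQ=SUj,FjQ=SUV,N`=UV,OSU=QQV,Fi=UVV,F[=KUV,UbV=Y`,ObKKK`=FMMV,Fj=UVY,S[=UY,Vk=UYj,";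
  "S\j=Yk,UWj=k,Xj=k,NnX=k,S\=XY,UW=X,SZ=X,SZj=k,GkQ=SXX,Gk=XXY,ak=XXn,Sl=QRn,QTn=l,Rm=Vl,";
  "VWl=Rn,^j=n,Pn=l,^jP=l,WmP=l,il=Pjm,Pd=^,Ond=^m,To=^m,VZ^=d,[^=d,On[=m,di=[m,Q[=U,OjU=Qi,";
  "VZQ=U,V\=Y[,Kj=Y[,[b=Yd,Vf=TYd,ObKKd=MMV,OYUd=`,[`=UVd,Km=Vd,Ko=`d,`h=UY_d,fh=gg,Kah=JY_g,";
  "Ik=X\,BgZ=Ie,`a^=__b,So=Q`n,`j=UVn,OnU`=QVo,QdV=`,U^V=`,`m=Vo,OnU=Qm,Qdm=o,U^m=o,io=Umm,";
  "cm=Zo,OnUc=QZo,QdZ=c,U^Z=c,OnU_=Qo,Qd=_,U^=_,`cQ=U__,On__=Q^o,`cQ^=___,Oncc=QZZ^o,";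
  "Ono=Q^mm,VZQ^m=o,On``=QVV^o,On`d=V^o,Mo=^`d,Obd=V^^,Mm=V^d,`g^=_bd,Ob_d=^^`,Mc=I_d,";
  "OeI=BZ^,ao=__n,]c=_a,]o=Q^`n,]l=QR^n,`aQ=S__,En]=S_b,`a]=S__b,`a=Y__,Sh=XY_,_k=UXn,Sc=X_,";
  "Rd=b,bl=R^n,Yi=Vj,W[=\,Tk=Wj,\i=[j,JoZ=Ucd,Jo=U_d,OgJZ=Ic,XcI=Je,J^e=Iac,Q\=X,Q\j=k,";
  "ik=Ujj,[k=U\j,Jk=UX\,hk=UX\n,ck=UXZn,QhZ=Xc,XoZ=Ucn,Qh=X_,Xo=U_n,jo=Umn,Ul=Qn,Sm=QVn,";
  "km=Ujn,SdV=Y`,Xcg=eh,gk=X\n,ek=XXZn,el=QWZ^n,Wm=n,kl=QWjn,[l=n,dj=[n,\m=[n,dl=^n,fm=Tdn,";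
  "H_bd=M^g,bo=^`n,Ym=Vn,OnUd=o,VZo=Udm,[o=Udm,`c=U_d,Yo=`n,hoZ=Ucdn,IoZ=cd,Io=_d,go=_dn,";
  "`c^=__d,On_d=^o,eoZ=ccn,Qhe=Xac,fj=T\n,fl=TW^n,\l=Wn,bm=V^n,VZl=n,lo=Q^mn,Oncd=Z^o,";
  "goZ=cdn,ho=U_dn,MU=K_,U]=S_,]d=_b,Hn=f,Jn=h,Eh=JY_,Gg=IYa,JM=IK_,bh=Y_g,Ma=I_b,GK=EIY,";
  "OeJ=Bc,BY=G,B]=DQa,CS=EQX,S^=],GO=DQ,BF=EE,BK=EI,GOI=BD,De=Ia,AC=BB,Af=HW^,Xf=Wg,NdI=L,";
  "LW=I\,MW=Ib,DL=IK,HaY=IWb,MN=K,NaD=G,H_K=IM,H_Y=Ib,af=W^g,Vf^=Tbd,OYH=DT,WdT=f,DLT=HK,";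
  "T`K=MV,T`Y=Vb,OYEK=DF,O]EE=DDQQ`,KQ=E,OYI=D,MSV=Fb,KQV=F,OYK=DV,MR=Db,QY=S,F_=E`,V_=`,";
  "MS=Eb,DeQ=Ba,GZQ=BX,N_I=J,N_B=C,EeQ=Ca,OeC=BQc,NcB=CZ,NcI=JZ,Z_=c,X_B=Ca,B_X=Ca,CF=EEU,";
  "Ue=Xc,BnZ=e,Bn=a,_gX=ah,IS=G,CI=BJ,IQ=B,EZ=J,EW=G,Wh=Xg,Ee=Ja,Ol=PPm,Nl=Pj,GR=DSW,FR=DSV,";
  "[f=T\d,Nf=T\,O\=,If=Hg,MY=Kb,IT=H,\^=g,cf=Z^g,Zb=g,ef=WZ^g,L^T=Hd,MZT=Hd,Of=T^,[h=U\d,";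
  "Nh=U\,Oh=_,E\=JY,DnQ=],FXQ=ESU,N_=U,MUF=EK`,Fn=Y`,Gn=Ya,FX=EUY,Fo=``,Ih=Jg,LY=K\,YZ=\,";
  "CL=JJ,\c=Zh,C\=JX,CdZ=Jc,^hZ=cg,C^Z=Bc,Cd=J_,C^=B_,^h=_g,I`=K_,Yc=h,YcI=Jg,\_=h,]j=Sn,";
  "MUV=K`,Ri=PVj,in=jm,^i=m,Wi=j,LV=K[,Lj=[\,M[=Kd,HV=KT,J`=KU_,I`^=M_,bc=_g,]e=aa,Sg=Ya,";
  "Se=Xa,OhZ=c,C^e=Bac,^he=acg,QgZ=e,]dV=`b,X_g=ah,_f=^g,Qg=a,Mn=bd,Ln=\d,Ed=K_,Dg=Ib,DJ=EI,";
  "Xb=Ya,ad=_g,KX=JY,OXJ=C,CY=EX,G^=Da,F^=D`,CK=EJ,Wd=g,afY=Wbg,N`D=F,_fY=bg,MWT=Hb,LWT=H\,";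
  "M]V=D`b,D_K=EM,K_D=EM,GeQ=BXa,OX=Q,G_=Ea,Ug=h,BU=C,I]=Da,CW=BX,RaY=SWb,R`Y=SVb,H[Y=KT\,";
  "DY`=Fb,Y`D=Fb,J[Y=KU\,EL=JK,FnQ=S`,GnQ=Sa,DU=E,Dn=b,IX_=Ja,IdY=Kg,YdI=Kg,Lc=JZd,X^Z=e,";
  "FI=EK,L_=Jd,DUV=F,FJ=EKU,be=ag,]g=ab,X^=a,In=g,Fd=K`,DX=G,de=cg,GOJ=BE,BY_=Ea,K^=M,N_D=E,";
  "N]=S,D_Y=Eb,X_I=Ja,GU=EX,IS_=Ea,Wc=e,Y]=Sb,I`D=EM,\_I=Jg,U]V=S`,Dd=M,X]=Sa,CD=BE,Xd=h,";
  "OXI=B,Y^=b,IU=J,W_=a,DY_=Eb,Df=Hb,LX=J\,DdY=Kb,"]%string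
  [:: 24; 30; 31; 33; 35; 45]
  [:: [:: 0; -1; 1; -1; 0; 1]; [:: -1; 0; 0; 1; 0; 0]; [:: 1; 1; -1; -1; 1; 0]; [:: 1; 1; -1; 0; 0;
  0]; [:: 0; -1; 1; 0; 0; 0]; [:: 1; 1; 0; -1; 0; 0]]%coqZ
  1%coqZ
  [:: ([:: Free 0; Free 3; Free 4; Free 5; Free 7; Free 9; Free 10; Free 14; Free 15; Free 22; Free
  26; Free 28; Solve 5 8; Solve 1 1; Solve 8 11; Solve 31 17; Solve 76 12; Solve 75 20; Solve 81 31;
  Solve 10 6; Solve 13 13; Solve 3 2; Solve 33 16; Solve 40 25; Solve 48 19; Open 54 33 32; Solve 58
  21; Solve 57 27; Solve 84 34; Solve 80 24; Solve 29 23; Dom 74 29; Solve 97 30; Solve 35 18], (0,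
  1, 5), [:: (5, 8); (1, 5); (8, 11); (76, 28); (75, 26); (81, 31); (3, 6); (33, 16); (80, 34); (31,
  15); (10, 9); (13, 13); (40, 25); (48, 19); (84, 33); (54, 32); (58, 21); (57, 27); (29, 23); (74,
  29); (97, 30); (35, 18)]); ([:: Free 0; Free 3; Free 4; Free 5; Free 7; Free 9; Free 10; Free 14;
  Free 15; Free 22; Free 26; Free 28; Solve 1 1; Solve 8 11; Solve 5 8; Solve 46 20; Solve 31 17;
  Solve 76 12; Solve 14 13; Solve 11 6; Solve 6 2; Solve 36 25; Solve 45 19; Solve 25 16; Solve 81
  31; Open 54 33 32; Solve 79 24; Solve 86 30; Solve 83 34; Solve 20 18; Solve 59 27; Solve 90 21;
  Dom 37 29; Solve 71 23], (0, 3, 5), [:: (1, 0); (8, 4); (5, 8); (46, 15); (31, 17); (14, 13); (11,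
  6); (6, 2); (81, 28); (54, 32); (79, 24); (86, 30); (83, 34); (20, 18); (76, 22); (36, 25); (45,
  19); (25, 16); (59, 27); (90, 21); (37, 29); (71, 23)]); ([:: Free 33; Free 15; Free 22; Free 28;
  Free 14; Free 12; Free 3; Free 29; Free 7; Free 9; Free 10; Free 0; Free 26; Solve 81 31; Solve 76
  17; Solve 75 20; Solve 84 34; Solve 89 30; Solve 31 5; Solve 10 6; Dom 68 13; Solve 1 1; Dom 39 8;
  Solve 48 19; Solve 3 2; Solve 12 11; Solve 33 16; Dom 72 23; Solve 50 21; Dom 43 18; Solve 57 27;
  Solve 40 25; Dom 100 32; Dom 5 4; Solve 95 24], (0, 3, 5), [:: (81, 28); (75, 17); (84, 34); (89,
  30); (10, 6); (1, 0); (48, 19); (3, 2); (12, 8); (33, 16); (50, 21); (5, 4); (76, 22); (31, 15);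
  (39, 29); (72, 23); (43, 18); (57, 27); (40, 25); (100, 32); (68, 13); (95, 24)]); ([:: Free 33;
  Free 26; Free 20; Free 11; Free 1; Free 29; Free 15; Free 4; Free 14; Free 32; Free 10; Free 9;
  Free 22; Solve 8 3; Solve 50 21; Solve 57 27; Solve 54 31; Solve 94 24; Solve 47 5; Solve 49 19;
  Solve 88 34; Dom 104 30; Solve 73 23; Solve 52 25; Dom 44 28; Solve 80 12; Solve 87 17; Solve 93
  13; Solve 68 6; Solve 77 7; Solve 21 2; Dom 62 16; Dom 96 8; Dom 100 18; Dom 19 0], (2, 3, 6), [::
  (57, 20); (47, 1); (104, 34); (52, 9); (44, 28); (96, 13); (100, 23); (50, 10); (54, 31); (49,
  19); (73, 22); (93, 4); (88, 24); (87, 17); (94, 14); (8, 3); (80, 12); (68, 6); (77, 7); (21, 2);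
  (62, 16); (19, 0)])].

Definition cert6 : cert := Cert
  [:: Free 0; Free 4; Free 9; Free 15; Free 16; Free 18; Free 24; Free 19; Free 25; Free 29; Free
  30; Free 31; Free 32; Solve 41 27; Solve 56 21; Solve 71 23; Solve 101 33; Solve 102 34; Solve 17
  1; Solve 19 2; Solve 45 5; Solve 49 11; Solve 54 10; Solve 58 20; Solve 59 26; Solve 60 6; Solve
  64 13; Solve 69 12; Solve 73 22; Solve 74 28; Solve 86 17; Solve 90 8; Solve 92 14; Solve 8 3;
  Solve 12 7]
  [:: [:: 2; -1; 2; -1; -1; 2; -1]; [:: 0; 3; -3; 0; 0; -3; 0]; [:: 1; -2; 1; 1; 1; 1; 1]; [:: -1;
  2; -1; 2; -1; -1; -1]; [:: -1; 2; -1; -1; 2; -1; -1]; [:: 0; -3; 3; 0; 0; 0; 3]; [:: 0; 0; 0; 0;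
  0; 3; 0]]%coqZ
  3%coqZ
  [:: [:: -1; 0; 0; 0; 0; -1]; [:: -1; 0; 0; 1; 0; 0]; [:: -1; 0; 1; 1; 0; 0]; [:: -1; 1; 1; 1; 0;
  0]; [:: -1; 1; 1; 2; 0; 0]; [:: -1; 1; 1; 2; 1; 1]; [:: -1; 1; 2; 2; 0; 0]; [:: -1; 1; 2; 2; 1;
  1]; [:: -1; 1; 2; 1; 0; 1]; [:: -1; 1; 1; 2; 1; 0]; [:: 0; -1; -1; -1; -1; -1]; [:: 0; -1; -1; -1;
  0; -1]; [:: 0; -1; 0; 0; 0; -1]; [:: 1; 0; -1; -1; 0; 0]; [:: 0; 0; 0; 0; 1; 0]; [:: 0; 0; 0; 1;
  0; 0]; [:: 0; 0; 1; 0; 0; 0]; [:: 0; 0; 1; 1; 0; 0]; [:: 0; 0; 1; 1; 1; 0]; [:: 1; 0; 0; -1; 0;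
  0]; [:: 1; 0; 0; 0; 0; 0]; [:: 0; 1; 1; 1; 1; 1]; [:: 0; -1; -1; -1; -1; 0]; [:: 0; -1; 0; -1; -1;
  0]; [:: 0; -1; 0; -1; 0; 0]; [:: 0; 0; 0; -1; -1; 0]; [:: 0; 0; 0; 0; -1; 0]; [:: 0; 0; 0; 0; 0;
  1]; [:: 0; 0; 1; 0; -1; 0]; [:: 0; 0; 1; 0; 0; 1]; [:: 1; 0; 0; -1; -1; 0]; [:: 0; 1; 1; 0; 0; 1];
  [:: 1; 0; 0; 0; 1; 0]; [:: 1; 0; 0; -1; 0; 1]]%coqZ
  35
  [::]
  [:: -3049; -2721; -88; -1473; -3245; -3882; -1346; -1335; -1002; -1812; -1194; -1688; -1534;
  -4997; -1220; -1950; 389; 41; -789; -1338; -1557; -1392; -2410; -276; -1207; -993; -1448; -2074;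
  464; 357; -1234; -1074; -1886; -582]%coqZ
  [:: "Ga=JQU,J]=G,KV=,EQ=G,DR=G,CU=R,GM=JKQR,CUD=G,AG=DJKQ,CV=H,FG=EH,GI=DH],CUD[=E],IKE=CD[,";
  "B]=C[,CN=,K\E=B[,AE=DJK,BH=CF,EO=J,J\=F,EO\=F,DW=BZ,K\D=BZ,A[=DK,BQ=C,DL=A,KOD=A,JZ=D,";
  "AF=BDO,A\=BOZ,AW=BLZ,KO=L,JZL=A,APO=JL,AP=JK,BT=,A_=DKT,NQ=T,AU=JKT,CT=Q,AH=CDO,AI=CDOZ,";
  "A]=DKQ,AX=CLZ,AM=JKLQ,AS=JLQ,AY=CLOZ,Ab=OZ,Aa=JLT,AbK=LZ,A`=DOZ,AV=DO,Db=`,O_=T,T\D=`,";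
  "VZ=`,Da=JT,OUD=JT,DPO=J,BV=F,BV[=E\,BUD=E,BU=P,EL=JK,BR=CP,EW=B[,BX=CW,K\=W,PZ=[,L[=K,";
  "PZL=K,JW=B,BM=CLP,BS=COP,FL=BO,DPO\=F,B^=C\,PZO=,L\=OW,BY=COW,BbK=W,BaK=LP,Ba=OP,BbL=OW,";
  "Bb=\,FI=DH\,D[H=EI,EOI=DH,H[D=EI,\]DDH=EII,EQI=DH],CVD[=EI,DH[=EI,\]D=I[,IK=CZ,O]=Q,Q\D=I,";
  "DS=JQ,GO=JQ,DX=CZ,CbK=X,K^=X,RZ=],W]=X[,KY=LX,QW=X,MW=LPX,PQL=M,CaK=M,PQ=R,EM=JKR,EX=C[,";
  "P]=R[,E^=H[,R\E=HP[,ES=JR,IP=H[,\]E=H[[,HX=C^,R\=P^,S[=R,OR=S,J^=H,HM=CS,HL=CO,PQO=S,";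
  "FS=HOP,HW=C\,S\=OP^,HY=CO^,IS=HQ,GS=JQR,M]=KQR,MZ=KQ,L]=KQ,Cb=^,IX=CZ^,Y]=QX,CbL=Y,";
  "MZY=LQX,LSX=MY,SXL=MY,LXS=MY,MO=LS,JYM=CLS,Ca=S,JY=CO,QWO=Y,PZY=X,Y[=X,RW=PX,X\=W^,M[=KR,";
  "CbM=SX,M^=SX,RY=SX,PQY=SX,UX=KRb,MU=KRa,JbK=,MN=Ka,MT=KQa,LU=Ka,PTL=Ka,NR=U,PT=U,Ea=JU,";
  "HUD=GV,E_=DU[,N]E=DU[,DbKU=_,T]=Q_,DbK=Z,K`=Z,N]=_,T[=_,NX=Kb,W_=K[b,TW=Kb,Wa=LPb,Za=T,";
  "L_=KT,TX=KQb,Ya=LSb,JbM=S,JbL=O,LV=O,ST=Qa,PTO=a,NS=a,Jb=V,Ha=SV,INE=DV[,IN=`,\_D=[`,";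
  "U`=V_,DbU=V_,IT=Q`,IW=CZ\,Q\=^,IY=COZ^,\]=[^,I_=]`,HU=RV,U\E=PV[,RT=QU,SU=Ra,MV=S,[a=U,";
  "UW=KPb,_a=TU,OU=a,Fa=OPV,U\=Pb,N^=b,VW=\,\a=OPb,NY=Lb,TWO=Lb,L`=OZ,TY=LQb,X_=K]b,]a=QU,";
  "T^=Qb,U^=Rb,^a=Sb,S]=QR,VX=^,Y\=OW^,Ib=^`,W`=Z\,VY=O^,Y`=OZ^,T\=b,\_=[b,X`=Z^,^_=]b,IR=H],";
  "C_=],HK=C,BG=CE,FK=B,BI=CD\,J[=E,IJ=DH,FT=V,UZ=_,B`=D\,B_=[,FW=B\,IPO=H,O[=,F[=E\,G[=E],";
  "Q[=],C`=I,FQ=H,KS=M,SW=PY,GX=C],GP=ER,D^=I,FR=HP,DP=E,S`=QV,SZ=Q,OX=Y,JX=C,L^=Y,LR=M,";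
  "EbK=[,GT=DQU,GN=DU,ET=DU,Xa=Mb,HN=V,U\D=V[,E`=DV[,Eb=V[,HT=QV,IU=V],FU=PV,`a=TV,Hb=V^,";
  "DR[=E],BH[=CE\,J_=DU,EZ=D[,P`O=V,G_=DU],F^=H\,G^=H],P_=U[,GbK=],FUD=EV,H`=IV,Gb=V],Fb=V\,";
  "R_=U],J`=DV,HZ=I,P`=V[,F`=DV\,R`=V],FZ=D\,GZ=D],"]%string
  [:: 6; 9; 10; 16; 17; 20]
  [:: [:: 0; 0; 0; 0; 0; 1]; [:: 1; 0; 0; 0; -2; 1]; [:: 0; 0; 0; 1; 0; 0]; [:: 0; 0; 0; -1; 1; 0];
  [:: -1; 1; 0; 1; 0; 0]; [:: 0; -1; -1; -1; 1; -1]]%coqZ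
  1%coqZ
  [:: ([:: Free 0; Free 4; Free 9; Free 15; Free 16; Free 18; Free 19; Free 24; Free 25; Free 29;
  Free 30; Free 31; Free 32; Solve 41 27; Solve 71 23; Solve 56 21; Solve 17 1; Solve 19 2; Solve 49
  11; Solve 102 34; Solve 74 28; Solve 73 22; Solve 103 33; Solve 24 3; Solve 59 26; Solve 94 14;
  Solve 54 10; Solve 82 7; Solve 87 17; Solve 81 12; Solve 90 8; Solve 25 20; Solve 45 5; Solve 61
  6; Solve 96 13], (3, 4, 6), [:: (71, 16); (56, 15); (49, 1); (74, 28); (73, 22); (103, 24); (59,
  26); (54, 10); (45, 5); (96, 8); (41, 18); (102, 30); (87, 17); (90, 4); (25, 20); (17, 0); (19,
  2); (24, 3); (94, 14); (82, 7); (81, 12); (61, 6)])].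

Definition cert7 : cert := Cert
  [:: Free 0; Free 4; Free 8; Free 12; Free 13; Free 15; Free 16; Free 14; Free 24; Free 29; Free
  30; Free 31; Free 32; Solve 92 18; Solve 98 34; Solve 34 6; Solve 68 28; Solve 69 9; Solve 74 25;
  Solve 83 7; Solve 91 23; Solve 4 2; Solve 5 3; Solve 30 5; Solve 33 17; Solve 36 26; Solve 37 27;
  Solve 52 11; Solve 59 33; Solve 60 19; Solve 61 22; Solve 81 10; Solve 85 20; Solve 90 21; Solve 0
  1]
  [:: [:: 3; 0; 0; 0; 0; -3; -3]; [:: -1; 2; -1; -1; -1; 2; 2]; [:: -1; -1; 2; -1; -1; 2; 2]; [:: 0;
  0; 0; 0; 0; 3; 0]; [:: 2; -1; -1; 2; 2; -4; -1]; [:: 0; 0; 0; 3; 0; 0; 0]; [:: -2; 1; 1; -2; 1; 1;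
  1]]%coqZ
  3%coqZ
  [:: [:: -1; -2; 0; -2; -1; 0]; [:: -1; -2; 0; -2; 0; 0]; [:: -1; -2; 0; -1; 0; 0]; [:: 0; -1; 0;
  -1; 0; 0]; [:: 0; -1; 0; 0; 1; 1]; [:: -1; -2; -1; -2; -1; 0]; [:: 0; -1; -1; -1; 0; 0]; [:: -1;
  -1; 0; -1; -1; 0]; [:: -1; -1; 0; -1; 0; 0]; [:: -1; -1; 0; -1; 0; 1]; [:: -1; -1; 1; -1; 0; 1];
  [:: -1; -1; 1; 0; -1; 0]; [:: -1; -1; 1; 0; 0; 0]; [:: -1; -1; 1; 0; 0; 1]; [:: -1; -1; 1; 0; 1;
  1]; [:: -1; -1; 1; 0; 1; 2]; [:: 0; 0; 0; 0; -1; -1]; [:: 0; 0; 0; 0; 0; 1]; [:: 0; 0; 0; 0; 1;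
  0]; [:: 0; 0; 0; 0; 1; 1]; [:: 0; 0; 0; 1; 0; 0]; [:: 0; 0; 1; 0; -1; 0]; [:: 0; 0; 1; 0; 0; 0];
  [:: 0; 0; 1; 0; 0; 1]; [:: 0; 0; 1; 0; 1; 1]; [:: 0; 0; 1; 1; 0; 0]; [:: 0; 0; 1; 1; 1; 1]; [:: 0;
  1; 0; 0; 0; 0]; [:: 1; 1; 0; 1; 1; 1]; [:: 1; 1; 1; 1; 0; 0]; [:: 1; 1; 1; 1; 1; 1]; [:: 0; 1; 1;
  1; 0; 0]; [:: 1; 2; 0; 2; 0; 0]; [:: 1; 2; 1; 2; 0; 0]; [:: 1; 2; 1; 2; 1; 1]; [:: 1; 2; 2; 2; 0;
  1]]%coqZ
  35
  [::]
  [:: -2473; -1647; -740; -1450; -1102; -4992; -3811; -1255; -366; -1480; -734; -1769; -371; -24;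
  956; -216; -3014; -1254; -4680; -304; -2705; -2174; -764; -436; 447; -568; 1176; -3966; -830;
  -1743; 9; -531; -2940; -331; 1231; -751]%coqZ
  [:: "RS=T,E\=T,G_=D],DaT=],B]=DT,GY=DT,C\D=B,BE=CDT,BEQ=CD,GW=D,BRQ=A,BR=AT,DJ=AT,BX=AY,BV=AW,";
  "BH=AI,C\=I,KQB=AIW,FW=A,AGI=BF,GIA=BF,JQB=AI,FK=AJ,AIG=BF,BRF=AGJ,C\AG=BF,FT=GJ,JQG=F,";
  "AYI=BK,IYA=BK,AIY=BK,C\AY=BK,KT=JY,AIT=BJ,C\AT=BJ,GYJ=ATT,AUI=CH,JQ=H,IRQ=H,AU=CQR,C\QR=H,";
  "FV=AQR,AUJ=CHR,C\R=J,AUGJ=CFR,C\GQR=F,AE=CDR,C\DQR=A,GV=DQR,C\DR=AT,GX=DR,A[=CX,RY=TX,";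
  "TV=X,C\DRV=AX,DH=A,RW=X,QX=V,AZ=CV,RWQ=V,C\DV=AW,VY=WX,C\DX=AY,AP=CJX,C\TX=JY,GXJ=ART,";
  "AUT=CR,AaT=R,AaGJ=FR,Aa=QR,AaI=H,AaJ=HR,Ac=X,JV=HX,C\X=K,KV=HWX,KQ=HW,AM=CHW,IV=HW,AL=CHV,";
  "C\V=HW,AN=CHX,C\RV=HX,Ad=VX,Ab=V,A_=DX,A^=DV,A]=DR,Z\D=W,EV=DRZ,RSQ=,C_=D[,EX=DR[,TZ=[,";
  "RSZ=[,EW=D[,EWQ=DZ,DM=CW,BZ=CW,B[=CY,BO=CIY,JS=IT,GYI=BT,BU=C,BM=CIW,B`=IW,Ba=,Bc=Y,Ya=c,";
  "O\=IIc,IP=JO,UYI=O,CcI=O,GO=CT,JM=HO,KUI=HO,KM=HOW,HS=I,IN=HO,OQ=M,UWI=M,C`=M,IL=HM,FM=CH,";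
  "HZ=L,UWH=L,MRQ=L,MR=N,CdH=NV,RWL=NV,FL=CHQR,UVH=LQR,UV=QRZ,UW=Z,L[=NZ,CdL=NVZ,Cd=V[,";
  "DNZ=CV[,RWZ=V[,XZ=V[,DN=CX,OV=NW,PV=NX,CcH=N,UXHP=NNR,MP=NO,UXHO=NN,KN=HOX,PW=OX,MX=NW,";
  "UWHO=MN,Cc=[,NS=O,OZ=M[,UWO=M[,NSZ=M[,EM=C[,EMQ=CZ,IZ=M,GM=C,I[=O,MY=OW,MT=O,CcJ=P,JXO=KP,";
  "OXJ=KP,KUJ=HP,JOX=KP,UXJJ=HPR,UYJ=P,OXT=PY,UXJT=PR,GP=CRT,Ca=U,EJ=CRT,U\R=Ja,U\=Ia,F`=H,";
  "Fb=QR,U\QR=Ha,U\GQR=Fa,GcJ=RT,J]=RT,GcI=T,EI=CT,EIQ=C,EO=CT[,EY=DT[,YZ=W[,UXP=NR[,PZ=N[,";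
  "UXO=N[,NY=OX,K[=OX,CcK=OX,A`=HW,Ib=`,QcI=`,WaI=`,M\=I`,Ma=U`,O`=IMc,K`=HIWc,Ka=Hc,J`=HIc,";
  "Oa=IUc,P\X=JKc,J_=TX,XaT=Rc,P\R=JJc,Pa=JUc,Jd=HXc,XaJ=HRc,Jb=Hc,H]=R,R`=Hc,U\Rb=Hac,";
  "Na=HUc,Qc=b,R`Q=Hb,La=HUb,L\QR=HHb,Qd=Vb,L\V=HHWb,L`=HMb,Md=NWb,NVb=Ld,RWb=d,VbN=Ld,";
  "NbV=Ld,UdH=LRb,UdHc=NRbb,Pb=Nc,Pd=NXc,Ob=Mc,N`=HMc,UWHc=Nb,HSb=`,UW`=Mb,M\b=``,Wa=b,";
  "`d=HWbc,V`=HWb,H^=V,Va=QRb,U\b=`a,ad=Rbb,N\Rb=HHcc,L\RV=HHd,H_=X,N\RVV=HHXd,N\Rd=HHXcc,";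
  "N\d=HHWcc,Od=NWc,Y`=IWc,G`=,I]Q=,I]=T,Gc=],U\]=Ta,Ea=U],E\Q=,G^=DQ],D][=E_,[^=Z_,D]Z=E^,";
  "RS^=_,Z]D=E^,DZ]=E^,EW^=DZ_,E\^=_,Da=Q],B]Q=D,B^=DW,B_=DY,[\D=Y,Dd=V_,RW^=V_,[\DV=WX,";
  "[\DRV=XX,Z\DR^=V_,Z\DQR=V,Vb[=Zd,N_Z=V[[,Ud=RZb,L^=VZ,N_b=[d,Zc=[b,NSb=Mc,UWc=[b,M]=[,";
  "M]Q=Z,Z`=Mb,PS=OT,UY=[,[`=Mc,M_=W[,SdZ=W[b,Sd^=W_b,Z\^=Wb,^`=Wb,]`Q=b,U\Q]=a,^a=Q]b,Gb=Q],";
  "Ec=[],U_T=[],EP=CRT[,EN=CR[,Eb=Z],U_=Z],U^=QZ],Tb=c,[a=Uc,O]=T[,I_=Y,T`=Ic,Za=Ub,Z\Q]=b,";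
  "Z\]^=_b,RSb=c,[\]b=cc,_a=]b,[\]=Tc,_aT=]c,U\]b=ac,]`=c,U_c=[]b,]d=R_b,[\DR=TX,DP=CTX,";
  "[\_=Yc,P_=TX[,UXT=R[,N_=X[,V_b=^d,Z\R^=d,_bV=^d,Z\QR^=Vb,Td=Xc,[\R_=TXc,P]=RT[,P\TX=JJYc,";
  "Sd=Wc,[\_b=Wcc,Yb=Wc,_`=Wc,Vb_=^d,Z\V_=Wd,[\VV_=WXd,[\RVV_=XXd,[\R_d=XXcc,Kd=HWXc,";
  "Udc=R[bb,N]=R[,[\R_bb=ccd,[\_d=WXcc,Yd=WXc,G[=E,IRGQ=F,DF=AG,DK=AY,HY=K,GH=F,QY=W,GWI=B,";
  "IR=J,QT=,KR=JX,FX=AR,C^=DZ,X]=R_,T^=_,W]Q=^,AO=CK,KS=IY,FS=GI,AcI=K,IX=K,IXT=JY,FO=CJ,";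
  "H[=N,CbH=L,Cb=Z,DL=CV,X^=V_,LX=NV,JN=HP,JW=K,LO=MN,LS=M,TXO=PY,OTX=PY,FP=CJR,EF=CGR,Fc=R,";
  "F]=GR,FcI=J,Y]=T_,Y^=W_,LP=NN,NT=P,J[=P,O\XX=KKc,K_=XY,Q_=^,NQ=L,N\VV=HHWd,MV=LW,MV[=NWZ,";
  "UVHN=LLR,H_b=d,GZ=EQ,[]D=E_,D[]=E_,W]=_,UV[=RZZ,UVN=LRZ,^c=_b,Lc=Nb,SX=Y,M^=WZ,SV=W,Dc=_,";
  "DUT=E,EL=CRZ,Db[=Z_,Db=^,DU[=EZ,DU=EQ,V]=R^,DO=CY,O_=Y[,L]=RZ,DI=B,HT=J,OR=P,C]=E,AS=B,";
  "Xb=d,TW=Y,Q[=Z,Vc=d,"]%string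
  [:: 3; 18; 19; 27; 28; 30]
  [:: [:: 1; 0; -1; 0; 1; 0]; [:: 0; 0; 0; 1; 0; 0]; [:: 0; 0; 0; 0; -1; 1]; [:: -1; 0; 0; -1; 0;
  0]; [:: 0; 1; 0; 0; 0; 0]; [:: 0; -1; 1; 0; 0; 0]]%coqZ
  1%coqZ
  [:: ([:: Free 0; Free 4; Free 8; Free 12; Free 13; Free 14; Free 15; Free 16; Free 24; Free 29;
  Free 30; Free 31; Free 32; Solve 92 18; Solve 98 34; Solve 34 6; Solve 91 23; Solve 69 9; Solve 67
  25; Solve 4 2; Solve 41 27; Solve 9 3; Solve 68 28; Solve 30 5; Solve 52 11; Solve 61 22; Solve 14
  10; Solve 97 33; Solve 12 7; Solve 88 20; Solve 51 26; Solve 90 21; Solve 27 17; Solve 1 1; Solve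
  58 19], (2, 4, 6), [:: (98, 14); (34, 0); (91, 4); (67, 9); (4, 2); (41, 15); (68, 12); (30, 5);
  (52, 11); (61, 22); (14, 10); (97, 33); (12, 7); (90, 21); (92, 24); (69, 31); (9, 3); (88, 20);
  (51, 26); (27, 17); (1, 1); (58, 19)])].

Definition cert8 : cert := Cert
  [:: Free 0; Free 1; Free 4; Free 5; Free 10; Free 12; Free 15; Free 11; Free 14; Free 30; Free 31;
  Free 32; Free 33; Solve 2 8; Solve 8 3; Solve 12 7; Solve 54 9; Solve 82 26; Solve 84 34; Solve 97
  27; Solve 99 13; Solve 104 29; Solve 6 2; Solve 10 6; Solve 31 17; Solve 32 18; Solve 46 20; Solve
  47 21; Solve 49 19; Solve 52 25; Solve 63 22; Solve 66 28; Solve 77 24; Solve 91 23; Solve 15 16]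
  [:: [:: 1; 1; 1; -2; -2; 1; -2]; [:: 1; 1; -2; 1; 1; -2; -2]; [:: 0; 0; 0; 0; 0; 0; 3]; [:: 1; -2;
  1; 1; 1; -2; 1]; [:: 0; 0; 0; 0; -3; 3; 0]; [:: 0; 0; 0; 0; 3; 0; 0]; [:: -2; 1; 1; 1; 1; 1; 1]]%coqZ
  3%coqZ
  [:: [:: -1; 0; 0; -1; -2; 0]; [:: 0; 0; 0; -1; -1; 0]; [:: 0; 0; 0; 0; -1; 0]; [:: 0; 0; 0; 0; 0;
  1]; [:: 0; 0; 1; 0; -1; 0]; [:: 0; 0; 1; 0; 0; 1]; [:: 1; 0; 0; 0; 0; 0]; [:: 0; 0; -1; -1; -1;
  -1]; [:: -1; 0; 0; 0; -1; 0]; [:: 0; 1; 1; 0; 0; 1]; [:: 0; -1; -2; -1; 0; -2]; [:: 0; -1; -2; 0;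
  0; -1]; [:: -1; -1; -1; 0; -1; -1]; [:: 1; 0; -1; 0; 1; 0]; [:: 0; 0; 0; 0; 1; 0]; [:: 0; 0; 0; 1;
  0; 0]; [:: 0; 0; 0; 1; 1; 1]; [:: 0; 0; 1; 0; 0; 0]; [:: 0; 0; 1; 1; 1; 1]; [:: 1; 0; 0; 0; 1; 0];
  [:: 1; 0; 0; 1; 2; 1]; [:: 0; -1; -1; 0; 0; -1]; [:: 0; -1; -1; 0; 1; -1]; [:: 0; -1; -1; 1; 1;
  0]; [:: 0; -1; 0; 1; 1; 0]; [:: 0; -1; 0; 1; 2; 0]; [:: 0; 0; -1; 0; 0; -1]; [:: -1; 0; 0; 1; 0;
  0]; [:: 0; 1; 1; 1; 1; 1]; [:: 0; 0; 0; 1; 1; 0]]%coqZ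
  35
  [::]
  [:: -2007; -857; -608; -833; -1154; -928; -1027; -1190; -1160; -1277; -1931; -649; -561; -992;
  -1222; -28; -28; -767; -78; -692; 91; 39; -759; 498; -23; -826; -936; -889; -1000; 243]%coqZ
  [:: "J^=],NR=T,OPJ=],QT=U,HU=N,G]=JPT,JV=,BPT=G,CT=G,GQH=CN,EN=G,BP=C,DGH=BCN,CR=E,AG=BC,HUE=G,";
  "GM=CV,GY=EUV,FG=BEU,BS=F,DE=CF,JYB=F,AUE=CF,FH=B,JMB=A,AY=FM,AV=BM,DEH=BC,AN=DH,CO=,";
  "AL=DHM,AX=DM,AU=D,DR=F,DRH=B,AT=B,EO=R,AGR=BE,AUR=F,AZ=FMO,AK=BHMO,A\=II,HS=,JM=I,DRHI=A,";
  "AQ=DI,DEHI=AC,DEI=ACS,FI=AS,JMF=AS,AP=CI,APR=EI,DRI=AS,A]=IJ,F^=S,MUOR=Z,OY=Z,RXO=Z,FW=BZ,";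
  "MU=X,DZ=FOX,FL=BX,DY=FX,FN=BU,JXB=D,BQ=D,DG=BCU,JLB=DH,DVH=BL,HX=L,MN=L,DV=BX,LU=NX,CW=V,";
  "NY=UV,GX=CUV,GO=T,HUR=T,ET=GR,BPR=E,GMR=EV,EZ=RY,FV=BY,MUR=Y,EX=CY,MUE=CY,HY=V,EL=CV,";
  "CK=HV,GL=CNV,GK=HTV,GW=TV,B]=J,JW=O,FT=BRU,JK=HO,DTH=BN,DK=BLO,DW=BOX,DT=BU,JZB=FO,JZ=OS,";
  "JXF=DS,DP=CQ,LS=X,IX=MQ,IL=HMQ,IN=HQ,JL=HQ,NS=U,JX=Q,IU=Q,C]=JP,EQ=CS,EQH=C,GI=C,IV=M,";
  "GS=EU,SV=Y,JY=S,C^=P,LY=VX,QV=X,C[=HP,QVH=L,GQ=CU,J[=H],QTH=N,D]=JQ,D\=IQ,D[=HQ,D^=Q,RX=Y,";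
  "CZ=Y,E^=PR,E\=IPR,E]=JPR,GIR=E,J\=I],QR=S,IT=,QRH=,I[=H\,OPI=\,M]=\,C\=IP,QY=SX,B^=,VZ=WY,";
  "OV=W,TX=UV,KU=NW,G^=PT,G[=HPT,TY=RUV,V]=^,OP=^,ST=RU,H^=[,OPH=[,T\H=[,K]=O[,OVH=K,MTHO=K,";
  "B[=H,LRHO=K,LR=V,LT=NV,LTHO=KN,MT=V,EK=HRV,EW=RV,KUR=TW,TZ=RUW,MTO=W,KZ=WW,LRO=W,KX=LW,";
  "LTO=NW,KY=VW,LZ=WX,NZ=UW,TXO=UW,PZ=Y^,X\=MQ^,S[=^,I^=\,N\=Q[,L\=MQ[,KQ=LO,KP=V[,K\=MO[,";
  "V\H=M[,E[=HPR,Y]=S^,U\R=S^,U\=Q^,QZ=OSX,QW=OX,LRO[=K^,OV[=K^,W[=K^,LTO[=KN^,MTO[=K^,V\=M^,";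
  "Y\=MS^,QR[=^,L]=Q[,V]H=[,QT[=N^,QV[=L^,X]=Q^,T\=^,Z\=MOS^,SW=Z,Z]=OS^,BI=A,IUE=CS,IY=MS,";
  "IUR=S,FQ=DS,FP=CS,FPR=ES,F]=JS,U[=N^,HW=K,W]=O^,U[R=T^,X[=L^,Y[=V^,PW=V^,"]%string
  [:: 9; 13; 15; 19; 20; 28]
  [:: [:: 1; 0; 1; 1; 0; -1]; [:: 0; 1; 0; 0; -1; 1]; [:: 0; -1; 0; 1; 0; 0]; [:: 0; 0; 1; 0; 0; 0];
  [:: -1; 0; -1; 0; 0; 1]; [:: 1; 0; 0; -1; 1; -1]]%coqZ
  1%coqZ
  [:: ([:: Free 0; Free 1; Free 4; Free 5; Free 10; Free 11; Free 12; Free 14; Free 15; Free 30;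
  Free 31; Free 32; Free 33; Solve 8 3; Solve 54 9; Solve 14 13; Solve 2 8; Solve 11 6; Solve 1 7;
  Solve 4 2; Solve 82 26; Solve 38 27; Solve 84 34; Solve 47 21; Solve 52 25; Solve 83 28; Solve 17
  18; Solve 49 19; Solve 48 20; Solve 63 22; Solve 44 29; Solve 92 24; Solve 91 23; Solve 27 17;
  Solve 30 16], (0, 2, 3), [:: (2, 4); (11, 13); (1, 3); (4, 2); (38, 30); (47, 21); (52, 32); (17,
  18); (49, 19); (30, 16); (8, 14); (14, 12); (82, 33); (92, 24); (54, 31); (84, 34); (83, 28); (48,
  20); (63, 22); (44, 29); (91, 23); (27, 17)])].

Definition cert9 : cert := Cert
  [:: Free 0; Free 4; Free 5; Free 8; Free 12; Free 15; Free 25; Free 27; Free 28; Free 29; Free 30;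
  Free 32; Free 33; Solve 32 18; Solve 37 6; Solve 39 7; Solve 41 16; Solve 43 17; Solve 44 26;
  Solve 59 31; Solve 66 9; Solve 81 10; Solve 82 14; Solve 84 34; Solve 92 24; Solve 5 3; Solve 12
  11; Solve 13 13; Solve 75 20; Solve 76 22; Solve 90 21; Solve 91 23; Solve 1 1; Solve 3 2; Solve
  45 19]
  [:: [:: 1; 1; 1; -2; 1; -2; -2]; [:: 1; 1; -2; 1; 1; -2; 1]; [:: 2; -1; -1; 2; -1; -1; -1]; [::
  -1; -1; 2; -1; -1; 2; 2]; [:: 0; 0; 0; 0; 0; 3; 0]; [:: -2; 1; 1; 1; -2; 4; 1]; [:: 0; 0; 0; 0; 3;
  -3; 0]]%coqZ
  3%coqZ
  [:: [:: 0; 0; 1; 0; 0; -1]; [:: 0; 0; 0; 1; -1; 0]; [:: 0; 1; 1; 1; 0; 0]; [:: 0; 1; 0; 1; -1; 0];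
  [:: 0; 1; 0; 2; -1; 1]; [:: 0; 1; 0; 2; 0; 1]; [:: -1; -1; 0; -2; 0; -2]; [:: 0; -1; 0; 0; 0; 0];
  [:: 0; 0; 1; 0; 1; 0]; [:: -1; -2; -1; -2; 0; -2]; [:: -1; -1; -1; -2; 0; -1]; [:: -1; -1; -1; -1;
  -1; -1]; [:: -1; -1; -1; -1; 0; -1]; [:: -1; -1; -1; -1; 0; 0]; [:: 0; -1; 0; -1; 0; -1]; [:: 0;
  0; 0; -1; 1; 0]; [:: 0; 0; 0; 0; 0; 1]; [:: 0; 0; 0; 0; 1; 0]; [:: 0; 0; 0; 0; 1; 1]; [:: 0; 0; 0;
  1; 0; 0]; [:: 0; 0; 0; 1; 0; 1]; [:: 0; 0; 0; 1; 1; 1]; [:: 1; 0; 0; 2; 0; 2]; [:: -1; -1; -2; -1;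
  -1; 0]; [:: 0; -1; -1; 0; 0; 0]; [:: 0; 0; -1; 0; 0; 1]; [:: 0; 0; -1; 1; -1; 1]; [:: 0; 0; -1; 1;
  0; 1]; [:: 0; 0; -1; 1; 0; 2]; [:: 1; 0; 0; 1; 0; 1]; [:: 1; 1; 0; 2; 0; 2]; [:: 1; 0; -1; 2; 0;
  2]; [:: 0; -1; 0; -1; 1; 0]; [:: 0; -1; 0; 0; 1; 0]; [:: 0; -1; -1; 0; 0; 1]; [:: 0; -1; -1; 1; 0;
  1]; [:: 1; 0; 0; 1; 1; 2]]%coqZ
  35
  [::]
  [:: -4403; -1567; -3169; -4030; -1429; -1131; -2958; -845; -1292; -3213; -2588; -1313; -983; 23;
  -2352; -3615; -5007; -1738; 1312; -582; 488; 779; -762; -2182; -1478; -895; 388; 754; 1757; -2292;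
  -1051; -1394; 239; -310; 649; 102; 382]%coqZ
  [:: "Ba=H,GW=H,IL=GU,QT=U,OU=H,ILO=GH,QTO=H,Bb=HT,G[=L,EH=BU,DH=B,BN=LU,CL=EG,DU=E,BND=EL,EO=B,";
  "QTD=E,BM=LT,BF=ET,AE=BC,G_=,BSD=E,C[=E,BR=T,C^=A_,DI=C,QTAD=BC,BP=,QTA=BI,AW=BI^,DI^=A_,";
  "O_=^,DIO=A,G^=O,AL=BG,QTDO=B,QTD^=B_,A`=T^,PT=R,AJ=GOT,AK=G,QRDO=,ASD=C,QRAD=C,AF=CT,AS=I,";
  "QRA=I,AV=IT,Aa=IO,AZ=,QRD^=_,De=_,P`=RZ^,DeO=^,K^=OZ,OSD=,PY=ORZ,GZ=K,JP=KOR,LP=K,BK=L,";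
  "KTO=J,LRO=J,G\=M,JND=LM,KT=M,LR=M,JSD=M,Db=T,BJ=LOT,EJ=LT,FJ=MT,CM=FG,STD=F,FN=EMS,C\=F,";
  "FP=DRS,CZ=DS,QR=S,CK=DGS,EP=DS,PU=S,Ca=I,PV=RS,FI=CV,RU=V,ST=V,Cb=IT,BS=U,Be=W,I[=U,U^=W,";
  "H_=W,H^=OW,I[O=H,LW=H[,Bc=H[,Bd=HT[,QT^=W,I[^=W,B]=U[,L_=[,B]D=E[,B\=T[,BZ=[,L^=O[,BX=L[,";
  "BY=OT[,B`=T[^,W`=T[^e,Wd=HT[e,Wb=HTe,HR=b,IdO=Hb,Ta=b,GeT=b,Ge=a,HP=a,HS=Ua,HV=Ub,HK=La,";
  "LS=N,KU=N,EK=DN,M]=N\,Q\=],EZ=D],S[=],N_=],EY=T[,E`=T[_,]`D=[\_,X_=Z[,Dc=[,LZ=X,K[=X,";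
  "Y]D=[\,X`=YZ[,O\=Y,QYD=[,DcK=X,QYDK=X,O]DK=X,MP=KR,NP=KS,MY=J\,KTY=J\,LRY=J\,J`=YY,DeY=`,";
  "R[=\,TZ=\,Y_=`,R[O=Y,TZO=Y,Y^=O`,R[^=`,TZ^=`,K`=YZ,K_=Z,P\=RZ,P]=SZ,Y]DK=X\,Nc=L]a,JN=LMa,";
  "Kb=Ma,KbO=Ja,JS=Ma,JV=Mb,IJ=Gb,OV=b,Pb=Ra,IKO=Ga,OS=a,QRO=a,IK=GS,IM=GV,Sb=Va,Ab=IOT,";
  "I`=Te,RW=Te,V^=Te,^b=OTe,IY=b,IZO=a,^a=Oe,IZ^=e,QR^=e,PW=e,Wa=He,Id=Ub,H\=d,LeT=d,HY=Od,";
  "Le=c,QdO=Hc,bc=ad,Leb=ad,Qd=Uc,H]=Uc,Wc=H[e,HZ=c,ZdO=Yc,QY=c,O]D=[,Dd=T[,L`=Y[,Q`DO=[^,";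
  "P[=Z,X^=OZ[,]^D=[_,Q`D=[_,Pc=Za,Ke=Za,LZa=Kc,O]=c,Xa=Kc,KbY=J\a,Jd=LYb,`a=Ye,KUc=L]a,";
  "Y]=\c,F`=T\_,S`D=\_,UZ=],_a=e,S`=\e,S^=e,IZ=S,EV=FU,STE=FU,SW=Ue,Fb=TV,W\=T[e,VW=TUe,I\=V,";
  "_b=Te,Fe=V_,Fa=V,V`=T\e,Ec=U[,Ed=TU[,_c=[e,]d=U\c,UY=d,`b=TYe,`d=TY[e,Q`=[e,WZ=[e,^c=O[e,";
  "`c=Y[e,]^=[e,W]=U[e,U`=T[e,_d=T[e,]`=[\e,\^=`,Zd=\c,DV=F,BV=TU,E^=B_,CW=BI_,DW=B_,CO=A,";
  "DWO=B^,S^D=_,TXO=LY,RdO=Yb,GY=J,G]=N,SYD=\,CN=EGS,NTD=EM,C]=ES,EI=CU,ER=F,Ae=I^,AU=BI,";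
  "CH=BI,AH=BIO,A[=B,IcO=Ha,Tc=d,HX=Lc,Sc=]a,FL=EM,KV=MS,FK=DMS,EX=DL],F]=ES\,MQ=N,FZ=DS\,";
  "F[=E\,M_=\,[a=c,MO=J,Da=,JQD=L,NOD=L,TX=L\,Rd=\b,KdO=LYa,SY=\a,VY=\b,IN=GSU,Nb=MUa,Ic=Ua,";
  "HM=Lb,JeT=Yb,HJ=LOb,Ne=]a,QbO=Ha,Je=Ya,Qb=Ua,HN=LUa,ZbO=Ya,JQ=La,PX=KZ,Xe=Zc,JZ=KY,NZ=K],";
  "NO=La,NX=KL],Kd=L\a,Md=L\b,Jc=LYa,UX=L],VZ=S\,NV=MSU,NT=MU,Eb=TU,I]=SU,Ee=U_,Ea=U,JU=Lb,";
  "Zb=\a,RcO=Ya,Gd=Lb,T]D=E\,EW=BU_,NR=MS,Ce=I_,SX=K],LV=MU,FQ=ES,V[=U\,N[=L],[b=d,Rc=\a,";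
  "XdO=LYc,MeT=\b,Me=\a,MZ=K\,Xd=L\c,JX=KLY,V]=SU\,T]=U\,RXO=KY,Gc=La,R]=S\,Vd=U\b,QV=SU,";
  "J[=LY,RX=K\,GX=KL,M[=L\,"]%string
  [:: 1; 6; 7; 8; 16; 20]
  [:: [:: 0; -1; 1; 0; 0; -2]; [:: 0; 0; -1; 0; 0; 0]; [:: 1; 0; 0; 1; 1; -1]; [:: 0; 0; 0; 0; -1;
  1]; [:: -1; 0; 0; 0; -1; 1]; [:: 0; 0; 0; 0; 1; 0]]%coqZ
  1%coqZ
  [:: ([:: Free 0; Free 4; Free 5; Free 8; Free 12; Free 15; Free 25; Free 27; Free 28; Free 29;
  Free 30; Free 32; Free 33; Solve 104 34; Solve 44 26; Solve 38 7; Solve 32 18; Solve 37 6; Solve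
  30 16; Solve 68 13; Solve 83 14; Solve 67 9; Solve 99 11; Solve 59 31; Solve 4 2; Solve 60 19;
  Solve 90 21; Solve 92 24; Solve 2 1; Solve 81 10; Solve 42 17; Solve 91 23; Solve 61 22; Solve 88
  20; Solve 20 3], (2, 3, 4), [:: (44, 30); (37, 8); (30, 0); (67, 13); (59, 33); (60, 2); (104,
  34); (38, 7); (32, 18); (68, 12); (83, 14); (99, 11); (4, 4); (90, 21); (92, 24); (2, 1); (81,
  10); (42, 17); (91, 23); (61, 22); (88, 20); (20, 3)])].

Definition cert10 : cert := Cert
  [:: Free 0; Free 4; Free 7; Free 8; Free 12; Free 15; Free 17; Free 14; Free 25; Free 26; Free 30;
  Free 33; Free 34; Solve 5 3; Solve 31 5; Solve 35 18; Solve 38 27; Solve 77 24; Solve 80 22; Solve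
  82 10; Solve 83 28; Solve 84 31; Solve 85 20; Solve 97 11; Solve 101 21; Solve 1 1; Solve 36 6;
  Solve 39 29; Solve 40 16; Solve 51 9; Solve 54 32; Solve 55 19; Solve 68 13; Solve 72 23; Solve 3
  2]
  [:: [:: 1; 1; 1; -2; 1; -2; -2]; [:: 1; 1; -2; 1; -2; 1; 1]; [:: 2; -1; -1; 2; -4; 2; -1]; [:: -1;
  -1; 2; -1; 2; -1; 2]; [:: 0; 0; 0; 0; 3; 0; 0]; [:: 0; 0; 0; 3; 0; 0; 0]; [:: -2; 1; 1; -2; 1; 1;
  1]]%coqZ
  3%coqZ
  [:: [:: 0; -1; -1; 0; -1; 0]; [:: 0; 0; 0; 0; -1; 0]; [:: 0; 0; 0; 1; 0; 0]; [:: 0; -1; 0; 1; 0;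
  0]; [:: 0; 0; 0; 1; 0; 1]; [:: 1; -1; 0; 0; 0; 0]; [:: 1; -1; 0; 1; 1; 0]; [:: 1; -1; 0; 1; 1; 1];
  [:: 1; 0; 1; 1; 1; 1]; [:: 1; 0; 1; 2; 2; 1]; [:: 0; -1; 0; -1; -1; -1]; [:: 0; 0; -1; 0; -1; 0];
  [:: 0; -1; 0; -1; 0; -1]; [:: 0; 0; -1; 0; 0; 1]; [:: -1; 1; 0; 0; -1; 0]; [:: 0; 1; 0; 1; 0; 1];
  [:: 1; -1; 0; 0; 1; 0]; [:: 0; -1; 0; 0; 0; -1]; [:: 0; -1; 0; 0; 0; 0]; [:: 0; 0; 0; 0; 0; 1];
  [:: 0; 0; 0; 0; 1; 0]; [:: 1; 0; 0; 1; 1; 1]; [:: 0; -1; 0; 0; 1; 0]; [:: 0; 0; 0; 0; 1; 1]; [::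
  0; 0; 1; 0; 0; 0]; [:: 0; 1; 0; 0; 0; 0]; [:: 0; 0; 1; 1; 1; 0]; [:: 0; 1; 1; 1; 1; 1]; [:: 0; 0;
  0; -1; 0; -1]; [:: 1; -1; 1; 0; 1; 0]; [:: 1; 0; 0; 0; 1; 0]; [:: 0; 0; 1; 0; 1; 0]; [:: 0; 1; 0;
  0; 1; 1]; [:: 1; 0; 1; 1; 2; 1]]%coqZ
  35
  [::]
  [:: -1878; -2624; -2174; -1821; -80; -1756; -1279; 976; -1203; -763; -3359; -2491; -1943; -2593;
  -5003; -612; -315; -1810; 141; -1450; -1402; 458; -1098; -171; -2076; -2009; -1381; 362; -2887;
  -1249; -1267; 465; -1030; 1394]%coqZ
  [:: "RT=S,H^=FSb,A^=FS,HK=FS,BQ=F,LS=A,GK=FR,RTL=A,KV=F,AZ=L,FO=B,AY=BS,AI=BH,EF=BH,SV=H,";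
  "DF=BHR,GS=HR,CF=BG,HLR=AG,RV=G,GT=H,HL=AV,GTL=AV,GO=C,GP=CV,CS=D,DP=CE,DL=AC,CK=BR,PR=C,";
  "CTL=AP,EL=AP,OV=P,CT=E,PS=E,EK=BS,DT=ES,DK=BRS,BM=K,KP=B,A^M=KQS,Ab=H,FX=QT,FW=QS,FU=Q,";
  "CQ=G,GN=AUV,CX=EU,CW=DU,DQ=HR,SU=W,DX=EW,DM=RS,DMU=RW,A`U=W,RX=W,LW=AU,CM=R,NR=AU,Aa=N,";
  "LX=N,MP=,TUL=N,HMU=QW,HM=QS,TW=SX,NS=AX,TU=X,NW=AUX,EM=S,M[=R`,MY=K`,O^M=K`,S]=M,RT]=M,";
  "L^M=KQ,M_=Q],L^]=K_,QZ=_,RT_=Q,F]=K_,L^=F,RTZ=,B_=FZ,LY=B,B^=FY,IK=FY,SZ=,VY=I,HZR=G,";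
  "GTZ=V,IL=BV,GY=IR,ILR=BG,FP=BV,EQ=H,VW=HU,EN=APX,BN=LT,CN=APU,PQ=V,HN=AVX,C]=RZ,L[=C,";
  "CTZ=P,L\=P,CTIZ=BV\,IP=BV\,EZI=BV\,BH\=EI,DVB\=CEI,H\B=EI,B\H=EI,E[=D\,IO=B\,R\=[,IOR=B[,";
  "BH[=DI,DY=BS[,CY=B[,EZ=P,Ba=TZ,B]=KZ,B`=Y,K[=RY,K\=Y,T[Z=\,PY=B\,SVB\=EI,IQ=Fb,H_=QV,";
  "H_R=GQ,G^=FRb,LbR=G,GT_=QV,Lb=V,FUZ=_,I_=FZb,Fa=T_,V^=Fb,GW=HRU,GX=HU,EMU=W,PW=EU,IUE=H\,";
  "DJ=CH[,IUD=H[,C`=[,Ca=PU,C_=GZ,Cb=J,G[=JR,IUC=J,G\=J,HZ[=J,V[=J,Ea=PX,IXE=HT\,IWE=HS\,";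
  "IWD=HS[,D`=S[,D`U=W[,Ob=\,WZ=U,ObR=[,W]=MU,Ra=U,TU]=Ma,N]=LMa,G]=R_,Ga=UV,G`=Rb,J_=GZb,";
  "IU=b,JQ=Gb,IX=Tb,H`=Sb,Q\=b,Q[=Rb,Ha=VX,IW=Sb,H`U=Wb,Ia=TZb,I^=FYb,K`_=]^,K`Q=M^,Q`K=M^,";
  "KQ`=M^,Y]=KZ`,O^]=KZ`,TUZ=a,V]=_,P_=VZ,TU_=Qa,P]=Z,Pb=V\,XZ=a,N\=PX,N`=X,Wa=UX,U^=Q`,";
  "W^=QS`,Sa=X,X^=QT`,^aM=QT]`,M\=`,\]=Z`,O^=Y,]b=_`,^a=T_`,V`=b,Nb=VX,\^=Yb,Ya=TZ`,I`=Yb,";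
  "XY=T`,WY=S`,UY=`,[]=RZ`,P`=\,[a=U\,J`=[b,\_=Zb,U^Z=_`,[_=RZb,[^=RYb,Ja=UV\,A\=E,F\=I,";
  "F[=IR,FJ=GI,JS=H[,P[=C\,JT=H\,T[=S\,A`=S,JX=HU\,JW=HU[,X[=W\,A]=LM,X]=Ma,QY=^,OQ=,S_=Q,";
  "L`=,MZ=],FM=KQ,JL=CV,JLR=CG,JTZ=V\,HP=EV,HZ=V,H[B=DI,B[H=DI,HO=E,HO[=D\,ER=D,HOR=D,EY=BS\,";
  "JY=I[,FN=LQT,EJ=CH\,Db=H[,DG=CHR,BU=,EG=CH,DZ=C,DV=CH,BX=T,BW=S,E`=S\,E`U=W\,W_=QU,N_=LQa,";
  "GM=QR,_`K=]^,K_`=]^,Y_=Z^,O_=Z,MV=Q,KU=M,KU_=Q],KW=MS,KX=MT,Mb=Q`,Ka=T],KUZ=],A[=D,A_=LQ,";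
  "X_=Qa,NZ=La,F`=^,JP=CV\,JO=C\,JOR=C[,HY=IS,BJ=CI,Eb=H\,G[B=CIR,G\B=CI,V[B=CI,Kb=^,KN=LMT,";
  "AJ=CH,Bb=I,"]%string
  [:: 5; 16; 17; 18; 29; 33]
  [:: [:: 1; 0; 0; -1; 0; 0]; [:: 0; 0; 0; -1; 0; 0]; [:: 0; -1; 0; 0; 1; 0]; [:: 1; -1; 1; 0; -1;
  1]; [:: -1; 1; 0; 0; 0; 0]; [:: 0; 0; -1; 1; 0; 0]]%coqZ
  1%coqZ
  [:: ([:: Free 0; Free 4; Free 7; Free 8; Free 12; Free 14; Free 15; Free 17; Free 25; Free 26;
  Free 30; Free 33; Free 34; Solve 83 28; Solve 5 3; Solve 76 22; Solve 77 24; Solve 82 10; Solve 20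
  18; Solve 40 16; Solve 84 31; Solve 75 20; Solve 31 5; Solve 43 29; Solve 28 23; Solve 1 1; Solve
  36 6; Solve 68 13; Solve 41 27; Solve 8 11; Solve 50 21; Solve 104 32; Solve 52 9; Solve 3 2;
  Solve 60 19], (0, 1, 5), [:: (5, 8); (76, 28); (77, 30); (20, 18); (75, 26); (1, 5); (8, 11); (3,
  6); (83, 34); (82, 33); (84, 31); (31, 15); (36, 25); (50, 21); (40, 16); (43, 29); (28, 23); (68,
  13); (41, 27); (104, 32); (52, 9); (60, 19)])].

Definition cert11 : cert := Cert
  [:: Free 0; Free 4; Free 6; Free 7; Free 8; Free 15; Free 16; Free 14; Free 25; Free 28; Free 30;
  Free 31; Free 34; Solve 5 3; Solve 30 5; Solve 33 17; Solve 35 18; Solve 36 26; Solve 38 27; Solve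
  39 29; Solve 74 32; Solve 77 24; Solve 83 12; Solve 87 22; Solve 89 33; Solve 97 11; Solve 98 13;
  Solve 101 21; Solve 102 23; Solve 2 1; Solve 3 2; Solve 52 9; Solve 53 10; Solve 56 19; Solve 57
  20]
  [:: [:: 1; 1; 1; -2; -2; -2; -2]; [:: 1; 1; -2; 1; 1; 1; 1]; [:: 2; -1; -1; 2; 2; -1; -1]; [:: 0;
  0; 0; 0; 0; 3; 0]; [:: -1; -1; 2; -1; -1; -1; 2]; [:: 0; 0; 0; 3; 0; 0; 0]; [:: -2; 1; 1; -2; 1;
  1; 1]]%coqZ
  3%coqZ
  [:: [:: 0; 0; 0; 0; -1; 0]; [:: 0; 0; 1; 0; 0; 0]; [:: 0; 0; 1; 1; 0; 1]; [:: 0; 0; 0; 0; -1; -1];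
  [:: 0; 0; 0; 1; -1; 0]; [:: 0; 0; 0; 1; 0; 0]; [:: 1; 0; 1; 1; 0; 1]; [:: -1; 0; 0; 0; -1; -1];
  [:: 0; -1; 0; 0; -1; 0]; [:: 0; 0; 0; -1; 0; 0]; [:: 0; 0; 1; 0; 1; 1]; [:: 0; 0; -1; -1; -1; -1];
  [:: 0; 0; -1; -1; 0; -1]; [:: 0; 0; -1; -1; 0; 0]; [:: 0; 0; 0; -1; 0; -1]; [:: 0; 0; 0; 0; 0; 1];
  [:: 0; 0; 0; 0; 1; 0]; [:: 0; 0; 0; 0; 1; 1]; [:: 0; 1; 1; 0; 1; 1]; [:: 0; 1; 0; 0; 0; 0]; [:: 0;
  1; 0; 0; 1; 0]; [:: 0; 1; 0; 0; 1; 1]; [:: 0; 1; 1; 0; 1; 0]; [:: 0; 1; 1; 1; 1; 1]; [:: 1; 0; 0;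
  0; 0; 1]; [:: 1; 0; 1; 0; 1; 1]; [:: 1; 0; 1; 1; 1; 2]; [:: 1; 0; 0; 0; 0; 0]; [:: 1; 0; 0; 1; 0;
  1]; [:: 1; 0; 0; 1; 1; 1]; [:: 1; 1; 1; 0; 1; 1]; [:: 1; 1; 1; 1; 1; 2]; [:: 1; 1; 2; 1; 2; 2];
  [:: 1; 1; 1; 1; 1; 1]; [:: 0; 0; 0; -1; 1; 0]; [:: 0; 1; 0; -1; 1; 0]; [:: 0; 1; 1; 0; 2; 1]; [::
  1; 0; 0; 0; 1; 1]; [:: 1; 1; 1; 0; 2; 2]; [:: 1; 1; 0; 0; 1; 1]; [:: 1; 1; 1; 0; 2; 1]; [:: 1; 1;
  1; 1; 2; 2]]%coqZ
  35
  [::]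
  [:: -7914; -32912; -12294; -28786; -26328; -57602; -20812; -99328; -99969; -54776; -8047; -48303;
  -77531; -63849; -60438; -17336; -47320; -17644; -5521; 1059; -25459; -11784; -22511; -1472; -2232;
  -15889; 7603; -10982; -6063; -37371; -13379; 10504; -14450; -9986; -51862; -48069; 169; 865;
  -1932; 4631; -7538; 17509]%coqZ
  [:: "J\=OY,L_=OTY,Ah=TY,O]=\,IT=A,DY=A\,Ad=JT,DJ=AO,Ac=J,EJ=A,IS=AK,CJ=AK,HZJ=AKO,BJ=AKO,CO=B,";
  "BE=CD,Hb=DX,Da=Bb,GX=Cb,GK=B[,Ia=B[,Bb[=Ga,[bB=Ga,B[b=Ga,B[X=Ca,Ha=BX,AWK=BS,OXAK=BS,";
  "H_=AW,OX=W,DS=AW,H\=D,BL=AO,GO=B\,Ob=W\,D_=AW\,AZW=B_,OaA=B_,WZA=B_,AWZ=B_,BJ_=AOSZ,K_=SZ,";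
  "OaAK=BSZ,CZ=B[,SbB=AWa,X_B=AWa,_bB=AW\a,GZ=B[\,]a=[b,AF=E,CD]=EG,D]C=EG,C]D=EG,D]X=Eb,";
  "AR=P,EK=C,PbE=AX],K]=[,C`=AX[,PaC=AKX[,PbC=AX[,Aj=`,Pb=`,XY=`,T[=`,Pa=K`,S[=K`,JX=S,AV=PT,";
  "AN=LP,AM=L,EO=D,AU=T,EW=DX,LbE=DT],GLE=AD],GL=A\,LW=OT,Lb=T\,Yb=\`,P\=Y,]_=\`,L`=TY,EY=A],";
  "J]=Y,Af=Y,LZ=OY,AfKO=JZ,OYK=JZ,J[=KY,Z]=[\,L[=Y,ES=AX,OYS=J_,SYO=J_,J`=SY,OSY=J_,Li=Oh,";
  "JM=Lc,Id=J,JN=LPc,JR=Pc,JQ=c,KM=c,Bc=KO,BF=CDQ,Be=KW,QSB=KW,Oa=WZ,Bi=WZ,Bf=Z,BU=W,BM=O,";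
  "Ya=Z`,`f=Yj,[i=Zj,Ij=[,Ii=Z,Iic=KOf,Zc=KOf,JQZ=KOf,Ih=Y,NY=LPf,FL=EM,DN=L,DNF=EM,FK=CQ,";
  "CNF=ER,FP=ER,CVF=ERX,E^=F],^a=Q[b,F[=C^,CD^=FG,Ce=KX,PQ=R,Cc=K,CN=P,CV=PX,Cf=[,K^=Q[,";
  "CN^=R],CV^=RX],RbC=X[,Hj=X,KV=Pe,RS=Pe,Xc=e,KN=Pc,NQ=MR,Fc=Q,FO=DQ,FT=EU,MbE=DU],GME=D],";
  "F\=D^,GMF=D^,MbF=DU^,DN^=M],Mb=U\,Df=\,DdM=LOU,MW=OU,De=W,QT=U,Dd=OT,O^=Q\,GM=\,Gf=[\,";
  "af=Zj,Z^=Q[\,RZ=Kf,[c=Kf,RY=Pf,IVF=ER,FLV=ENU,NX=V,RUE=FV,VbF=UX],EdN=LV,NT=LV,EdM=LU,";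
  "N\=Lf,IdM=Lc,NO=Lc,Qd=Uc,NOU=Md,LUc=Md,LcU=Md,UcL=Md,HhN=LV,IdN=LPc,LVf=Nh,JNh=LPdf,";
  "PULf=Nh,]d=h,VfL=Nh,LfV=Nh,EhN=LV],Eh=T],Ed=T,Dh=T\,Di=W\,FW=DQX,Fj=X^,Fe=QX,FcN=MR,Ff=^,";
  "R]M=N^,IV^=R],RU]=V^,U]R=V^,R]U=V^,FcV=RU,FeV=RUX,^c=Qf,MZ=Of,Mh=LUf,\dM=LOUf,]dM=LUf,";
  "RdM=NUc,^cN=MRf,N\^=M]f,UZ=i,QSZ=Ki,KU=e,QS=e,Wc=Oe,Hi=W,Hic=Oe,HiJ=OS,Hid=OTe,SU=Te,";
  "Wd=OTe,Xd=Te,SV=PTe,VW=Te,U`=Tj,bh=T\j,UY=h,]i=\j,\d=Oh,NOh=Ldf,Jj=g,Pi=g,Ye=g,Kh=g,Sf=g,";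
  "Pic=Jef,Oef=ci,Ofe=ci,efO=ci,KdOf=Jci,Zg=KYi,JjZ=KYi,SfZ=KYi,dg=Jeh,Pid=Jeh,Oeh=di,Sh=Tg,";
  "Jj_=SYi,S]=`,`h=TYj,]g=Yj,Xg=Sj,N[=Pf,Nj=Vf,Ne=Vc,Rd=Vc,RW=e,KUOf=ci,U_=Ti,Vi=eh,Xh=Tj,";
  "Vb=Tj,VbE=TX],Ta=W`,Sb=W`,X_=W`,WZ`=_a,_b=W\`,ai=WZj,QSa=KWj,ae=KWj,Xi=Wj,R`=Pj,Xf=j,";
  "[e=Kj,Ri=ef,be=Wj,Ua=Wj,bi=W\j,^e=Qj,Y^=]f,Ra=Kj,RaC=KX[,V[=Pj,Vic=def,^cV=RUf,bf=\j,";
  "^i=Q\j,Neh=Vdf,N[^=R]f,V[^=R]j,^eV=RUj,V`=PTj,Vb^=U]j,[h=Yj,^`=]j,S\=_,LS=JT,I_=AZ,";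
  "H_J=AOS,GH=CD,Ib=G,BX[=Ca,X[B=Ca,H[=C,HZ=B,DK=B,DZ=B\,JW=OS,AKW=BS,KWA=BS,B]=G,A^=],";
  "DX]=Eb,X]D=Eb,GPE=AC],G`=A[b,Cj=X[,GP=A[,CY=A[,CT=AX,BP=AK,[_=Z`,CS=AKX,W]=b,LX=T,CL=A,";
  "GY=A[\,KL=J,O[=Z,KYO=JZ,KOY=JZ,Mi=OUf,JU=d,Rg=Pef,Qg=ef,Ae=S,Q_B=WZ,O`=_,Ai=_,AiK=SZ,";
  "BY=AZ,[g=KYj,Ig=KY,Ie=K,QY=f,VY=Ph,L^=M],P^=R],D^X=Fb,D^C=FG,C^D=FG,B^=GQ,E[=C],DX^=Fb,";
  "CU=X,GR=[,QV=RU,T^=U],E\=D],CM=,Dc=O,MX=U,RbF=X^,RbE=X],DVF=EU,Tf=h,V\=h,LQ=M,IhN=LPf,";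
  "JV=Pd,W^=Qb,Ej=X],Ef=],ERM=FN,IU=,EUR=FV,ERU=FV,Ec=,Ee=X,ch=df,MV=NU,V\^=U]f,Q_=i,Wf=i,";
  "Hf=,Hg=S,Hh=T,Wh=Ti,MY=Lf,\c=Of,dj=eh,PZ=KY,Ze=Ki,Yd=Jh,Kd=Je,Zh=Yi,Sc=Je,_g=SYi,_f=Yi,";
  "_h=TYi,Sd=JTe,Lj=h,DV=T,BT=AW,Kb=a,XZ=a,KW`=Sa,Zb=\a,`iK=SZj,`i=_j,Q_a=WZj,`e=Sj,OR=c,";
  "BR=K,OV=d,]c=f,M[=f,U[=j,]e=j,Rb=j,K\=Z,IW=B,HY=A,H]=E,IX=C,H`=AX,WYK=SZ,DP=A,B`=Aa,Gj=[b,";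
  "GT=Ab,PW=S,S[B=AKa,CW=BX,Me=Uc,Lic=Odf,Ug=eh,AQ=,Ag=SY,WY=_,^h=U]f,PU=V,X^D=Fb,E`=AX],";
  "D[=G,GU=b,Q]=^,RT=V,C\=G,GRF=C^,GRE=C],MT=LU,Qh=Uf,IV=P,Vg=Peh,Dj=b,ehO=di,LcV=Nd,cg=Jef,";
  "Ohe=di,LVc=Nd,M]R=N^,MRE=FN,MR]=N^,VcL=Nd,R\=f,\e=i,cj=ef,P_=SY,_e=Si,Yc=Jf,SfO=Ji,Mj=Uf,";
  "TZ=_,`g=SYj,Q`=j,\g=Yi,H^=F,I`=A[,W`K=Sa,W`Z=_a,Z`W=_a,Bj=a,[_B=AZa,GW=Bb,Le=d,Wg=Si,";
  "Rh=Vf,MP=N,D`=Ab,EQ=F,X\=b,DR=,Tc=d,Og=Ji,EMR=FN,Oj=i,OP=J,KT=S,K`W=Sa,W[=a,Lg=Jh,LR=N,"]%string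
  [:: 19; 24; 27; 30; 40; 41]
  [:: [:: 0; 0; 1; 0; 0; 0]; [:: 1; 0; 0; 0; 0; 0]; [:: -1; -1; 0; 2; -1; 0]; [:: 0; -1; 1; 0; -1;
  1]; [:: 0; 0; 0; -1; 1; 0]; [:: 0; 1; -1; 0; 0; 0]]%coqZ
  1%coqZ
  [:: ([:: Free 0; Free 4; Free 6; Free 7; Free 8; Free 14; Free 15; Free 16; Free 25; Free 28; Free
  30; Free 31; Free 34; Solve 39 29; Solve 98 13; Solve 83 12; Solve 33 17; Solve 34 18; Solve 30 5;
  Solve 91 23; Solve 66 9; Solve 72 22; Solve 69 32; Solve 95 24; Solve 10 10; Solve 5 3; Solve 36
  26; Solve 41 27; Solve 12 11; Solve 3 2; Solve 85 20; Solve 1 1; Solve 88 33; Solve 60 19; Solve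
  90 21], (0, 1, 2), [:: (33, 28); (34, 29); (30, 25); (5, 14); (36, 26); (41, 27); (3, 12); (1,
  10); (39, 30); (83, 34); (10, 9); (12, 11); (60, 19); (90, 21); (98, 13); (91, 23); (66, 31); (72,
  22); (69, 32); (95, 24); (85, 20); (88, 33)])].

Local Close Scope nat_scope.

Local Notation entry_ok i K := (cert_ok (nth ([::], [::]) chirotopes37 i).1 (nth ([::], [::]) chirotopes37 i).2 K).

Lemma cert1_ok : entry_ok 0%N cert1.
(* The test is evaluated by the virtual machine only once, when the finished proof term is
   checked. *)
Proof. by vm_cast_no_check (erefl true). Qed.
Lemma cert2_ok : entry_ok 1%N cert2.
Proof. by vm_cast_no_check (erefl true). Qed.
Lemma cert3_ok : entry_ok 2%N cert3.
Proof. by vm_cast_no_check (erefl true). Qed.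
Lemma cert4_ok : entry_ok 3%N cert4.
Proof. by vm_cast_no_check (erefl true). Qed.
Lemma cert5_ok : entry_ok 4%N cert5.
Proof. by vm_cast_no_check (erefl true). Qed.
Lemma cert6_ok : entry_ok 5%N cert6.
Proof. by vm_cast_no_check (erefl true). Qed.
Lemma cert7_ok : entry_ok 6%N cert7.
Proof. by vm_cast_no_check (erefl true). Qed.
Lemma cert8_ok : entry_ok 7%N cert8.
Proof. by vm_cast_no_check (erefl true). Qed.
Lemma cert9_ok : entry_ok 8%N cert9.
Proof. by vm_cast_no_check (erefl true). Qed.
Lemma cert10_ok : entry_ok 9%N cert10.
Proof. by vm_cast_no_check (erefl true). Qed.
Lemma cert11_ok : entry_ok 10%N cert11.
Proof. by vm_cast_no_check (erefl true). Qed.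

Lemma certified i : (i < 11)%N -> exists K, entry_ok i K.
Proof.
case: i => [|[|[|[|[|[|[|[|[|[|[|i]]]]]]]]]]] //  _.
- by exists cert1; exact: cert1_ok.
- by exists cert2; exact: cert2_ok.
- by exists cert3; exact: cert3_ok.
- by exists cert4; exact: cert4_ok.
- by exists cert5; exact: cert5_ok.
- by exists cert6; exact: cert6_ok.
- by exists cert7; exact: cert7_ok.
- by exists cert8; exact: cert8_ok.
- by exists cert9; exact: cert9_ok.
- by exists cert10; exact: cert10_ok.
- by exists cert11; exact: cert11_ok.
Qed.

Theorem theorem5p2 (R : realType) (negatives : seq (seq nat)) (fvec : seq nat)
    (entry : (negatives, fvec) \in chirotopes37) :
  let chi : signvec 3 7 := signvec_of_negatives negatives in
  let Sigma := Dressian_fan R chi in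
  [/\ realizable R chi,
      [/\ polyhedral_fan Sigma,
          \bigcup_(C in Sigma) C = @mod_lineality R 3 7 @` chi_Dressian R chi
        & pure_dim Sigma 6],
      chi_Dressian R chi = chi_TropGr R chi
    & forall d : nat, (1 <= d <= 6)%N -> num_cones Sigma d (nth 0%N fvec d.-1)].
Proof.
have i11 : (index (negatives, fvec) chirotopes37 < 11)%N by rewrite -index_mem in entry.
have [K cK] := certified i11; rewrite nth_index // in cK; exact: cert_okP cK.
Qed.
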